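(* Let $X$ be a smooth projective complex curve of genus $\ge 2$ with an action of the alternating group $A_5$ (so $A_5\subset\mathrm{Aut}(X)$), and let $Y=X/A_5$. Let $V$, $W$ and $T$ be the nontrivial irreducible $\mathbb{Q}$-representations of $A_5$, where $V$ and $W$ are absolutely irreducible of dimensions $4$ and $5$, and $T\otimes_{\mathbb{Q}}\mathbb{C}= T_1\oplus T_2$ is the sum of the two irreducible complex representations of dimension $3$. Then $$JX\sim JY\times B_V^4\times B_W^5\times B_T^3,$$ with $$B_V\sim P(X_{A_4}/Y),\qquad B_W\sim P(X_{D_5}/Y),\qquad B_T\sim P(X_{Z_5}/X_{D_5}),$$ where $A_4=\langle(23)(45),(345)\rangle$, $D_5=\langle(12345),(25)(34)\rangle$, $Z_5=\langle(12345)\rangle$ and $X_M=X/M$ for a subgroup $M$.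
   Context: $\sim$ means ''isogenous to''. For a finite morphism $f:X'\to Y'$ of smooth projective curves, $P(X'/Y'):=\ker(\mathrm{Nm} f:JX'\to JY')^{\circ}$ (connected component of $0$ of the kernel of the norm map). For a finite group $G\subset\mathrm{Aut}(X)$ let $\rho:\mathbb{Q}[G]\to\mathrm{End}_{\mathbb{Q}}(JX)$ be the induced homomorphism. For an irreducible $\mathbb{Q}$-representation $R$ of $G$ with $D=\mathrm{End}_G(R)$, let $Q_R\simeq\mathrm{End}_D(R)$ be the corresponding simple factor of $\mathbb{Q}[G]$ and let $p$ be a primitive idempotent of $Q_R$. Then $B_R:=\mathrm{Im}(\rho(mp))\subset JX$ for any positive integer $m$ with $mp\in\mathbb{Z}[G]$; its isogeny class does not depend on $p$. *)

(* Defs.v *)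
From HB Require Import structures.
From mathcomp Require Import all_boot all_order all_algebra all_fingroup.
From mathcomp Require Import all_solvable all_field all_character.
From mathcomp Require Import mpoly freeg complex.
From mathcomp Require Import boolp classical_sets functions cardinality reals.

Set Implicit Arguments.
Unset Strict Implicit.
Unset Printing Implicit Defensive.

Import GRing.Theory Num.Theory.
Local Open Scope ring_scope.

(* The subgroups of the alternating group.  The letters 1, .., 5 are the      *)
(* elements 0, .., 4 of 'I_5.  Products of permutations apply the left factor *)
(* first, so (a b) (a c) = (a b c); the opposite convention replaces each     *)
(* cycle by its inverse and generates the same subgroups.                     *)

Definition letter (k : nat) : 'I_5 := inord k.-1.
Definition transp (a b : nat) : {perm 'I_5} := tperm (letter a) (letter b).

Definition c12345 : {perm 'I_5} :=
  (transp 1 2 * transp 1 3 * transp 1 4 * transp 1 5)%g.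

Definition A5 : {group {perm 'I_5}} := 'Alt_('I_5)%G.
Definition A4 : {set {perm 'I_5}} :=
  <<[set (transp 2 3 * transp 4 5)%g; (transp 3 4 * transp 3 5)%g]>>%g.
Definition D5 : {set {perm 'I_5}} :=
  <<[set c12345; (transp 2 5 * transp 3 4)%g]>>%g.
Definition Z5 : {set {perm 'I_5}} := <<[set c12345]>>%g.

(* The group algebra Q[G] is group_ring rat G, that is, the image of Q[G] in  *)
(* the regular representation; gring_op rG is the action of Q[G] on rG.       *)

Section GroupAlgebra.

Variables (gT : finGroupType) (G : {group gT}).
Local Notation QG := (group_ring rat G).

Definition gring_coef (a : 'M[rat]_(gcard G)) (g : gT) : rat :=
  gring_row a 0 (gring_index G g).

Definition two_sided_ideal (I : 'A[rat]_(gcard G)) : Prop :=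
  (I <= QG)%MS /\ mx_ideal QG I.

Definition simple_factor_of n (rG : mx_representation rat G n)
    (I : 'A[rat]_(gcard G)) : Prop :=
  [/\ two_sided_ideal I, I != 0,
      (forall J : 'A[rat]_(gcard G),
         two_sided_ideal J -> (J <= I)%MS -> J != 0 -> (I <= J)%MS)
    & exists2 a, (a \in I)%MS & gring_op rG a != 0].

Definition primitive_idempotent (I : 'A[rat]_(gcard G))
    (p : 'M[rat]_(gcard G)) : Prop :=
  [/\ (p \in I)%MS, p != 0, p *m p = p
    & forall q r, (q \in I)%MS -> (r \in I)%MS ->
        q *m q = q -> r *m r = r -> q *m r = 0 -> r *m q = 0 ->
        p = q + r -> q = 0 \/ r = 0].

(* z is an element m p of Z[G], with m > 0 and p a primitive idempotent of    *)
(* the simple factor of Q[G] corresponding to rG                              *)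
Definition integral_primitive_idempotent n (rG : mx_representation rat G n)
    (z : gT -> int) : Prop :=
  exists (m : nat) (I : 'A[rat]_(gcard G)) (p : 'M[rat]_(gcard G)),
    [/\ (0 < m)%N, simple_factor_of rG I, primitive_idempotent I p
      & {in G, forall g, (z g)%:~R = m%:R * gring_coef p g}].

End GroupAlgebra.

Definition direct_sum_repr (F : fieldType) (gT : finGroupType) (G : {group gT})
    n1 n2 (r1 : mx_representation F G n1) (r2 : mx_representation F G n2) :
    representation F G :=
  dadd_grepr (Representation r1) (Representation r2).

Local Open Scope classical_set_scope.

(* Varieties over an algebraically closed field are spaces with functions: a  *)
(* set of (closed) points with a Zariski topology and a sheaf of K-valued     *)
(* regular functions.  The topologies are explicit families of sets rather    *)
(* than topologicalType instances because the topology of a product of        *)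
(* varieties is not the product topology.  Functions are total, and only      *)
(* their values on U matter in  reg U f.  The record carries no axioms: they  *)
(* hold for projective space and are inherited by the constructions below.    *)

Section Varieties.

Variable K : closedFieldType.

Record fun_space := FunSpace {
  pt :> choiceType;
  open : set (set pt);
  reg : set pt -> set (pt -> K) }.

Arguments open : clear implicits.
Arguments reg : clear implicits.

Definition closed (X : fun_space) (Z : set X) : Prop := open X (~` Z).

Definition morphism (X Y : fun_space) (f : X -> Y) : Prop :=
  (forall V, open Y V -> open X (f @^-1` V)) /\
  (forall V h, reg Y V h -> reg X (f @^-1` V) (h \o f)).

Definition isomorphic (X Y : fun_space) : Prop :=
  exists (f : X -> Y) (g : Y -> X),
    [/\ morphism f, morphism g, cancel f g & cancel g f].

Definition sub_space (X : fun_space) (S : set X) : fun_space :=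
  let opn (U : set S) := exists2 U', open X U' & U = val @^-1` U' in
  @FunSpace S opn (fun U f => opn U /\
    forall x, U x -> exists U' h,
      [/\ open X U', U' (val x), reg X U' h
        & forall y, U y -> U' (val y) -> f y = h (val y)]).

(* The product in the category of spaces with functions: the sets where a     *)
(* function  sum_i f_i(x) g_i(y)  does not vanish form a basis of the         *)
(* topology, and regular functions are locally quotients of such functions.   *)

Definition tensor (X Y : fun_space) (U : set X) (V : set Y)
    (h : X * Y -> K) : Prop :=
  exists n (f : 'I_n -> X -> K) (g : 'I_n -> Y -> K),
    [/\ forall i, reg X U (f i), forall i, reg Y V (g i)
      & forall p, h p = \sum_i f i p.1 * g i p.2].

Definition prod_space (X Y : fun_space) : fun_space :=
  let opn (W : set (X * Y)) :=
    forall p, W p -> exists (U : set X) (V : set Y) h,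
      [/\ open X U /\ open Y V, U p.1 /\ V p.2, tensor U V h, h p != 0
        & forall q, U q.1 -> V q.2 -> h q != 0 -> W q] in
  @FunSpace (X * Y)%type opn (fun W F => opn W /\
    forall p, W p -> exists (U : set X) (V : set Y) a b,
      [/\ open X U /\ open Y V, U p.1 /\ V p.2,
          tensor U V a /\ tensor U V b, b p != 0
        & forall q, W q -> U q.1 -> V q.2 -> b q != 0 -> F q = a q / b q]).

(* Projective space: its points are the lines of K^(n+1). *)

Definition proj_pt (n : nat) : choiceType :=
  {L : {vspace 'rV[K]_n.+1} | \dim L == 1%N}.

Definition line n (L : proj_pt n) : {vspace 'rV[K]_n.+1} := sval L.

Definition poly_at n (f : {mpoly K[n]}) (v : 'rV[K]_n) : K := f.@[v 0].

Definition proj_space (n : nat) : fun_space :=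
  let zeros (F : set {mpoly K[n.+1]}) : set (proj_pt n) :=
    [set L | forall f v, F f -> v \in line L -> poly_at f v = 0] in
  let opn (U : set (proj_pt n)) := exists2 F : set {mpoly K[n.+1]},
    (forall f, F f -> exists d : nat, f \is d.-homog) & ~` U = zeros F in
  @FunSpace (proj_pt n) opn (fun U f => opn U /\
    forall L, U L -> exists V (d : nat) (a b : {mpoly K[n.+1]}),
      [/\ opn V, V L, a \is d.-homog /\ b \is d.-homog
        & forall L' v, U L' -> V L' -> v \in line L' -> v != 0 ->
            poly_at b v != 0 /\ f L' = poly_at a v / poly_at b v]).

Definition irreducible_closed (X : fun_space) (Z : set X) : Prop :=
  [/\ closed Z, Z !=set0
    & forall A B : set X, closed A -> closed B ->
        Z `<=` A `|` B -> Z `<=` A \/ Z `<=` B].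

Definition projective_variety (X : fun_space) : Prop :=
  irreducible_closed [set: X] /\
  exists n (Z : set (proj_space n)), closed Z /\ isomorphic X (sub_space Z).

Definition irreducible_chain (X : fun_space) (d : nat) : Prop :=
  exists Z : nat -> set X,
    (forall i, (i <= d)%N -> irreducible_closed (Z i)) /\
    (forall i, (i < d)%N -> Z i `<` Z i.+1).

Definition has_dimension (X : fun_space) (d : nat) : Prop :=
  irreducible_chain X d /\ ~ irreducible_chain X d.+1.

(* Curves.  [reg_at x f]: f defines an element of the local ring at x. *)

Definition near_pt (X : fun_space) (x : X) (P : X -> Prop) : Prop :=
  exists U, [/\ open X U, U x & forall y, U y -> P y].

Definition reg_at (X : fun_space) (x : X) (f : X -> K) : Prop :=
  exists U, [/\ open X U, U x & reg X U f].

(* t generates the maximal ideal of the local ring at x *)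
Definition uniformizer (X : fun_space) (x : X) (t : X -> K) : Prop :=
  [/\ reg_at x t, t x = 0
    & forall f, reg_at x f -> f x = 0 ->
        exists2 h, reg_at x h & near_pt x (fun y => f y = h y * t y)].

(* smoothness: in dimension 1, a local ring is regular when its maximal ideal *)
(* is principal                                                               *)
Definition smooth_projective_curve (X : fun_space) : Prop :=
  [/\ projective_variety X, has_dimension X 1
    & forall x : X, exists t, uniformizer x t].

(* tangent vectors at x, as derivations of the local ring *)
Definition tangent_vector (X : fun_space) (x : X) (v : (X -> K) -> K) : Prop :=
  [/\ forall f g, reg_at x f -> reg_at x g -> near_pt x (fun y => f y = g y) ->
        v f = v g,
      forall (a : K) f g, reg_at x f -> reg_at x g ->
        v (fun y => a * f y + g y) = a * v f + v g
    & forall f g, reg_at x f -> reg_at x g ->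
        v (fun y => f y * g y) = f x * v g + g x * v f].

(* 1-forms: functions of a point and a tangent vector at that point, locally  *)
(* of the form  sum_i f_i dg_i                                                *)
Definition form (X : fun_space) := X -> ((X -> K) -> K) -> K.

Definition regular_form (X : fun_space) (w : form X) : Prop :=
  forall x, exists U n (f g : 'I_n -> X -> K),
    [/\ open X U, U x, forall i, reg X U (f i) /\ reg X U (g i)
      & forall y v, U y -> tangent_vector y v ->
          w y v = \sum_i f i y * v (g i)].

Definition form_eq (X : fun_space) (w w' : form X) : Prop :=
  forall y v, tangent_vector y v -> w y v = w' y v.

(* g is the dimension of the space of regular 1-forms *)
Definition has_genus (X : fun_space) (g : nat) : Prop :=
  exists w : 'I_g -> form X,
    let lin (c : 'I_g -> K) : form X := fun y v => \sum_i c i * w i y v in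
    [/\ forall i, regular_form (w i),
        forall c, form_eq (lin c) (fun _ _ => 0) -> forall i, c i = 0
      & forall w', regular_form w' -> exists c, form_eq w' (lin c)].

(* f, a function on U, has order n at x: f = u t^n on a punctured             *)
(* neighbourhood of x, with t a uniformizer and u a unit                      *)
Definition has_order (X : fun_space) (U : set X) (f : X -> K) (x : X)
    (n : int) : Prop :=
  exists t u V,
    [/\ uniformizer x t, open X V /\ V x, reg X V u,
        forall y, V y -> u y != 0
      & forall y, U y -> V y -> y != x -> f y = u y * t y ^ n].

Definition principal_divisor (X : fun_space) (D : {freeg X / int}) : Prop :=
  exists U f,
    [/\ open X U, reg X U f, exists2 y, U y & f y != 0
      & forall x, has_order U f x (coeff x D)].

Definition push_divisor (X Y : fun_space) (f : X -> Y) (D : {freeg X / int}) :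
    {freeg Y / int} :=
  \sum_(x <- dom D) << coeff x D *g f x >>.

(* Commutative groups with a structure of space with functions, and           *)
(* subgroups of these, with the induced structure.                            *)

Record group_space := GroupSpace {
  group_pt :> zmodType;
  group_open : set (set group_pt);
  group_reg : set group_pt -> set (group_pt -> K) }.

Definition gspace (A : group_space) : fun_space :=
  @FunSpace (group_pt A) (@group_open A) (@group_reg A).

Definition abelian_variety (A : group_space) : Prop :=
  [/\ projective_variety (gspace A),
      @morphism (prod_space (gspace A) (gspace A)) (gspace A)
        (fun p => p.1 + p.2 : A)
    & @morphism (gspace A) (gspace A) (fun x => - x : A)].

Record subgroup_space := SubgroupSpace {
  ambient : group_space;
  supp : set ambient }.

Definition whole (A : group_space) : subgroup_space :=
  @SubgroupSpace A setT.

Definition sspace (A : subgroup_space) : fun_space :=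
  @sub_space (gspace (ambient A)) (@supp A).

Definition elt (A : subgroup_space) (x : sspace A) : ambient A := val x.

Definition group_prod (A B : group_space) : group_space :=
  @GroupSpace (A * B)%type
    (@open (prod_space (gspace A) (gspace B)))
    (@reg (prod_space (gspace A) (gspace B))).

Definition gprod (A B : subgroup_space) : subgroup_space :=
  @SubgroupSpace (group_prod (ambient A) (ambient B))
    [set p | @supp A p.1 /\ @supp B p.2].

(* the n-fold product of A with itself, for n > 0 *)
Definition gpow (A : subgroup_space) (n : nat) : subgroup_space :=
  iter n.-1 (gprod A) A.

(* an isogeny: a surjective homomorphism with finite kernel *)
Definition isogeny (A B : subgroup_space) (f : sspace A -> sspace B) : Prop :=
  [/\ morphism f,
      forall x y z, elt z = elt x + elt y -> elt (f z) = elt (f x) + elt (f y),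
      forall y, exists x, f x = y
    & finite_set [set x | elt (f x) = 0]].

Definition isogenous (A B : subgroup_space) : Prop :=
  exists f : sspace A -> sspace B, isogeny f.

Definition connected_in (X : fun_space) (C : set X) : Prop :=
  forall U V, open X U -> open X V -> C `<=` U `|` V ->
    C `&` U `&` V = set0 -> C `<=` U \/ C `<=` V.

Definition component_in (X : fun_space) (S : set X) (x : X) : set X :=
  [set y | exists C, [/\ C `<=` S, connected_in C, C x & C y]].

(* The Jacobian of X is the group Pic^0(X) of divisors of degree 0 modulo     *)
(* principal divisors, with its structure of abelian variety, for which the   *)
(* Abel-Jacobi maps  x |-> [x - x0]  are morphisms.  jac_cl is the class map; *)
(* its values on divisors of nonzero degree are irrelevant.                   *)
Record jacobian (X : fun_space) := Jacobian {
  jac :> group_space;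
  jac_cl : {freeg X / int} -> jac;
  jac_abelian : abelian_variety jac;
  jac_clD : forall D E, deg D = 0 -> deg E = 0 ->
    jac_cl (D + E) = jac_cl D + jac_cl E;
  jac_cl_surj : forall a, exists D, deg D = 0 /\ jac_cl D = a;
  jac_cl_ker : forall D, deg D = 0 -> (jac_cl D = 0 <-> principal_divisor D);
  jac_AJ : forall x0 : X,
    @morphism X (gspace jac) (fun x => jac_cl (<<x>> - <<x0>>)) }.

Definition jac_divisor (X : fun_space) (J : jacobian X) (a : J) :
    {freeg X / int} :=
  projT1 (cid (jac_cl_surj a)).

(* the norm map of f : X -> Y, that is, [D] |-> [f_* D] *)
Definition Nm (X Y : fun_space) (JX : jacobian X) (JY : jacobian Y) (f : X -> Y)
    (a : JX) : JY :=
  jac_cl JY (push_divisor f (jac_divisor a)).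

(* P(X / Y) *)
Definition prym (X Y : fun_space) (JX : jacobian X) (JY : jacobian Y)
    (f : X -> Y) : subgroup_space :=
  @SubgroupSpace JX
    (@component_in (gspace JX) [set a : JX | Nm JY f a = 0] (0 : JX)).

Section Action.

Variables (gT : finGroupType) (X : fun_space) (act : gT -> X -> X).

(* G, acting on the left through act, is a subgroup of Aut(X) *)
Definition faithful_action (G : {set gT}) : Prop :=
  [/\ {in G, forall g, morphism (act g)},
      forall x, act 1%g x = x,
      {in G &, forall g h x, act (g * h)%g x = act g (act h x)}
    & {in G, forall g, (forall x, act g x = x) -> g = 1%g}].

Definition act_orbit (M : {set gT}) (x : X) : set X :=
  [set y | exists2 g, g \in M & y = act g x].

(* X / M is the set of M-orbits, with the quotient topology and the invariant *)
(* regular functions of X.                                                    *)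

Definition orbit_set (M : {set gT}) : set (set X) := range (act_orbit M).

Definition quot_pr (M : {set gT}) (x : X) : orbit_set M :=
  SigSub (mem_set (imageT (act_orbit M) x)).

Definition quot (M : {set gT}) : fun_space :=
  @FunSpace (orbit_set M) (fun U => open X (@quot_pr M @^-1` U))
    (fun U f => reg X (@quot_pr M @^-1` U) (f \o @quot_pr M)).

Lemma quot_pr_surj M (o : quot M) : exists x, quot_pr M x = o.
Proof.
case: o => o oM; move: (set_mem oM) => [x _ xo].
by exists x; apply: val_inj.
Qed.

(* the morphism X / M -> X / N, for M a subgroup of N *)
Definition quot_map (M N : {set gT}) (o : quot M) : quot N :=
  quot_pr N (projT1 (cid (quot_pr_surj o))).

(* rho(z) for z in Z[G] *)
Definition rho (JX : jacobian X) (G : {set gT}) (z : gT -> int) (a : JX) : JX :=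
  \sum_(g in G) Nm JX (act g) a *~ z g.

Definition im_rho (JX : jacobian X) (G : {set gT}) (z : gT -> int) :
    subgroup_space :=
  @SubgroupSpace JX (range (rho (JX := JX) G z)).

End Action.

End Varieties.

Arguments quot_map {K gT X} act M N o.

(* Main.v *)
(* Write e_M for the average of a subgroup M in Q[A5].  The trace of the regular
   representation shows that e_A4 - e_A5, e_D5 - e_A5 and e_Z5 - e_D5 have rank
   1, 1 and 2 on V, W and T respectively and vanish on the other irreducible
   representations.  Hence they are primitive idempotents of the three simple
   factors, equivalent (p = ab, q = ba) to the given ones, and 1 is the sum of
   e_A5 and of 4 + 5 + 3 orthogonal idempotents equivalent to them.  As JX is
   divisible with finite n-torsion, such identities in Q[A5] become isogenies.
   The image of (e_M - e_N) JX under the norm JX -> J(X/M) is closed, connected,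
   divisible and of finite index in the kernel of the norm to J(X/N), so it is
   P((X/M)/(X/N)).

   The norm of r : Z -> Y is well defined on classes because orders of functions
   on X/M are read on X: a uniformizer of X/M pulls back to a unit times t^e, with
   e the order of the stabilizer.  It is a morphism because the differences
   [z] - [z'] generate JZ, so that a power of Z x Z maps onto JZ, and because an
   additive map of abelian varieties is a morphism as soon as its composition with
   a surjective morphism from a complete variety is one (characteristic 0).
   Uncountability of the ground field gives a short proof of the Nullstellensatz,
   hence of the completeness of projective varieties. *)

From HB Require Import structures.
From mathcomp Require Import all_boot all_order all_algebra all_fingroup.
From mathcomp Require Import all_solvable all_field all_character.
From mathcomp Require Import mpoly freeg complex.
From mathcomp Require Import boolp classical_sets functions cardinality reals.
From mathcomp Require Import ring lra zify.

Set Implicit Arguments.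
Unset Strict Implicit.
Unset Printing Implicit Defensive.

Require Import Defs.
Import GRing.Theory Num.Theory.
Local Open Scope ring_scope.
Local Open Scope classical_set_scope.

(** * Germs and morphisms *)

(** [jacobian] provides divisor classes and Abel-Jacobi morphisms only: neither functoriality nor a
    pull-back is given. So the geometric effort goes into making [Nm] a morphism, and a pull-back
    occurs only as an arbitrary lift followed by a trace. Characteristic 0 enters the geometry three
    times: n acts on the cotangent space at 0 by an invertible scalar, so torsion is isolated; no
    inseparable function such as a p-th root obstructs the descent of regularity; an automorphism of
    finite order that is trivial on a cotangent line is trivial. A bound on the length of chains of
    closed irreducible sets, obtained from the growth of Hilbert functions, makes the chains m^k A
    and the sums of differences [z] - [z'] stop. The rank 2 on T is minimal because a nonzero
    idempotent of the block of T cannot vanish on one of T1, T2 alone. *)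

Section Germs.
Variable K : closedFieldType.
Implicit Types X Y Z : fun_space K.

(** [fun_space] carries no axioms; these make germs usable: a topology, a sheaf of K-algebras of
    functions, and open nonvanishing loci with regular inverses. They are checked for each
    construction: subspaces, products, quotients, projective space. *)
Record good X : Prop := Good {
  good_openT : open [set: X];
  good_openI : forall U V : set X, open U -> open V -> open (U `&` V);
  good_open_local : forall U : set X,
    (forall x, U x -> exists V, [/\ open V, V x & V `<=` U]) -> open U;
  good_reg_open : forall (U : set X) f, reg U f -> open U;
  good_reg_local : forall (U : set X) f, open U ->
    (forall x, U x -> exists V h,
       [/\ open V, V x, reg V h & forall y, U y -> V y -> f y = h y]) -> reg U f;
  good_reg_cst : forall a : K, reg [set: X] (fun=> a);
  good_reg_add : forall (U : set X) f g, reg U f -> reg U g ->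
    reg U (fun x => f x + g x);
  good_reg_mul : forall (U : set X) f g, reg U f -> reg U g ->
    reg U (fun x => f x * g x);
  good_reg_nz : forall (U : set X) f, reg U f -> open [set x | U x /\ f x != 0];
  good_reg_inv : forall (U : set X) f, reg U f -> (forall x, U x -> f x != 0) ->
    reg U (fun x => (f x)^-1) }.

Lemma near_self X (x : X) P : near_pt x P -> P x.
Proof. by case=> U [_ Ux]; apply. Qed.

Lemma near_mono X (x : X) (P Q : X -> Prop) :
  near_pt x P -> (forall y, P y -> Q y) -> near_pt x Q.
Proof. by case=> U [oU Ux UP] PQ; exists U; split=> // y /UP/PQ. Qed.

Lemma near_near X (x : X) P : near_pt x P -> near_pt x (fun y => near_pt y P).
Proof. by case=> U [oU Ux UP]; exists U; split=> // y Uy; exists U. Qed.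

Lemma near_open X (U : set X) x : open U -> U x -> near_pt x U.
Proof. by move=> oU Ux; exists U. Qed.

Lemma near_reg X (x : X) f : reg_at x f -> near_pt x (fun y => reg_at y f).
Proof. by case=> U [oU Ux rf]; exists U; split=> // y Uy; exists U. Qed.

Lemma reg_reg_at X (U : set X) f x : good X -> reg U f -> U x -> reg_at x f.
Proof. by move=> gX rf Ux; exists U; split=> //; apply: good_reg_open rf. Qed.

Section Good.
Variables (X : fun_space K) (gX : good X).
Implicit Types (x y : X) (f g : X -> K).

Lemma nearI x P Q : near_pt x P -> near_pt x Q -> near_pt x (fun y => P y /\ Q y).
Proof.
case=> U [oU Ux UP] [V [oV Vx VQ]]; exists (U `&` V); split=> //.
  exact: good_openI.
by move=> y [/UP ? /VQ].
Qed.

Lemma near_app2 x (P Q S : X -> Prop) :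
  near_pt x P -> near_pt x Q -> (forall y, P y -> Q y -> S y) -> near_pt x S.
Proof. by move=> nP nQ h; apply: near_mono (nearI nP nQ) _ => y [/h] /[apply]. Qed.

Lemma nearT x (P : X -> Prop) : (forall y, P y) -> near_pt x P.
Proof. by move=> h; exists setT; split=> //; apply: good_openT. Qed.

Lemma near_all x (I : finType) (P : I -> X -> Prop) :
  (forall i, near_pt x (P i)) -> near_pt x (fun y => forall i, P i y).
Proof.
move=> h; have: near_pt x (fun y => forall i, i \in enum I -> P i y).
  elim: (enum I) => [|i s IH]; first exact: nearT.
  apply: near_app2 (h i) IH _ => y Piy Ps j.
  by rewrite inE => /predU1P[->//|/Ps].
by move=> /near_mono; apply=> y + i; apply; rewrite mem_enum.
Qed.

Lemma near_all_seq x (I : eqType) (s : seq I) (P : I -> X -> Prop) :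
  (forall i, i \in s -> near_pt x (P i)) ->
  near_pt x (fun y => forall i, i \in s -> P i y).
Proof.
elim: s => [|i s IH] h; first exact: nearT.
apply: near_app2 (h i _) (IH _) _; rewrite ?mem_head //.
  by move=> j js; apply: h; rewrite inE js orbT.
by move=> y Piy Ps j; rewrite inE => /predU1P[->//|/Ps].
Qed.

Lemma openP (U : set X) : open U <-> forall x, U x -> near_pt x U.
Proof.
split=> [oU x Ux|h]; first exact: near_open.
by apply: good_open_local => // x /h[V [oV Vx VU]]; exists V; split.
Qed.

Lemma open_near (P : X -> Prop) : open [set x | near_pt x P].
Proof. by apply/openP => x /near_near. Qed.

Lemma regP (U : set X) f : reg U f <-> open U /\ forall x, U x -> reg_at x f.
Proof.
split=> [rf|[oU h]].
  by split=> [|x Ux]; [apply: good_reg_open rf|apply: reg_reg_at rf Ux].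
apply: good_reg_local => // x /h[V [oV Vx rf]].
by exists V, f; split.
Qed.

Lemma reg_sub (U V : set X) f : reg U f -> open V -> V `<=` U -> reg V f.
Proof. by move=> /regP[_ h] oV VU; apply/regP; split=> // x /VU/h. Qed.

Lemma reg_at_eq x f g : reg_at x f -> near_pt x (fun y => f y = g y) -> reg_at x g.
Proof.
move=> [U [oU Ux rf]] [V [oV Vx fg]]; exists (U `&` V).
have oUV := good_openI gX oU oV; split=> //.
apply: good_reg_local => // y [Uy Vy]; exists U, f; split=> //.
by move=> z [_ /fg ->].
Qed.

Lemma reg_at_cst x (a : K) : reg_at x (fun=> a).
Proof. by exists setT; split=> //; [apply: good_openT | apply: good_reg_cst]. Qed.

Lemma reg_at_2 x f g : reg_at x f -> reg_at x g ->
  exists U, [/\ open U, U x, reg U f & reg U g].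
Proof.
move=> [U [oU Ux rf]] [V [oV Vx rg]]; exists (U `&` V).
have oUV := good_openI gX oU oV.
by split=> //; [apply: reg_sub rf _ _|apply: reg_sub rg _ _] => // y [].
Qed.

Lemma reg_atD x f g : reg_at x f -> reg_at x g -> reg_at x (fun y => f y + g y).
Proof.
move=> rf rg; have [U [oU Ux rfU rgU]] := reg_at_2 rf rg.
by exists U; split=> //; apply: good_reg_add.
Qed.

Lemma reg_atM x f g : reg_at x f -> reg_at x g -> reg_at x (fun y => f y * g y).
Proof.
move=> rf rg; have [U [oU Ux rfU rgU]] := reg_at_2 rf rg.
by exists U; split=> //; apply: good_reg_mul.
Qed.

Lemma reg_atN x f : reg_at x f -> reg_at x (fun y => - f y).
Proof.
move=> rf; apply: reg_at_eq (reg_atM (reg_at_cst x (-1)) rf) _.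
by apply: nearT => y; rewrite mulN1r.
Qed.

Lemma reg_atB x f g : reg_at x f -> reg_at x g -> reg_at x (fun y => f y - g y).
Proof. by move=> rf /reg_atN; apply: reg_atD. Qed.

Lemma reg_atX x f n : reg_at x f -> reg_at x (fun y => f y ^+ n).
Proof.
move=> rf; elim: n => [|n IH].
  by apply: reg_at_eq (reg_at_cst x 1) _; apply: nearT.
by apply: reg_at_eq (reg_atM rf IH) _; apply: nearT => y; rewrite exprS.
Qed.

Lemma reg_at_sum x (I : Type) (s : seq I) (P : pred I) (F : I -> X -> K) :
  (forall i, P i -> reg_at x (F i)) -> reg_at x (fun y => \sum_(i <- s | P i) F i y).
Proof.
move=> h; elim: s => [|i s IH].
  by apply: reg_at_eq (reg_at_cst x 0) _; apply: nearT => y; rewrite big_nil.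
case Pi: (P i).
  by apply: reg_at_eq (reg_atD (h i Pi) IH) _; apply: nearT => y; rewrite big_cons Pi.
by apply: reg_at_eq IH _; apply: nearT => y; rewrite big_cons Pi.
Qed.

Lemma reg_at_prod x (I : Type) (s : seq I) (P : pred I) (F : I -> X -> K) :
  (forall i, P i -> reg_at x (F i)) -> reg_at x (fun y => \prod_(i <- s | P i) F i y).
Proof.
move=> h; elim: s => [|i s IH].
  by apply: reg_at_eq (reg_at_cst x 1) _; apply: nearT => y; rewrite big_nil.
case Pi: (P i).
  by apply: reg_at_eq (reg_atM (h i Pi) IH) _; apply: nearT => y; rewrite big_cons Pi.
by apply: reg_at_eq IH _; apply: nearT => y; rewrite big_cons Pi.
Qed.

Lemma near_nz x f : reg_at x f -> f x != 0 -> near_pt x (fun y => f y != 0).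
Proof.
move=> [U [oU Ux rf]] fx; exists [set y | U y /\ f y != 0]; split=> //.
  exact: good_reg_nz.
by move=> y [].
Qed.

Lemma reg_atV x f : reg_at x f -> f x != 0 -> reg_at x (fun y => (f y)^-1).
Proof.
move=> [U [oU Ux rf]] fx; pose V := [set y | U y /\ f y != 0].
have oV : open V by apply: good_reg_nz.
exists V; split=> //; apply: good_reg_inv => //.
  by apply: reg_sub rf oV _ => y [].
by move=> y [].
Qed.

Lemma reg_at_div x f g : reg_at x f -> reg_at x g -> g x != 0 ->
  reg_at x (fun y => f y / g y).
Proof. by move=> rf rg gx; apply: reg_atM => //; apply: reg_atV. Qed.

Lemma reg_at_exprz x f (n : int) : reg_at x f -> f x != 0 ->
  reg_at x (fun y => f y ^ n).
Proof.
move=> rf fx; case: n => n; first exact: reg_atX.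
by apply: reg_atV; [exact: reg_atX | rewrite expf_neq0].
Qed.

Lemma reg_at_det x n (A : X -> 'M[K]_n) :
  (forall i j, reg_at x (fun y => A y i j)) -> reg_at x (fun y => \det (A y)).
Proof.
move=> h; apply: reg_at_sum => s _; apply: reg_atM; first exact: reg_at_cst.
exact: reg_at_prod.
Qed.

Lemma reg_at_meval x n (h : 'I_n -> X -> K) (p : {mpoly K[n]}) :
  (forall i, reg_at x (h i)) -> reg_at x (fun y => p.@[fun i => h i y]).
Proof.
move=> rh.
have: reg_at x (fun y => \sum_(m <- msupp p) p@_m * \prod_i h i y ^+ m i).
  apply: reg_at_sum => m _; apply: reg_atM; first exact: reg_at_cst.
  by apply: reg_at_prod => i _; apply: reg_atX.
by move=> /reg_at_eq; apply; apply: nearT => y; rewrite mevalE.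
Qed.

Definition closed_set (C : set X) := forall x, ~ C x -> near_pt x (~` C).

Lemma closedP (C : set X) : closed C <-> closed_set C.
Proof. by rewrite /closed openP. Qed.

(** No closedness is built in: in this form irreducibility passes at once to images and products. *)
Definition irrset (H : set X) := (exists x, H x) /\
  forall x y P Q, H x -> H y -> near_pt x P -> near_pt y Q ->
    exists z, [/\ H z, P z & Q z].

Lemma irrset_closed (H : set X) : irreducible_closed H <-> closed_set H /\ irrset H.
Proof.
split=> [[/closedP cH [x0 Hx0] h]|[/closedP cH [[x0 Hx0] h]]].
  split=> //; split; first by exists x0.
  move=> x y P Q Hx Hy [U [oU Ux UP]] [V [oV Vx VQ]]; apply: contrapT => no.
  have := h (~` U) (~` V); rewrite /closed !setCK => /(_ oU oV)[].
  - move=> z Hz /=; apply: contrapT => /not_orP[/contrapT Uz /contrapT Vz].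
    by apply: no; exists z; split=> //; [apply: UP|apply: VQ].
  - by move=> /(_ x Hx).
  - by move=> /(_ y Hy).
split=> //; first by exists x0.
move=> A B /closedP cA /closedP cB HAB; apply: contrapT => /not_orP[].
move=> /existsNP[x /not_implyP[Hx nAx]] /existsNP[y /not_implyP[Hy nBy]].
have [z [Hz nAz nBz]] := h x y _ _ Hx Hy (cA _ nAx) (cB _ nBy).
by case: (HAB z Hz).
Qed.

End Good.

(** Pointwise, so that a homomorphism can be tested at one generic point and then translated, as in
    [descent_morphism]. *)
Definition morph_at X Y (f : X -> Y) x :=
  (forall P, near_pt (f x) P -> near_pt x (fun y => P (f y))) /\
  (forall h, reg_at (f x) h -> reg_at x (fun y => h (f y))).

Lemma morphismP X Y (f : X -> Y) : good X -> good Y ->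
  morphism f <-> forall x, morph_at f x.
Proof.
move=> gX gY; split=> [[fo fr] x|h].
  split=> [P [V [oV Vx VP]]|h [V [oV Vx rh]]].
    by exists (f @^-1` V); split=> //; [apply: fo | move=> y /VP].
  by exists (f @^-1` V); split=> //; [apply: fo | apply: fr].
have fo (V : set Y) : open V -> open (f @^-1` V).
  move=> /(openP gY) oV; apply/openP => // x Vfx.
  by case: (h x) => + _; apply; apply: oV.
split=> // V g rg; apply/regP => //; split; first exact/fo/(good_reg_open gY rg).
move=> x Vfx; case: (h x) => _; apply; exact: reg_reg_at rg Vfx.
Qed.

Lemma morph_at_comp X Y Z (f : X -> Y) (g : Y -> Z) x :
  morph_at f x -> morph_at g (f x) -> morph_at (g \o f) x.
Proof.
move=> [f1 f2] [g1 g2]; split=> [P /g1/f1 //|h /g2/f2 //].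
Qed.

Lemma morph_at_id X (x : X) : morph_at id x.
Proof. by []. Qed.

Lemma morph_at_cst X Y (y : Y) (x : X) : good X -> good Y -> morph_at (fun=> y) x.
Proof.
move=> gX gY; split=> [P /near_self Py|h _]; [exact: nearT | exact: reg_at_cst].
Qed.

Lemma morph_at_eq X Y (f g : X -> Y) x : good X -> morph_at f x ->
  near_pt x (fun y => f y = g y) -> morph_at g x.
Proof.
move=> gX [f1 f2] fg; have fgx := near_self fg; split=> [P|h].
  by rewrite -fgx => /f1 /near_app2 - /(_ gX _ _ fg); apply=> y + <-.
by rewrite -fgx => /f2 /reg_at_eq; apply=> //; apply: near_mono fg _ => y ->.
Qed.

Section SubSpace.
Variables (X : fun_space K) (gX : good X) (S : set X).
Local Notation XS := (sub_space S).

Lemma sub_near (x : XS) P :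
  near_pt x P <-> near_pt (val x : X) (fun y => forall s : XS, val s = y -> P s).
Proof.
split=> [[U [[U' oU' ->] Ux UP]]|[U [oU Ux UP]]].
  by exists U'; split=> // y U'y s sy; apply: UP; rewrite /= sy.
exists (val @^-1` U); split=> //; first by exists U.
by move=> s /UP; apply.
Qed.

Lemma sub_reg_loc (x : XS) f : reg_at x f <-> exists2 h, reg_at (val x : X) h &
   near_pt x (fun y => f y = h (val y)).
Proof.
split=> [[U [oU Ux [_ /(_ x Ux)[U' [h [oU' U'x rh fh]]]]]]|].
  exists h; first by exists U'.
  have [U'' oU'' UE] := oU.
  exists (val @^-1` (U' `&` U'')); split.
  - by exists (U' `&` U'') => //; apply: good_openI.
  - by split=> //; move: Ux; rewrite UE.
  by move=> y [U'y U''y]; apply: fh => //; rewrite UE.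
case=> h [U [oU Ux rh]] [V [[V' oV' VE] Vx fh]].
have oW : open (val @^-1` (U `&` V') : set XS).
  by exists (U `&` V') => //; apply: good_openI.
exists (val @^-1` (U `&` V')); split=> //.
  by split=> //; move: Vx; rewrite VE.
split=> // y [Uy V'y]; exists U, h; split=> // z [Uz V'z] _.
by apply: fh; rewrite VE.
Qed.

Lemma sub_good : good XS.
Proof.
have loc (U : set XS) : (forall x, U x -> exists V, [/\ open V, V x & V `<=` U]) ->
    open U.
  move=> h; exists [set y | near_pt y (fun z => forall s : XS, val s = z -> U s)].
    exact: open_near.
  apply/seteqP; split=> x /=.
    by move=> /h[V [oV Vx VU]]; apply/(sub_near x U); exists V.
  by move=> /near_self; apply.
have rloc (U : set XS) f : open U ->
    (forall x, U x -> exists V h,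
      [/\ open V, V x, reg V h & forall y, U y -> V y -> f y = h y]) -> reg U f.
  move=> oU h; split=> // x Ux.
  have [V [k [oV Vx [_ /(_ x Vx)[U' [l [oU' U'x rl kl]]]] fk]]] := h x Ux.
  have [V' oV' VE] := oV.
  exists (U' `&` V'), l; split=> //.
  - exact: good_openI.
  - by split=> //; move: Vx; rewrite VE.
  - by apply: (reg_sub gX rl); [apply: good_openI | move=> y []].
  move=> y Uy [U'y V'y]; rewrite fk ?VE // kl ?VE //.
have openI2 (U V : set XS) : open U -> open V -> open (U `&` V).
  move=> [U' oU' ->] [V' oV' ->]; exists (U' `&` V') => //.
  exact: good_openI.
have op2 (op : K -> K -> K) :
    (forall (U : set X) f g, reg U f -> reg U g -> reg U (fun x => op (f x) (g x))) ->
    forall (U : set XS) f g, reg U f -> reg U g -> reg U (fun x => op (f x) (g x)).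
  move=> hop U f g [oU rf] [_ rg]; split=> // x Ux.
  have [U1 [h1 [oU1 U1x r1 e1]]] := rf x Ux.
  have [U2 [h2 [oU2 U2x r2 e2]]] := rg x Ux.
  have oI := good_openI gX oU1 oU2.
  exists (U1 `&` U2), (fun x => op (h1 x) (h2 x)); split=> //.
    by apply: hop; [apply: (reg_sub gX r1 oI) => y []|apply: (reg_sub gX r2 oI) => y []].
  by move=> y Uy [/e1 -> // /e2 ->].
split=> //.
- by exists setT => //; apply: good_openT.
- by move=> U f [].
- move=> a; split; first by exists setT => //; apply: good_openT.
  move=> x _; exists setT, (fun=> a); split=> //; first exact: good_openT.
  exact: good_reg_cst.
- by apply: op2; apply: good_reg_add.
- by apply: op2; apply: good_reg_mul.
- move=> U f [oU rf]; apply: loc => x [Ux fx].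
  have [U1 [h [oU1 U1x r1 e1]]] := rf x Ux.
  have [U' oU' UE] := oU.
  exists (val @^-1` (U' `&` [set y | U1 y /\ h y != 0])); split.
  + exists (U' `&` [set y | U1 y /\ h y != 0]) => //.
    by apply: good_openI => //; apply: good_reg_nz.
  + by split; [move: Ux; rewrite UE|split=> //; rewrite -e1].
  by move=> y [U'y [U1y hy]]; have Uy : U y by [rewrite UE]; split=> //; rewrite e1.
move=> U f [oU rf] fnz; split=> // x Ux.
have [U1 [h [oU1 U1x r1 e1]]] := rf x Ux.
have oV := good_reg_nz gX r1.
exists [set y | U1 y /\ h y != 0], (fun y => (h y)^-1); split=> //.
- by split=> //; rewrite -e1 ?fnz.
- by apply: good_reg_inv => // [|y []//]; apply: (reg_sub gX r1) => // y [].
by move=> y Uy [U1y _]; rewrite e1.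
Qed.

Lemma sub_val_morph (x : XS) : morph_at (val : XS -> X) x.
Proof.
split=> [P nP|h rh]; first by apply/sub_near; apply: near_mono nP _ => y Py s ->.
by apply/sub_reg_loc; exists h => //; apply: nearT => //; exact: sub_good.
Qed.

Lemma sub_morph (Y : fun_space K) (f : Y -> XS) y : good Y ->
  morph_at (fun y => val (f y) : X) y -> morph_at f y.
Proof.
move=> gY [f1 f2]; split=> [P /sub_near /f1 nP|h /sub_reg_loc[k /f2 rk nk]].
  by apply: near_mono nP _ => z /(_ _ erefl).
apply: (reg_at_eq gY rk).
have /sub_near /f1 nk' := nk.
by apply: near_mono nk' _ => z /(_ _ erefl).
Qed.

End SubSpace.

End Germs.

(** * Products and completeness *)

Section Products.
Variable K : closedFieldType.
Implicit Types X Y Z T : fun_space K.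

Section Prod.
Variables (X Y : fun_space K) (gX : good X) (gY : good Y).
Local Notation XY := (prod_space X Y).
Implicit Type p : XY.

Definition ten_at p (h : XY -> K) := exists n (f : 'I_n -> X -> K) (g : 'I_n -> Y -> K),
  [/\ forall i, reg_at p.1 (f i), forall i, reg_at p.2 (g i)
    & forall q, h q = \sum_i f i q.1 * g i q.2].

(** A box cut down by the nonvanishing of one tensor; boxes alone would give the product topology,
    which is too coarse. *)
Definition box_at p (P : XY -> Prop) := exists h A B,
  [/\ ten_at p h, h p != 0, near_pt p.1 A, near_pt p.2 B &
      forall q, A q.1 -> B q.2 -> h q != 0 -> P q].

Lemma ten_open p h : ten_at p h -> exists U V,
  [/\ open U, open V, U p.1, V p.2 & forall U' V', open U' -> open V' ->
      U' `<=` U -> V' `<=` V -> @tensor K X Y U' V' h].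
Proof.
case=> n [f [g [rf rg hE]]].
have nf := near_all gX (fun i => near_reg (rf i)).
have ng := near_all gY (fun i => near_reg (rg i)).
exists [set x | near_pt x (fun x => forall i, reg_at x (f i))].
exists [set y | near_pt y (fun y => forall i, reg_at y (g i))].
split; try exact: open_near; try exact: near_near.
- by apply: near_self (near_near nf).
- by apply: near_self (near_near ng).
move=> U' V' oU' oV' UU VV; exists n, f, g; split=> // i; apply/regP => //; split=> // z.
  by move=> /UU /near_self.
by move=> /VV /near_self.
Qed.

Lemma tensor_ten (U : set X) (V : set Y) p h :
  U p.1 -> V p.2 -> @tensor K X Y U V h -> ten_at p h.
Proof.
move=> Up Vp [n [f [g [rf rg hE]]]]; exists n, f, g; split=> // i.
  exact: reg_reg_at (rf i) _.
exact: reg_reg_at (rg i) _.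
Qed.

Lemma ten_left p f : reg_at p.1 f -> ten_at p (fun q => f q.1).
Proof.
move=> rf; exists 1%N, (fun=> f), (fun _ => fun=> 1); split=> // [i|q].
  exact: reg_at_cst.
by rewrite big_ord1 mulr1.
Qed.

Lemma ten_right p f : reg_at p.2 f -> ten_at p (fun q => f q.2).
Proof.
move=> rf; exists 1%N, (fun _ => fun=> 1), (fun=> f); split=> // [i|q].
  exact: reg_at_cst.
by rewrite big_ord1 mul1r.
Qed.

Lemma ten_cst p (a : K) : ten_at p (fun=> a).
Proof. exact: (ten_left (reg_at_cst gX p.1 a)). Qed.

Lemma tenD p h k : ten_at p h -> ten_at p k -> ten_at p (fun q => h q + k q).
Proof.
move=> [n [f [g [rf rg hE]]]] [m [f' [g' [rf' rg' kE]]]].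
exists (n + m)%N, (fun i : 'I_(n + m) => match fintype.split i with inl a => f a | inr b => f' b end),
  (fun i : 'I_(n + m) => match fintype.split i with inl a => g a | inr b => g' b end).
split=> [i|i|q]; try by case: fintype.split.
rewrite big_split_ord hE kE /=; congr (_ + _); apply: eq_bigr => i _.
  by rewrite (unsplitK (inl i)).
by rewrite (unsplitK (inr i)).
Qed.

Lemma tenM p h k : ten_at p h -> ten_at p k -> ten_at p (fun q => h q * k q).
Proof.
move=> [n [f [g [rf rg hE]]]] [m [f' [g' [rf' rg' kE]]]].
pose I := prod 'I_n 'I_m : finType.
exists #|I|, (fun i x => f (enum_val i : I).1 x * f' (enum_val i : I).2 x),
  (fun i y => g (enum_val i : I).1 y * g' (enum_val i : I).2 y).
split=> [i|i|q]; try exact: reg_atM.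
rewrite hE kE big_distrlr /= pair_big /= (reindex (@enum_val _ I)) /=; last first.
  by apply: onW_bij; apply: enum_val_bij.
by apply: eq_bigr => i _; rewrite mulrACA.
Qed.

Lemma boxP p P : box_at p P <-> exists (U : set X) (V : set Y) h,
    [/\ open U /\ open V, U p.1 /\ V p.2, @tensor K X Y U V h, h p != 0
        & forall q, U q.1 -> V q.2 -> h q != 0 -> P q].
Proof.
split=> [[h [A [B [th hp [U [oU Up UA]] [V [oV Vp VB]] hP]]]]|].
  have [U' [V' [oU' oV' U'p V'p tUV]]] := ten_open th.
  exists (U `&` U'), (V `&` V'), h; split=> //.
  - by split; apply: good_openI.
  - by apply: tUV; try apply: good_openI => //; move=> ? [].
  by move=> q [/UA ? _] [/VB ? _]; apply: hP.
move=> [U [V [h [[oU oV] [Up Vp] th hp hP]]]]; exists h, U, V; split=> //.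
- exact: tensor_ten th.
- exact: near_open.
- exact: near_open.
Qed.

Lemma box_mono p P Q : box_at p P -> (forall q, P q -> Q q) -> box_at p Q.
Proof.
move=> [h [A [B [th hp nA nB hP]]]] PQ; exists h, A, B; split=> // q Aq Bq hq.
exact/PQ/hP.
Qed.

Lemma boxI p P Q : box_at p P -> box_at p Q -> box_at p (fun q => P q /\ Q q).
Proof.
move=> [h [A [B [th hp nA nB hP]]]] [h' [A' [B' [th' hp' nA' nB' hP']]]].
exists (fun q => h q * h' q), (fun x => A x /\ A' x), (fun x => B x /\ B' x); split.
- exact: tenM.
- by rewrite mulf_neq0.
- exact: nearI.
- exact: nearI.
by move=> q [Aq A'q] [Bq B'q]; rewrite mulf_eq0 negb_or => /andP[hq h'q]; split; auto.
Qed.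

Lemma box_box p P : box_at p P -> box_at p (fun q => box_at q P).
Proof.
move=> [h [A [B [th hp nA nB hP]]]].
have [C [D [nC nD tCD]]] : exists C D, [/\ near_pt p.1 C, near_pt p.2 D &
   forall q, C q.1 -> D q.2 -> ten_at q h].
  have [U' [V' [oU' oV' U'p V'p tUV]]] := ten_open th.
  exists U', V'; split; try exact: near_open.
  by move=> q Uq Vq; apply: (tensor_ten Uq Vq); apply: tUV.
exists h, (fun x => near_pt x A /\ C x), (fun y => near_pt y B /\ D y); split=> //.
- by apply: nearI => //; apply: near_near.
- by apply: nearI => //; apply: near_near.
by move=> q [Aq Cq] [Bq Dq] hq; exists h, A, B; split=> //; apply: tCD.
Qed.

Lemma box_self p P : box_at p P -> P p.
Proof. by move=> [h [A [B [th hp nA nB hP]]]]; apply: hP => //; apply: near_self. Qed.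

Lemma box_nz p h : ten_at p h -> h p != 0 -> box_at p (fun q => h q != 0).
Proof.
move=> th hp; exists h, setT, setT; split=> //; exact: nearT.
Qed.

Lemma box_near p P : near_pt p P <-> box_at p P.
Proof.
split=> [[W [oW Wp WP]]|bP].
  by apply: box_mono WP; apply/boxP; apply: oW.
exists (fun q => box_at q P); split=> //; last by move=> q /box_self.
by move=> q /box_box bq; apply/boxP.
Qed.

Lemma prod_reg_loc p F : @reg_at K XY p F <-> exists a b, [/\ ten_at p a, ten_at p b, b p != 0
  & near_pt p (fun q => F q = a q / b q)].
Proof.
split=> [[W [oW Wp [_ /(_ p Wp)[U [V [a [b [[oU oV] [Up Vp] [ta tb] bp FE]]]]]]]]|].
  exists a, b; split=> //; try exact: tensor_ten (_ : @tensor K X Y U V _).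
  apply/box_near; apply: box_mono (boxI (boxI _ (box_nz (tensor_ten Up Vp tb) bp)) _) _.
  - exact: (proj1 (box_near p W) (near_open oW Wp)).
  - exists (fun=> 1), U, V; split; [exact: ten_cst | exact: oner_neq0 | | | ].
    + exact: near_open.
    + exact: near_open.
    + by move=> q Uq Vq _; exact: (conj Uq Vq).
  by move=> q [[Wq bq] [Uq Vq]]; apply: FE.
move=> [a [b [ta tb bp /box_near nF]]].
pose G q := [/\ ten_at q a, ten_at q b, b q != 0 & F q = a q / b q].
have tt h : ten_at p h -> box_at p (fun q => ten_at q h).
  move=> th; have [U' [V' [oU' oV' U'p V'p tUV]]] := ten_open th.
  exists (fun=> 1), U', V'; split; [exact: ten_cst | exact: oner_neq0 | | | ].
  - exact: near_open.
  - exact: near_open.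
  by move=> q Uq Vq _; apply: (tensor_ten Uq Vq); apply: tUV.
have bG : box_at p G.
  apply: box_mono (boxI (boxI (tt a ta) (tt b tb)) (boxI (box_nz tb bp) nF)) _.
  by move=> q [[? ?] [? ?]]; split.
have oW : @open K XY [set q | box_at q G].
  by move=> q /box_box bq; apply/boxP.
exists [set q | box_at q G]; split=> //; split=> // q bq.
have [taq tbq bq0 _] := box_self bq.
have [U1 [V1 [oU1 oV1 U1q V1q t1]]] := ten_open taq.
have [U2 [V2 [oU2 oV2 U2q V2q t2]]] := ten_open tbq.
have oU := good_openI gX oU1 oU2; have oV := good_openI gY oV1 oV2.
exists (U1 `&` U2), (V1 `&` V2), a, b; split=> //.
- by split; [apply: t1 | apply: t2] => // ? [].
by move=> r /box_self [].
Qed.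

Lemma prod_open (W : set XY) : open W <-> forall p, W p -> near_pt p W.
Proof.
split=> [oW p Wp|h]; first exact: near_open.
rewrite /open /= => p Wp.
by apply/boxP/box_near; apply: h.
Qed.

Lemma prod_reg (W : set XY) F : reg W F <-> open W /\ forall p, W p -> reg_at p F.
Proof.
split=> [rF|[oW h]].
  by split=> [|p Wp]; [case: rF | exists W; split=> //; case: rF].
split=> // p Wp; have [U [oU Up [_ /(_ p Up)[A [B [a [b [oAB ABp tAB bp FE]]]]]]]] := h p Wp.
have [A' [B' [h' [[oA' oB'] [A'p B'p] th' h'p h'U]]]] := proj1 (boxP p U) (proj1 (box_near p U) (near_open oU Up)).
move: oAB ABp tAB => [oA oB] [Ap Bp] [ta tb].
have t'a : ten_at p a by exact: tensor_ten ta.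
have t'b : ten_at p b by exact: tensor_ten tb.
have t'h : ten_at p h' by exact: tensor_ten th'.
have tah := tenM t'a t'h; have tbh := tenM t'b t'h.
have [U1 [V1 [oU1 oV1 U1p V1p t1]]] := ten_open tah.
have [U2 [V2 [oU2 oV2 U2p V2p t2]]] := ten_open tbh.
have oL := good_openI gX (good_openI gX oU1 oU2) (good_openI gX oA oA').
have oR := good_openI gY (good_openI gY oV1 oV2) (good_openI gY oB oB').
(* Multiplying numerator and denominator by [h'] makes a nonzero denominator force the point into
   [U], where the local formula for [F] is known. *)
exists ((U1 `&` U2) `&` (A `&` A')), ((V1 `&` V2) `&` (B `&` B')).
exists (fun q => a q * h' q), (fun q => b q * h' q); split=> //.
- by split; [apply: t1|apply: t2] => // ? [[]].
- by rewrite mulf_neq0.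
move=> q Wq [_ [Aq A'q]] [_ [Bq B'q]]; rewrite mulf_eq0 negb_or => /andP[bq hq].
by rewrite FE ?invfM ?mulrA; [rewrite mulrAC mulfK ?mulrA // mulrAC mulfK|apply: h'U| | |].
Qed.

Lemma prod_good : good XY.
Proof.
have rdiv p F a b : ten_at p a -> ten_at p b -> b p != 0 ->
  near_pt p (fun q => F q = a q / b q) -> @reg_at K XY p F.
  by move=> *; apply/prod_reg_loc; exists a, b.
have nI (p : XY) P Q : near_pt p P -> near_pt p Q -> near_pt p (fun q => P q /\ Q q).
  by move=> /box_near bP /box_near bQ; apply/box_near; apply: boxI.
have nn p b : ten_at p b -> b p != 0 -> near_pt p (fun q => b q != 0).
  by move=> *; apply/box_near; apply: box_nz.
split.
- by apply/prod_open => p _; apply/box_near; exists (fun=> 1), setT, setT; split;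
    [exact: ten_cst | exact: oner_neq0 | exact: nearT | exact: nearT | ].
- move=> U V /prod_open oU /prod_open oV; apply/prod_open => p [/oU nU /oV nV].
  exact: nI.
- move=> U h; apply/prod_open => p /h[V [oV Vp VU]]; exists V; split=> //.
- by move=> U f /prod_reg[].
- move=> U f oU h; apply/prod_reg; split=> // p Up.
  have [V [k [oV Vp rk fk]]] := h p Up.
  have [a [b [ta tb bp nab]]] := proj1 (prod_reg_loc p k) (proj2 (proj1 (prod_reg _ _) rk) p Vp).
  apply: (rdiv _ _ a b) => //; apply: near_mono (nI _ _ _ nab (nI _ _ _ (near_open oU Up) (near_open oV Vp))) _.
  by move=> q [<- [Uq Vq]]; apply: fk.
- move=> a; apply/prod_reg; split.
    by apply/prod_open => p _; apply/box_near; exists (fun=> 1), setT, setT; split;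
     [exact: ten_cst | exact: oner_neq0 | exact: nearT | exact: nearT | ].
  move=> p _; apply: (rdiv _ _ (fun=> a) (fun=> 1)); try exact: ten_cst.
    exact: oner_neq0.
  apply/box_near; apply: box_mono (box_nz (ten_cst p 1) (oner_neq0 _)) _.
  by move=> q _; rewrite divr1.
- move=> U f g /prod_reg[oU rf] /prod_reg[_ rg]; apply/prod_reg; split=> // p Up.
  have [a [b [ta tb bp nab]]] := proj1 (prod_reg_loc p f) (rf p Up).
  have [c [d [tc td dp ncd]]] := proj1 (prod_reg_loc p g) (rg p Up).
  apply: (rdiv _ _ (fun q => a q * d q + c q * b q) (fun q => b q * d q)).
  + by apply: tenD; apply: tenM.
  + exact: tenM.
  + by rewrite mulf_neq0.
  apply: near_mono (nI _ _ _ (nI _ _ _ nab ncd) (nI _ _ _ (nn _ _ tb bp) (nn _ _ td dp))) _.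
  by move=> q [[-> ->] [bq dq]]; rewrite addf_div.
- move=> U f g /prod_reg[oU rf] /prod_reg[_ rg]; apply/prod_reg; split=> // p Up.
  have [a [b [ta tb bp nab]]] := proj1 (prod_reg_loc p f) (rf p Up).
  have [c [d [tc td dp ncd]]] := proj1 (prod_reg_loc p g) (rg p Up).
  apply: (rdiv _ _ (fun q => a q * c q) (fun q => b q * d q)).
  + exact: tenM.
  + exact: tenM.
  + by rewrite mulf_neq0.
  apply: near_mono (nI _ _ _ nab ncd) _ => q [-> ->].
  by rewrite mulf_div.
- move=> U f /prod_reg[oU rf]; apply/prod_open => p [Up fp].
  have [a [b [ta tb bp nab]]] := proj1 (prod_reg_loc p f) (rf p Up).
  have ap : a p != 0.
    by apply: contraNneq fp => ap; rewrite (near_self nab) ap mul0r.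
  apply: near_mono (nI _ _ _ (nI _ _ _ nab (near_open oU Up)) (nI _ _ _ (nn _ _ tb bp) (nn _ _ ta ap))) _.
  by move=> q [[fq Uq] [bq aq]]; split=> //; rewrite fq mulf_neq0 ?invr_eq0.
move=> U f /prod_reg[oU rf] fnz; apply/prod_reg; split=> // p Up.
have [a [b [ta tb bp nab]]] := proj1 (prod_reg_loc p f) (rf p Up).
have ap : a p != 0.
  by apply: contraNneq (fnz p Up) => ap; rewrite (near_self nab) ap mul0r.
apply: (rdiv _ _ b a) => //; apply: near_mono nab _ => q ->.
by rewrite invf_div.
Qed.

Lemma fst_morph p : morph_at (fst : XY -> X) p.
Proof.
split=> [P nP|h rh].
  apply/box_near; exists (fun=> 1), P, setT; split=> //.
  - exact: ten_cst.
  - exact: oner_neq0.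
  - exact: nearT.
apply/prod_reg_loc; exists (fun q => h q.1), (fun=> 1); split.
- exact: ten_left.
- exact: ten_cst.
- exact: oner_neq0.
by apply: nearT; [exact: prod_good | move=> q; rewrite divr1].
Qed.

Lemma snd_morph p : morph_at (snd : XY -> Y) p.
Proof.
split=> [P nP|h rh].
  apply/box_near; exists (fun=> 1), setT, P; split=> //.
  - exact: ten_cst.
  - exact: oner_neq0.
  - exact: nearT.
apply/prod_reg_loc; exists (fun q => h q.2), (fun=> 1); split.
- exact: ten_right.
- exact: ten_cst.
- exact: oner_neq0.
by apply: nearT; [exact: prod_good | move=> q; rewrite divr1].
Qed.

Lemma pair_morph Z (f : Z -> X) (g : Z -> Y) z : good Z ->
  morph_at f z -> morph_at g z -> morph_at (fun z => (f z, g z) : XY) z.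
Proof.
move=> gZ [f1 f2] [g1 g2].
have tz h : @ten_at (f z, g z) h -> reg_at z (fun z => h (f z, g z)).
  move=> [n [a [b [ra rb hE]]]].
  have : reg_at z (fun z => \sum_i a i (f z) * b i (g z)).
    apply: reg_at_sum => // i _; apply: reg_atM => //; [exact: f2 | exact: g2].
  by move=> /(reg_at_eq gZ); apply; apply: nearT => // y; rewrite hE.
split=> [P /box_near[h [A [B [th hp /f1 nA /g1 nB hP]]]]|h /prod_reg_loc[a [b [ta tb bp nab]]]].
  apply: near_app2 (near_app2 gZ nA nB (fun y Ay By => conj Ay By)) (near_nz gZ (tz _ th) hp) _ => //.
  by move=> y [Ay By] hy; apply: hP.
apply: (reg_at_eq gZ (reg_at_div gZ (tz _ ta) (tz _ tb) bp)).
move: nab => /box_near[k [A [B [tk kp /f1 nA /g1 nB kP]]]].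
apply: near_app2 (near_app2 gZ nA nB (fun y Ay By => conj Ay By)) (near_nz gZ (tz _ tk) kp) _ => //.
by move=> y [Ay By] ky; rewrite kP.
Qed.

End Prod.

Lemma near_slice1 X Y (gX : good X) (gY : good Y) x y (P : X * Y -> Prop) :
  near_pt ((x, y) : prod_space X Y) P -> near_pt x (fun a => P (a, y)).
Proof.
have [+ _] := pair_morph gX gY gX (morph_at_id x) (morph_at_cst y x gX gY).
by apply.
Qed.

Lemma near_slice2 X Y (gX : good X) (gY : good Y) x y (P : X * Y -> Prop) :
  near_pt ((x, y) : prod_space X Y) P -> near_pt y (fun b => P (x, b)).
Proof.
have [+ _] := pair_morph gX gY gY (morph_at_cst x y gY gX) (morph_at_id y).
by apply.
Qed.

(** The points a whose slice of an open set is a neighbourhood of b form an open set ([sl]).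
    Irreducibility of X gives one a good for both open sets, and that of Y then gives a common point
    in the slice over a. *)
Lemma irrset_prod X Y : good X -> good Y -> irrset [set: X] -> irrset [set: Y] ->
  irrset [set: prod_space X Y].
Proof.
move=> gX gY [[x0 _] iX] [[y0 _] iY]; split; first by exists (x0, y0).
move=> [x y] [x' y'] P Q _ _ nP nQ.
have sl (a : X) (b : Y) R : near_pt ((a, b) : prod_space X Y) R ->
    near_pt a (fun a' => near_pt b (fun b' => R (a', b'))).
  move=> /near_near /(near_slice1 gX gY) nR; apply: near_mono nR _ => a'.
  exact: near_slice2.
have [a [_ /= nPa nQa]] := iX _ _ _ _ I I (sl _ _ _ nP) (sl _ _ _ nQ).
have [b [_ Pab Qab]] := iY _ _ _ _ I I nPa nQa.
by exists (a, b).
Qed.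

Lemma irrset_image X Y (f : X -> Y) (H : set X) : (forall x, morph_at f x) ->
  irrset H -> irrset (f @` H).
Proof.
move=> mf [[x0 Hx0] h]; split; first by exists (f x0), x0.
move=> _ _ P Q [x Hx <-] [y Hy <-] nP nQ.
have [z [Hz Pz Qz]] := h x y _ _ Hx Hy ((mf x).1 _ nP) ((mf y).1 _ nQ).
by exists (f z); split=> //; exists z.
Qed.

(* The tube lemma at each point of T; equivalent to universal closedness. *)
Definition complete_space X := forall T, good T -> forall (C : set (prod_space X T)) t,
  (forall x, near_pt ((x, t) : prod_space X T) (~` C)) ->
  near_pt t (fun t' => forall x, ~ C (x, t')).

Lemma complete_prod X Y : good X -> good Y -> complete_space X -> complete_space Y ->
  complete_space (prod_space X Y).
Proof.
move=> gX gY cX cY T gT C t nC.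
have gXY := prod_good gX gY; have gXT := prod_good gX gT.
have gYXT := prod_good gY gXT.
have h x : near_pt ((x, t) : prod_space X T) (fun q => forall y, ~ C ((q.1, y), q.2)).
  apply: (cY _ gXT (fun r => C ((r.2.1, r.1), r.2.2))) => y.
  pose F (r : prod_space Y (prod_space X T)) := ((r.2.1, r.1), r.2.2) : prod_space (prod_space X Y) T.
  have mF : morph_at F (y, (x, t)).
    have m1 : morph_at (fun r : prod_space Y (prod_space X T) => r.2 : prod_space X T) (y, (x, t)).
      exact: snd_morph.
    apply: pair_morph => //.
      apply: pair_morph => //; last exact: fst_morph.
      exact: (morph_at_comp m1 (fst_morph gX gT _)).
    exact: (morph_at_comp m1 (snd_morph gX gT _)).
  exact: (mF.1 _ (nC (x, y))).
have := cX _ gT (fun q => exists y, C ((q.1, y), q.2)) t.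
move=> H; have {}H : near_pt t (fun t' => forall x, ~ exists y, C ((x, y), t')).
  by apply: H => x; apply: near_mono (h x) _ => q Cq [y]; apply: Cq.
by apply: near_mono H _ => t' Ht' [x y] Cxy; apply: (Ht' x); exists y.
Qed.

Lemma complete_image X Y (f : X -> Y) : good X -> good Y -> (forall x, morph_at f x) ->
  (forall y, exists x, f x = y) -> complete_space X -> complete_space Y.
Proof.
move=> gX gY mf sf cX T gT C t nC.
have := cX _ gT (fun q => C (f q.1, q.2)) t.
move=> H; have {}H : near_pt t (fun t' => forall x, ~ C (f x, t')).
  apply: H => x; pose F (q : prod_space X T) := (f q.1, q.2) : prod_space Y T.
  have mF : morph_at F (x, t).
    apply: pair_morph (snd_morph gX gT _) => //; first exact: prod_good.
    exact: (morph_at_comp (fst_morph gX gT _) (mf _)).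
  exact: (mF.1 _ (nC (f x))).
by apply: near_mono H _ => t' h y; have [x <-] := sf y; apply: h.
Qed.

(** The part of the graph of f over C is closed, by [sep]; the image is its projection to Y. *)
Lemma image_closed X Y (f : X -> Y) (C : set X) : good X -> good Y -> complete_space X ->
  (forall x y, f x <> y -> near_pt ((x, y) : prod_space X Y) (fun q => f q.1 <> q.2)) ->
  closed_set C -> closed_set (f @` C).
Proof.
move=> gX gY cX sep clC y nCy.
have := cX _ gY (fun q => C q.1 /\ f q.1 = q.2) y.
move=> H; have {}H : near_pt y (fun y' => forall x, ~ (C x /\ f x = y')).
  apply: H => x; have [Cx|nCx] := pselect (C x).
    apply: near_mono (sep x y _) _ => [fx|q + [_]]; last by [].
    by apply: nCy; exists x.
  apply: near_mono ((fst_morph gX gY (x, y)).1 _ (clC x nCx)) _.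
  by move=> q /= nCq [].
by apply: near_mono H _ => y' h [x Cx fx]; apply: (h x).
Qed.

End Products.

(** * Nullstellensatz over an uncountable field *)

Section Ideals.
Variable A : comNzRingType.

Definition ideal (I : set A) := [/\ I 0, (forall a b, I a -> I b -> I (a + b))
  & forall r a, I a -> I (r * a)].

Lemma idealN I a : ideal I -> I a -> I (- a).
Proof. by move=> [_ _ h] /(h (-1)); rewrite mulN1r. Qed.

Lemma idealB I a b : ideal I -> I a -> I b -> I (a - b).
Proof. by move=> iI Ia Ib; have [_ h _] := iI; apply: h => //; apply: idealN. Qed.

Lemma ideal_sum I (J : Type) (s : seq J) (P : pred J) (F : J -> A) : ideal I ->
  (forall j, P j -> I (F j)) -> I (\sum_(j <- s | P j) F j).
Proof. by move=> [I0 ID _] h; apply: big_ind. Qed.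

Definition ideal_gen (S : set A) : set A := [set a | exists s : seq (A * A),
  (forall p, p \in s -> S p.2) /\ a = \sum_(p <- s) p.1 * p.2].

Lemma ideal_genP S : ideal (ideal_gen S).
Proof.
split.
- by exists [::]; rewrite big_nil.
- move=> _ _ [s [hs ->]] [t [ht ->]]; exists (s ++ t); rewrite big_cat; split=> //.
  by move=> p; rewrite mem_cat => /orP[/hs|/ht].
move=> r _ [s [hs ->]]; exists [seq (r * p.1, p.2) | p <- s]; split.
  by move=> _ /mapP[p /hs ? ->].
by rewrite big_map mulr_sumr; apply: eq_bigr => p _; rewrite mulrA.
Qed.

Lemma ideal_gen_sub S a : S a -> ideal_gen S a.
Proof.
by move=> Sa; exists [:: (1, a)]; rewrite big_seq1 mul1r; split=> // p; rewrite inE => /eqP->.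
Qed.

(** The quotient A / P with x inverted is a field: the last conclusion says that u outside P has the
    inverse q / x^d there. Stated without localization, it yields plain polynomial identities. *)
Lemma maximal_avoiding (I : set A) (x : A) : ideal I -> (forall d, ~ I (x ^+ d)) ->
  exists P, [/\ ideal P, I `<=` P, forall d, ~ P (x ^+ d)
    & forall u, ~ P u -> exists q d, P (x ^+ d - q * u)].
Proof.
move=> iI Ix.
(* The union of the empty chain is empty and must satisfy [Q] too, hence the alternative [J = set0];
   maximality excludes it afterwards. *)
pose Q (J : set A) := [/\ forall a b, J a -> J b -> J (a + b),
  forall r a, J a -> J (r * a), forall d, ~ J (x ^+ d) & J = set0 \/ I `<=` J].
have [F FQ totF|M [[MD Mm Mx MI] Mmax]] := @Zorn_bigcup _ Q.
  have sup J1 J2 : F J1 -> F J2 -> exists J, [/\ F J, J1 `<=` J & J2 `<=` J].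
    by move=> F1 F2; case: (totF _ _ F1 F2) => h; [exists J2|exists J1]; split.
  split.
  - move=> a b [J1 F1 J1a] [J2 F2 J2b]; have [J [FJ s1 s2]] := sup _ _ F1 F2.
    exists J => //; have [h _ _ _] := FQ _ FJ.
    by apply: h; [apply: s1|apply: s2].
  - by move=> r a [J FJ Ja]; exists J => //; have [_ h _ _] := FQ _ FJ; apply: h.
  - by move=> d [J FJ]; have [_ _ + _] := FQ _ FJ; apply.
  have [[J [FJ [a Ja]]]|no] := pselect (exists J, F J /\ J !=set0).
    have [_ _ _ [J0|IJ]] := FQ _ FJ; first by rewrite J0 in Ja.
    by right=> b Ib; exists J => //; apply: IJ.
  left; apply/seteqP; split=> // a [J FJ Ja]; apply: no; exists J; split=> //.
  by exists a.
have [I0 ID Im] := iI.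
have {}MI : I `<=` M.
  case: MI => // M0; exfalso; apply: (Mmax I); last by split=> //; right.
  by rewrite M0; split=> // h; apply: (h 0).
have iM : ideal M by split=> //; apply: MI.
exists M; split=> // u nMu; apply: contrapT => no.
apply: (Mmax [set a | exists m q, M m /\ a = m + q * u]).
  split; first by move=> a Ma; exists a, 0; rewrite mul0r addr0.
  by move=> /(_ u) h; apply/nMu/h; exists 0, 1; rewrite mul1r add0r; split=> //; apply: MI.
split.
- move=> _ _ [m [q [Mma ->]]] [m' [q' [Mm' ->]]]; exists (m + m'), (q + q').
  by split; [apply: MD | rewrite mulrDl addrACA].
- move=> r _ [m [q [Mma ->]]]; exists (r * m), (r * q).
  by split; [apply: Mm | rewrite mulrDr mulrA].
- by move=> d [m [q [Mma e]]]; apply: no; exists q, d; rewrite e addrK.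
by right=> a Ia; exists a, 0; rewrite mul0r addr0; split=> //; apply: MI.
Qed.

Lemma maximal_avoiding_prime (P : set A) x : ideal P -> (forall d, ~ P (x ^+ d)) ->
  (forall u, ~ P u -> exists q d, P (x ^+ d - q * u)) ->
  forall u v, P (u * v) -> P u \/ P v.
Proof.
move=> iP Px Pm u v Puv; have [_ PD PM] := iP.
apply: contrapT => /not_orP[/Pm[q [d h]] /Pm[q' [d' h']]].
apply: (Px (d + d')%N).
have -> : x ^+ (d + d') = (x ^+ d - q * u) * x ^+ d' + q * u * (x ^+ d' - q' * v)
    + q * q' * (u * v) by rewrite exprD; ring.
apply: (PD); last by apply: PM.
apply: (PD); last by apply: PM.
by rewrite mulrC; apply: PM.
Qed.

End Ideals.

Section HomogNS.
Variable K : closedFieldType.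
Hypothesis uncK : ~ countable [set: K].

(** A countable union of finite sets is countable, so some fibre is infinite. Long finite lists from
    that fibre are all that a linear dependence argument asks for. *)
Lemma uncountable_fiber (phi : K -> nat) :
  exists N : nat, forall m, exists s : seq K,
    [/\ uniq s, size s = m & all (fun c => phi c == N) s].
Proof.
have [N iN] : exists N, infinite_set [set c | phi c = N].
  apply: contrapT => /forallNP h; apply: uncK.
  have -> : [set: K] = \bigcup_(N in [set: nat]) [set c | phi c = N].
    by apply/seteqP; split=> // c _; exists (phi c).
  apply: bigcup_countable; first exact: countableP.
  by move=> N _; apply: finite_set_countable; apply: contrapT (h N).
exists N => m; elim: m => [|m [s [us ss /allP hs]]]; first by exists [::].
have [c [cN cs]] : exists c, phi c = N /\ c \notin s.
  apply: contrapT => no; apply: iN; apply: (@sub_finite_set _ _ [set` s]) => [c cN|].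
    by apply: contrapT => cs; apply: no; exists c; split=> //; apply/negP.
  by apply/finite_seqP; exists s.
by exists (c :: s); rewrite /= cs us ss cN eqxx; split=> //; apply/allP.
Qed.

Lemma mpoly_dependent n (N : nat) (m : nat) (q : 'I_m -> {mpoly K[n]}) :
  (#|{: 'X_{1..n < N}}| < m)%N -> (forall j, (msize (q j) <= N)%N) ->
  exists2 l : 'I_m -> K, exists j, l j != 0 & \sum_j l j *: q j = 0.
Proof.
move=> lt_m sq.
pose B := \matrix_(j < m, k < #|{: 'X_{1..n < N}}|) (q j)@_(enum_val k).
have kB : kermx B != 0.
  rewrite -mxrank_eq0 mxrank_ker subn_eq0 -ltnNge.
  exact: leq_ltn_trans (rank_leq_col _) lt_m.
pose v := nz_row (kermx B).
have vB : v *m B = 0 by apply: sub_kermxP; apply: nz_row_sub.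
have v0 : v != 0 by rewrite nz_row_eq0.
exists (fun j => v 0 j).
  apply: contrapT => no; move/eqP: v0; apply; apply/rowP => j; rewrite [RHS]mxE.
  by apply/eqP; apply: contrapT => h; apply: no; exists j; apply/negP.
apply/mpolyP => k; rewrite raddf_sum mcoeff0 /=.
have [kN|kN] := ltnP (mdeg k) N.
  have : (v *m B) 0 (enum_rank (BMultinom kN)) = 0 by rewrite vB mxE.
  rewrite mxE => vk; rewrite -[RHS]vk.
  by apply: eq_bigr => j _; rewrite mcoeffZ mxE enum_rankK.
apply: big1 => j _; rewrite mcoeffZ [X in _ * X]memN_msupp_eq0 ?mulr0 //.
by apply: msize_mdeg_ge; apply: leq_trans (sq j) kN.
Qed.

Section BinaryForm.
Variables (n : nat) (x y : {mpoly K[n]}).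

(** The homogenization x^d p(y/x), written without division. A [d] beyond the degree of p leaves a
    factor x^k, as in [bform_prod]. *)
Definition bform (d : nat) (p : {poly K}) : {mpoly K[n]} :=
  \sum_(i < d.+1) p`_i *: (y ^+ i * x ^+ (d - i)).

Lemma bformZ d c p : bform d (c *: p) = c *: bform d p.
Proof. by rewrite /bform scaler_sumr; apply: eq_bigr => i _; rewrite coefZ scalerA. Qed.

Lemma bform_sum d (I : Type) (s : seq I) (F : I -> {poly K}) :
  bform d (\sum_(i <- s) F i) = \sum_(i <- s) bform d (F i).
Proof.
rewrite /bform exchange_big /=; apply: eq_bigr => i _.
by rewrite coef_sum scaler_suml.
Qed.

Lemma bformM d c (p : {poly K}) : (size p <= d.+1)%N ->
  bform d.+1 (('X - c%:P) * p) = (y - c *: x) * bform d p.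
Proof.
move=> sp; rewrite /bform [RHS]mulrBl.
have -> : y * \sum_(i < d.+1) p`_i *: (y ^+ i * x ^+ (d - i)) =
    \sum_(i < d.+2) ('X * p)`_i *: (y ^+ i * x ^+ (d.+1 - i)).
  rewrite [RHS]big_ord_recl coefXM eqxx scale0r add0r mulr_sumr; apply: eq_bigr => i _.
  by rewrite coefXM /= subSS -scalerAr mulrA -exprS.
have -> : (c *: x) * \sum_(i < d.+1) p`_i *: (y ^+ i * x ^+ (d - i)) =
    \sum_(i < d.+2) (c *: p)`_i *: (y ^+ i * x ^+ (d.+1 - i)).
  rewrite [RHS]big_ord_recr /= coefZ [p`_d.+1]nth_default // mulr0 scale0r addr0 mulr_sumr.
  apply: eq_bigr => i _; rewrite coefZ /= subSn; last by rewrite -ltnS.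
  by rewrite exprS -scalerAl -scalerAr scalerA; congr (_ *: _); ring.
rewrite -sumrB; apply: eq_bigr => i _.
by rewrite mulrBl mul_polyC coefB scalerBl.
Qed.

Lemma bform_prod k (rs : seq K) :
  bform (size rs + k) (\prod_(r <- rs) ('X - r%:P)) = (\prod_(r <- rs) (y - r *: x)) * x ^+ k.
Proof.
elim: rs => [|r rs IH].
  rewrite !big_nil /bform big_ord_recl big1 ?addr0 => [|i _].
    by rewrite coef1 scale1r expr0 subn0.
  by rewrite coef1 scale0r.
by rewrite !big_cons addSn bformM ?IH ?mulrA // size_prod_XsubC ltnS leq_addr.
Qed.

End BinaryForm.

(** In the field made of the polynomials modulo [P] with x_i inverted, of countable dimension over
    K, each x_k / x_i is a constant c_k: otherwise the inverses of x_k / x_i - c, for uncountably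
    many c, are linearly dependent, and such a dependence is a polynomial equation for x_k / x_i,
    which splits over K. A form G of degree d in I is then congruent to G(c) x_i^d modulo P, whence
    G(c) = 0. *)
Lemma homog_NS n (I : set {mpoly K[n]}) (i : 'I_n) : ideal I ->
  (forall d, ~ I ('X_i ^+ d)) ->
  exists2 c : 'I_n -> K, c i = 1 & forall G d, I G -> G \is d.-homog -> G.@[c] = 0.
Proof.
move=> iI Ix; have [P [iP IP Px Pm]] := maximal_avoiding iI Ix.
have Pp := maximal_avoiding_prime iP Px Pm.
have [P0 PD PM] := iP.
have ev k : exists c, P ('X_k - c *: 'X_i).
  apply: contrapT => /forallNP no.
  have /choice [q hq] : forall c, exists qd : {mpoly K[n]} * nat,
      P ('X_i ^+ qd.2 - qd.1 * ('X_k - c *: 'X_i)).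
    by move=> c; have [q [d h]] := Pm _ (no c); exists (q, d).
  (* Size of the numerator and exponent of the denominator are coded together, so that on one fibre
     of [phi] all the inverses lie in one finite-dimensional space. *)
  pose phi c := pickle (msize (q c).1, (q c).2).
  have [N hN] := uncountable_fiber phi.
  have [[|c0 s1] [us ss hs]] := hN (#|{: 'X_{1..n < (odflt (0,0)%N (unpickle N)).1}}|.+1) => //.
  set M := (odflt _ _).1 in ss *; set D := (odflt (0,0)%N (unpickle N)).2.
  set s := c0 :: s1 in us ss hs.
  have hMD c : c \in s -> msize (q c).1 = M /\ (q c).2 = D.
    by move=> /(allP hs) /eqP cN; rewrite /M /D -cN /phi pickleK.
  have lts : (#|{: 'X_{1..n < M}}| < size s)%N by rewrite ss.
  have [l [j0 lj0] l0] := @mpoly_dependent n M (size s) (fun j => (q (nth 0 s j)).1)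
    lts (fun j => eq_leq (hMD _ (mem_nth 0 (ltn_ord j))).1).
  pose c (j : 'I_(size s)) := nth 0 s j.
  have c_inj : injective c by move=> a b /eqP; rewrite nth_uniq // => /eqP /val_inj.
  (* The numerator of the sum of the l_j / (X - c_j) over the common denominator; its value at c_j0
     is l_j0 times nonzero differences. *)
  pose h := \sum_j l j *: \prod_(r <- [seq c k | k <- enum 'I_(size s) & k != j]) ('X - r%:P).
  have sz j : size [seq c k | k <- enum 'I_(size s) & k != j] = (size s).-1.
    rewrite size_map -(@rem_filter _ j) ?enum_uniq // size_rem ?mem_enum //.
    by rewrite size_enum_ord.
  have h0 : h != 0.
    apply/negP => /eqP /(congr1 (fun p => p.[c j0])); rewrite horner_sum horner0.
    rewrite (bigD1 j0) //= [X in _ + X]big1 ?addr0.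
      rewrite hornerZ horner_prod => /eqP; rewrite mulf_eq0 (negPf lj0) /=.
      rewrite prodf_seq_eq0 => /hasP[r /mapP[k1 +] -> /=].
      by rewrite mem_filter => /andP[kj _]; rewrite hornerXsubC subr_eq0 (inj_eq c_inj) eq_sym (negPf kj).
    move=> j jj0; rewrite hornerZ horner_prod; apply/eqP; rewrite mulf_eq0; apply/orP; right.
    rewrite prodf_seq_eq0; apply/hasP; exists (c j0); last by rewrite /= hornerXsubC subrr.
    by apply/mapP; exists j0 => //; rewrite mem_filter eq_sym jj0 mem_enum.
  have Ph : P (bform 'X_i 'X_k (size s).-1 h).
    have e j : bform 'X_i 'X_k (size s).-1
        (\prod_(r <- [seq c k | k <- enum 'I_(size s) & k != j]) ('X - r%:P)) =
       \prod_(r <- [seq c k | k <- enum 'I_(size s) & k != j]) ('X_k - r *: 'X_i).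
      by rewrite -{1}(sz j) -[size _]addn0 bform_prod expr0 mulr1.
    (* Subtracting the product of all x_k - c_j x_i times the zero sum of the l_j q_j puts a factor
       x_i^D - q_j (x_k - c_j x_i), which lies in P, into each summand. *)
    suff : P ('X_i ^+ D * bform 'X_i 'X_k (size s).-1 h) by case/Pp => // /Px.
    rewrite /h bform_sum mulr_sumr.
    have -> : \sum_j 'X_i ^+ D * bform 'X_i 'X_k (size s).-1
        (l j *: \prod_(r <- [seq c k | k <- enum 'I_(size s) & k != j]) ('X - r%:P))
      = \sum_j (l j *: \prod_(r <- [seq c k | k <- enum 'I_(size s) & k != j]) ('X_k - r *: 'X_i)
            * ('X_i ^+ D - (q (c j)).1 * ('X_k - c j *: 'X_i))).
      rewrite -[LHS]subr0; have z0 : \prod_j ('X_k - c j *: 'X_i) * (\sum_j l j *: (q (c j)).1) = 0.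
        by rewrite l0 mulr0.
      rewrite -[X in _ - X]z0 mulr_sumr; rewrite -sumrB; apply: eq_bigr => j _.
      rewrite bformZ e.
      have -> : \prod_j0 ('X_k - c j0 *: 'X_i) = ('X_k - c j *: 'X_i) *
         \prod_(r <- [seq c k | k <- enum 'I_(size s) & k != j]) ('X_k - r *: 'X_i).
        by rewrite (bigD1 j) //= big_map big_filter big_enum_cond.
      rewrite -!mul_mpolyC; ring.
    apply: ideal_sum => // j _; apply: PM.
    by have := hq (c j); rewrite (hMD _ (mem_nth 0 (ltn_ord j))).2.
  have [rs hrs] := closed_field_poly_normal h.
  have ssz : (size rs <= (size s).-1)%N.
    have : (size h <= (size s).-1.+1)%N.
      apply: leq_trans (size_sum _ _ _) _; apply/bigmax_leqP => j _.
      by apply: leq_trans (size_scale_leq _ _) _; rewrite size_prod_XsubC sz.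
    by rewrite hrs size_scale ?lead_coef_eq0 // size_prod_XsubC.
  move: Ph; rewrite hrs bformZ -(subnKC ssz) bform_prod.
  rewrite -mul_mpolyC => /(PM ((lead_coef h)^-1)%:MP); rewrite !mulrA -mpolyCM mulVf ?lead_coef_eq0 //.
  rewrite mul1r => /Pp[|/Px//].
  elim: rs {hrs ssz} => [|r rs IH]; first by rewrite big_nil => /(Px 0%N).
  by rewrite big_cons => /Pp[/no|/IH].
have /choice [c0 hc0] := ev.
pose c k := if k == i then 1 else c0 k.
have hc k : P ('X_k - c k *: 'X_i).
  by rewrite /c; case: eqP => // ->; rewrite scale1r subrr.
exists c; first by rewrite /c eqxx.
have Pprod (s : seq 'I_n) (e : 'I_n -> nat) : P (\prod_(k <- s) 'X_k ^+ e k -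
    (\prod_(k <- s) c k ^+ e k) *: 'X_i ^+ (\sum_(k <- s) e k)).
  have Pe k m : P ('X_k ^+ m - c k ^+ m *: 'X_i ^+ m).
    by rewrite -exprZn subrXX mulrC; apply: PM.
  elim: s => [|k s IH]; first by rewrite !big_nil expr0 scale1r subrr.
  rewrite !big_cons.
  have -> : 'X_k ^+ e k * \prod_(j <- s) 'X_j ^+ e j -
    (c k ^+ e k * \prod_(j <- s) c j ^+ e j) *: 'X_i ^+ (e k + \sum_(j <- s) e j) =
    'X_k ^+ e k * (\prod_(j <- s) 'X_j ^+ e j - (\prod_(j <- s) c j ^+ e j) *: 'X_i ^+ (\sum_(j <- s) e j)) +
    ((\prod_(j <- s) c j ^+ e j) *: 'X_i ^+ (\sum_(j <- s) e j)) * ('X_k ^+ e k - c k ^+ e k *: 'X_i ^+ e k).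
    rewrite exprD -!mul_mpolyC mpolyCM; ring.
  by apply: PD; apply: PM.
move=> G d IG hG.
have PG : P (G - G.@[c] *: 'X_i ^+ d).
  rewrite {1}[G]mpolyE mevalE scaler_suml -sumrB big_seq; apply: ideal_sum => // m mG.
  have /= <- := dhomog_mf hG mG; rewrite mdegE.
  have -> : G@_m *: 'X_[m] - (G@_m * \prod_i c i ^+ m i) *: 'X_i ^+ (\sum_i m i) =
    (G@_m)%:MP * (\prod_k 'X_k ^+ m k - (\prod_k c k ^+ m k) *: 'X_i ^+ (\sum_k m k)).
    by rewrite mpolyXE_id mul_mpolyC scalerBr scalerA.
  exact: PM.
apply/eqP; apply: contrapT => /negP Gc; apply: (Px d).
have := PM (G.@[c]^-1)%:MP _ (idealB iP (IP _ IG) PG).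
by rewrite opprB addrC subrK mul_mpolyC scalerA mulVf // scale1r.
Qed.

End HomogNS.

(** * Projective space *)

Section FracSpace.
Variables (K : closedFieldType) (X : choiceType).
(* D: functions whose nonvanishing loci are a basis of the topology;
   F: pairs (numerator, denominator) of the local fractions *)
Variables (D : set (X -> K)) (F : (X -> K) -> (X -> K) -> Prop).
Hypotheses (D1 : D (fun=> 1)) (DM : forall f g, D f -> D g -> D (fun x => f x * g x)).
Hypothesis FC : forall c, F (fun=> c) (fun=> 1).
Hypothesis FD : forall a b, F a b -> D a /\ D b.
Hypothesis F_add : forall a b c d, F a b -> F c d ->
  F (fun x => a x * d x + c x * b x) (fun x => b x * d x).
Hypothesis F_mul : forall a b c d, F a b -> F c d ->
  F (fun x => a x * c x) (fun x => b x * d x).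
Hypothesis F_inv : forall a b, F a b -> F b a.

(** Common model of the affine line and of projective space, so that the sheaf axioms are verified
    once for both. *)
Definition frac_space : fun_space K :=
  let opn (U : set X) := forall x, U x -> exists2 f, D f &
    f x != 0 /\ forall y, f y != 0 -> U y in
  @FunSpace K X opn (fun U h => opn U /\ forall x, U x -> exists a b f,
    [/\ F a b, D f, b x != 0, f x != 0 & forall y, U y -> f y != 0 -> h y = a y / b y]).

Lemma frac_open (U : set X) : @open K frac_space U <-> forall x, U x ->
  exists2 f, D f & f x != 0 /\ forall y, f y != 0 -> U y.
Proof. by []. Qed.

Lemma frac_near (x : frac_space) P : near_pt x P <-> exists2 f, D f &
  f x != 0 /\ forall y, f y != 0 -> P y.
Proof.
split=> [[U [oU Ux UP]]|[f Df [fx fP]]].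
  by have [f Df [fx fU]] := oU x Ux; exists f => //; split=> // y /fU/UP.
exists [set y | f y != 0]; split=> //; apply/frac_open => y fy.
by exists f.
Qed.

Lemma frac_reg (x : frac_space) h : reg_at x h <-> exists a b,
  [/\ F a b, b x != 0 & near_pt x (fun y => h y = a y / b y)].
Proof.
split=> [[U [oU Ux [_ /(_ x Ux)[a [b [f [Fab Df bx fx E]]]]]]]|[a [b [Fab bx /frac_near[f Df [fx fE]]]]]].
  exists a, b; split=> //; apply/frac_near.
  have [g Dg [gx gU]] := oU x Ux.
  exists (fun y => f y * g y); first exact: DM.
  by split=> [|y]; rewrite mulf_eq0 negb_or ?fx // => /andP[? /gU ?]; apply: E.
have oW : @open K frac_space [set y | f y != 0 /\ b y != 0].
  move=> y [fy by0]; exists (fun y => f y * b y); first by apply: DM => //; have [] := FD Fab.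
  by split=> [|z]; rewrite mulf_eq0 negb_or ?fy // => /andP[].
exists [set y | f y != 0 /\ b y != 0]; split=> //; split=> // y [fy by0].
by exists a, b, f; split=> // z [/fE].
Qed.

Lemma frac_good : good frac_space.
Proof.
have Dnz (u v : K) : u * v != 0 -> u != 0 /\ v != 0.
  by rewrite mulf_eq0 negb_or => /andP.
split.
- by move=> x _; exists (fun=> 1); rewrite ?oner_neq0.
- move=> U V oU oV; apply/frac_open => x [/oU[f Df [fx fU]] /oV[g Dg [gx gV]]].
  exists (fun y => f y * g y); first exact: DM.
  by split=> [|y /Dnz[/fU ? /gV ?]]; rewrite ?mulf_neq0.
- move=> U h; apply/frac_open => x /h[V [oV Vx VU]]; have [f Df [fx fV]] := oV x Vx.
  by exists f => //; split=> // y /fV/VU.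
- by move=> U f [].
- move=> U f oU h; split=> // x Ux; have [V [k [oV Vx [_ /(_ x Vx)[a [b [e [Fab De bx ex E]]]]] fk]]] := h x Ux.
  have [g Dg [gx gV]] := oV x Vx.
  exists a, b, (fun y => e y * g y); split=> //; [exact: DM|by rewrite mulf_neq0|].
  by move=> y Uy /Dnz[ey /gV Vy]; rewrite fk // E.
- move=> a; split=> [|x _]; first by move=> x _; exists (fun=> 1); rewrite ?oner_neq0.
  by exists (fun=> a), (fun=> 1), (fun=> 1); rewrite ?oner_neq0; split=> // y; rewrite divr1.
- move=> U f g [oU rf] [_ rg]; split=> // x Ux.
  have [a [b [e [Fab De bx ex E]]]] := rf x Ux; have [c [d [e' [Fcd De' dx ex' E']]]] := rg x Ux.
  have [Da Db] := FD Fab; have [Dc Dd] := FD Fcd.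
  exists (fun x => a x * d x + c x * b x), (fun x => b x * d x), (fun x => e x * e' x * (b x * d x)).
  split; rewrite ?mulf_neq0 //; [exact: F_add | by do ?apply: DM |].
  by move=> y Uy /Dnz[/Dnz[ey ey'] /Dnz[yb yd]]; rewrite E // E' // addf_div.
- move=> U f g [oU rf] [_ rg]; split=> // x Ux.
  have [a [b [e [Fab De bx ex E]]]] := rf x Ux; have [c [d [e' [Fcd De' dx ex' E']]]] := rg x Ux.
  exists (fun x => a x * c x), (fun x => b x * d x), (fun x => e x * e' x).
  split; rewrite ?mulf_neq0 //; [exact: F_mul | exact: DM |].
  by move=> y Uy /Dnz[ey ey']; rewrite E // E' // mulf_div.
- move=> U f [oU rf]; apply/frac_open => x [Ux fx]; have [a [b [e [Fab De bx ex E]]]] := rf x Ux.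
  have [g Dg [gx gU]] := oU x Ux; have [Da Db] := FD Fab.
  exists (fun y => e y * g y * (a y * b y)); first by do ?apply: DM.
  move: fx; rewrite E // mulf_eq0 negb_or invr_eq0 => /andP[ax _].
  split=> [|y /Dnz[/Dnz[ey /gU Uy] /Dnz[ay yb]]]; first by rewrite !mulf_neq0.
  by split=> //; rewrite E // mulf_neq0 ?invr_eq0.
move=> U f [oU rf] fnz; split=> // x Ux; have [a [b [e [Fab De bx ex E]]]] := rf x Ux.
exists b, a, e; split=> //; first exact: F_inv.
  by apply: contraNneq (fnz x Ux) => ax; rewrite E // ax mul0r.
by move=> y Uy ey; rewrite E // invf_div.
Qed.

End FracSpace.

Section AffineLine.
Variable K : closedFieldType.

(** It parametrizes the candidate values t of a function in [descent_separating]. *)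
Definition affine_line : fun_space K :=
  @frac_space K K [set f | exists p : {poly K}, f = horner p]
    (fun a b => exists p q : {poly K}, a = horner p /\ b = horner q).

Let h1 : [set f | exists p : {poly K}, f = horner p] (fun=> 1 : K).
Proof. by exists 1; apply/funext => x; rewrite hornerC. Qed.
Let h2 (f g : K -> K) : [set f | exists p : {poly K}, f = horner p] f ->
  [set f | exists p : {poly K}, f = horner p] g ->
  [set f | exists p : {poly K}, f = horner p] (fun x => f x * g x).
Proof. by move=> [p ->] [q ->]; exists (p * q); apply/funext => x; rewrite hornerM. Qed.

Lemma affine_near (x : affine_line) P : near_pt x P <-> exists2 p : {poly K}, p.[x] != 0 &
  forall y, p.[y] != 0 -> P y.
Proof.
split=> [/(frac_near _ _)[_ [p ->] [px pP]]|[p px pP]]; first by exists p.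
by apply/frac_near; exists (horner p); [exists p | split].
Qed.

Lemma affine_good : good affine_line.
Proof.
apply: frac_good => //.
- by move=> c; exists c%:P, 1; split; apply/funext => x; rewrite hornerC.
- by move=> a b [p [q [-> ->]]]; split; [exists p|exists q].
- move=> _ _ _ _ [p [q [-> ->]]] [r [s [-> ->]]]; exists (p * s + r * q), (q * s).
  by split; apply/funext => x; rewrite ?hornerD !hornerM.
- move=> _ _ _ _ [p [q [-> ->]]] [r [s [-> ->]]]; exists (p * r), (q * s).
  by split; apply/funext => x; rewrite !hornerM.
by move=> a b [p [q [-> ->]]]; exists q, p.
Qed.

Lemma affine_coord (x : affine_line) : @reg_at K affine_line x id.
Proof.
have oT : @open K affine_line setT.
  by apply/frac_open => y _; exists (fun=> 1) => //; split=> //; apply: oner_neq0.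
exists setT; split=> //; split=> // y _.
exists (horner 'X), (horner 1), (fun=> 1); split=> //.
- by exists 'X, 1.
- by rewrite hornerC oner_neq0.
- exact: oner_neq0.
by move=> z _ _; rewrite hornerX hornerC divr1.
Qed.

Lemma affine_reg (x : affine_line) h : reg_at x h -> exists p q : {poly K},
  q.[x] != 0 /\ near_pt x (fun y => h y = p.[y] / q.[y]).
Proof.
have FD : forall a b : K -> K, (exists p q : {poly K}, a = horner p /\ b = horner q) ->
    [set f | exists p : {poly K}, f = horner p] a /\ [set f | exists p : {poly K}, f = horner p] b.
  by move=> a b [p [q [-> ->]]]; split; [exists p|exists q].
by move=> /(frac_reg h2 FD)[_ [_ [[p [q [-> ->]]] qx nE]]]; exists p, q.
Qed.

End AffineLine.

Section ProjSpace.
Variables (K : closedFieldType) (n : nat).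
Local Notation PK := (@proj_pt K n).
Implicit Type L : PK.

(** Forms are evaluated at one chosen vector of the line. The vanishing of a form and the quotients
    of forms of equal degree do not depend on the choice. *)
Definition rp L : 'rV[K]_n.+1 := vpick (line L).

Lemma rp_neq0 L : rp L != 0.
Proof. by rewrite vpick0 -dimv_eq0 (eqP (valP L)). Qed.

Lemma lineP L v : v \in line L -> exists c, v = c *: rp L.
Proof.
have -> : line L = <[rp L]>%VS.
  apply/esym/eqP; rewrite eqEdim -memvE memv_pick /= (eqP (valP L)).
  by rewrite dim_vline rp_neq0.
by move=> /vlineP.
Qed.

Lemma rp_line L : rp L \in line L. Proof. exact: memv_pick. Qed.

Lemma poly_atZ d (f : {mpoly K[n.+1]}) c v : f \is d.-homog ->
  poly_at f (c *: v) = c ^+ d * poly_at f v.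
Proof.
move=> hf; rewrite /poly_at !mevalE mulr_sumr !big_seq; apply: eq_bigr => m mf.
have /= <- := dhomog_mf hf mf; rewrite mulrCA; congr (_ * _).
rewrite mdegE -prodrXr -big_split /=; apply: eq_bigr => i _.
by rewrite mxE exprMn.
Qed.

Lemma poly_at_rp d (f : {mpoly K[n.+1]}) L v : f \is d.-homog -> v \in line L ->
  poly_at f v != 0 -> poly_at f (rp L) != 0.
Proof.
move=> hf /lineP[c ->]; rewrite (poly_atZ _ _ hf) mulf_eq0 negb_or.
by case/andP.
Qed.

Lemma poly_atD (f g : {mpoly K[n.+1]}) v : poly_at (f + g) v = poly_at f v + poly_at g v.
Proof. exact: mevalD. Qed.
Lemma poly_atM (f g : {mpoly K[n.+1]}) v : poly_at (f * g) v = poly_at f v * poly_at g v.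
Proof. exact: mevalM. Qed.
Lemma poly_at1 v : poly_at (1 : {mpoly K[n.+1]}) v = 1.
Proof. exact: meval1. Qed.
Lemma poly_at0 v : poly_at (0 : {mpoly K[n.+1]}) v = 0.
Proof. exact: meval0. Qed.
Lemma poly_at_sum (I : Type) (s : seq I) (P : pred I) (F : I -> {mpoly K[n.+1]}) v :
  poly_at (\sum_(i <- s | P i) F i) v = \sum_(i <- s | P i) poly_at (F i) v.
Proof. exact: raddf_sum. Qed.
Lemma poly_at_prod (I : Type) (s : seq I) (P : pred I) (F : I -> {mpoly K[n.+1]}) v :
  poly_at (\prod_(i <- s | P i) F i) v = \prod_(i <- s | P i) poly_at (F i) v.
Proof. exact: rmorph_prod. Qed.
Lemma poly_at_scale c (f : {mpoly K[n.+1]}) v : poly_at (c *: f) v = c * poly_at f v.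
Proof. exact: mevalZ. Qed.

Definition pden : set (PK -> K) := [set f | exists (d : nat) (p : {mpoly K[n.+1]}),
  p \is d.-homog /\ f = (fun L => poly_at p (rp L))].
Definition pfrac (a b : PK -> K) := exists (d : nat) (p q : {mpoly K[n.+1]}),
  [/\ p \is d.-homog, q \is d.-homog, a = (fun L => poly_at p (rp L))
    & b = (fun L => poly_at q (rp L))].

Lemma pden1 : pden (fun=> 1).
Proof. by exists 0%N, 1; split; [exact: dhomog1 | apply/funext => L; rewrite poly_at1]. Qed.

Lemma pdenM f g : pden f -> pden g -> pden (fun L => f L * g L).
Proof.
move=> [d [p [hp ->]]] [e [q [hq ->]]]; exists (d + e)%N, (p * q); split.
  exact: dhomogM.
by apply/funext => L; rewrite poly_atM.
Qed.

Lemma pfracD a b : pfrac a b -> pden a /\ pden b.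
Proof. by move=> [d [p [q [hp hq -> ->]]]]; split; [exists d, p | exists d, q]. Qed.

Lemma proj_openE : @open K (proj_space K n) = @open K (frac_space pden pfrac).
Proof.
  apply/seteqP; split=> U; rewrite /open /=.
    move=> [F Fh UE] L UL.
    have : ~ (~` U) L by move=> /(_ UL).
    rewrite UE => /existsNP[f /existsNP[v /not_implyP[Ff /not_implyP[vL /eqP fv]]]].
    have [d hf] := Fh f Ff.
    exists (fun L => poly_at f (rp L)); first by exists d, f.
    split=> [|L' fL']; first exact: poly_at_rp hf vL fv.
    apply: contrapT; rewrite -[~ U L']/((~` U) L') UE => /(_ f _ Ff (rp_line L')) e.
    by rewrite e eqxx in fL'.
  move=> h; exists [set f | (exists d : nat, f \is d.-homog) /\ forall L, ~ U L -> poly_at f (rp L) = 0].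
    by move=> f [].
  apply/seteqP; split=> L /= UL.
    move=> f v [[d hf] fU] vL; apply/eqP; apply: contrapT => /negP fv.
    by have := poly_at_rp hf vL fv; rewrite fU ?eqxx.
  move=> /h[_ [d [p [hp ->]]] [pL pU]]; move/eqP: pL; apply.
  apply: UL (rp_line L); split; first by exists d.
  by move=> L' UL'; apply/eqP; apply: contrapT => /negP /pU.
Qed.

Lemma proj_regE : @reg K (proj_space K n) = @reg K (frac_space pden pfrac).
Proof.
  apply/funext => U; apply/seteqP; split=> f.
    move=> [oU h]; have oU' : @open K (proj_space K n) U by [].
    have oUf : @open K (frac_space pden pfrac) U by rewrite -proj_openE.
    split=> //.
    move=> L UL; have [V [d [a [b [oV VL [ha hb] E]]]]] := h L UL.
    have : @open K (proj_space K n) V by [].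
    rewrite proj_openE => /(_ L VL)[g Dg [gL gV]].
    exists (fun L => poly_at a (rp L)), (fun L => poly_at b (rp L)), g.
    have E' L' : U L' -> V L' -> _ := fun u v => E L' _ u v (rp_line L') (rp_neq0 L').
    split=> //; first by exists d, a, b.
      by have [] := E' L UL VL.
    by move=> L' UL' /gV VL'; have [] := E' L' UL' VL'.
  move=> [oU h]; have oU' : @open K (proj_space K n) U by rewrite proj_openE.
  split=> //.
  move=> L UL; have [_ [_ [g [[d [a [b [ha hb -> ->]]]] Dg bL gL E]]]] := h L UL.
  exists [set L' | g L' * poly_at b (rp L') != 0], d, a, b; split=> //.
  - suff : @open K (proj_space K n) [set L' | g L' * poly_at b (rp L') != 0] by [].
    rewrite proj_openE; apply/frac_open => L' gL'.
    exists (fun L' => g L' * poly_at b (rp L')); last by split.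
    by apply: pdenM => //; exists d, b.
  - by rewrite /= mulf_neq0.
  move=> L' v UL' /= ; rewrite mulf_eq0 negb_or => /andP[gL' bL'] /lineP[c ->].
  rewrite scaler_eq0 negb_or => /andP[c0 _].
  rewrite !(poly_atZ _ _ ha) !(poly_atZ _ _ hb) mulf_neq0 ?expf_neq0 // E //.
  by rewrite -mulf_div divff ?mul1r ?expf_neq0.
Qed.

Lemma proj_spaceE : proj_space K n = frac_space pden pfrac.
Proof.
by rewrite /frac_space -[proj_space K n]/(@FunSpace K PK (@open K (proj_space K n)) (@reg K (proj_space K n))) proj_openE proj_regE.
Qed.

Lemma proj_good : good (proj_space K n).
Proof.
rewrite proj_spaceE; apply: frac_good.
- exact: pden1.
- exact: pdenM.
- move=> c; exists 0%N, c%:MP, 1; split; [|exact: dhomog1| |].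
  + by rewrite -[c%:MP]mulr1 mul_mpolyC dhomogZ ?dhomog1.
  + by apply/funext => L; rewrite /poly_at mevalC.
  + by apply/funext => L; rewrite poly_at1.
- exact: pfracD.
- move=> _ _ _ _ [d [p [q [hp hq -> ->]]]] [e [r [s [hr hs -> ->]]]].
  exists (d + e)%N, (p * s + r * q), (q * s); split.
  + by apply: dhomogD; [|rewrite addnC]; apply: dhomogM.
  + exact: dhomogM.
  + by apply/funext => L; rewrite poly_atD !poly_atM.
  + by apply/funext => L; rewrite !poly_atM.
- move=> _ _ _ _ [d [p [q [hp hq -> ->]]]] [e [r [s [hr hs -> ->]]]].
  exists (d + e)%N, (p * r), (q * s); split; try exact: dhomogM.
  + by apply/funext => L; rewrite !poly_atM.
  + by apply/funext => L; rewrite !poly_atM.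
by move=> a b [d [p [q [hp hq -> ->]]]]; exists d, q, p.
Qed.

Lemma proj_near (L : proj_space K n) P : near_pt L P <-> exists d (f : {mpoly K[n.+1]}),
  [/\ f \is d.-homog, poly_at f (rp L) != 0 & forall L', poly_at f (rp L') != 0 -> P L'].
Proof.
split=> [[U [+ UL UP]]|[d [p [hp pL pP]]]].
  rewrite proj_openE => /(_ L UL)[_ [d [p [hp ->]]] [pL pU]].
  by exists d, p; split=> // L' /pU/UP.
exists [set L' | poly_at p (rp L') != 0]; split=> //; rewrite proj_openE.
by apply/frac_open => L' pL'; exists (fun L => poly_at p (rp L)); [exists d, p | split].
Qed.

Lemma proj_reg (L : proj_space K n) h : reg_at L h <-> exists d (a b : {mpoly K[n.+1]}),
  [/\ a \is d.-homog, b \is d.-homog, poly_at b (rp L) != 0 &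
   near_pt L (fun L' => h L' = poly_at a (rp L') / poly_at b (rp L'))].
Proof.
have nE (P : PK -> Prop) : @near_pt K (proj_space K n) L P = @near_pt K (frac_space pden pfrac) L P.
  by rewrite /near_pt proj_openE.
have -> : reg_at L h = @reg_at K (frac_space pden pfrac) L h.
  by rewrite /reg_at proj_openE proj_regE.
split.
  move=> /(frac_reg pdenM pfracD)[_ [_ [[d [p [q [hp hq -> ->]]]] qL nh]]].
  by exists d, p, q; split=> //; rewrite nE.
move=> [d [p [q [hp hq qL nh]]]]; rewrite nE in nh; apply/(frac_reg pdenM pfracD).
exists (fun L => poly_at p (rp L)), (fun L => poly_at q (rp L)); split=> //.
by exists d, p, q; split.
Qed.

Definition mkline (v : 'rV[K]_n.+1) (v0 : v != 0) : PK :=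
  Sub <[v]>%VS (introT eqP (etrans (dim_vline v) (congr1 nat_of_bool v0))).

Lemma rp_mkline v (v0 : v != 0) : exists2 c, c != 0 & v = c *: rp (mkline v0).
Proof.
have [c vE] := @lineP (mkline v0) v (memv_line v).
by exists c => //; apply/eqP => c0; move/eqP: (v0); apply; rewrite vE c0 scale0r.
Qed.

End ProjSpace.

Section Closed.
Variable K : closedFieldType.
Hypothesis uncK : ~ countable [set: K].

Lemma poly_eq0_everywhere (p : {poly K}) : (forall c, p.[c] = 0) -> p = 0.
Proof.
move=> h; have [N /(_ (size p).+1)[s [us ss _]]] := uncountable_fiber uncK (fun=> 0%N).
apply: (roots_geq_poly_eq0 (rs := s)); rewrite ?ss //.
by apply/allP => c _; apply/rootP.
Qed.

Lemma eq_big_support (T : eqType) (V : nmodType) (s1 s2 : seq T) (G : T -> V) :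
  uniq s1 -> uniq s2 -> (forall m, G m != 0 -> (m \in s1) = (m \in s2)) ->
  \sum_(m <- s1) G m = \sum_(m <- s2) G m.
Proof.
move=> u1 u2 h.
have nz s : \sum_(m <- s) G m = \sum_(m <- [seq m <- s | G m != 0]) G m.
  rewrite big_filter [RHS]big_mkcond; apply: eq_bigr => m _.
  by case: eqP.
rewrite nz [RHS]nz; apply: perm_big; apply: uniq_perm; rewrite ?filter_uniq //.
by move=> m; rewrite !mem_filter; case: eqP => //= /eqP /h.
Qed.

(** The value at c v is a polynomial in c whose coefficients are the homogeneous parts of H at v; it
    vanishes on the infinite field K, hence is zero. *)
Lemma homog_part_eq0 n (H : {mpoly K[n.+1]}) (v : 'rV[K]_n.+1) d :
  (forall c, poly_at H (c *: v) = 0) ->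
  \sum_(m <- msupp H | mdeg m == d) H@_m * \prod_i v 0 i ^+ m i = 0.
Proof.
move=> h; pose q : {poly K} := \sum_(m <- msupp H) (H@_m * \prod_i v 0 i ^+ m i) *: 'X^(mdeg m).
have q0 : q = 0.
  apply: poly_eq0_everywhere => c; rewrite -[RHS](h c) /q horner_sum /poly_at mevalE.
  apply: eq_bigr => m _; rewrite hornerZ hornerXn -mulrA; congr (_ * _).
  rewrite mdegE -prodrXr -big_split /=; apply: eq_bigr => i _.
  by rewrite mxE exprMn mulrC.
have q0d := congr1 (fun p : {poly K} => p`_d) q0; rewrite coef0 in q0d.
rewrite -[RHS]q0d /q coef_sum big_mkcond; apply: eq_bigr => m _.
by rewrite coefZ coefXn eq_sym; case: eqP; rewrite ?mulr1 ?mulr0.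
Qed.

Lemma mdeg_pigeonhole n (m : 'X_{1..n.+1}) d : mdeg m = (n.+1 * d)%N ->
  exists i, (d <= m i)%N.
Proof.
move=> md; apply: contrapT => /forallNP h.
have d0 : (0 < d)%N by rewrite lt0n; apply/eqP => d0; apply: (h ord0); rewrite d0.
suff : (mdeg m < n.+1 * d)%N by rewrite md ltnn.
rewrite mdegE; apply: (@leq_ltn_trans (\sum_(i < n.+1) d.-1)%N).
  by apply: leq_sum => i _; have /negP := h i; rewrite -ltnNge; case: (d) d0.
by rewrite sum_nat_const card_ord ltn_pmul2l // prednK.
Qed.

Section ProjClosed.
Variables (n : nat) (S : set (proj_space K n)) (cS : closed_set S).
Local Notation XS := (sub_space S).
Local Notation gP := (proj_good K n).
Let gXS : good XS := sub_good gP S.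

(** If no power of x_i were in the ideal, [homog_NS] would give a common zero of the homogeneous
    members of [G], with i-th coordinate 1. The maximum of the exponents serves all i. *)
Lemma homog_family_NS (G : set {mpoly K[n.+1]}) :
  (forall L, exists d f, [/\ G f, f \is d.-homog & poly_at f (rp L) != 0]) ->
  exists d, forall i, ideal_gen G ('X_i ^+ d).
Proof.
move=> h; have iG := ideal_genP G.
have {}h i : exists d, ideal_gen G ('X_i ^+ d).
  apply: contrapT => /forallNP no.
  have [c ci cG] := homog_NS uncK iG no.
  pose v : 'rV[K]_n.+1 := \row_j c j.
  have v0 : v != 0.
    by apply/eqP => /rowP /(_ i); rewrite !mxE ci => /eqP; rewrite oner_eq0.
  have [d [f [Gf hf /eqP]]] := h (mkline v0); apply.
  have [a a0 vE] := rp_mkline v0.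
  have : poly_at f v = 0.
    rewrite -(cG f d (ideal_gen_sub Gf) hf) /poly_at; apply: meval_eq => j; by rewrite mxE.
  rewrite {1}vE (poly_atZ _ _ hf) => /eqP; rewrite mulf_eq0 (negPf (expf_neq0 _ a0)) /=.
  by move/eqP.
have /choice [e he] := h; exists (\max_i e i)%N => i.
have [_ _ Gm] := iG.
by rewrite -(subnK (leq_bigmax i)) exprD; apply: Gm.
Qed.

Lemma ideal_gen_common (G : set {mpoly K[n.+1]}) (I : finType) (f : I -> {mpoly K[n.+1]}) :
  (forall i, ideal_gen G (f i)) -> exists2 s : seq {mpoly K[n.+1]}, (forall g, g \in s -> G g) &
    exists t : I -> seq ({mpoly K[n.+1]} * {mpoly K[n.+1]}), forall i,
      (forall p, p \in t i -> p.2 \in s) /\ f i = \sum_(p <- t i) p.1 * p.2.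
Proof.
move=> /choice[t ht]; exists (flatten [seq [seq p.2 | p <- t i] | i <- enum I]).
  by move=> g /flatten_mapP[i _ /mapP[p pt ->]]; have [h _] := ht i; apply: h.
exists t => i; split; last by have [] := ht i.
move=> p pt; apply/flatten_mapP; exists i; first by rewrite mem_enum.
by apply/mapP; exists p.
Qed.

(** Read [P x y] as: y lies in the chosen neighbourhood of x. The forms whose nonvanishing locus on
    S lies in one such neighbourhood, together with those vanishing on S, have no common zero. So
    x_i^d is a finite combination of them, and where x_i is nonzero one of these finitely many forms
    is nonzero. *)
Lemma closed_quasicompact (P : XS -> XS -> Prop) : (forall x, near_pt x (P x)) ->
  exists s : seq XS, forall y, exists2 x, x \in s & P x y.
Proof.
move=> nP.
pose G := [set g : {mpoly K[n.+1]} | (exists x : XS, forall y : XS, poly_at g (rp (val y)) != 0 -> P x y)].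
pose G0 := [set g : {mpoly K[n.+1]} | forall y : XS, poly_at g (rp (val y)) = 0].
have [d hd] : exists d, forall i, ideal_gen (fun g => G g \/ G0 g) ('X_i ^+ d).
  apply: homog_family_NS => L; have [SL|nSL] := pselect (S L).
    pose x : XS := SigSub (mem_set SL).
    have /sub_near /proj_near[d [f [hf fL fP]]] := nP x.
    exists d, f; split=> //; left; exists x => y fy.
    exact: (fP (val y)).
  have /proj_near[d [f [hf fL fP]]] := cS nSL.
  exists d, f; split=> //; right => y.
  apply/eqP; apply: contrapT => /negP /fP; apply; exact: set_mem (valP y).
have [s sG [t ht]] := ideal_gen_common hd.
have /choice[w hw] : forall g : {mpoly K[n.+1]}, exists w : seq XS, g \in s ->
     G0 g \/ forall y : XS, poly_at g (rp (val y)) != 0 -> exists2 x, x \in w & P x y.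
  move=> g.
  have [gs|ngs] := boolP (g \in s); last by exists [::].
  have [[x hx]|h0] := sG g gs; last by exists [::] => _; left.
  exists [:: x] => _; right => y /hx Pxy; exists x => //; exact: mem_head.
exists (flatten [seq w g | g <- s]) => y.
have [i yi] : exists i, rp (val y) 0 i != 0.
  apply: contrapT => /forallNP h; move/eqP: (rp_neq0 (val y)); apply.
  by apply/rowP => i; rewrite [RHS]mxE; apply/eqP; apply: contrapT => /negP /h.
have [hs hX] := ht i.
have : poly_at ('X_i ^+ d) (rp (val y)) != 0.
  by rewrite /poly_at rmorphXn /= mevalXU expf_neq0.
rewrite hX poly_at_sum => h.
have [p pt p2] : exists2 p, p \in t i & poly_at p.2 (rp (val y)) != 0.
  apply: contrapT => no; move/eqP: h; apply.
  rewrite big_seq; apply: big1 => p pt; rewrite poly_atM.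
  have /eqP -> : poly_at p.2 (rp (val y)) == 0.
    by apply: contrapT => /negP h; apply: no; exists p.
  by rewrite mulr0.
have [h0|h1] := hw _ (hs p pt); first by rewrite h0 eqxx in p2.
have [x xw Pxy] := h1 _ p2; exists x => //.
by apply/flatten_mapP; exists p.2 => //; apply: hs.
Qed.

(** Elimination theory with germs at t0. The families of forms with regular coefficients vanishing
    on the fibres of C have, at t0, no common zero, so they generate all monomials of some degree D.
    Extending these expressions to nearby u gives a square matrix [A u], equal to 1 at t0 and
    therefore invertible near t0; a point of C over u would put its nonzero vector of monomials in
    the kernel. *)
Lemma closed_complete : complete_space XS.
Proof.
move=> T gT C t0 nC.
pose good_fam (G : T -> {mpoly K[n.+1]}) := [/\ (forall m, reg_at t0 (fun t => (G t)@_m)),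
  near_pt t0 (fun t => exists d : nat, G t \is d.-homog) &
  near_pt t0 (fun t => forall x : XS, C (x, t) -> poly_at (G t) (rp (val x)) = 0)].
pose GG := [set g | exists2 G, good_fam G & G t0 = g].
have [d hd] : exists d, forall i, ideal_gen GG ('X_i ^+ d).
  apply: homog_family_NS => L; have [SL|nSL] := pselect (S L); last first.
    have /proj_near[d [f [hf fL fP]]] := cS nSL.
    exists d, f; split=> //; exists (fun=> f) => //; split.
    - by move=> m; apply: reg_at_cst.
    - by apply: nearT => // t; exists d.
    apply: nearT => // t x _; apply/eqP; apply: contrapT => /negP /fP; apply.
    exact: set_mem (valP x).
  pose x : XS := SigSub (mem_set SL).
  have /(box_near gXS gT)[h [A [B [[k [f [g [rf rg hE]]]] hx nA nB hC]]]] := nC x.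
  have /choice[r hr] : forall i : 'I_k, exists r : nat * {mpoly K[n.+1]} * {mpoly K[n.+1]},
     [/\ r.1.2 \is (r.1.1).-homog, r.2 \is (r.1.1).-homog, poly_at r.2 (rp L) != 0 &
       near_pt x (fun y => poly_at r.2 (rp (val y)) != 0 /\
         f i y = poly_at r.1.2 (rp (val y)) / poly_at r.2 (rp (val y)))].
    move=> i; have /(sub_reg_loc gP)[l /proj_reg[e [a [b [ha hb bL nl]]]] nf] := rf i.
    exists (e, a, b); split=> //=.
    have nb : near_pt (L : proj_space K n) (fun L' => poly_at b (rp L') != 0) by apply/proj_near; exists e, b; split.
    have [vx _] := sub_val_morph gP x.
    apply: near_app2 nf (vx _ (nearI gP nl nb)) _ => //.
    by move=> y -> [-> ->].
  have nf : near_pt x (fun y => forall i, poly_at (r i).2 (rp (val y)) != 0 /\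
      f i y = poly_at (r i).1.2 (rp (val y)) / poly_at (r i).2 (rp (val y))).
    by apply: near_all => // i; have [] := hr i.
  have /sub_near /proj_near[e [p [hp pL pP]]] := nearI gXS nA nf.
  pose D := (\sum_i (r i).1.1)%N.
  pose F i := (r i).1.2 * \prod_(j | j != i) (r j).2.
  have hprod (Q : pred 'I_k) : \prod_(j | Q j) (r j).2 \is (\sum_(j | Q j) (r j).1.1)%N.-homog.
    apply: (big_ind2 (fun p (e : nat) => p \is e.-homog)); first exact: dhomog1.
      by move=> p1 e1 p2 e2; apply: dhomogM.
    by move=> i _; have [] := hr i.
  have hF i : F i \is D.-homog.
    rewrite /D (bigD1 i) //=; apply: dhomogM; last exact: hprod.
    by have [] := hr i.
  (* The tensor [h] cleared of its denominators in the point of S: [F i] puts f_i over the common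
     denominator, and nonvanishing of [p] guarantees that these formulas hold. *)
  pose G t := (\sum_i g i t *: F i) * p.
  have hG t : G t \is (D + e).-homog.
    apply: dhomogM => //; apply: rpred_sum => i _; exact: dhomogZ.
  have ry (y : XS) i : poly_at p (rp (val y)) != 0 -> poly_at (r i).2 (rp (val y)) != 0.
    by move=> py; have [_ /(_ i)[]] := pP _ py _ erefl.
  have GE t (y : XS) : poly_at p (rp (val y)) != 0 ->
     poly_at (G t) (rp (val y)) = h (y, t) * poly_at (\prod_i (r i).2 * p) (rp (val y)).
    move=> py; rewrite !poly_atM poly_at_sum mulrA hE mulr_suml; congr (_ * _).
    apply: eq_bigr => i _ /=; rewrite poly_at_scale poly_atM.
    have [_ /(_ i)[_ fy]] := pP _ py _ erefl; rewrite fy [in RHS](bigD1 i) //= poly_atM.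
    have := ry y i py; set u := poly_at _ _; set w := poly_at (\prod_(_ | _) _) _.
    by move=> u0; field.
  exists (D + e)%N, (G t0); split=> //.
    exists (G) => //; split.
    - move=> m; have E t : \sum_i g i t * (F i * p)@_m = (G t)@_m.
        rewrite /G mulr_suml raddf_sum; apply: eq_bigr => i _.
        by rewrite -scalerAl -[RHS]/((g i t *: (F i * p))@_m) mcoeffZ.
      have : reg_at t0 (fun t => \sum_i g i t * (F i * p)@_m).
        by apply: reg_at_sum => // i _; apply: reg_atM => //; apply: reg_at_cst.
      by move=> /(reg_at_eq gT); apply; apply: nearT => // t; rewrite E.
    - by apply: nearT => // t; exists (D + e)%N.
    apply: near_mono nB _ => t Bt y Cyt; apply/eqP; apply: contrapT => /negP Gy.
    have py : poly_at p (rp (val y)) != 0.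
      by apply: contraNneq Gy; rewrite poly_atM => ->; rewrite mulr0.
    have [Ay fy] := pP _ py _ erefl.
    apply: (hC (y, t)) => //=; apply: contraNneq Gy => h0.
    by rewrite GE // h0 mul0r.
  have pL' : poly_at p (rp (val x)) != 0 by [].
  rewrite -[L]/(val x) GE // mulf_neq0 // poly_atM mulf_neq0 // poly_at_prod.
  by apply/prodf_neq0 => i _; apply: ry.
(* In this degree every monomial is divisible by some x_i^d. *)
pose D := (n.+1 * d)%N.
pose MI := {m : 'X_{1..n.+1 < D.+1} | mdeg m == D} : finType.
have hm (m : MI) : ideal_gen GG 'X_[val m].
  have [i di] : exists i, (d <= (val m : 'X_{1..n.+1}) i)%N.
    exact/mdeg_pigeonhole/eqP/(valP m).
  have [_ _ Gm] := ideal_genP GG.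
  have -> : 'X_[val m] = 'X_[(val m : 'X_{1..n.+1}) - U_(i) *+ d] * 'X_i ^+ d :> {mpoly K[n.+1]}.
    rewrite mpolyXn -mpolyXD submK //; apply/mnm_lepP => j.
    by rewrite mulmnE mnm1E; case: eqP => [<-|_]; rewrite ?mul1n ?mul0n.
  exact: Gm.
have [s sG [t ht]] := ideal_gen_common hm.
have /choice[E hE] : forall g : {mpoly K[n.+1]}, exists G, g \in s -> good_fam G /\ G t0 = g.
  move=> g; have [/sG[G gG Gt]|_] := boolP (g \in s); first by exists G.
  by exists (fun=> 0).
(* [H m u] need not be homogeneous; but at a point of the fibre it vanishes along the whole line,
   hence so does its part of degree [D], whose coefficients form a row of [A u]. *)
pose H (m : MI) u := \sum_(p <- t m) p.1 * E p.2 u.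
have rH m k : reg_at t0 (fun u => (H m u)@_k).
  have : reg_at t0 (fun u => \sum_(p <- t m) if p \in t m then (p.1 * E p.2 u)@_k else 0).
    apply: reg_at_sum => // p _; have [pt|_] := boolP (p \in t m); last exact: reg_at_cst.
    have [[rG _ _] _] := hE _ ((ht m).1 p pt).
    have : reg_at t0 (fun u => \sum_(j : 'X_{1..n.+1 < (mdeg k).+1, (mdeg k).+1} | k == (j.1 + j.2)%MM)
       p.1@_j.1 * (E p.2 u)@_j.2).
      by apply: reg_at_sum => // j _; apply: reg_atM => //; apply: reg_at_cst.
    by move=> /(reg_at_eq gT); apply; apply: nearT => // u; rewrite mcoeffM.
  move=> /(reg_at_eq gT); apply; apply: nearT => // u.
  rewrite /H raddf_sum /= [RHS]big_seq [LHS]big_seq; apply: eq_bigr => p pt.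
  by rewrite pt.
pose A u := \matrix_(i < #|MI|, j < #|MI|) (H (enum_val i) u)@_(val (enum_val j)).
have A0 : A t0 = 1%:M.
  apply/matrixP => i j; rewrite !mxE.
  have -> : H (enum_val i) t0 = 'X_[val (enum_val i)].
    rewrite (ht (enum_val i)).2 /H big_seq [RHS]big_seq; apply: eq_bigr => p pt.
    by have [_ ->] := hE _ ((ht (enum_val i)).1 p pt).
  rewrite mcoeffX -(inj_eq enum_val_inj); congr (_%:R).
have nA : near_pt t0 (fun u => \det (A u) != 0).
  apply: near_nz => //; last by rewrite A0 det1 oner_neq0.
  apply: reg_at_det => // i j; apply: reg_at_eq (rH (enum_val i) (val (enum_val j))) _ => //.
  by apply: nearT => // u; rewrite mxE.
have nE : near_pt t0 (fun u => forall g, g \in s ->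
    (exists d' : nat, E g u \is d'.-homog) /\
    forall x : XS, C (x, u) -> poly_at (E g u) (rp (val x)) = 0).
  apply: near_all_seq => // g gs; have [[_ n1 n2] _] := hE g gs.
  exact: nearI.
apply: near_app2 nA nE _ => // u Au Eu x Cxu.
have Hc m c : poly_at (H m u) (c *: rp (val x)) = 0.
  rewrite /H poly_at_sum big_seq; apply: big1 => p pt; rewrite poly_atM.
  have [[d' hd'] vx] := Eu _ ((ht m).1 p pt).
  by rewrite (poly_atZ _ _ hd') vx // !mulr0.
pose w := \col_(j < #|MI|) \prod_i rp (val x) 0 i ^+ (val (enum_val j : MI) : 'X_{1..n.+1}) i.
have Aw : A u *m w = 0.
  apply/matrixP => i j; rewrite mxE [RHS]mxE -[RHS](homog_part_eq0 D (Hc (enum_val i))).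
  set Hi := H _ _; pose G (k : 'X_{1..n.+1}) := Hi@_k * \prod_i0 rp (val x) 0 i0 ^+ k i0.
  rewrite -[RHS]big_filter -/(G _).
  transitivity (\sum_(m : MI) G (val m)).
    rewrite (reindex (@enum_val _ MI)) /=; last by apply: onW_bij; apply: enum_val_bij.
    by apply: eq_bigr => l _; rewrite !mxE.
  rewrite -big_enum -(big_map (fun m : MI => val m : 'X_{1..n.+1}) predT G).
  apply: eq_big_support.
  - rewrite map_inj_uniq ?enum_uniq // => a b e; do 2!apply: val_inj; exact: e.
  - by rewrite filter_uniq // msupp_uniq.
  move=> k Gk; rewrite mem_filter.
  have -> : k \in msupp Hi by rewrite mcoeff_msupp; apply: contraNneq Gk => h; rewrite /G h mul0r.
  rewrite andbT; apply/mapP/idP => [[m _ ->]|kD]; first exact: (valP m).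
  have kD' : (mdeg k < D.+1)%N by rewrite (eqP kD).
  by exists (Sub (BMultinom kD') kD : MI); rewrite ?mem_enum.
have w0 : w = 0.
  have Au1 : A u \in unitmx by rewrite unitmxE unitfE.
  by rewrite -[w](mulKmx Au1) Aw mulmx0.
move/eqP: (rp_neq0 (val x)); apply; apply/rowP => i; rewrite [RHS]mxE; apply/eqP.
have mD : mdeg (U_(i) *+ D : 'X_{1..n.+1})%MM == D by rewrite mdegMn mdeg1 mul1n.
have mD' : (mdeg (U_(i) *+ D : 'X_{1..n.+1})%MM < D.+1)%N by rewrite (eqP mD).
pose m : MI := Sub (BMultinom mD') mD.
have := congr1 (fun M : 'cV[K]_#|MI| => M (enum_rank m) 0) w0.
rewrite !mxE enum_rankK /= (bigD1 i) //= big1 ?mulr1 => [|j ji]; last first.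
  by rewrite mulmnE mnm1E eq_sym (negPf ji) mul0n expr0.
by move/eqP; rewrite mulmnE mnm1E eqxx mul1n expf_eq0 => /andP[].
Qed.

End ProjClosed.
End Closed.

(** * Chains and charts *)

(** Finite dimension as it is used here: N strict inclusions in a row are impossible, so an
    increasing family of closed irreducible sets must repeat. *)
Definition bounded_chain (K : closedFieldType) (X : fun_space K) (N : nat) :=
  ~ exists Z : nat -> set X, (forall i, (i <= N)%N -> closed_set (Z i) /\ irrset (Z i)) /\
     forall i, (i < N)%N -> Z i `<=` Z i.+1 /\ ~ (Z i.+1 `<=` Z i).

Section Chains.
Variables (K : closedFieldType) (n : nat).
Local Notation PK := (proj_space K n).
Implicit Types Z : set PK.

(** A lower bound N for the Hilbert function of [Z] in degree [D], with independence tested on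
    points instead of in a quotient ring. *)
Definition indep_forms Z D N := exists F : 'I_N -> {mpoly K[n.+1]},
  (forall i, F i \is D.-homog) /\
  forall c : 'I_N -> K, (forall L, Z L -> \sum_i c i * poly_at (F i) (rp L) = 0) ->
  forall i, c i = 0.

Lemma indep_forms_leq Z D N : indep_forms Z D N -> (N <= D.+1 ^ n.+1)%N.
Proof.
move=> [F [hF iF]]; apply: (@leq_trans #|{: 'X_{1..n.+1 < D.+1}}|); last first.
  pose g (m : 'X_{1..n.+1 < D.+1}) : {ffun 'I_n.+1 -> 'I_D.+1} := [ffun i => inord ((m : 'X_{1..n.+1}) i)].
  have g_inj : injective g.
    move=> m m' /ffunP e; apply: val_inj; apply/mnmP => i.
    have := congr1 val (e i); rewrite !ffunE /= !inordK //.
      by rewrite (leq_ltn_trans _ (bmdeg m')) // mdegE (bigD1 i) //= leq_addr.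
    by rewrite (leq_ltn_trans _ (bmdeg m)) // mdegE (bigD1 i) //= leq_addr.
  by apply: leq_trans (leq_card _ g_inj) _; rewrite card_ffun !card_ord.
rewrite leqNgt; apply/negP => lt; have [] := @mpoly_dependent K n.+1 D.+1 N F lt.
  move=> j; rewrite msizeE big_seq; apply/bigmax_leqP_seq => m mF _.
  by have /= -> := dhomog_mf (hF j) mF.
move=> l [j lj] l0; move/eqP: lj; apply; apply: (iF l) => L _.
rewrite -[RHS](poly_at0 (rp L)) -l0 poly_at_sum; apply: eq_bigr => i _.
by rewrite poly_at_scale.
Qed.

Lemma irr_nz Z d e (f g : {mpoly K[n.+1]}) L L' : irrset Z -> Z L -> Z L' ->
  f \is d.-homog -> g \is e.-homog -> poly_at f (rp L) != 0 -> poly_at g (rp L') != 0 ->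
  exists L0, [/\ Z L0, poly_at f (rp L0) != 0 & poly_at g (rp L0) != 0].
Proof.
move=> [_ iZ] ZL ZL' hf hg fL gL'; apply: (iZ L L') => //.
  by apply/proj_near; exists d, f; split.
by apply/proj_near; exists e, g; split.
Qed.

(** Multiplication by f is injective on forms on the irreducible Z', and its image vanishes on Z. A
    relation therefore restricts to Z, where it kills the first N coefficients; f can then be
    cancelled. *)
Lemma indep_forms_step Z Z' e D N M (f : {mpoly K[n.+1]}) L0 : irrset Z' -> Z `<=` Z' ->
  f \is e.-homog -> (forall L, Z L -> poly_at f (rp L) = 0) ->
  Z' L0 -> poly_at f (rp L0) != 0 ->
  indep_forms Z (e + D) N -> indep_forms Z' D M -> indep_forms Z' (e + D) (N + M).
Proof.
move=> irrZ' ZZ hf fZ ZL0 fL0 [A [hA iA]] [B [hB iB]].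
exists (fun i => match fintype.split i with inl a => A a | inr b => f * B b end).
split=> [i|c hc]; first by case: fintype.split => a //; apply: dhomogM.
have sum L : \sum_i c i * poly_at (match fintype.split i with inl a => A a | inr b => f * B b end) (rp L)
  = \sum_a c (lshift M a) * poly_at (A a) (rp L) + poly_at f (rp L) * \sum_b c (rshift N b) * poly_at (B b) (rp L).
  rewrite big_split_ord mulr_sumr /=; congr (_ + _); apply: eq_bigr => i _.
    by rewrite (unsplitK (inl i)).
  by rewrite (unsplitK (inr i)) poly_atM mulrCA.
have cA a : c (lshift M a) = 0.
  apply: (iA (fun a => c (lshift M a))) => L ZL.
  by rewrite -[RHS](hc L (ZZ _ ZL)) sum fZ // mul0r addr0.
have cB b : c (rshift N b) = 0.
  apply: (iB (fun b => c (rshift N b))) => L ZL; apply/eqP; apply: contrapT => /negP nz.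
  pose g := \sum_b c (rshift N b) *: B b.
  have hg : g \is D.-homog by apply: rpred_sum => i _; apply: dhomogZ.
  have gE L' : poly_at g (rp L') = \sum_b c (rshift N b) * poly_at (B b) (rp L').
    by rewrite poly_at_sum; apply: eq_bigr => i _; rewrite poly_at_scale.
  have [L1 [ZL1 f1]] := irr_nz irrZ' ZL0 ZL hf hg fL0 (eq_ind_r (fun x => x != 0) nz (gE L)).
  move/eqP; rewrite gE; apply.
  have := hc L1 ZL1; rewrite sum big1 ?add0r => [/eqP|a _]; last by rewrite cA mul0r.
  by rewrite mulf_eq0 (negPf f1) => /eqP.
by move=> i; rewrite -(splitK i); case: fintype.split.
Qed.

Lemma bin_lower a k : (a.+1 ^ k <= 'C(k * a.+1, k))%N.
Proof.
rewrite -(@leq_pmul2r k`!) ?fact_gt0 // bin_ffact -ffactnn.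
suff h j : (j <= k)%N -> (a.+1 ^ j * k ^_ j <= (k * a.+1) ^_ j)%N by apply: h.
elim: j => [|j IH] jk; first by rewrite !ffactn0.
rewrite !ffactnSr expnSr mulnACA; apply: leq_mul; first exact/IH/ltnW.
by rewrite mulnC mulnBl leq_sub2l // leq_pmulr.
Qed.

(** Pascal's rule and [indep_forms_step] give at least C(d + k, k) independent forms of degree d e
    on the k-th set of a chain. For k = n + 2 this outgrows the crude count (D + 1)^(n + 1) of
    monomials of degree D; the crude count is why the bound is not the sharp n + 1. *)
Lemma proj_bounded_chain : bounded_chain PK n.+2.
Proof.
move=> [Z [hZ sZ]]; pose k := n.+2.
have /choice[df hdf] : forall i : 'I_k, exists df : nat * {mpoly K[n.+1]},
   [/\ df.2 \is (df.1).-homog, (forall L, Z i L -> poly_at df.2 (rp L) = 0) &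
    exists2 L, Z i.+1 L & poly_at df.2 (rp L) != 0].
  move=> i; have [_ /existsNP[L /not_implyP[ZL nZL]]] := sZ i (ltn_ord i).
  have [cZ _] := hZ i (ltnW (ltn_ord i)).
  have /proj_near[d [f [hf fL fP]]] := cZ L nZL.
  exists (d, f); split=> //; last by exists L.
  by move=> L' ZL'; apply/eqP; apply: contrapT => /negP /fP.
have d0 i : (0 < (df i).1)%N.
  rewrite lt0n; apply/eqP => di0; have [hf fZ [L ZL fL]] := hdf i.
  have [_ [[L' ZL'] _]] := hZ i (ltnW (ltn_ord i)).
  move: hf fL (fZ _ ZL'); rewrite di0 => hf.
  have -> : (df i).2 = ((df i).2@_0)%:MP.
    apply/mpolyP => m; rewrite mcoeffC; case: eqP => [<-|m0]; first by rewrite mulr1.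
    by rewrite mulr0 (dhomog_nemf_coeff hf) //= mdeg_eq0; apply/eqP => m0'; apply: m0.
  by rewrite /poly_at !mevalC => /eqP.
(* Powers bring the separating forms to one common degree [e], so that degrees d e serve every step
   of the chain. *)
pose e := (\prod_i (df i).1)%N.
have e0 : (0 < e)%N by rewrite prodn_gt0.
pose f (i : 'I_k) := (df i).2 ^+ (\prod_(j | j != i) (df j).1)%N.
have hf i : f i \is e.-homog.
  by rewrite /e (bigD1 i) //=; apply: dhomogMn; have [] := hdf i.
have pf i v : poly_at (f i) v = poly_at (df i).2 v ^+ (\prod_(j | j != i) (df j).1)%N.
  by rewrite /poly_at rmorphXn.
have main k' : (k' <= k)%N -> forall d, indep_forms (Z k') (d * e) 'C(d + k', k').
  elim: k' => [|k' IH] k'k d.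
    have [_ [[L ZL] _]] := hZ 0%N isT.
    have [i Li] : exists i, rp L 0 i != 0.
      apply: contrapT => /forallNP h; move/eqP: (rp_neq0 L); apply.
      by apply/rowP => i; rewrite [RHS]mxE; apply/eqP; apply: contrapT => /negP /h.
    rewrite bin0; exists (fun=> 'X_i ^+ (d * e)); split=> [_|c /(_ L ZL)].
      rewrite mpolyXn dhomogX /= mdegMn mdeg1 mul1n //.
    rewrite big_ord1 /poly_at rmorphXn /= mevalXU => /eqP.
    by rewrite mulf_eq0 expf_eq0 (negPf Li) andbF orbF => /eqP c0 j; rewrite ord1.
  have [cZ iZ] := hZ k'.+1 k'k; elim: d => [|d IHd].
    have [[L ZL] _] := iZ; rewrite add0n binn mul0n.
    exists (fun=> 1); split=> [_|c /(_ L ZL)]; first exact: dhomog1.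
    by rewrite big_ord1 poly_at1 mulr1 => c0 j; rewrite ord1.
  have -> : 'C(d.+1 + k'.+1, k'.+1) = ('C(d.+1 + k', k') + 'C(d + k'.+1, k'.+1))%N.
    by rewrite addnS binS addnC addSnnS.
  pose i := Ordinal k'k; have [hfi fZ [L ZL fL]] := hdf i.
  have [sub _] := sZ k' k'k.
  rewrite mulSn; apply: (@indep_forms_step (Z k') _ e _ _ _ (f i) L) => //.
  - move=> L' ZL'; rewrite pf fZ // expr0n.
    by have /lt0n_neq0/negPf -> : (0 < \prod_(j | j != i) (df j).1)%N by rewrite prodn_gt0.
  - by rewrite pf expf_neq0.
  by rewrite -mulSn; apply/IH/ltnW.
(* Chosen so that (k q e + 1)^(n + 1) <= (k e (q + 1))^(n + 1) = q (q + 1)^(n + 1) < (q + 1)^(n + 2)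
   <= C(k q + k, k). *)
pose q := ((k * e) ^ n.+1)%N.
have := indep_forms_leq (main k (leqnn _) (k * q)%N).
have -> : (k * q + k = k * q.+1)%N by rewrite mulnS addnC.
rewrite leqNgt => /negP; apply.
apply: leq_trans (bin_lower q k); rewrite [X in (_ < _ ^ X)%N](_ : k = n.+1.+1) // [X in (_ < X)%N]expnS.
apply: (@leq_ltn_trans (q * q.+1 ^ n.+1)%N); last by rewrite ltn_pmul2r // expn_gt0.
rewrite /q -expnMn leq_exp2r //.
rewrite mulnAC -/q mulnS -addn1 addnC leq_add // muln_gt0 e0 andbT //.
Qed.

End Chains.

Section Charts.
Variable K : closedFieldType.
Implicit Types X Y : fun_space K.

Definition chart X (V : set X) N (h : 'I_N -> X -> K) :=
  [/\ forall x, V x -> near_pt x V,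
      forall x i, V x -> reg_at x (h i),
      forall x y, V x -> V y -> (forall i, h i x = h i y) -> x = y &
      forall x f, V x -> reg_at x f -> exists p q : {mpoly K[N]},
        q.@[h^~ x] != 0 /\ near_pt x (fun y => f y = p.@[h^~ y] / q.@[h^~ y])].

(** The function f defining a small neighbourhood of y is regular also at a prescribed point x,
    possibly far from P. This makes punctured neighbourhoods of x accessible in [near_punctured]. *)
Definition has_basis X := forall (x y : X) P, near_pt y P -> exists V f,
  [/\ open V, V x /\ V y, forall z, V z -> reg_at z f, f y != 0 &
   forall z, V z -> f z != 0 -> P z].

(** One chart contains any given finite set: pairs of points give separatedness, and orbits of a
    finite group are needed for quotients. *)
Definition has_charts X := forall s : seq X, exists V N (h : 'I_N -> X -> K),
  chart V h /\ forall x, x \in s -> V x.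

(** Points (1, c, c^2, ...) of the moment curve: each v excludes only the roots c of a nonzero
    polynomial. *)
Lemma avoid_hyperplanes n (s : seq 'rV[K]_n) : ~ countable [set: K] ->
  (forall v, v \in s -> v != 0) ->
  exists l : 'I_n -> K, forall v, v \in s -> \sum_i l i * v 0 i != 0.
Proof.
move=> uncK nz; pose pl (v : 'rV[K]_n) : {poly K} := \sum_i v 0 i *: 'X^i.
have pl0 v : v != 0 -> pl v != 0.
  move=> v0; apply/eqP => p0; move/eqP: v0; apply; apply/rowP => i; rewrite [RHS]mxE.
  have := congr1 (fun p : {poly K} => p`_i) p0; rewrite coef0 coef_sum (bigD1 i) //= big1.
    by rewrite coefZ coefXn eqxx mulr1 addr0.
  by move=> j ji; rewrite coefZ coefXn eq_sym (inj_eq val_inj) (negPf ji) mulr0.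
have : \prod_(v <- s) pl v != 0 by rewrite prodf_seq_neq0; apply/allP => v /nz/pl0.
move=> P0; have [c /eqP cP] : exists c, (\prod_(v <- s) pl v).[c] <> 0.
  by apply/existsNP => h; move/eqP: P0; apply; apply: poly_eq0_everywhere.
exists (fun i => c ^+ i) => v vs; move: cP; rewrite horner_prod prodf_seq_neq0 => /allP /(_ v vs).
rewrite /= /pl horner_sum; congr (_ != _); apply: eq_bigr => i _.
by rewrite hornerZ hornerXn mulrC.
Qed.

Lemma proj_charts n : ~ countable [set: K] -> has_charts (proj_space K n).
Proof.
move=> uncK s; have [|l hl] := @avoid_hyperplanes n.+1 [seq rp x | x <- s] uncK.
  by move=> _ /mapP[x _ ->]; apply: rp_neq0.
pose l' : {mpoly K[n.+1]} := \sum_i l i *: 'X_i.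
have l'E v : poly_at l' v = \sum_i l i * v 0 i.
  by rewrite poly_at_sum; apply: eq_bigr => i _; rewrite poly_at_scale /poly_at mevalXU.
have hX i : ('X_i : {mpoly K[n.+1]}) \is 1.-homog by rewrite dhomogX /= mdeg1.
have hl' : l' \is 1.-homog by apply: rpred_sum => i _; apply: dhomogZ.
exists [set L | poly_at l' (rp L) != 0], n.+1, (fun i L => rp L 0 i / poly_at l' (rp L)).
split; last by move=> x xs; rewrite /= l'E; apply: hl; apply: map_f.
have nl (x : proj_space K n) : poly_at l' (rp x) != 0 -> near_pt x (fun L : proj_space K n => poly_at l' (rp L) != 0).
  by move=> lx; apply/proj_near; exists 1%N, l'; split.
split=> //.
- move=> x i /= lx; apply/proj_reg; exists 1%N, 'X_i, l'; split=> //.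
  apply: nearT => [|L]; first exact: proj_good.
  by rewrite {2}/poly_at mevalXU.
- move=> x y /= lx ly h.
  have xy : rp x = (poly_at l' (rp x) / poly_at l' (rp y)) *: rp y.
    apply/rowP => i; rewrite mxE; have /(congr1 (fun a => a * poly_at l' (rp x))) := h i.
    by rewrite divfK // => ->; rewrite mulrC mulrCA mulrC.
  apply: val_inj; rewrite /= -[val x]/(line x) -[val y]/(line y).
  apply/eqP; rewrite eqEdim (eqP (valP x)) (eqP (valP y)) leqnn andbT.
  apply/subvP => v /lineP[c ->]; rewrite xy scalerA memvZ //; exact: rp_line.
move=> x f /= lx /proj_reg[d [a [b [ha hb bx nf]]]]; exists a, b.
have E (p : {mpoly K[n.+1]}) (L : proj_space K n) : p \is d.-homog -> poly_at l' (rp L) != 0 ->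
   p.@[fun i => rp L 0 i / poly_at l' (rp L)] = (poly_at l' (rp L))^-1 ^+ d * poly_at p (rp L).
  move=> hp _; rewrite -(poly_atZ _ _ hp); apply: meval_eq => i.
  by rewrite mxE mulrC.
split; first by rewrite E // mulf_neq0 // expf_neq0 // invr_eq0.
apply: near_app2 nf (nl x lx) _; first exact: proj_good.
move=> L -> lL; rewrite !E // -mulf_div divff ?mul1r //.
by rewrite expf_neq0 // invr_eq0.
Qed.

Lemma proj_basis n : ~ countable [set: K] -> has_basis (proj_space K n).
Proof.
move=> uncK x y P /proj_near[d [a [ha ay aP]]].
have [|l hl] := @avoid_hyperplanes n.+1 [:: rp x; rp y] uncK.
  by move=> v; rewrite !inE => /orP[/eqP->|/eqP->]; apply: rp_neq0.
pose l' : {mpoly K[n.+1]} := \sum_i l i *: 'X_i.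
have l'E v : poly_at l' v = \sum_i l i * v 0 i.
  by rewrite poly_at_sum; apply: eq_bigr => i _; rewrite poly_at_scale /poly_at mevalXU.
have hl' : l' \is 1.-homog.
  by apply: rpred_sum => i _; apply: dhomogZ; rewrite dhomogX /= mdeg1.
have hld : l' ^+ d \is d.-homog by rewrite -[d in d.-homog]mul1n; apply: dhomogMn.
have ldE v : poly_at (l' ^+ d) v = poly_at l' v ^+ d by rewrite /poly_at rmorphXn.
have gP := proj_good K n.
have nl (z : proj_space K n) : poly_at l' (rp z) != 0 -> near_pt z (fun L : proj_space K n => poly_at l' (rp L) != 0).
  by move=> lz; apply/proj_near; exists 1%N, l'; split.
exists [set L | poly_at l' (rp L) != 0], (fun L => poly_at a (rp L) / poly_at (l' ^+ d) (rp L)); split.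
- by apply/(openP gP) => z /nl.
- by rewrite /= !l'E; split; apply: hl; rewrite !inE eqxx ?orbT.
- move=> z /= lz; apply/proj_reg; exists d, a, (l' ^+ d); split=> //; last exact: nearT.
  by rewrite ldE expf_neq0.
- rewrite mulf_neq0 // invr_eq0 ldE expf_neq0 // l'E; apply: hl.
  by rewrite !inE eqxx orbT.
by move=> z _; rewrite mulf_eq0 negb_or => /andP[/aP].
Qed.

Lemma sub_basis X (S : set X) : good X -> has_basis X -> has_basis (sub_space S).
Proof.
move=> gX hX x y P /sub_near nP; have [V [f [oV Vxy rf fy fP]]] := hX (val x) _ _ nP.
exists (fun z => V (val z)), (fun z => f (val z)); split=> //.
- by exists V.
- by move=> z Vz; apply: (sub_val_morph gX z).2; apply: rf.
by move=> z Vz fz; apply: (fP _ Vz fz).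
Qed.

Lemma sub_charts X (S : set X) : good X -> has_charts X -> has_charts (sub_space S).
Proof.
move=> gX hX s; have [V [N [h [[oV rh sep fr] Vs]]]] := hX [seq val x | x <- s].
exists (fun x => V (val x)), N, (fun i x => h i (val x)); split; last first.
  by move=> x xs; apply: Vs; apply/mapP; exists x.
have gS := sub_good gX S.
split.
- by move=> x Vx; have [+ _] := sub_val_morph gX x; apply; apply: oV.
- by move=> x i Vx; have [_ +] := sub_val_morph gX x; apply; apply: rh.
- by move=> x y Vx Vy e; apply: val_inj; apply: sep.
move=> x f Vx /(sub_reg_loc gX)[k rk nk]; have [p [q [qx npq]]] := fr _ _ Vx rk.
exists p, q; split=> //; have [+ _] := sub_val_morph gX x; move=> /(_ _ npq) npq'.
by apply: near_app2 nk npq' _ => // y -> .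
Qed.

End Charts.

Section Nice.
Variable K : closedFieldType.
Implicit Types X Y : fun_space K.

Definition quasicompact X := forall P : X -> X -> Prop, (forall x, near_pt x (P x)) ->
  exists s : seq X, forall y, exists2 x, x \in s & P x y.

(** What the sequel uses of projectivity, in a form invariant under isomorphism, so that the
    embedding can be forgotten. *)
Record nice X : Prop := Nice {
  nice_good : good X;
  nice_complete : complete_space X;
  nice_charts : has_charts X;
  nice_basis : has_basis X;
  nice_quasicompact : quasicompact X;
  nice_chain : exists N, bounded_chain X N }.

Section Iso.
Variables (X Y : fun_space K) (f : X -> Y) (g : Y -> X).
Hypotheses (mf : morphism f) (mg : morphism g) (fK : cancel f g) (gK : cancel g f).

Let preK (U : set X) : f @^-1` (g @^-1` U) = U.
Proof. by apply/seteqP; split=> x /=; rewrite fK. Qed.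

Let isoO (U : set X) : open U <-> open (g @^-1` U).
Proof. by split=> [/(mg.1 _)//|/(mf.1 _)]; rewrite preK. Qed.

Let isoR (U : set X) h : reg U h <-> reg (g @^-1` U) (h \o g).
Proof.
split=> [/(mg.2 _)//|/(mf.2 _)]; rewrite preK.
by have -> : (h \o g) \o f = h by apply/funext => x /=; rewrite fK.
Qed.

Lemma good_iso : good Y -> good X.
Proof.
move=> gY; split.
- by apply/isoO; apply: (good_openT gY).
- by move=> U V /isoO oU /isoO oV; apply/isoO; apply: (good_openI gY).
- move=> U h; apply/isoO; apply: (good_open_local gY) => y /h[V [oV Vy VU]].
  by exists (g @^-1` V); split=> //; [apply/isoO | move=> z /VU].
- by move=> U h /isoR /(good_reg_open gY) /isoO.
- move=> U h oU hl; apply/isoR; apply: (good_reg_local gY); first exact/isoO.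
  move=> y /hl[V [k [oV Vy rk hk]]]; exists (g @^-1` V), (k \o g); split=> //.
  + exact/isoO.
  + exact/isoR.
  by move=> z /hk /[apply].
- by move=> a; apply/isoR; apply: (good_reg_cst gY).
- by move=> U h k /isoR rh /isoR rk; apply/isoR; apply: (good_reg_add gY rh rk).
- by move=> U h k /isoR rh /isoR rk; apply/isoR; apply: (good_reg_mul gY rh rk).
- by move=> U h /isoR rh; apply/isoO; apply: (good_reg_nz gY rh).
by move=> U h /isoR rh nz; apply/isoR; apply: (good_reg_inv gY rh) => y /nz.
Qed.

Hypothesis gY : good Y.
Let gX := good_iso gY.
Let mfx x : morph_at f x := proj1 (morphismP f gX gY) mf x.
Let mgx x : morph_at g x := proj1 (morphismP g gY gX) mg x.

Lemma charts_iso : has_charts Y -> has_charts X.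
Proof.
move=> hY s; have [V [N [h [[oV rh sep fr] Vs]]]] := hY [seq f x | x <- s].
exists (fun x => V (f x)), N, (fun i x => h i (f x)); split; last first.
  by move=> x xs; apply: Vs; apply: map_f.
split.
- by move=> x Vx; apply: (mfx x).1; apply: oV.
- by move=> x i Vx; apply: (mfx x).2; apply: rh.
- by move=> x y Vx Vy e; apply: (can_inj fK); apply: sep.
move=> x k Vx rk; have rkg : reg_at (f x) (fun y => k (g y)).
  by apply: (mgx (f x)).2; rewrite fK.
have [p [q [qx npq]]] := fr _ _ Vx rkg.
exists p, q; split=> //; apply: near_mono ((mfx x).1 _ npq) _ => y.
by rewrite fK.
Qed.

Lemma basis_iso : has_basis Y -> has_basis X.
Proof.
move=> hY x y P nP; have nPg : near_pt (f y) (fun z => P (g z)).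
  by apply: (mgx (f y)).1; rewrite fK.
have [V [h [oV Vxy rh hy hP]]] := hY (f x) _ _ nPg.
exists (f @^-1` V), (h \o f); split=> //.
- exact: (mf.1 _ oV).
- by move=> z Vz; apply: (mfx z).2; apply: rh.
by move=> z Vz hz; rewrite -(fK z); apply: hP.
Qed.

Lemma quasicompact_iso : quasicompact Y -> quasicompact X.
Proof.
move=> qY P nP; have [|s hs] := qY (fun y y' => P (g y) (g y')).
  by move=> y; apply: (mgx y).1.
exists [seq g y | y <- s] => x; have [y ys Py] := hs (f x).
by exists (g y); [apply: map_f | rewrite fK in Py].
Qed.

Lemma chain_iso N : bounded_chain Y N -> bounded_chain X N.
Proof.
move=> bY [Z [hZ sZ]]; apply: bY; exists (fun i => g @^-1` (Z i)); split=> i iN.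
  have [cZ iZ] := hZ i iN; split=> [y nZ|].
    by apply: near_mono ((mgx y).1 _ (cZ _ nZ)) _.
  have -> : g @^-1` (Z i) = f @` (Z i).
    by apply/seteqP; split=> [y Zy|_ [x Zx <-]]; [exists (g y) | rewrite /= fK].
  by apply: irrset_image => //.
have [s1 s2] := sZ i iN; split=> [y /s1//|h]; apply: s2 => x Zx.
by have := h (f x); rewrite /= fK; apply.
Qed.

Lemma nice_iso : nice Y -> nice X.
Proof.
move=> [_ cY hY bY qY [N bN]]; split=> //.
- by apply: (complete_image gY gX mgx _ cY) => x; exists (f x).
- exact: charts_iso.
- exact: basis_iso.
- exact: quasicompact_iso.
by exists N; apply: chain_iso.
Qed.

End Iso.

Lemma closed_nice n (S : set (proj_space K n)) : ~ countable [set: K] ->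
  closed_set S -> nice (sub_space S).
Proof.
move=> uncK cS; have gP := proj_good K n; have gS := sub_good gP S; split=> //.
- exact: closed_complete.
- by apply: sub_charts => //; apply: proj_charts.
- by apply: sub_basis => //; apply: proj_basis.
- by move=> P; apply: closed_quasicompact.
exists n.+2 => -[Z [hZ sZ]]; apply: (@proj_bounded_chain K n).
exists (fun i => val @` (Z i)); split=> i iN.
  have [cZ iZ] := hZ i iN; split; last by apply: irrset_image => // x; apply: sub_val_morph.
  move=> L nL; have [SL|] := pselect (S L); last first.
    by move=> /cS /near_mono; apply=> L' nSL' [x _ xL']; apply: nSL'; rewrite -xL'; apply: set_mem (valP x).
  pose x : sub_space S := SigSub (mem_set SL).
  have /cZ /sub_near : ~ Z i x by move=> Zx; apply: nL; exists x.
  by move=> /near_mono; apply=> L' h [y Zy yL']; apply: (h y).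
have [s1 s2] := sZ i iN; split=> [_ [x /s1 Zx <-]|h]; first by exists x.
apply: s2 => x Zx; have [|y Zy /val_inj <-//] := h (val x).
by exists x.
Qed.

Lemma projective_nice X : ~ countable [set: K] -> projective_variety X ->
  nice X /\ irrset [set: X].
Proof.
move=> uncK [iX [n [S [cS [f [g [mf mg fK gK]]]]]]].
have nX : nice X.
  apply: (nice_iso mf mg fK gK); first exact: (sub_good (proj_good K n)).
  apply: closed_nice => //; exact/(closedP (proj_good K n)).
by split=> //; have /(irrset_closed (nice_good nX))[] := iX.
Qed.

Lemma charts_separated X : good X -> has_charts X -> forall x y : X, x <> y ->
  near_pt ((x, y) : prod_space X X) (fun q => q.1 <> q.2).
Proof.
move=> gX hX x y xy; have [V [N [h [[oV rh sep _] Vs]]]] := hX [:: x; y].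
have Vx : V x by apply: Vs; rewrite inE eqxx.
have Vy : V y by apply: Vs; rewrite !inE eqxx orbT.
have [i hi] : exists i, h i x != h i y.
  apply: contrapT => /forallNP e; apply: xy; apply: sep => // i.
  by apply/eqP; apply: contrapT => /negP /(e i).
have gXX := prod_good gX gX.
have r1 : reg_at ((x, y) : prod_space X X) (fun q => h i q.1 - h i q.2).
  apply: reg_atB => //.
    by apply: (fst_morph gX gX (x, y)).2; apply: rh.
  by apply: (snd_morph gX gX (x, y)).2; apply: rh.
apply: near_mono (near_nz gXX r1 _) _ => /=; first by rewrite subr_eq0.
by move=> [a b] /= + ab; rewrite ab subrr eqxx.
Qed.

End Nice.

(** * Abelian varieties *)

Section Abelian.
Variable K : closedFieldType.
Hypothesis uncK : ~ countable [set: K].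
Hypothesis char0 : forall m, m.+1%:R != 0 :> K.

Lemma irr_cover (X : fun_space K) (I : eqType) (s : seq I) (C : I -> set X) : good X ->
  irrset [set: X] -> (forall a, a \in s -> closed_set (C a)) ->
  (forall x, exists2 a, a \in s & C a x) -> exists2 a, a \in s & forall x, C a x.
Proof.
move=> gX [[x0 _] iX] cC cov; apply: contrapT => no.
suff [x hx] : exists x, near_pt x (fun x => forall a, a \in s -> ~ C a x).
  by have [a as_ Ca] := cov x; have := near_self hx a as_.
have {no} : forall a, a \in s -> exists x, ~ C a x.
  by move=> a as_; apply/existsNP => h; apply: no; exists a.
elim: s cC {cov} => [|a s IH] cC h; first by exists x0; apply: nearT.
have [x hx] : exists x, near_pt x (fun x => forall b, b \in s -> ~ C b x).
  by apply: IH => b bs; [apply: cC | apply: h]; rewrite inE bs orbT.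
have [y hy] := h a (mem_head _ _).
have [z [_ /= n1 n2]] := iX _ _ _ _ Logic.I Logic.I (near_near hx) (near_near (cC a (mem_head _ _) y hy)).
exists z; apply: near_app2 n1 n2 _ => // w w1 w2 b.
by rewrite inE => /predU1P[->|/w1].
Qed.

Lemma mpoly_taylor n (p : {mpoly K[n]}) (a : 'I_n -> K) : exists Q : 'I_n -> {mpoly K[n]},
  forall v, p.@[v] - p.@[a] = \sum_i (v i - a i) * (Q i).@[v].
Proof.
pose E (p : {mpoly K[n]}) := exists Q : 'I_n -> {mpoly K[n]},
  forall v, p.@[v] - p.@[a] = \sum_i (v i - a i) * (Q i).@[v].
have E1 : E 1.
  exists (fun=> 0) => v; rewrite !meval1 subrr big1 // => i _.
  by rewrite meval0 mulr0.
have EM p1 p2 : E p1 -> E p2 -> E (p1 * p2).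
  move=> [Q1 h1] [Q2 h2]; exists (fun i => p1 * Q2 i + p2.@[a] *: Q1 i) => v.
  rewrite !mevalM; transitivity (p1.@[v] * (p2.@[v] - p2.@[a]) + p2.@[a] * (p1.@[v] - p1.@[a])); first by ring.
  rewrite h1 h2 !mulr_sumr -big_split; apply: eq_bigr => i _ /=.
  by rewrite mevalD mevalM mevalZ; ring.
have EX i : E 'X_i.
  exists (fun j => (i == j)%:R%:MP) => v; rewrite !mevalXU (bigD1 i) //= eqxx mevalC mulr1.
  by rewrite big1 ?addr0 // => j ji; rewrite eq_sym (negPf ji) mevalC mulr0.
have EXn m : E 'X_[m].
  rewrite mpolyXE_id; apply: (big_ind E) => // i _.
  by elim: (m i) => [|k IH]; rewrite ?expr0 // exprS; apply: EM.
rewrite -/(E p); elim/mpolyind: p => [|c m p _ _ [Q h]].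
  by exists (fun=> 0) => v; rewrite !meval0 subrr big1 // => i _; rewrite ?meval0 mulr0.
have [Q' h'] := EXn m; exists (fun i => c *: Q' i + Q i) => v.
rewrite !mevalD !mevalZ; transitivity (c * ('X_[m].@[v] - 'X_[m].@[a]) + (p.@[v] - p.@[a])); first by ring.
rewrite h h' mulr_sumr -big_split; apply: eq_bigr => i _ /=.
by rewrite mevalD mevalZ; ring.
Qed.

Variable A : group_space K.
Hypothesis abA : abelian_variety A.
Local Notation GA := (gspace A).

Lemma ab_nice : nice GA.
Proof. by have [/(projective_nice uncK)[]] := abA. Qed.
Lemma ab_irr : irrset [set: GA].
Proof. by have [/(projective_nice uncK)[]] := abA. Qed.
Lemma ab_good : good GA. Proof. exact: nice_good ab_nice. Qed.
Let gA := ab_good.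

Lemma ab_add (p : prod_space GA GA) : morph_at (fun p : prod_space GA GA => p.1 + p.2 : GA) p.
Proof. by move: p; apply/(morphismP _ (prod_good gA gA) gA); have [] := abA. Qed.

Lemma ab_opp (x : GA) : morph_at (fun x : GA => - x : GA) x.
Proof. by move: x; apply/(morphismP _ gA gA); have [] := abA. Qed.

Section Morphisms.
Variables (X : fun_space K) (gX : good X).

Lemma ab_addm (f g : X -> GA) x : morph_at f x -> morph_at g x ->
  morph_at (fun x => f x + g x : GA) x.
Proof.
move=> mf mg.
exact: (morph_at_comp (pair_morph gA gA gX mf mg) (ab_add _)).
Qed.

Lemma ab_oppm (f : X -> GA) x : morph_at f x -> morph_at (fun x => - f x : GA) x.
Proof. by move=> mf; exact: (morph_at_comp mf (ab_opp _)). Qed.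

Lemma ab_subm (f g : X -> GA) x : morph_at f x -> morph_at g x ->
  morph_at (fun x => f x - g x : GA) x.
Proof. by move=> mf mg; apply: ab_addm => //; apply: ab_oppm. Qed.

Lemma ab_mulnm (f : X -> GA) n x : morph_at f x -> morph_at (fun x => f x *+ n : GA) x.
Proof.
move=> mf; elim: n => [|n IH].
  apply: (morph_at_eq gX (morph_at_cst (0 : GA) x gX gA)).
  by apply: nearT => // y; rewrite mulr0n.
apply: (morph_at_eq gX (ab_addm mf IH)).
by apply: nearT => // y; rewrite mulrS.
Qed.

Lemma ab_mulzm (f : X -> GA) (n : int) x : morph_at f x ->
  morph_at (fun x => (f x : A) *~ n : GA) x.
Proof.
case: n => n mf; first exact: ab_mulnm.
by apply: (morph_at_eq gX (ab_oppm (ab_mulnm n.+1 mf))); apply: nearT.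
Qed.

Lemma ab_summ (I : Type) (s : seq I) (P : pred I) (f : I -> X -> GA) x :
  (forall i, P i -> morph_at (f i) x) ->
  morph_at (fun x => \sum_(i <- s | P i) (f i x : A) : GA) x.
Proof.
move=> mf; elim: s => [|i s IH].
  apply: (morph_at_eq gX (morph_at_cst (0 : GA) x gX gA)).
  by apply: nearT => // y; rewrite big_nil.
case Pi: (P i); last by apply: (morph_at_eq gX IH); apply: nearT => // y; rewrite big_cons Pi.
apply: (morph_at_eq gX (ab_addm (mf i Pi) IH)).
by apply: nearT => // y; rewrite big_cons Pi.
Qed.

Lemma ab_neq_near (f g : X -> GA) x : morph_at f x -> morph_at g x -> f x <> g x ->
  near_pt x (fun y => f y <> g y).
Proof.
move=> mf mg fg; have := charts_separated gA (nice_charts ab_nice) fg.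
exact: (pair_morph gA gA gX mf mg).1.
Qed.

Lemma ab_image_closed (f : X -> GA) (C : set X) : complete_space X ->
  (forall x, morph_at f x) -> closed_set C -> closed_set (f @` C).
Proof.
move=> cX mf cC; apply: image_closed => // x y fxy.
have gXA := prod_good gX gA.
have := charts_separated gA (nice_charts ab_nice) fxy.
have m1 := morph_at_comp (fst_morph gX gA (x, y)) (mf _).
exact: (pair_morph gA gA gXA m1 (snd_morph gX gA (x, y))).1.
Qed.

End Morphisms.

Lemma ab_trans (a x : GA) : morph_at (fun x : GA => x + a : GA) x.
Proof.
apply: ab_addm => //.
exact: (morph_at_cst a x gA gA).
Qed.

Section Cotangent.
Variables (N : nat) (V : set GA) (h : 'I_N -> GA -> K).
Hypothesis chV : chart V h.
Hypothesis V0 : V (0 : GA).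
Local Notation o := (0 : GA).

Definition max_germ (f : GA -> K) := reg_at o f /\ f o = 0.
(** This is m^2, for m the maximal ideal at the origin, because the h_i - h_i(0) generate m
    ([max_germ_gen]). Fixed generators turn questions on m / m^2 into matrices. *)
Definition sq_germ (f : GA -> K) := exists c : 'I_N -> GA -> K,
  (forall i, max_germ (c i)) /\ near_pt o (fun y => f y = \sum_i (h i y - h i o) * c i y).

Lemma max_germ_gen f : max_germ f -> exists c : 'I_N -> GA -> K,
  (forall i, reg_at o (c i)) /\ near_pt o (fun y => f y = \sum_i (h i y - h i o) * c i y).
Proof.
move=> [rf f0]; have [oV rh sep fr] := chV.
have [p [q [q0 nf]]] := fr _ _ V0 rf.
have [Q hQ] := mpoly_taylor p (h^~ o).
have p0 : p.@[h^~ o] = 0.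
  apply/eqP; have := near_self nf; rewrite f0 => /esym/eqP.
  by rewrite mulf_eq0 invr_eq0 (negPf q0) orbF.
have rm (r : {mpoly K[N]}) : reg_at o (fun y => r.@[h^~ y]).
  by apply: reg_at_meval => // i; apply: rh.
exists (fun i y => (Q i).@[h^~ y] / q.@[h^~ y]); split=> [i|]; first exact: reg_at_div.
apply: near_mono nf _ => y ->; have := hQ (h^~ y); rewrite p0 subr0 => ->.
by rewrite mulr_suml; apply: eq_bigr => i _; rewrite mulrA.
Qed.

Lemma sq_germ_eq f g : sq_germ f -> near_pt o (fun y => f y = g y) -> sq_germ g.
Proof.
move=> [c [mc nf]] fg; exists c; split=> //.
by apply: near_app2 nf fg _ => // y -> <-.
Qed.

Lemma sq_germM f g : max_germ f -> max_germ g -> sq_germ (fun y => f y * g y).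
Proof.
move=> mf [rg g0]; have [c [rc nf]] := max_germ_gen mf.
exists (fun i y => c i y * g y); split=> [i|].
  by split; [apply: reg_atM | rewrite g0 mulr0].
by apply: near_mono nf _ => y ->; rewrite mulr_suml; apply: eq_bigr => i _; rewrite mulrA.
Qed.

Lemma sq_germD f g : sq_germ f -> sq_germ g -> sq_germ (fun y => f y + g y).
Proof.
move=> [c [mc nf]] [d [md ng]]; exists (fun i y => c i y + d i y); split=> [i|].
  have [rc c0] := mc i; have [rd d0] := md i.
  by split; [apply: reg_atD | rewrite c0 d0 addr0].
apply: near_app2 nf ng _ => // y -> ->; rewrite -big_split.
by apply: eq_bigr => i _; rewrite mulrDr.
Qed.

Lemma sq_germZ (a : K) f : sq_germ f -> sq_germ (fun y => a * f y).
Proof.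
move=> [c [mc nf]]; exists (fun i y => a * c i y); split=> [i|].
  have [rc c0] := mc i; split; last by rewrite c0 mulr0.
  by apply: reg_atM => //; apply: reg_at_cst.
apply: near_mono nf _ => y ->; rewrite mulr_sumr.
by apply: eq_bigr => i _; rewrite mulrCA.
Qed.

Lemma sq_germ0 : sq_germ (fun=> 0).
Proof.
exists (fun _ => fun=> 0); split=> [i|]; first by split=> //; apply: reg_at_cst.
by apply: nearT => // y; rewrite big1 // => i _; rewrite mulr0.
Qed.

Lemma sq_germ_sum n (F : 'I_n -> GA -> K) : (forall i, sq_germ (F i)) ->
  sq_germ (fun y => \sum_i F i y).
Proof.
elim: n F => [|n IH] F hF.
  by apply: sq_germ_eq sq_germ0 _; apply: nearT => // y; rewrite big_ord0.
apply: sq_germ_eq (sq_germD (hF ord0) (IH (fun i => F (fintype.lift ord0 i)) (fun i => hF _))) _.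
by apply: nearT => // y; rewrite big_ord_recl.
Qed.

(** Addition induces addition on the cotangent space. Near (0, 0), f(x + y) is a quotient of tensors
    a / b with a(0, 0) = 0, and a(x, y) - a(x, 0) - a(0, y) is a sum of products of a germ in x and
    a germ in y, both vanishing at 0; then y = phi(x) is substituted. *)
Lemma cotangent_add f (phi : GA -> GA) : max_germ f -> morph_at phi o -> phi o = o ->
  sq_germ (fun y => f (y + phi y) - f y - f (phi y)).
Proof.
move=> [rf f0] mphi phi0.
have gAA := prod_good gA gA.
have : @reg_at K (prod_space GA GA) (o, o) (fun p => f (p.1 + p.2)).
  by apply: (ab_add (o, o)).2; rewrite /= addr0.
move=> /(prod_reg_loc gA gA)[a [b [[n [a1 [a2 [ra1 ra2 aE]]]] [k [b1 [b2 [rb1 rb2 bE]]]] b0 nF]]].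
pose D := b (o, o).
have a0 : a (o, o) = 0.
  apply/eqP; have := near_self nF; rewrite /= addr0 f0 => /esym/eqP.
  by rewrite mulf_eq0 invr_eq0 (negPf b0) orbF.
have mid : morph_at (fun y : GA => (y, phi y) : prod_space GA GA) o.
  by apply: pair_morph.
have tb : ten_at ((o, o) : prod_space GA GA) b by exists k, b1, b2.
have nb := proj2 (box_near gA gA _ _) (box_nz gA gA tb b0).
have nFb : near_pt ((o, o) : prod_space GA GA) (fun q => f (q.1 + q.2) * b q = a q).
  have [+ _] := morph_at_id ((o, o) : prod_space GA GA).
  move=> _; apply: near_app2 nF nb _ => // q -> bq.
  by rewrite divfK.
have n1 : near_pt o (fun y => f (y + phi y) * b (y, phi y) = a (y, phi y)).
  have := mid.1 (fun q : prod_space GA GA => f (q.1 + q.2) * b q = a q).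
  by rewrite phi0; apply.
have n2 : near_pt o (fun y => f y * b (y, o) = a (y, o)).
  by apply: near_mono (near_slice1 gA gA nFb) _ => y /=; rewrite addr0.
have n3 : near_pt o (fun y => f (phi y) * b (o, phi y) = a (o, phi y)).
  have := near_slice2 gA gA nFb; rewrite -{1}phi0 => /mphi.1.
  by move=> /near_mono; apply=> y /=; rewrite add0r.
have rphi g : reg_at o g -> reg_at o (fun y => g (phi y)).
  by move=> rg; apply: mphi.2; rewrite phi0.
have mB (g : GA -> K) : reg_at o g -> max_germ (fun y => g y - g o).
  by move=> rg; split; [apply: reg_atB => //; apply: reg_at_cst | rewrite subrr].
pose R y := \sum_i (a1 i y - a1 i o) * (a2 i (phi y) - a2 i o).
have sR : sq_germ R.
  apply: sq_germ_sum => i; apply: sq_germM; first exact/mB/ra1.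
  have [r1 r2] := mB _ (ra2 i); split; last by rewrite phi0 subrr.
  by apply: reg_atB; [|exact: rphi (ra2 i)|exact: reg_at_cst].
have RE y : a (y, phi y) = a (y, o) + a (o, phi y) + R y.
  transitivity (a (y, phi y) + a (o, o)); first by rewrite a0 addr0.
  by rewrite !aE -!big_split /=; apply: eq_bigr => i _; ring.
have rb1' : reg_at o (fun y => b (y, o)).
  have : reg_at o (fun y => \sum_i b1 i y * b2 i o).
    by apply: (reg_at_sum gA) => i _; apply: (reg_atM gA); [exact: rb1 | exact: reg_at_cst].
  by move=> /(reg_at_eq gA); apply; apply: nearT => // y; rewrite bE.
have rb2' : reg_at o (fun y => b (o, phi y)).
  have : reg_at o (fun y => \sum_i b1 i o * b2 i (phi y)).
    by apply: (reg_at_sum gA) => i _; apply: (reg_atM gA); [exact: reg_at_cst | exact: rphi (rb2 i)].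
  by move=> /(reg_at_eq gA); apply; apply: nearT => // y; rewrite bE.
have rb3' : reg_at o (fun y => b (y, phi y)).
  have : reg_at o (fun y => \sum_i b1 i y * b2 i (phi y)).
    by apply: (reg_at_sum gA) => i _; apply: (reg_atM gA); [exact: rb1 i | exact: rphi (rb2 i)].
  by move=> /(reg_at_eq gA); apply; apply: nearT => // y; rewrite bE.
have mfphi : max_germ (fun y => f (phi y)).
  by split; [exact: rphi | rewrite phi0].
have mF : max_germ (fun y => f (y + phi y)).
  split; last by rewrite phi0 addr0.
  have m : morph_at (fun y : GA => y + phi y : GA) o by apply: ab_addm.
  by apply: m.2; rewrite phi0 addr0.
have S1 := sq_germM (conj rf f0) (mB _ rb1').
have S2 : sq_germ (fun y => f (phi y) * (b (o, phi y) - D)).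
  have [r2 _] := mB _ rb2'; apply: sq_germM => //; split; last by rewrite phi0 subrr.
  by move: r2; rewrite phi0.
have S3 : sq_germ (fun y => f (y + phi y) * (b (y, phi y) - D)).
  have [r2 _] := mB _ rb3'; apply: sq_germM => //; split; last by rewrite phi0 subrr.
  by move: r2; rewrite phi0.
(* Replacing a value of the denominator b by the constant [D] costs a product of two germs vanishing
   at the origin, hence an element of m^2. *)
have S := sq_germZ D^-1 (sq_germD (sq_germD (sq_germD S1 S2) (sq_germZ (-1) S3)) sR).
apply: sq_germ_eq S _.
apply: near_app2 (near_app2 gA n1 n2 (fun _ p q => conj p q)) n3 _ => // y [e1 e2] e3.
have e4 := RE y; rewrite -e1 -e2 -e3 in e4.
apply: (mulfI b0); rewrite mulVKf //.
have -> : R y = f (y + phi y) * b (y, phi y) - f y * b (y, o) - f (phi y) * b (o, phi y).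
  by rewrite e4; ring.
rewrite -/D; ring.
Qed.

Lemma cotangent_muln f m : max_germ f -> sq_germ (fun y => f (y *+ m) - m%:R * f y).
Proof.
move=> mf; elim: m => [|m IH].
  apply: sq_germ_eq sq_germ0 _; apply: nearT => // y.
  by rewrite mulr0n mf.2 mul0r subr0.
have mm : morph_at (fun y : GA => y *+ m : GA) o by apply: ab_mulnm.
have := sq_germD (cotangent_add mf mm (mul0rn _ m)) IH.
move=> /sq_germ_eq; apply; apply: nearT => // y.
by rewrite mulrS -natr1; ring.
Qed.

(** Multiplication by n = m + 1 acts on m / m^2 as n. So the coordinates of n y are obtained from
    those of y by a matrix equal to n at the origin, invertible nearby; if n y = 0 the coordinates
    of y vanish. *)
Lemma torsion_isolated m : near_pt o (fun y => y *+ m.+1 = 0 -> y = 0).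
Proof.
have [oV rh sep fr] := chV.
have mt i : max_germ (fun y => h i y - h i o).
  by split; [apply: reg_atB => //; [exact: rh|exact: reg_at_cst] | rewrite subrr].
have /choice[c hc] := fun i => cotangent_muln m.+1 (mt i).
pose M y := \matrix_(i, j) ((m.+1%:R *+ (i == j)) + c i j y) : 'M[K]_N.
have nM : near_pt o (fun y => \det (M y) != 0).
  apply: near_nz => //.
    apply: reg_at_det => // i j.
    have : reg_at o (fun y => (m.+1%:R *+ (i == j)) + c i j y).
      by apply: reg_atD => //; [exact: reg_at_cst | have [+ _] := hc i; case/(_ j)].
    by move=> /(reg_at_eq gA); apply; apply: nearT => // y; rewrite mxE.
  have -> : M o = (m.+1%:R)%:M.
    apply/matrixP => i j; rewrite !mxE; have [+ _] := hc i; case/(_ j) => _ ->.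
    by rewrite addr0.
  by rewrite det_scalar expf_neq0.
have nc : near_pt o (fun y => forall i, (h i (y *+ m.+1) - h i o) - m.+1%:R * (h i y - h i o) =
   \sum_j (h j y - h j o) * c i j y).
  by apply: near_all => // i; have [_] := hc i.
apply: near_app2 nM (near_app2 gA nc (oV _ V0) (fun _ p q => conj p q)) _ => // y My [cy Vy] ym.
apply: sep => // i.
pose t := \col_j (h j y - h j o).
have Mt : M y *m t = 0.
  apply/matrixP => i' j'; rewrite mxE [RHS]mxE.
  have := cy i'; rewrite ym subrr sub0r => /esym/eqP; rewrite -addr_eq0 => /eqP e.
  rewrite -[RHS]e; under eq_bigr do rewrite !mxE mulrDl.
  rewrite big_split addrC /=; congr (_ + _); last by apply: eq_bigr => j _; rewrite mulrC.
  rewrite (bigD1 i') //= eqxx mulr1n big1 ?addr0 // => j ji.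
  by rewrite eq_sym (negPf ji) mulr0n mul0r.
have t0 : t = 0.
  by rewrite -[t](mulKmx (_ : M y \in unitmx)) ?Mt ?mulmx0 // unitmxE unitfE.
have := congr1 (fun M : 'cV[K]_N => M i 0) t0; rewrite !mxE => /eqP.
by rewrite subr_eq0 => /eqP.
Qed.

End Cotangent.

(** By translation every torsion point is isolated, and a point that is not torsion has a
    neighbourhood without torsion; quasi-compactness concludes. *)
Lemma torsion_finite m : (0 < m)%N -> exists s : seq A, forall x : A, x *+ m = 0 -> x \in s.
Proof.
case: m => // m _; have [V [N [h [chV Vs]]]] := nice_charts ab_nice [:: (0 : GA)].
have n0 := torsion_isolated chV (Vs _ (mem_head _ _)) m.
have qc : quasicompact GA by exact: nice_quasicompact ab_nice.
have [|s hs] := qc (fun (a y : GA) => y *+ m.+1 = 0 -> y = a :> A).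
  move=> a; have [am|am] := pselect ((a : A) *+ m.+1 = 0).
    have : near_pt a (fun y : GA => (y - a : A) *+ m.+1 = 0 -> (y - a : A) = 0).
      have := (ab_trans (- a) a).1 (fun z : GA => (z : A) *+ m.+1 = 0 -> (z : A) = 0).
      by rewrite subrr; apply.
    move=> /near_mono; apply=> y + ym; rewrite mulrnBl ym am subrr => /(_ erefl)/eqP.
    by rewrite subr_eq0 => /eqP.
  have := @ab_neq_near _ gA (fun y : GA => y *+ m.+1 : GA) (fun=> 0 : GA) a _ _ am.
  move=> H; apply: near_mono (H _ _) _.
  - by apply: ab_mulnm.
  - exact: (morph_at_cst (0 : GA) a gA gA).
  by move=> y ym /ym.
by exists s => x xm; have [a as_ /(_ xm) ->] := hs x.
Qed.

(** The closed irreducible sets m^k A decrease, so m^k A = m^(k + 1) A for some k. Then A is the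
    union of the translates of m A by the finitely many m^k-torsion points, and irreducibility
    leaves a single translate. *)
Lemma divisible m (y : A) : (0 < m)%N -> exists x : A, x *+ m = y.
Proof.
move=> m0.
pose H k : set GA := range (fun x : GA => x *+ (m ^ k)%N : GA).
have mm n (x : GA) : morph_at (fun x : GA => x *+ n : GA) x by apply: ab_mulnm.
have cT : closed_set [set: GA] by move=> x /(_ I).
have cH k : closed_set (H k) /\ irrset (H k).
  split; last exact: irrset_image (mm _) ab_irr.
  by apply: ab_image_closed => //; apply: nice_complete ab_nice.
have Hsub k : H k.+1 `<=` H k.
  by move=> _ [x _ <-]; exists (x *+ m : A) => //; rewrite -mulrnA expnS.
have [k Hk] : exists k, H k `<=` H k.+1.
  apply: contrapT => /forallNP no; have [N] := nice_chain ab_nice; apply.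
  (* The decreasing family is reversed to fit the increasing chains of [bounded_chain]. *)
  exists (fun i => H (N - i)%N); split=> [i _|i iN]; first exact: cH.
  by rewrite -(subnSK iN); split; [exact: Hsub | exact: no].
have mk0 : (0 < m ^ k)%N by rewrite expn_gt0 m0.
have [s hs] := torsion_finite mk0.
have ctr (a : A) : closed_set [set x : GA | exists x' : A, x = a + x' *+ m].
  have -> : [set x : GA | exists x' : A, x = a + x' *+ m] = range (fun x : GA => x *+ m + a : GA).
    by apply/seteqP; split=> x [x' h]; [exists x' => //; rewrite h addrC | move=> <-; exists x'; rewrite addrC].
  apply: ab_image_closed => //; first exact: nice_complete ab_nice.
  by move=> x; apply: ab_addm => //; exact: (morph_at_cst (a : GA) x gA gA).
have [|a _ ha] := @irr_cover GA _ s (fun a => [set x : GA | exists x' : A, x = a + x' *+ m]) gA ab_irr (fun a _ => ctr a).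
  move=> x; have [|x' _ e] := Hk (x *+ (m ^ k)%N : A); first by exists x.
  exists (x - x' *+ m : A); last by exists x'; rewrite subrK.
  by apply: hs; rewrite mulrnBl -e -mulrnA expnS subrr.
by have [x /esym e] := ha (y + a); exists x; move: e; rewrite addrC => /addIr.
Qed.

End Abelian.

(** * Descent of morphisms along surjections *)

Section Descent.
Variable K : closedFieldType.
Hypothesis uncK : ~ countable [set: K].
Hypothesis char0 : forall m, m.+1%:R != 0 :> K.

Lemma irr_meet (X : fun_space K) (I : finType) (P : I -> X -> Prop) : good X ->
  irrset [set: X] -> (forall i, exists x, near_pt x (P i)) ->
  exists z, forall i, near_pt z (P i).
Proof.
move=> gX iX h; apply: contrapT => /forallNP no.
have [| |i _ hi] := @irr_cover K X I (enum I) (fun i => [set x | ~ near_pt x (P i)]) gX iX.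
- by move=> i _ x /contrapT /near_near /near_mono; apply=> y ny; apply.
- by move=> x; have /existsNP[i ni] := no x; exists i; rewrite ?mem_enum.
by have [x /hi] := h i; apply.
Qed.

Section PolyFamilies.
Variables (X : fun_space K) (gX : good X).

Definition polyfam (x : X) (P : X -> {poly K}) := forall i, reg_at x (fun y => (P y)`_i).

Lemma polyfam_near x P d : polyfam x P -> near_pt x (fun y => (size (P y) <= d)%N) ->
  near_pt x (polyfam^~ P).
Proof.
move=> pP nd; have n1 := near_all gX (fun i : 'I_d => near_reg (pP i)).
apply: near_app2 n1 (near_near nd) _ => // y ry nd' i.
have [id|di] := ltnP i d; first exact: (ry (Ordinal id)).
apply: (reg_at_eq gX (reg_at_cst gX y 0)); apply: near_mono nd' _ => z sz.
by rewrite nth_default // (leq_trans sz di).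
Qed.

(** Euclidean division in families: the leading coefficient of P is a unit of the local ring at
    x. *)
Lemma polyfam_division x P Q d D : polyfam x P -> polyfam x Q -> (P x)`_d != 0 ->
  near_pt x (fun y => (size (P y) <= d.+1)%N) -> near_pt x (fun y => (size (Q y) <= D)%N) ->
  exists R, polyfam x R /\ near_pt x (fun y => (size (R y) <= d)%N /\ exists S, Q y = S * P y + R y).
Proof.
move=> pP + Pd nP; elim: D Q => [|D IH] Q pQ nQ.
  exists Q; split=> //; apply: near_mono nQ _ => y sQ; split; last by exists 0; rewrite mul0r add0r.
  by rewrite (leq_trans sQ).
have [Dd|dD] := leqP D.+1 d.
  exists Q; split=> //; apply: near_mono nQ _ => y sQ; split; last by exists 0; rewrite mul0r add0r.
  by rewrite (leq_trans sQ).
pose c y := (Q y)`_D / (P y)`_d.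
have rc : reg_at x c by apply: reg_at_div.
have [||R [pR nR]] := IH (fun y => Q y - c y *: ('X^(D - d) * P y)).
- move=> i; case: (leqP (D - d) i) => h.
    have : reg_at x (fun y => (Q y)`_i - c y * (P y)`_(i - (D - d))).
      by apply: reg_atB => //; apply: reg_atM.
    move=> /(reg_at_eq gX); apply; apply: nearT => // y.
    by rewrite coefB coefZ coefXnM ltnNge h.
  apply: (reg_at_eq gX (pQ i)); apply: nearT => // y.
  by rewrite coefB coefZ coefXnM h mulr0 subr0.
- apply: near_app2 (near_app2 gX nP nQ (fun _ p q => conj p q)) (near_nz gX (pP d) Pd) _ => //.
  move=> y [sP sQ] Py; apply/leq_sizeP => j Dj; rewrite coefB coefZ coefXnM.
  rewrite ltnNge (leq_trans (leq_subr _ _) Dj) /=.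
  move: Dj; rewrite leq_eqVlt => /predU1P[<-|Dj].
    by rewrite subKn // /c divfK // subrr.
  rewrite nth_default ?(leq_trans sQ) // [(P y)`_ _]nth_default ?mulr0 ?subr0 //.
  apply: leq_trans sP _; rewrite ltn_subRL; rewrite -ltnS in dD.
  by rewrite addnC subnKC.
exists R; split=> //; apply: near_mono nR _ => y [sR [S e]]; split=> //.
exists (S + c y *: 'X^(D - d)); rewrite mulrDl -scalerAl -[LHS](subrK (c y *: ('X^(D - d) * P y))) e.
by rewrite addrAC.
Qed.

Variable F : X -> K.

(** The degree of a relation satisfied by F on some open set. The point is quantified inside, so
    that the minimal degree is one number for the whole irreducible X. *)
Definition vanishing_degree d := exists x P, [/\ polyfam x P,
  near_pt x (fun y => (P y).[F y] = 0), near_pt x (fun y => (size (P y) <= d.+1)%N) & (P x)`_d != 0].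

Lemma vanishing_degree_exists x Q D : polyfam x Q -> near_pt x (fun y => (Q y).[F y] = 0) ->
  near_pt x (fun y => (size (Q y) <= D)%N) -> Q x != 0 ->
  exists2 d, (d < D)%N & vanishing_degree d.
Proof.
move=> pQ vQ; elim: D => [|D IH] sQ Qx.
  by move: Qx; rewrite -size_poly_leq0 (near_self sQ).
have [h|h] := pselect (near_pt x (fun y => (Q y)`_D = 0)).
  have [||d dD ?] := IH; [|by []|by exists d => //; rewrite ltnS ltnW].
  apply: near_app2 sQ h _ => // y sy Qy; apply/leq_sizeP => j.
  by rewrite leq_eqVlt => /predU1P[<-//|Dj]; rewrite nth_default // (leq_trans sy).
have n1 := near_near (nearI gX sQ (nearI gX vQ (polyfam_near pQ sQ))).
have [y [ny Qy]] : exists y, near_pt y (fun y => (size (Q y) <= D.+1)%N /\ (Q y).[F y] = 0 /\ polyfam y Q) /\ (Q y)`_D != 0.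
  apply: contrapT => no; apply: h; apply: near_mono n1 _ => y ny.
  by apply/eqP; apply: contrapT => /negP Qy; apply: no; exists y.
exists D => //; exists y, Q; split=> //.
- by have [_ []] := near_self ny.
- by apply: near_mono ny _ => z [_ []].
- by apply: near_mono ny _ => z [].
Qed.

(* a minimal relation P(y, F y) = 0 of degree d has F y as its only root, so F = - P_(d-1) / (d P_d) *)
Lemma generic_regular (W : set X) x0 : near_pt x0 W -> (forall x, W x -> near_pt x W) ->
  (forall x t, W x -> t <> F x -> exists Q D, [/\ polyfam x Q,
     near_pt x (fun y => (Q y).[F y] = 0), near_pt x (fun y => (size (Q y) <= D)%N) & (Q x).[t] != 0]) ->
  irrset [set: X] -> exists x, reg_at x F.
Proof.
move=> nW0 oW hW [_ iX].
have Qnz (p : {poly K}) t : p.[t] != 0 -> p != 0.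
  by apply: contraNneq => ->; rewrite horner0.
have [d [vd dmin]] : exists d, vanishing_degree d /\ forall d', (d' < d)%N -> ~ vanishing_degree d'.
  have [|Q [D [pQ vQ sQ Qt]]] := hW x0 (F x0 + 1) (near_self nW0).
    by move=> /eqP; rewrite -subr_eq0 addrC addKr oner_eq0.
  have [d0 _ vd0] := vanishing_degree_exists pQ vQ sQ (Qnz _ _ Qt).
  have ex : exists d, `[< vanishing_degree d >] by exists d0; apply/asboolP.
  exists (ex_minn ex); case: ex_minnP => d /asboolP vd hd; split=> // d' dd' vd'.
  by have := hd d' (asboolT vd'); rewrite leqNgt dd'.
have [x1 [P [pP vP sP Px]]] := vd.
have [x [_ /= /near_near nx nWx]] := iX _ _ _ _ Logic.I Logic.I
  (near_near (nearI gX (nearI gX vP (near_near vP)) (nearI gX (nearI gX (near_near sP) (polyfam_near pP sP)) (near_nz gX (pP d) Px)))) (near_near nW0).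
have {}nWx : near_pt x W by [].
exists x.
have nroot : near_pt x (fun y => P y = (P y)`_d *: ('X - (F y)%:P) ^+ d).
  apply: near_app2 nx nWx _ => // y ny Wy.
  have [[Py vPy] [[sPy pPy] Pyd]] := near_self ny.
  (* A root t other than F y would be separated from it by some Q; the remainder of Q by P vanishes
     at F, is nonzero at t, and has degree below d, against minimality. *)
  have rt t : root (P y) t -> t = F y.
    move=> /rootP Pt; apply: contrapT => tF.
    have [Q [D [pQ vQ sQ Qt]]] := hW y t Wy tF.
    have [R [pR nR]] := polyfam_division pPy pQ Pyd sPy sQ.
    have [|||d' dd'] := @vanishing_degree_exists y R d pR; last by apply: dmin.
    - apply: near_app2 nR (nearI gX vQ vPy) _ => // z [_ [S]] e [Qz Pz].
      by move: Qz; rewrite e hornerD hornerM Pz mulr0 add0r.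
    - by apply: near_mono nR _ => z [].
    have [_ [S e]] := near_self nR; apply: (Qnz _ t).
    by move: Qt; rewrite e hornerD hornerM Pt mulr0 add0r.
  have [rs hrs] := closed_field_poly_normal (P y).
  have sz : size (P y) = d.+1.
    apply/eqP; rewrite eqn_leq (near_self sPy) /= ltnNge; apply: contra Pyd => h.
    by rewrite nth_default.
  have lc : lead_coef (P y) = (P y)`_d by rewrite /lead_coef sz.
  have P0 : lead_coef (P y) != 0 by rewrite lc.
  have srs : size rs = d.
    by move: sz; rewrite {1}hrs size_scale // size_prod_XsubC => -[].
  rewrite {1}hrs lc; congr (_ *: _); rewrite -srs.
  have : forall r, r \in rs -> r = F y.
    by move=> r rr; apply: rt; rewrite hrs rootZ // root_prod_XsubC.
  elim: (rs) => [|r s IH] h; first by rewrite big_nil expr0.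
  by rewrite big_cons /= exprS (h r (mem_head _ _)) IH // => r' r's; apply: h; rewrite inE r's orbT.
have [[Px0 _] [[_ pPx] Pxd]] := near_self (near_self nx).
case: (d) pPx Pxd nroot => [|e] pPx Pxd nroot.
  move: Px0 (near_self nroot); rewrite expr0 => + e; rewrite e hornerZ hornerC mulr1 => /eqP.
  by rewrite (negPf Pxd).
have r0 : reg_at x (fun y => - (P y)`_e / (e.+1%:R * (P y)`_e.+1)).
  apply: reg_at_div => //; first exact: reg_atN.
    by apply: reg_atM => //; apply: reg_at_cst.
  by rewrite mulf_neq0.
apply: (reg_at_eq gX r0).
apply: near_app2 nroot (near_nz gX (pPx e.+1) Pxd) _ => // y Py Pyd.
have -> : (P y)`_e = - (e.+1%:R * (P y)`_e.+1 * F y).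
  rewrite {1}Py coefZ.
  have -> : (('X - (F y)%:P) ^+ e.+1)`_e = - (e.+1%:R * F y).
    elim: (e) => [|k IH]; first by rewrite expr1 coefB coefX coefC mul1r sub0r.
    rewrite exprSr mulrBr coefB coefMX coefMC /= IH.
    have -> : (('X - (F y)%:P) ^+ k.+1)`_k.+1 = 1.
      have /monicP : ('X - (F y)%:P) ^+ k.+1 \is monic by rewrite monic_exp ?monicXsubC.
      by rewrite /lead_coef size_exp_XsubC.
    by rewrite -[k.+2%:R]natr1; ring.
  by rewrite mulrN mulrA [e.+1%:R * _]mulrC.
by rewrite opprK mulrC mulKf // mulf_neq0.
Qed.

End PolyFamilies.

Section Homomorphism.
Variables (A B : group_space K) (abA : abelian_variety A) (abB : abelian_variety B).
Local Notation GA := (gspace A).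
Local Notation GB := (gspace B).
Variables (phi : A -> B) (phiD : forall x y, phi (x + y) = phi x + phi y).
Variables (M : fun_space K) (s : M -> GA).
Hypotheses (gM : good M) (cM : complete_space M).
Hypotheses (ms : forall m, morph_at s m) (surj : forall a, exists m, s m = a).
Hypothesis mphis : forall m, morph_at (fun m => phi (s m) : GB) m.

Let gA : good GA := ab_good uncK abA.
Let gB : good GB := ab_good uncK abB.

(** The points of M where P fails to hold locally form a closed set, and completeness of M makes its
    image in A closed. *)
Lemma descent_continuous (x : GA) P : near_pt (phi x : GB) P -> near_pt x (fun y => P (phi y)).
Proof.
move=> nP; pose C : set M := [set m | ~ near_pt (phi (s m) : GB) P].
have cC : closed_set C.
  by move=> m /contrapT /near_near /(mphis m).1 /near_mono; apply=> y ny; apply.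
have := ab_image_closed uncK abA gM cM ms cC.
move=> /(_ x) h; apply: near_mono (h _) _ => [[m Cm e]|y nC].
  by apply: Cm; rewrite e.
have [m e] := surj y; have [Cm|/contrapT] := pselect (C m); first by case: nC; exists m.
by rewrite e => /near_self.
Qed.

(** Completeness of M shows that a neighbourhood of (x, t) misses the graph of f after phi. It
    contains a basic one, so some tensor is nonzero at (x, t) and vanishes on the nearby graph. In
    its second variable the tensor is a fraction of polynomials, and clearing denominators gives
    Q. *)
Lemma descent_separating f (x : GA) t : reg_at (phi x : GB) f -> t <> f (phi x) ->
  exists Q D, [/\ polyfam x Q, near_pt x (fun y => (Q y).[f (phi y)] = 0),
    near_pt x (fun y => (size (Q y) <= D)%N) & (Q x).[t] != 0].
Proof.
move=> rf tf; have gL := affine_good K; have gT := prod_good gA gL.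
have nt : near_pt ((x, t) : prod_space GA (affine_line K)) (fun q => q.2 <> f (phi q.1)).
  have := cM gT (C := fun q => s q.1 = q.2.1 /\ q.2.2 = f (phi (s q.1))) (t := (x, t)).
  move=> H; have {}H : near_pt ((x, t) : prod_space GA (affine_line K))
      (fun q => forall m, ~ (s m = q.1 /\ q.2 = f (phi (s m)))).
    apply: H => m; have gMT := prod_good gM gT.
    have m1 := fst_morph gM gT (m, (x, t)); have m2 := snd_morph gM gT (m, (x, t)).
    have [sx|sx] := pselect (s m = x); last first.
      have m1' := morph_at_comp m1 (ms m).
      have m2' := morph_at_comp m2 (fst_morph gA gL _).
      have := ab_neq_near uncK abA gMT m1' m2' sx.
      by move=> /near_mono; apply=> q /= h [].
    have rt : reg_at ((m, (x, t)) : prod_space M (prod_space GA (affine_line K))) (fun q => q.2.2).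
      have m2' := morph_at_comp m2 (snd_morph gA gL _).
      by apply: (m2'.2 id); apply: affine_coord.
    have rF : reg_at ((m, (x, t)) : prod_space M (prod_space GA (affine_line K))) (fun q => f (phi (s q.1))).
      apply: (m1.2 (fun m : M => f (phi (s m)))).
      by apply: ((mphis m).2 f); rewrite sx.
    apply: near_mono (near_nz gMT (reg_atB gMT rt rF) _) _ => [|q /=].
      by rewrite /= sx subr_eq0; apply/eqP.
    by move=> + [_ e]; rewrite e subrr eqxx.
  apply: near_mono H _ => -[y u] /= h e; have [m my] := surj y.
  by apply: (h m); rewrite my.
have /(box_near gA gL)[h [A' [B' [[k [a [b [ra rb hE]]]] hx nA nB hAB]]]] := nt.
have /choice[pq hpq] : forall i : 'I_k, exists pq : {poly K} * {poly K}, pq.2.[t] != 0 /\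
    near_pt (t : affine_line K) (fun u => b i u = pq.1.[u] / pq.2.[u]).
  by move=> i; have [p [q [qt nq]]] := affine_reg (rb i); exists (p, q).
have := near_all gL (fun i => proj2 (hpq i)).
move=> /(nearI gL nB) /affine_near[r rt hr].
pose Qi i := (pq i).1 * \prod_(j | j != i) (pq j).2.
pose q := \prod_j (pq j).2.
have qt u : q.[u] = \prod_j (pq j).2.[u] by rewrite horner_prod.
pose Q y := r * q * \sum_i a i y *: Qi i.
have QE y u : r.[u] != 0 -> q.[u] != 0 -> (Q y).[u] = r.[u] * q.[u] * q.[u] * h (y, u).
  move=> ru qu; rewrite !hornerM horner_sum -!mulrA hE; congr (_ * (_ * _)).
  rewrite mulr_sumr; apply: eq_bigr => i _ /=; have [_ /(_ i) ->] := hr u ru.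
  rewrite hornerZ hornerM [RHS]mulrCA; congr (_ * _).
  have : q.[u] = (pq i).2.[u] * (\prod_(j | j != i) (pq j).2).[u].
    by rewrite qt (bigD1 i) //= horner_prod.
  move=> e; move: qu; rewrite e mulf_eq0 negb_or => /andP[q1 q2].
  by field.
exists Q, (size (r * q)%R + \max_i size (Qi i))%N; split.
- move=> i; have : reg_at x (fun y => \sum_j a j y * (r * q * Qi j)`_i).
    by apply: (reg_at_sum gA) => j _; apply: (reg_atM gA); [exact: ra j | exact: reg_at_cst].
  move=> /(reg_at_eq gA); apply; apply: nearT => // y.
  rewrite /Q mulr_sumr coef_sum; apply: eq_bigr => j _.
  by rewrite -scalerAr coefZ.
- apply: near_mono nA _ => y Ay; apply/eqP; apply: contrapT => /negP Qy.
  have rF : r.[f (phi y)] != 0 by apply: contraNneq Qy; rewrite !hornerM => ->; rewrite !mul0r.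
  have qF : q.[f (phi y)] != 0 by apply: contraNneq Qy; rewrite !hornerM => ->; rewrite mulr0 mul0r.
  have [Bu _] := hr _ rF; apply: (hAB (y, f (phi y))) => //=.
  by apply: contraNneq Qy => h0; rewrite QE // h0 mulr0.
- apply: nearT => // y; apply: leq_trans (size_polyMleq _ _) _.
  apply: leq_trans (leq_pred _) _; rewrite leq_add2l.
  apply: leq_trans (size_sum _ _ _) _; apply/bigmax_leqP => i _.
  by apply: leq_trans (size_scale_leq _ _) _; apply: (leq_bigmax i).
have q0 : q.[t] != 0 by rewrite qt; apply/prodf_neq0 => i _; have [] := hpq i.
by rewrite QE // !mulf_neq0.
Qed.

(** By [generic_regular] each chart function of B becomes regular somewhere after composition with
    phi, hence all of them at one point z by irreducibility. So phi is a morphism at z, and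
    translations carry z to any x. *)
Lemma descent_morphism (x : GA) : morph_at (phi : GA -> GB) x.
Proof.
have phi0 : phi 0 = 0 by apply: (addIr (phi 0)); rewrite -phiD !add0r.
have phiN y : phi (- y) = - phi y by apply/eqP; rewrite -addr_eq0 -phiD addNr phi0.
have iA := ab_irr uncK abA.
have [V [N [h [[oV rh sep fr] Vs]]]] := nice_charts (ab_nice uncK abB) [:: (0 : GB)].
have V0 : V 0 by apply: Vs; rewrite inE.
have oV0 : near_pt (0 : GA) (fun y => V (phi y)).
  by apply: descent_continuous; rewrite phi0; apply: oV.
have [z [Vz hz]] : exists z : GA, near_pt z (fun y => V (phi y)) /\
   forall i, reg_at z (fun y => h i (phi y)).
  have [|z hz] := @irr_meet GA (option 'I_N) (fun o y => if o is Some i then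
     reg_at (y : GA) (fun y => h i (phi y)) else V (phi y)) gA iA.
    case=> [i|]; last by exists 0.
    have [||||y ry] := @generic_regular GA gA (fun y : GA => h i (phi y)) [set y : GA | near_pt y (fun y => V (phi y))] 0.
    - exact: near_near.
    - by move=> y /near_near.
    - move=> y t /near_self Vy; apply: descent_separating; exact: rh.
    - exact: iA.
    by exists y; apply: near_reg.
  by exists z; split=> [|i]; [exact: (hz None) | exact: near_self (hz (Some i))].
have mz : morph_at (phi : GA -> GB) z.
  split=> [P|f rf]; first exact: descent_continuous.
  have [p [q [qz npq]]] := fr _ _ (near_self Vz) rf.
  have rp' (r : {mpoly K[N]}) : reg_at z (fun y => r.@[fun i => h i (phi y)]) by apply: reg_at_meval.
  apply: (reg_at_eq gA (reg_at_div gA (rp' p) (rp' q) qz)).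
  by apply: near_mono (descent_continuous npq) _ => y ->.
have m1 := ab_trans uncK abA (z - x) x.
have m2 : morph_at (phi : GA -> GB) (x + (z - x)) by rewrite addrC subrK.
have m3 := morph_at_comp (morph_at_comp m1 m2) (ab_trans uncK abB (phi (x - z)) _).
apply: (morph_at_eq gA m3); apply: nearT => // y /=.
by rewrite -phiD; congr phi; rewrite -addrA -opprB addNr addr0.
Qed.

End Homomorphism.
End Descent.

(** * Local rings of a curve *)

Section HilbertBasis.

(** The ascending chain condition for sequences: some term lies in the ideal of its predecessors,
    which is what [germ_order] consumes. *)
Definition noetherian (A : comNzRingType) := forall a : nat -> A,
  exists N (c : nat -> A), a N = \sum_(j < N) c j * a j.

Lemma noetherian_field (F : fieldType) : noetherian F.
Proof.
move=> a; have [a0|a0] := eqVneq (a 0%N) 0.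
  by exists 0%N, (fun=> 0); rewrite big_ord0.
by exists 1%N, (fun=> a 1%N / a 0%N); rewrite big_ord1 divfK.
Qed.

Lemma noetherian_image (A B : comNzRingType) (f : A -> B) :
  (forall x y, f (x + y) = f x + f y) -> (forall x y, f (x * y) = f x * f y) ->
  (forall y, exists x, f x = y) -> noetherian A -> noetherian B.
Proof.
move=> fD fM fs nA b; have /choice[a ha] := fun n => fs (b n).
have [N [c e]] := nA a; exists N, (f \o c).
have f0 : f 0 = 0 by apply: (addIr (f 0)); rewrite -fD !add0r.
rewrite -ha e (big_morph f fD f0); apply: eq_bigr => j _.
by rewrite fM ha.
Qed.

(** Hilbert's argument: g_n has least degree among the elements of the ideal I of all f_n outside
    the ideal of g_0, ..., g_(n-1). A relation between leading coefficients then makes g_N minus a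
    combination of its predecessors an element outside of smaller degree. *)
Lemma noetherian_poly (A : comNzRingType) : noetherian A -> noetherian {poly A}.
Proof.
move=> nA f; apply: contrapT => no.
pose span (s : seq {poly A}) := ideal_gen [set g | g \in s].
pose S : set {poly A} := range f.
pose I := ideal_gen S.
have iI : ideal I := ideal_genP S.
have spanS s g : (forall h, h \in s -> I h) -> span s g -> I g.
  move=> sI [t [ht ->]]; rewrite big_seq; apply: ideal_sum => // p pt.
  by have [_ _ m] := iI; apply/m/sI/ht.
(* Finitely many generators of I would be combinations of f_0, ..., f_(N-1) for some N, and then so
   would f_N, against [no]. *)
have fg s : (forall h, h \in s -> I h) -> exists2 g, I g & ~ span s g.
  move=> sI; apply: contrapT => nog.
  have {}nog g : I g -> span s g by move=> Ig; apply: contrapT => h; apply: nog; exists g.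
  have [N hN] : exists N, forall h, h \in s -> exists c : nat -> {poly A}, h = \sum_(j < N) c j * f j.
    elim: s sI {nog} => [|h s IH] sI; first by exists 0%N.
    have [N hN] := IH (fun h' hs => sI h' (mem_behead (hs : h' \in behead (h :: s)))).
    have [t [ht he]] := sI h (mem_head _ _).
    have [M [d hd]] : exists M (d : nat -> {poly A}), h = \sum_(j < M) d j * f j.
      rewrite he; elim: (t) ht => [|p t' IH'] ht; first by exists 0%N, (fun=> 0); rewrite big_nil big_ord0.
      have [k _ fk] := ht p (mem_head _ _).
      have [M [d hd]] := IH' (fun p' p't => ht p' (mem_behead (p't : p' \in behead (p :: t')))).
      exists (maxn M k.+1), (fun j => (if (j < M)%N then d j else 0) + (if j == k then p.1 else 0)).
      rewrite big_cons hd -fk.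
      under [RHS]eq_bigr do rewrite mulrDl; rewrite big_split addrC /=; congr (_ + _).
        rewrite (big_ord_widen (maxn M k.+1) (fun j => d j * f j)) ?leq_maxl // big_mkcond.
        by apply: eq_bigr => j _; case: ifP; rewrite ?mul0r.
      rewrite (bigD1 (Ordinal (leq_maxr M k.+1))) //= eqxx big1 ?addr0 // => j jk.
      by rewrite ifN ?mul0r.
    exists (maxn N M) => h'; rewrite inE => /predU1P[->|/hN[c ->]].
      exists (fun j => if (j < M)%N then d j else 0).
      rewrite hd (big_ord_widen (maxn N M) (fun j => d j * f j)) ?leq_maxr // big_mkcond.
      by apply: eq_bigr => j _; case: ifP; rewrite ?mul0r.
    exists (fun j => if (j < N)%N then c j else 0).
    rewrite (big_ord_widen (maxn N M) (fun j => c j * f j)) ?leq_maxl // big_mkcond.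
    by apply: eq_bigr => j _; case: ifP; rewrite ?mul0r.
  apply: no; exists N; have [|t [ht ->]] := nog (f N); first by apply: ideal_gen_sub; exists N.
  have /choice[c hc] : forall h, exists c : nat -> {poly A}, h \in s -> h = \sum_(j < N) c j * f j.
    by move=> h; have [/hN[c hc]|_] := boolP (h \in s); [exists c | exists (fun=> 0)].
  exists (fun j => \sum_(p <- t) p.1 * c p.2 j).
  under [RHS]eq_bigr do rewrite mulr_suml; rewrite exchange_big /= big_seq [RHS]big_seq.
  apply: eq_bigr => p pt; rewrite [in LHS](hc p.2 (ht _ pt)) mulr_sumr.
  by apply: eq_bigr => j _; rewrite mulrA.
have /choice[nxt hnxt] : forall s, exists g, (forall h, h \in s -> I h) ->
    [/\ I g, ~ span s g & forall g', I g' -> ~ span s g' -> (size g <= size g')%N].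
  move=> s; have [sI|] := pselect (forall h, h \in s -> I h); last by exists 0.
  have ex : exists d, `[< exists g, [/\ I g, ~ span s g & size g = d] >].
    by have [g Ig ng] := fg s sI; exists (size g); apply/asboolP; exists g.
  have := ex_minnP ex; case=> d /asboolP[g [Ig ng sg]] dmin; exists g => _; split=> // g' Ig' ng'.
  by rewrite sg; apply: dmin; apply/asboolP; exists g'.
pose st := fix st n := if n is n'.+1 then nxt (st n') :: st n' else [::].
pose g n := nxt (st n).
have stI n h : h \in st n -> I h.
  elim: n h => // n IH h; rewrite inE => /predU1P[->|/IH//].
  by have [] := hnxt _ IH.
have stg n h : h \in st n <-> exists2 k, (k < n)%N & h = g k.
  elim: n h => [|n IH] h; first by split=> // -[].
  rewrite inE; split=> [/predU1P[->|/IH[k kn ->]]|[k]]; first by exists n.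
    by exists k => //; apply: ltnW.
  rewrite ltnS leq_eqVlt => /predU1P[-> ->|kn ->]; first by rewrite eqxx.
  by apply/orP; right; apply/IH; exists k.
have mono m n : (m <= n)%N -> (size (g m) <= size (g n))%N.
  move=> mn; have [_ _ hm] := hnxt _ (stI m); have [In nn _] := hnxt _ (stI n).
  apply: hm => // -[t [ht e]]; apply: nn; exists t; split=> // p /ht /stg[k km pe].
  by apply/stg; exists k => //; apply: leq_trans mn.
have [N [c e]] := nA (fun n => lead_coef (g n)).
have [IN nN minN] := hnxt _ (stI N).
have iS := ideal_genP [set h | h \in st N].
have gN0 : g N != 0 by apply/eqP => g0; apply: nN; rewrite -/(g N) g0; have [] := iS.
pose q := \sum_(j < N) c j *: 'X^(size (g N) - size (g j)) * g j.
have sq : span (st N) q.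
  apply: ideal_sum => // j _; have [_ _ m] := iS; apply: m; apply: ideal_gen_sub.
  by apply/stg; exists j.
have : ~ span (st N) (g N - q).
  by move=> h; apply: nN; rewrite -/(g N) -(subrK q (g N)); have [_ d _] := iS; apply: d.
have Iq : I (g N - q) by apply: idealB => //; apply: spanS sq; apply: stI.
move=> /(minN _ Iq); rewrite -/(g N) leqNgt => /negP; apply.
have sgN : (0 < size (g N))%N by rewrite size_poly_gt0.
rewrite -(prednK sgN) ltnS; apply/leq_sizeP => j; rewrite leq_eqVlt coefB => /predU1P[<-|jN].
  rewrite -/(lead_coef _) e /q coef_sum; apply/eqP; rewrite subr_eq0; apply/eqP; apply: eq_bigr => k _.
  rewrite -scalerAl coefZ coefXnM lead_coefE.
  have kN := mono k N (ltnW (ltn_ord k)).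
  have [->|gk0] := eqVneq (g k) 0; first by rewrite !coef0 if_same.
  have sgk : (0 < size (g k))%N by rewrite size_poly_gt0.
  have le : (size (g N) - size (g k) <= (size (g N)).-1)%N by rewrite -subn1 leq_sub2l.
  rewrite ltnNge le /=; congr (_ * _`_ _).
  by rewrite -!subn1 subnAC subKn.
have sj : (size (g N) <= j)%N by rewrite -(prednK sgN).
rewrite nth_default // sub0r /q coef_sum big1 ?oppr0 // => k _.
rewrite -scalerAl coefZ coefXnM; case: ifP => _; rewrite ?mulr0 //.
rewrite nth_default ?mulr0 //.
by rewrite leq_subRL ?(leq_trans (leq_subr _ _) sj) // subnK // mono // ltnW.
Qed.

Lemma noetherian_mpoly (F : fieldType) n : noetherian {mpoly F[n]}.
Proof.
elim: n => [|n IH].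
  apply: (@noetherian_image F _ (@mpolyC 0 F)); last exact: noetherian_field.
  - exact: mpolyCD.
  - exact: mpolyCM.
  by move=> p; exists (p@_0%MM); rewrite -nvar0_mpolyC.
pose f (p : {poly {mpoly F[n]}}) : {mpoly F[n.+1]} := (map_poly (@mwiden n F) p).['X_ord_max].
have fD x y : f (x + y) = f x + f y by rewrite /f rmorphD hornerD.
have fM x y : f (x * y) = f x * f y by rewrite /f rmorphM hornerM.
apply: (@noetherian_image {poly {mpoly F[n]}} _ f) => //; last exact: noetherian_poly.
have fC c : exists x, f x = c%:MP.
  by exists (c%:MP)%:P; rewrite /f map_polyC hornerC /= mwidenC.
have fX i : exists x, f x = 'X_i.
  case: (unliftP ord_max i) => [j ->|->]; last by exists 'X; rewrite /f map_polyX hornerX.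
  exists ('X_j)%:P; rewrite /f map_polyC hornerC /= mwidenX mnmwiden1; congr 'X_[U_(_)].
  by apply: val_inj; rewrite /= /bump leqNgt ltn_ord.
have fXm m : exists x, f x = 'X_[m].
  rewrite mpolyXE_id; apply: (big_ind (fun y => exists x, f x = y)).
  - exact: (fC 1).
  - by move=> _ _ [x <-] [y <-]; exists (x * y).
  move=> i _; elim: (m i) => [|k [x hx]]; first exact: (fC 1).
  by have [y hy] := fX i; exists (y * x); rewrite fM hx hy exprS.
move=> p; elim/mpolyind: p => [|c m p _ _ [x hx]]; first by exists 0; rewrite /f rmorph0 horner0.
have [y hy] := fXm m; have [z hz] := fC c.
by exists (z * y + x); rewrite fD fM hx hy hz mul_mpolyC.
Qed.

End HilbertBasis.

(** * Uniformizers and orders of functions *)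

Section CurveGerms.
Variable K : closedFieldType.
Variables (X : fun_space K) (nX : nice X) (iX : irrset [set: X]).
Let gX : good X := nice_good nX.

Lemma germ_domain (x : X) f g : reg_at x f -> reg_at x g -> near_pt x (fun y => f y * g y = 0) ->
  near_pt x (fun y => f y = 0) \/ near_pt x (fun y => g y = 0).
Proof.
move=> rf rg n; apply: contrapT => /not_orP[nf ng].
have h0 := near_near (nearI gX n (nearI gX (near_reg rf) (near_reg rg))).
have ex k : reg_at x k -> ~ near_pt x (fun y => k y = 0) -> exists y, near_pt y (fun y =>
   (f y * g y = 0 /\ reg_at y f /\ reg_at y g)) /\ k y != 0.
  move=> rk nk; apply: contrapT => no; apply: nk; apply: near_mono h0 _ => y ny.
  by apply/eqP; apply: contrapT => /negP ky; apply: no; exists y.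
have [y [ny fy]] := ex f rf nf; have [z [nz gz]] := ex g rg ng.
have [_ [ryf _]] := near_self ny; have [_ [_ rzg]] := near_self nz.
have [_ i] := iX.
have [w [_ /= [w1 w2] w3]] := i y z _ _ Logic.I Logic.I (nearI gX ny (near_nz gX ryf fy)) (near_nz gX rzg gz).
by move/eqP: w1.1; rewrite mulf_eq0 (negPf w2) (negPf w3).
Qed.

Lemma point_not_open : (exists x y : X, x <> y) -> forall x : X, ~ near_pt x (eq x).
Proof.
move=> [a [b ab]] x nx; have [y xy] : exists y, x <> y.
  by have [<-|xa] := pselect (a = x); [exists b | exists a => e; apply: xa].
have := near_slice2 gX gX (charts_separated gX (nice_charts nX) xy).
have [_ i] := iX => ny; have [z [_ <-]] := i x y _ _ Logic.I Logic.I nx ny.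
by apply.
Qed.

Hypothesis twoX : exists x y : X, x <> y.

(** Each h_i - h_i(x) of a chart is a multiple of t near x, so a zero of t has the coordinates of
    x. *)
Lemma uniformizer_isolated (x : X) t : uniformizer x t -> near_pt x (fun y => t y = 0 -> y = x).
Proof.
move=> [rt t0 gen]; have [V [N [h [[oV rh sep fr] Vs]]]] := nice_charts nX [:: x].
have Vx : V x by apply: Vs; rewrite inE.
have /choice[c hc] : forall i, exists c, near_pt x (fun y => h i y - h i x = c y * t y).
  move=> i; have [||c _ nc] := gen (fun y => h i y - h i x).
  - by apply: reg_atB => //; [exact: rh | exact: reg_at_cst].
  - by rewrite subrr.
  by exists c.
apply: near_app2 (near_all gX hc) (oV _ Vx) _ => // y hy Vy ty.
by apply: sep => // i; apply/eqP; rewrite -subr_eq0 hy ty mulr0.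
Qed.

Lemma uniformizer_nz (x : X) t : uniformizer x t -> ~ near_pt x (fun y => t y = 0).
Proof.
move=> ut n0; apply: (point_not_open twoX (x := x)).
apply: near_app2 n0 (uniformizer_isolated ut) _ => // y ty h.
by rewrite h.
Qed.

Lemma near_zero_unit (x : X) f u : reg_at x u -> u x != 0 -> near_pt x (fun y => f y * u y = 0) ->
  near_pt x (fun y => f y = 0).
Proof.
move=> ru ux n; apply: near_app2 n (near_nz gX ru ux) _ => // y /eqP.
by rewrite mulf_eq0 => /orP[/eqP//|/eqP->]; rewrite eqxx.
Qed.

Lemma uniformizer_cancel (x : X) t k f : uniformizer x t -> reg_at x f ->
  near_pt x (fun y => f y * t y ^+ k = 0) -> near_pt x (fun y => f y = 0).
Proof.
move=> ut rf; have [rt _ _] := ut; elim: k => [|k IH] n.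
  by apply: near_mono n _ => y; rewrite mulr1.
have [||//|] := @germ_domain x (fun y => f y * t y ^+ k) t _ rt.
- by apply: reg_atM => //; apply: reg_atX.
- by apply: near_mono n _ => y; rewrite exprSr mulrA.
by move=> /(uniformizer_nz ut).
Qed.

(* Krull: an element of all the powers of the maximal ideal is zero *)
Lemma germ_order (x : X) t f : uniformizer x t -> reg_at x f -> ~ near_pt x (fun y => f y = 0) ->
  exists k u, [/\ reg_at x u, u x != 0 & near_pt x (fun y => f y = u y * t y ^+ k)].
Proof.
move=> ut rf nf; have [rt t0 gen] := ut; apply: contrapT => no.
have /choice[g hg] : forall k, exists g, reg_at x g /\ near_pt x (fun y => f y = g y * t y ^+ k).
  elim=> [|k [g [rg ng]]]; first by exists f; split=> //; apply: nearT => // y; rewrite mulr1.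
  have gx : g x = 0.
    by apply/eqP; apply: contrapT => /negP gx; apply: no; exists k, g; split.
  have [g' rg' ng'] := gen g rg gx; exists g'; split=> //.
  by apply: near_app2 ng ng' _ => // y -> ->; rewrite exprS mulrA.
have [V [N [h [[oV rh sep fr] Vs]]]] := nice_charts nX [:: x].
have Vx : V x by apply: Vs; rewrite inE.
have /choice[pq hpq] : forall k, exists pq : {mpoly K[N]} * {mpoly K[N]},
    pq.2.@[h^~ x] != 0 /\ near_pt x (fun y => g k y = pq.1.@[h^~ y] / pq.2.@[h^~ y]).
  by move=> k; have [p [q [qx n]]] := fr _ _ Vx (hg k).1; exists (p, q).
have [n [c e]] := noetherian_mpoly (fun k => (pq k).1).
have rm (r : {mpoly K[N]}) : reg_at x (fun y => r.@[h^~ y]).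
  by apply: reg_at_meval => // i; apply: rh.
(* With f = g_k t^k and g_k = p_k / q_k, noetherianity gives p_n as a combination of the p_j = q_j
   g_j, where g_j = g_n t^(n - j) for j < n. This reads g_n u = 0 with u(x) = q_n(x) nonzero, so f =
   0 near x. *)
pose u y := (pq n).2.@[h^~ y] - \sum_(j < n) (c j).@[h^~ y] * (pq j).2.@[h^~ y] * t y ^+ (n - j).
have ru : reg_at x u.
  apply: (reg_atB gX); first exact: rm (pq n).2.
  apply: (reg_at_sum gX) => j _; apply: (reg_atM gX); last exact: reg_atX.
  by apply: (reg_atM gX); [exact: rm (c j) | exact: rm (pq j).2].
have ux : u x != 0.
  rewrite /u big1 ?subr0; first by have [] := hpq n.
  by move=> j _; rewrite t0 expr0n subn_eq0 leqNgt ltn_ord /= mulr0.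
have ngt (j : 'I_n) : near_pt x (fun y => g j y = g n y * t y ^+ (n - j)).
  have : near_pt x (fun y => g j y - g n y * t y ^+ (n - j) = 0).
    apply: (@uniformizer_cancel x t j) => //.
      by apply: reg_atB => //; [have [] := hg j | apply: reg_atM => //; [have [] := hg n | exact: reg_atX]].
    apply: near_app2 (hg j).2 (hg n).2 _ => // y e1 e2.
    by rewrite mulrBl -mulrA -exprD subnK ?(ltnW (ltn_ord j)) // -e1 -e2 subrr.
  by move=> /near_mono; apply=> y /eqP; rewrite subr_eq0 => /eqP.
have nE : near_pt x (fun y => forall j : 'I_n.+1, g j y * (pq j).2.@[h^~ y] = (pq j).1.@[h^~ y]).
  apply: near_all => // j; have [qx nq] := hpq j.
  by apply: near_app2 nq (near_nz gX (rm _) qx) _ => // y -> q0; rewrite divfK.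
have : near_pt x (fun y => g n y * u y = 0).
  apply: near_app2 (near_all gX ngt) nE _ => // y gj gE.
  rewrite /u mulrBr (gE ord_max) e raddf_sum mulr_sumr -sumrB big1 // => j _.
  rewrite /= mevalM -(gE (widen_ord (leqnSn n) j)) /= (gj j).
  by rewrite -!mulrA; apply/eqP; rewrite subr_eq0; apply/eqP; ring.
move=> /(near_zero_unit ru ux) n0; apply: nf.
by apply: near_app2 n0 (hg n).2 _ => // y -> ->; rewrite mul0r.
Qed.

End CurveGerms.

(** * Quotients of a curve *)

Section QuotientCurve.
Variable K : closedFieldType.
Hypothesis char0 : forall m, m.+1%:R != 0 :> K.
Variables (X : fun_space K) (nX : nice X) (iX : irrset [set: X]).
Hypothesis twoX : exists x y : X, x <> y.
Hypothesis unifX : forall x : X, exists t, uniformizer x t.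
Variables (gT : finGroupType) (act : gT -> X -> X) (G : {group gT}).
Hypothesis actG : faithful_action act G.
Let gX : good X := nice_good nX.
Implicit Types (x y : X) (M : {group gT}).

Lemma act_id x : act 1%g x = x. Proof. by have [_ + _ _] := actG; apply. Qed.
Lemma act_mul g h x : g \in G -> h \in G -> act (g * h)%g x = act g (act h x).
Proof. by move=> gG hG; have [_ _ aM _] := actG; apply: aM. Qed.
Lemma act_cancel g x : g \in G -> act g^-1 (act g x) = x.
Proof. by move=> gG; rewrite -act_mul ?groupV // mulVg act_id. Qed.
Lemma act_cancelV g x : g \in G -> act g (act g^-1 x) = x.
Proof. by move=> gG; rewrite -act_mul ?groupV // mulgV act_id. Qed.
Lemma act_morph g x : g \in G -> morph_at (act g) x.
Proof. by move=> gG; have [mG _ _ _] := actG; exact: (proj1 (morphismP _ gX gX) (mG g gG)). Qed.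

(* p : X -> Z is, up to isomorphism, the projection X -> X / M *)
Record quotient_map (Z : fun_space K) (p : X -> Z) (M : {group gT}) : Prop := QuotientMap {
  qm_sub : M \subset G;
  qm_good : good Z;
  qm_surj : forall z, exists x, p x = z;
  qm_eq : forall x y, p x = p y <-> exists2 g, g \in M & y = act g x;
  qm_near : forall x P, near_pt (p x) P <-> near_pt x (fun y => P (p y));
  qm_reg : forall x f, reg_at (p x) f <-> reg_at x (fun y => f (p y)) }.

(** Automorphisms count as quotients by the trivial group, so one push-forward theorem covers both
    them and the projections. *)
Lemma act_quotient_map g : g \in G -> quotient_map (act g) 1%G.
Proof.
move=> gG; split; rewrite ?sub1G //.
- by move=> z; exists (act g^-1 z); rewrite act_cancelV.
- move=> x y; split=> [e|[h]]; last by rewrite inE => /eqP -> ->; rewrite act_id.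
  by exists 1%g; rewrite ?group1 // act_id -(act_cancel y gG) -e act_cancel.
- move=> x P; split=> [|n]; first exact: (act_morph x gG).1.
  have [+ _] := act_morph (act g x) (groupVr gG); rewrite act_cancel // => /(_ _ n).
  by move=> /near_mono; apply=> y; rewrite act_cancelV.
move=> x f; split=> [|r]; first exact: (act_morph x gG).2.
have [_ +] := act_morph (act g x) (groupVr gG); rewrite act_cancel // => /(_ _ r).
by move=> /(reg_at_eq gX); apply; apply: nearT => // y; rewrite act_cancelV.
Qed.

Lemma quot_pr_eq (M : {group gT}) x y : M \subset G ->
  quot_pr act M x = quot_pr act M y <-> exists2 g, g \in M & y = act g x.
Proof.
move=> MG; have inG g : g \in M -> g \in G by exact: fintype.subsetP MG g.
split=> [/(congr1 val) /= e|[g gM ->]].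
  have : act_orbit act M x y by rewrite e; exists 1%g; rewrite ?group1 ?act_id.
  by move=> [g gM ->]; exists g.
apply: val_inj; apply/seteqP; split=> z [h hM ->].
  by exists (h * g^-1)%g; rewrite ?groupM ?groupV // act_mul ?groupV ?inG // act_cancel ?inG.
by exists (h * g)%g; rewrite ?groupM // act_mul ?inG.
Qed.

Lemma quot_good (M : {group gT}) : good (quot act M).
Proof.
split.
- exact: (good_openT gX).
- by move=> U V oU oV; apply: (good_openI gX).
- move=> U h; apply: (good_open_local gX) => x /h[V [oV Vx VU]].
  by exists (quot_pr act M @^-1` V); split=> // y /VU.
- by move=> U f /(good_reg_open gX).
- move=> U f oU h; apply: (good_reg_local gX) => // x /h[V [k [oV Vx rk fk]]].
  exists (quot_pr act M @^-1` V), (k \o quot_pr act M); split=> // y Uy Vy /=.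
  exact: fk.
- by move=> a; apply: (good_reg_cst gX).
- by move=> U f g rf rg; apply: (good_reg_add gX).
- by move=> U f g rf rg; apply: (good_reg_mul gX).
- by move=> U f rf; apply: (good_reg_nz gX).
by move=> U f rf nz; apply: (good_reg_inv gX) => // x; apply: nz.
Qed.

Lemma quot_quotient_map (M : {group gT}) : M \subset G ->
  @quotient_map (quot act M) (quot_pr act M) M.
Proof.
move=> MG; have inG g : g \in M -> g \in G by exact: fintype.subsetP MG g.
have gQ := quot_good M.
have inv g x : g \in M -> quot_pr act M (act g x) = quot_pr act M x.
  by move=> gM; apply/esym/quot_pr_eq => //; exists g.
have nearP x (P : quot act M -> Prop) : near_pt (quot_pr act M x : quot act M) P <->
    near_pt x (fun y => P (quot_pr act M y)).
  split=> [[U [oU Ux UP]]|n].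
    by exists (quot_pr act M @^-1` U); split=> // y /UP.
  exists [set z | exists y, near_pt y (fun y => P (quot_pr act M y)) /\ quot_pr act M y = z]; split.
  - suff : open [set y | exists y', near_pt y' (fun y => P (quot_pr act M y)) /\
        quot_pr act M y' = quot_pr act M y] by [].
    apply/openP => // y [y' [ny' /quot_pr_eq[] // g gM ->]].
    have [+ _] := act_morph (act g y') (groupVr (inG _ gM)); rewrite act_cancel ?inG // => /(_ _ (near_near ny')).
    move=> /near_mono; apply=> w nw; exists (act g^-1 w); split=> //.
    by rewrite inv ?groupV.
  - by exists x.
  by move=> _ [y [/near_self ny <-]].
split=> //.
- by move=> z; apply: quot_pr_surj.
- by move=> x y; apply: quot_pr_eq.
move=> x f; split=> [[U [oU Ux rf]]|rf].
  by exists (quot_pr act M @^-1` U).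
pose W : set (quot act M) := [set z | exists y, reg_at y (fun y => f (quot_pr act M y)) /\ quot_pr act M y = z].
have WP y : W (quot_pr act M y) -> reg_at y (fun y => f (quot_pr act M y)).
  move=> [y' [ry' /quot_pr_eq[] // g gM ->]].
  have [_ +] := act_morph (act g y') (groupVr (inG _ gM)); rewrite act_cancel ?inG // => /(_ _ ry').
  by move=> /(reg_at_eq gX); apply; apply: nearT => // w; rewrite inv ?groupV.
have oW : open W.
  apply/(openP gQ) => z; have [y <-] := quot_pr_surj z => /WP ry.
  by apply/nearP; apply: near_mono (near_reg ry) _ => w rw; exists w.
exists W; split=> //; first by exists x.
suff : reg (quot_pr act M @^-1` W) (f \o quot_pr act M) by [].
apply/(regP gX); split=> [|y /WP //]; exact: oW.
Qed.

Section Ramification.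
Variables (Z : fun_space K) (p : X -> Z) (M : {group gT}) (qm : quotient_map p M).
Let inG g : g \in M -> g \in G. Proof. exact: fintype.subsetP (qm_sub qm) g. Qed.

Definition stab (M : {group gT}) x : {set gT} := [set g in M | `[< act g x = x >]].

Lemma stabP g x : reflect (g \in M /\ act g x = x) (g \in stab M x).
Proof.
by rewrite inE; apply: (iffP andP) => -[gM] => [/asboolP|/asboolP]; split.
Qed.

Section Cotangent.
Variables (x : X) (t : X -> K) (ut : uniformizer x t).

(** The stabilizer acts on the cotangent line at x through the character sending g to c_g(x), where
    g^* t = c_g t. *)
Lemma stab_cotangent : exists c : gT -> X -> K,
  [/\ forall g, g \in stab M x -> reg_at x (c g) /\ near_pt x (fun y => t (act g y) = c g y * t y),
      forall g h, g \in stab M x -> h \in stab M x -> c (g * h)%g x = c g x * c h x &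
      c 1%g x = 1].
Proof.
have [rt t0 gen] := ut.
have /choice[c hc] : forall g, exists c, g \in stab M x ->
    reg_at x c /\ near_pt x (fun y => t (act g y) = c y * t y).
  move=> g; have [/stabP[gM gx]|_] := boolP (g \in stab M x); last by exists t.
  have [||c rc nc] := gen (fun y => t (act g y)); last by exists c.
    by apply: ((act_morph x (inG gM)).2 t); rewrite gx.
  by rewrite gx.
have cancel f h : reg_at x f -> reg_at x h -> near_pt x (fun y => f y * t y = h y * t y) -> f x = h x.
  move=> rf rh n; have : near_pt x (fun y => f y - h y = 0).
    apply: (uniformizer_cancel nX iX twoX (k := 1) ut); first exact: reg_atB.
    by apply: near_mono n _ => y e; rewrite expr1 mulrBl e subrr.
  by move=> /near_self /eqP; rewrite subr_eq0 => /eqP.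
have s1 : 1%g \in stab M x by apply/stabP; rewrite group1 act_id.
exists c; split=> //.
  move=> g h gs hs; have /stabP[gM gx] := gs; have /stabP[hM hx] := hs.
  have ghs : (g * h)%g \in stab M x.
    by apply/stabP; rewrite groupM // act_mul ?inG // hx gx.
  have [rg ng] := hc _ gs; have [rh nh] := hc _ hs; have [rgh ngh] := hc _ ghs.
  have rgh' : reg_at x (fun y => c g (act h y)).
    by apply: ((act_morph x (inG hM)).2 (c g)); rewrite hx.
  rewrite (cancel (c (g * h)%g) (fun y => c g (act h y) * c h y)) ?hx //.
    exact: reg_atM.
  have ng' : near_pt x (fun y => t (act g (act h y)) = c g (act h y) * t (act h y)).
    by apply: ((act_morph x (inG hM)).1 (fun y => t (act g y) = c g y * t y)); rewrite hx.
  apply: near_app2 ngh (nearI gX nh ng') _ => // y e1 [e2 e3].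
  by rewrite -e1 act_mul ?inG // e3 e2 mulrA.
have [r1 n1] := hc _ s1.
apply: (cancel (c 1%g) (fun=> 1)) => //; first exact: reg_at_cst.
by apply: near_mono n1 _ => y <-; rewrite act_id mul1r.
Qed.

(* an automorphism of finite order that is trivial on the cotangent line is trivial, in characteristic 0 *)
Lemma cotangent_faithful (c : gT -> X -> K) g :
  (forall h, h \in stab M x -> reg_at x (c h) /\ near_pt x (fun y => t (act h y) = c h y * t y)) ->
  (forall h k, h \in stab M x -> k \in stab M x -> c (h * k)%g x = c h x * c k x) ->
  c 1%g x = 1 -> g \in stab M x -> c g x = 1 -> g = 1%g.
Proof.
move=> hc cM c1 gs cg; have /stabP[gM gx] := gs.
have gis i : (g ^+ i)%g \in stab M x /\ c (g ^+ i)%g x = 1.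
  elim: i => [|i [IHs IHc]]; first by rewrite expg0; split=> //; apply/stabP; rewrite group1 act_id.
  have /stabP[_ gix] := IHs; rewrite expgSr; split; last by rewrite cM // IHc cg mulr1.
  by apply/stabP; rewrite groupM ?groupX // act_mul ?inG ?groupX // gx gix.
apply: contrapT => g1.
have [f [rf nf]] : exists f, reg_at x f /\ ~ near_pt x (fun y => f (act g y) = f y).
  apply: contrapT => no; apply: g1; have [_ _ _ faithful] := actG.
  apply: faithful; first exact: inG.
  have [V [N [h [[oV rh sep fr] Vs]]]] := nice_charts nX [:: x].
  have Vx : V x by apply: Vs; rewrite inE.
  have nid : near_pt x (fun y => act g y = y).
    have nV : near_pt x (fun y => V (act g y)).
      by apply: (act_morph x (inG gM)).1; rewrite gx; apply: oV.
    have nh i : near_pt x (fun y => h i (act g y) = h i y).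
      by apply: contrapT => nh; apply: no; exists (h i); split=> //; apply: rh.
    apply: near_app2 (near_all gX nh) (nearI gX nV (oV _ Vx)) _ => // y hy [Vgy Vy].
    exact: sep.
  move=> y; apply: contrapT => gy.
  have ny : near_pt y (fun y => act g y <> y).
    have := charts_separated gX (nice_charts nX) gy.
    exact: (pair_morph gX gX gX (act_morph y (inG gM)) (morph_at_id y)).1.
  have [_ i] := iX; have [z [_ /= e1]] := i _ _ _ _ Logic.I Logic.I nid ny.
  by apply.
have rfg i : reg_at x (fun y => f (act (g ^+ i)%g y)).
  have [/stabP[gi gix] _] := gis i.
  by apply: ((act_morph x (inG gi)).2 f); rewrite gix.
pose th y := f (act g y) - f y.
have rth : reg_at x th by apply: reg_atB => //; have := rfg 1%N; rewrite expg1.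
have nth : ~ near_pt x (fun y => th y = 0).
  by move=> n; apply: nf; apply: near_mono n _ => y /eqP; rewrite subr_eq0 => /eqP.
have [k [u [ru ux nu]]] := germ_order nX iX twoX ut rth nth.
(* Summed over the powers of g, [th] telescopes to 0. As th = u t^k, the same sum is w t^k, so w
   vanishes; but w(x) = #[g] u(x). *)
pose w y := \sum_(i < #[g]%g) u (act (g ^+ i)%g y) * c (g ^+ i)%g y ^+ k.
have rw : reg_at x w.
  apply: (reg_at_sum gX) => i _; have [gs' _] := gis i; have /stabP[gi gix] := gs'.
  apply: (reg_atM gX); last by apply: reg_atX => //; have [] := hc _ gs'.
  by apply: ((act_morph x (inG gi)).2 u); rewrite gix.
have wx : w x != 0.
  have -> : w x = #[g]%g%:R * u x.
    rewrite /w (eq_bigr (fun=> u x)) ?sumr_const ?card_ord ?mulr_natl // => i _.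
    by have [/stabP[_ ->] ->] := gis i; rewrite expr1n mulr1.
  by rewrite mulf_neq0 //; have := order_gt0 g; case: #[g]%g.
have : near_pt x (fun y => w y * t y ^+ k = 0).
  have nE : near_pt x (fun y => forall i : 'I_#[g]%g,
     th (act (g ^+ i)%g y) = u (act (g ^+ i)%g y) * c (g ^+ i)%g y ^+ k * t y ^+ k).
    apply: near_all => // i; have [gs' _] := gis i; have /stabP[gi gix] := gs'.
    have [_ nc] := hc _ gs'.
    have nu' : near_pt x (fun y => th (act (g ^+ i)%g y) = u (act (g ^+ i)%g y) * t (act (g ^+ i)%g y) ^+ k).
      by apply: ((act_morph x (inG gi)).1 (fun y => th y = u y * t y ^+ k)); rewrite gix.
    by apply: near_app2 nc nu' _ => // y e1 ->; rewrite e1 exprMn mulrA.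
  apply: near_mono nE _ => y hy; rewrite /w mulr_suml -(eq_bigr _ (fun i _ => hy i)).
  have tel n : \sum_(i < n) th (act (g ^+ i)%g y) = f (act (g ^+ n)%g y) - f y.
    elim: n => [|n IH]; first by rewrite big_ord0 expg0 act_id subrr.
    rewrite big_ord_recr /= IH /th expgS act_mul ?groupX ?inG //.
    by rewrite addrC addrA subrK.
  by rewrite tel expg_order act_id subrr.
move=> /(uniformizer_cancel nX iX twoX ut rw) /near_self w0.
by rewrite w0 eqxx in wx.
Qed.

End Cotangent.

Lemma quotient_invariant g y : g \in M -> p (act g y) = p y.
Proof. by move=> gM; apply/esym/(qm_eq qm); exists g. Qed.

(** If f = h t^k with h(x) nonzero and k > 0, invariance forces c_g(x)^k = 1 on the stabilizer.
    These values are distinct by [cotangent_faithful], so X^k - 1 has as many roots as the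
    stabilizer has elements, and k cannot be smaller. *)
Lemma invariant_divisible x t f : uniformizer x t -> reg_at x f -> f x = 0 ->
  (forall g y, g \in M -> f (act g y) = f y) ->
  exists h, reg_at x h /\ near_pt x (fun y => f y = h y * t y ^+ #|stab M x|).
Proof.
move=> ut rf fx fM; have [rt t0 gen] := ut.
have [c [hc cM c1]] := stab_cotangent ut.
suff h k : (k <= #|stab M x|)%N -> exists h, reg_at x h /\ near_pt x (fun y => f y = h y * t y ^+ k).
  exact: h.
elim: k => [|k IH] ke.
  by exists f; split=> //; apply: nearT => // y; rewrite mulr1.
have [h [rh nh]] := IH (ltnW ke).
suff hx : h x = 0.
  have [h' rh' nh'] := gen h rh hx; exists h'; split=> //.
  by apply: near_app2 nh nh' _ => // y -> ->; rewrite exprS mulrA.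
case: k ke IH nh => [|k] ke _ nh; first by move: (near_self nh); rewrite fx mulr1.
apply/eqP; apply: contrapT => /negP hx.
have root g : g \in stab M x -> c g x ^+ k.+1 = 1.
  move=> gs; have /stabP[gM gx] := gs; have [rc nc] := hc _ gs.
  have rhg : reg_at x (fun y => h (act g y)) by apply: ((act_morph x (inG gM)).2 h); rewrite gx.
  have : near_pt x (fun y => h (act g y) * c g y ^+ k.+1 - h y = 0).
    apply: (uniformizer_cancel nX iX twoX (k := k.+1) ut).
      by apply: reg_atB => //; apply: reg_atM => //; apply: reg_atX.
    have nhg : near_pt x (fun y => f (act g y) = h (act g y) * t (act g y) ^+ k.+1).
      by apply: ((act_morph x (inG gM)).1 (fun y => f y = h y * t y ^+ k.+1)); rewrite gx.
    apply: near_app2 nh (nearI gX nhg nc) _ => // y e1 [e2 e3].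
    by rewrite mulrBl -e1 -(fM g) // e2 e3 exprMn mulrA subrr.
  move=> /near_self; rewrite gx => /eqP; rewrite subr_eq0 -[X in _ == X]mulr1.
  by rewrite (inj_eq (mulfI hx)) => /eqP.
pose rs := [seq c g x | g <- enum (stab M x)].
have c_inj : {in stab M x &, injective (fun g => c g x)}.
  move=> g h' gs hs e; have /stabP[gM gx] := gs; have /stabP[hM hx'] := hs.
  have hVs : h'^-1%g \in stab M x.
    by apply/stabP; rewrite groupV -{1}hx' act_cancel ?inG.
  suff : (g * h'^-1)%g = 1%g by move=> e1; rewrite -[g](mulgKV h') e1 mul1g.
  have ghs : (g * h'^-1)%g \in stab M x.
    by apply/stabP; have /stabP[_ hVx] := hVs; rewrite groupM ?groupV // act_mul ?groupV ?inG // hVx gx.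
  by apply: (cotangent_faithful ut hc cM c1 ghs); rewrite cM // e -cM // mulgV.
have urs : uniq rs.
  by rewrite map_inj_in_uniq ?enum_uniq // => g h'; rewrite !mem_enum; apply: c_inj.
have : (size rs < size ('X^(k.+1) - 1 : {poly K})%R)%N.
  apply: max_poly_roots; rewrite ?urs //.
    by rewrite -size_poly_gt0 size_XnsubC.
  apply/allP => r /mapP[g]; rewrite mem_enum => gs ->.
  by rewrite rootE !hornerE root // subrr.
by rewrite size_XnsubC // size_map -cardE ltnNge ke.
Qed.

(** A norm over M needs a function regular on the whole orbit whose only zero there is a simple one
    at x, while t is known only near x. A chart containing the orbit supplies it. *)
Lemma local_separating_function x t : uniformizer x t -> exists u v,
  [/\ reg_at x v, v x != 0, near_pt x (fun y => u y = v y * t y) &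
   forall g, g \in M -> reg_at (act g x) u /\ (act g x <> x -> u (act g x) != 0)].
Proof.
move=> ut; have [rt t0 gen] := ut.
have [V [N [h [[oV rh sep fr] Vs]]]] := nice_charts nX (x :: [seq act g x | g <- enum M]).
have Vx : V x by apply: Vs; rewrite inE eqxx.
have Vg g : g \in M -> V (act g x).
  by move=> gM; apply: Vs; rewrite inE; apply/orP; right; apply: map_f; rewrite mem_enum.
have [P [Q [Qx nt]]] := fr _ _ Vx rt.
have /choice[j hj] : forall g, exists F : X -> K, (forall y, V y -> reg_at y F) /\
    (F x = 1 /\ (g \in M -> act g x <> x -> F (act g x) = 0)).
  move=> g; have [[gM gx]|no] := pselect (g \in M /\ act g x <> x); last first.
    exists (fun=> 1); split=> [y _|]; first exact: reg_at_cst.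
    by split=> // gM gx; case: no.
  have [i hi] : exists i, h i x != h i (act g x).
    apply: contrapT => /forallNP e; apply: gx; apply: sep => //; first exact: Vg.
    by move=> i; apply/esym/eqP; apply: contrapT => /negP /(e i).
  exists (fun y => (h i y - h i (act g x)) / (h i x - h i (act g x))); split=> [y Vy|].
    apply: reg_atM => //; last exact: reg_at_cst.
    by apply: reg_atB => //; [exact: rh | exact: reg_at_cst].
  by split=> [|_ _]; [rewrite divff // subr_eq0 | rewrite subrr mul0r].
pose w y := \prod_(g in M) j g y.
have rw y : V y -> reg_at y w.
  by move=> Vy; apply: (reg_at_prod gX) => g _; have [+ _] := hj g; apply.
have wx : w x = 1 by rewrite /w big1 // => g _; have [_ []] := hj g.
have wg g : g \in M -> act g x <> x -> w (act g x) = 0.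
  move=> gM gx; rewrite /w (bigD1 g) //=; have [_ [_ h0]] := hj g.
  by rewrite h0 // mul0r.
have [||d rd nd] := gen (fun y => 1 - w y).
- by apply: reg_atB => //; [exact: reg_at_cst | exact: rw].
- by rewrite wx subrr.
have rm (r : {mpoly K[N]}) y : V y -> reg_at y (fun y => r.@[h^~ y]).
  by move=> Vy; apply: reg_at_meval => // i; apply: rh.
(* Near x, P = Q t and 1 - w = d t, so u = (Q w + d^2 t) t; at the other points of the orbit w = 0,
   so u = 1 whatever P is. *)
pose u y := P.@[h^~ y] * w y + (1 - w y) ^+ 2.
pose v y := Q.@[h^~ y] * w y + d y ^+ 2 * t y.
exists u, v; split.
- apply: (reg_atD gX); first by apply: (reg_atM gX); [exact: rm | exact: rw].
  by apply: (reg_atM gX) => //; apply: reg_atX.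
- by rewrite /v wx t0 mulr0 mulr1 addr0.
- apply: near_app2 nt (nearI gX nd (near_nz gX (rm Q _ Vx) Qx)) _ => // y e1 [e2 q0].
  rewrite /u /v e2 e1; field.
  exact: q0.
move=> g gM; split=> [|gx].
  apply: (reg_atD gX); first by apply: (reg_atM gX); [exact/rm/Vg | exact/rw/Vg].
  by apply: (reg_atX gX); apply: (reg_atB gX); [exact: reg_at_cst | exact/rw/Vg].
by rewrite /u wg // mulr0 subr0 add0r expr1n oner_neq0.
Qed.

(** tau is the norm of the function of [local_separating_function]: the factors from the stabilizer
    give a unit times t each, the others are units. It generates the maximal ideal because an
    invariant germ vanishing at x is divisible by t^e ([invariant_divisible]). *)
Lemma quotient_uniformizer x t : uniformizer x t -> exists tau u,
  [/\ uniformizer (p x) tau, reg_at x u, u x != 0 &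
   near_pt x (fun y => tau (p y) = u y * t y ^+ #|stab M x|)].
Proof.
move=> ut; have [rt t0 gen] := ut.
have [c [hc cM c1]] := stab_cotangent ut.
have [u [v [rv vx nu hu]]] := local_separating_function ut.
pose tau0 y := \prod_(g in M) u (act g y).
have tauM g y : g \in M -> tau0 (act g y) = tau0 y.
  move=> gM; rewrite /tau0 [RHS](reindex_inj (mulIg g)) /=.
  apply: eq_big => [h|h hM]; first by rewrite groupMr.
  by rewrite act_mul ?inG.
have /choice[sec hsec] := qm_surj qm.
pose tau z := tau0 (sec z).
have tauE y : tau (p y) = tau0 y.
  have /(qm_eq qm)[g gM e] : p (sec (p y)) = p y by rewrite hsec.
  by rewrite /tau {2}e tauM.
pose w y := (\prod_(g in stab M x) (v (act g y) * c g y)) * \prod_(g in M :\: stab M x) u (act g y).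
have smul g : g \in stab M x -> g \in M by move=> /stabP[].
have rw : reg_at x w.
  apply: (reg_atM gX); apply: (reg_at_prod gX) => g; last first.
    rewrite inE => /andP[_ gM]; apply: ((act_morph x (inG gM)).2 u).
    by have [] := hu _ gM.
  move=> gs; have /stabP[gM gx] := gs; have [rc _] := hc _ gs.
  by apply: (reg_atM gX) => //; apply: ((act_morph x (inG gM)).2 v); rewrite gx.
have cnz g : g \in stab M x -> c g x != 0.
  move=> gs; have /stabP[gM gx] := gs.
  have gVs : g^-1%g \in stab M x by apply/stabP; rewrite groupV -{1}gx act_cancel ?inG.
  apply/eqP => c0; have := cM _ _ gs gVs; rewrite mulgV c1 c0 mul0r => /eqP.
  by rewrite oner_eq0.
have wx : w x != 0.
  rewrite mulf_neq0 //; apply/prodf_neq0 => g.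
    by move=> gs; have /stabP[gM gx] := gs; rewrite gx mulf_neq0 // cnz.
  rewrite inE => /andP[gs gM]; have [_ h0] := hu _ gM; apply: h0 => gx.
  by move/negP: gs; apply; apply/stabP.
have ntau : near_pt x (fun y => tau0 y = w y * t y ^+ #|stab M x|).
  have n1 : near_pt x (fun y => forall g : {g | g \in stab M x},
     u (act (val g) y) = v (act (val g) y) * c (val g) y * t y).
    apply: near_all => // -[g gs] /=; have /stabP[gM gx] := gs; have [_ nc] := hc _ gs.
    have nug : near_pt x (fun y => u (act g y) = v (act g y) * t (act g y)).
      by apply: ((act_morph x (inG gM)).1 (fun y => u y = v y * t y)); rewrite gx.
    by apply: near_app2 nug nc _ => // y -> ->; rewrite mulrA.
  apply: near_mono n1 _ => y hy; rewrite /tau0 (big_setID (stab M x)) /=.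
  have -> : M :&: stab M x = stab M x by apply/finset.setIidPr/fintype.subsetP => g /smul.
  rewrite /w mulrAC; congr (_ * _).
  rewrite -prodr_const -big_split /=; apply: eq_bigr => g gs.
  by have := hy (exist _ g gs).
exists tau, w; split=> //; last by apply: near_mono ntau _ => y <-; rewrite tauE.
have rtau0 : reg_at x tau0.
  apply: (reg_at_prod gX) => g gM; apply: ((act_morph x (inG gM)).2 u).
  by have [] := hu _ gM.
have e0 : (0 < #|stab M x|)%N.
  by apply/card_gt0P; exists 1%g; apply/stabP; rewrite group1 act_id.
split.
- apply/(qm_reg qm); apply: (reg_at_eq gX rtau0).
  by apply: nearT => // y; rewrite tauE.
- by rewrite tauE (near_self ntau) t0 expr0n eqn0Ngt e0 mulr0.
move=> f /(qm_reg qm) rf fx.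
have [h [rh nh]] := invariant_divisible ut rf fx (fun g y gM => congr1 f (quotient_invariant y gM)).
pose h1 y := h y / w y.
have rh1 : reg_at x h1 by apply: reg_at_div.
(* Near p x the only zero of tau is p x, where the quotient receives the value [h1 x]; thus H pulls
   back to [h1]. *)
pose H z := if tau z == 0 then h1 x else f z / tau z.
have nf : near_pt x (fun y => f (p y) = h1 y * tau0 y).
  apply: near_app2 nh (nearI gX ntau (near_nz gX rw wx)) _ => // y -> [-> wy].
  by rewrite /h1 mulrA divfK.
have nH : near_pt x (fun y => h1 y = H (p y)).
  apply: near_app2 nf (nearI gX ntau (nearI gX (near_nz gX rw wx) (uniformizer_isolated nX ut))) _ => //.
  move=> y e1 [e2 [wy iso]]; rewrite /H tauE; case: eqP => [tau0y|/eqP tau0y]; last by rewrite e1 mulfK.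
  suff -> : y = x by [].
  apply: iso; move/eqP: tau0y; rewrite e2 mulf_eq0 (negPf wy) /= expf_eq0.
  by move=> /andP[_ /eqP].
exists H; first by apply/(qm_reg qm); apply: (reg_at_eq gX rh1).
apply/(qm_near qm); apply: near_app2 nf nH _ => // y -> <-.
by rewrite tauE.
Qed.

End Ramification.
End QuotientCurve.

(** * Divisors on quotients *)

Section QuotientDivisors.
Variable K : closedFieldType.
Hypothesis char0 : forall m, m.+1%:R != 0 :> K.
Variables (X : fun_space K) (nX : nice X) (iX : irrset [set: X]).
Hypothesis twoX : exists x y : X, x <> y.
Hypothesis unifX : forall x : X, exists t, uniformizer x t.
Variables (gT : finGroupType) (act : gT -> X -> X) (G : {group gT}).
Hypothesis actG : faithful_action act G.
Let gX : good X := nice_good nX.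
Let actGM := act_mul actG.
Let actG1 := act_id actG.
Implicit Types (x : X) (M N : {group gT}).

(** U contains the nonvanishing locus of some f regular at x, and f is a unit times a power of t
    there, so it has no other zero near x. *)
Lemma near_punctured (U : set X) y0 x : open U -> U y0 -> near_pt x (fun y => y <> x -> U y).
Proof.
move=> oU Uy0; have [t ut] := unifX x.
have [V [f [oV [Vx Vy0] rf fy fU]]] := nice_basis nX x (near_open oU Uy0).
have nf : ~ near_pt x (fun y => f y = 0).
  move=> n; have [_ i] := iX.
  have [z [_ /= fz nz]] := i _ _ _ _ Logic.I Logic.I n (near_nz gX (rf _ Vy0) fy).
  by rewrite fz eqxx in nz.
have [k [u [ru ux nE]]] := germ_order nX iX twoX ut (rf _ Vx) nf.
apply: near_app2 nE (nearI gX (near_open oV Vx) (nearI gX (near_nz gX ru ux) (uniformizer_isolated nX ut))) _ => //.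
move=> y fE [Vy [uy iso]] yx; apply: fU => //.
by rewrite fE mulf_neq0 // expf_neq0 //; apply/eqP => /iso.
Qed.

Lemma uniformizer_unit (Z : fun_space K) (z : Z) t t' : good Z -> ~ near_pt z (fun y => t y = 0) ->
  (forall f g, reg_at z f -> reg_at z g -> near_pt z (fun y => f y * g y = 0) ->
     near_pt z (fun y => f y = 0) \/ near_pt z (fun y => g y = 0)) ->
  uniformizer z t -> uniformizer z t' ->
  exists c, [/\ reg_at z c, c z != 0 & near_pt z (fun y => t y = c y * t' y)].
Proof.
move=> gZ nt dom [rt t0 gen] [rt' t0' gen'].
have [c rc nc] := gen' t rt t0; have [c' rc' nc'] := gen t' rt' t0'.
exists c; split=> //; apply/eqP => cz.
have : near_pt z (fun y => (1 - c y * c' y) * t y = 0).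
  apply: near_app2 nc nc' _ => // y e1 e2.
  by rewrite mulrBl mul1r -mulrA -e2 -e1 subrr.
have r1 : reg_at z (fun y => 1 - c y * c' y).
  by apply: (reg_atB gZ); [exact: reg_at_cst | exact: reg_atM].
move=> /(dom _ _ r1 rt)[|//] /near_self /eqP.
by rewrite cz mul0r subr0 oner_eq0.
Qed.

Section OneMap.
Variables (Z : fun_space K) (p : X -> Z) (M : {group gT}) (qm : quotient_map act G p M).
Let gZ : good Z := qm_good qm.

Lemma quotient_morph x : morph_at p x.
Proof. by split=> [P /(qm_near qm)|f /(qm_reg qm)]. Qed.

Lemma quotient_germ_domain (z : Z) f g : reg_at z f -> reg_at z g ->
  near_pt z (fun y => f y * g y = 0) -> near_pt z (fun y => f y = 0) \/ near_pt z (fun y => g y = 0).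
Proof.
have [x <-] := qm_surj qm z => /(qm_reg qm) rf /(qm_reg qm) rg /(qm_near qm) n.
by have [n'|n'] := germ_domain nX iX rf rg n; [left|right]; apply/(qm_near qm).
Qed.

Lemma has_order_near (U : set Z) f z n : has_order U f z n <-> exists t u,
  [/\ uniformizer z t, reg_at z u, u z != 0 &
   near_pt z (fun y => U y -> y <> z -> f y = u y * t y ^ n)].
Proof.
split=> [[t [u [V [ut [oV Vz] ru nz uE]]]]|[t [u [ut ru uz nE]]]].
  exists t, u; split=> //; [exact: (reg_reg_at gZ ru Vz) | exact: nz|].
  by exists V; split=> // y Vy Uy /eqP; apply: uE.
pose W := [set y | near_pt y (fun y => reg_at y u /\ (u y != 0 /\ (U y -> y <> z -> f y = u y * t y ^ n)))].
have oW : open W by apply: open_near.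
have Wz : W z by apply: (nearI gZ (near_reg ru) (nearI gZ (near_nz gZ ru uz) nE)).
exists t, u, W; split=> //.
- by apply/(regP gZ); split=> // y /near_self[].
- by move=> y /near_self[_ []].
by move=> y Uy /near_self[_ [_ h]] /eqP yz; apply: h.
Qed.

(** tau pulls back to a unit times t^e, with e the order of the stabilizer, so an order n becomes e
    n. Nonemptiness of U puts the image of a punctured neighbourhood of x inside U. *)
Lemma pull_order (U : set Z) f x n t : open U -> U !=set0 -> has_order U f (p x) n ->
  uniformizer x t -> exists u, [/\ reg_at x u, u x != 0 &
  near_pt x (fun y => y <> x -> f (p y) = u y * t y ^ (#|stab act M x|%:Z * n))].
Proof.
move=> oU [z0 Uz0] /has_order_near[s [v [us rv vz nv]]] ut.
have [tau [w [utau rw wx nw]]] := quotient_uniformizer char0 nX iX twoX actG qm ut.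
have nw0 : near_pt x (fun y => y <> x -> tau (p y) != 0).
  apply: near_app2 nw (nearI gX (near_nz gX rw wx) (uniformizer_isolated nX ut)) _ => //.
  move=> y -> [wy iso] yx; rewrite mulf_neq0 // expf_neq0 //.
  by apply/eqP => /iso.
have nznear : ~ near_pt x (fun y => y = x).
  by move=> n1; apply: (point_not_open nX iX twoX (x := x)); apply: near_mono n1 _.
have ns : ~ near_pt (p x) (fun z => s z = 0).
  have [_ _ gens] := us; have [rtau tau0 _] := utau; have [k rk nk] := gens tau rtau tau0.
  move=> n1; apply: nznear.
  have n2 := (quotient_morph x).1 _ nk; have n3 := (quotient_morph x).1 _ n1.
  apply: near_app2 n2 (nearI gX n3 nw0) _ => // y e1 [e2 e3].
  by apply: contrapT => /e3; rewrite e1 e2 mulr0 eqxx.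
have [c [rc cz nc]] := uniformizer_unit gZ ns (quotient_germ_domain (z := p x)) us utau.
exists (fun y => v (p y) * (c (p y) * w y) ^ n).
have rpc : reg_at x (fun y => c (p y)) by apply/(qm_reg qm).
have rpv : reg_at x (fun y => v (p y)) by apply/(qm_reg qm).
split.
- by apply: (reg_atM gX) => //; apply: (reg_at_exprz gX); [exact: reg_atM | rewrite mulf_neq0].
- by rewrite mulf_neq0 // expfz_neq0 // mulf_neq0.
have [x0 px0] := qm_surj qm z0.
have nU : near_pt x (fun y => y <> x -> U (p y)).
  apply: (@near_punctured (p @^-1` U) x0); last by rewrite /= px0.
  by apply/(openP gX) => y Uy; apply: (quotient_morph y).1; apply: near_open.
have n1 := (quotient_morph x).1 _ nv; have n2 := (quotient_morph x).1 _ nc.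
apply: near_app2 (nearI gX n1 n2) (nearI gX nU (nearI gX nw0 nw)) _ => //.
move=> y [e1 e2] [e3 [e4 e5]] yx; rewrite e1 ?e2 //; last first.
- by move=> pyx; have [_ tau0 _] := utau; have := e4 yx; rewrite pyx tau0 eqxx.
- exact: e3.
by rewrite e5 -[t y ^+ _]/(t y ^ #|stab act M x|%:Z) !expfzMl -!mulrA exprz_exp.
Qed.

Lemma descend_order (U : set Z) F x m t : uniformizer x t ->
  (exists u, [/\ reg_at x u, u x != 0 &
    near_pt x (fun y => y <> x -> F (p y) = u y * t y ^ (#|stab act M x|%:Z * m))]) ->
  has_order U F (p x) m.
Proof.
move=> ut [u [ru ux nu]].
have [tau [w [utau rw wx nw]]] := quotient_uniformizer char0 nX iX twoX actG qm ut.
have nw0 : near_pt x (fun y => y <> x -> tau (p y) != 0).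
  apply: near_app2 nw (nearI gX (near_nz gX rw wx) (uniformizer_isolated nX ut)) _ => //.
  move=> y -> [wy iso] yx; rewrite mulf_neq0 // expf_neq0 //.
  by apply/eqP => /iso.
pose v y := u y * w y ^ (- m).
have rv : reg_at x v by apply: (reg_atM gX) => //; apply: reg_at_exprz.
(* F may be arbitrary at p x itself; the unit takes there the value of [v], which is regular at
   x. *)
pose v' z := if z == p x then v x else F z * tau z ^ (- m).
have [_ tau0 _] := utau.
have nv : near_pt x (fun y => v y = v' (p y)).
  apply: near_app2 nu (nearI gX nw0 (nearI gX nw (near_nz gX rw wx))) _ => //.
  move=> y e1 [e2 [e3 wy]]; rewrite /v'; have [->|/eqP yx] := eqVneq y x; first by rewrite eqxx.
  have tauy := e2 yx.
  case: eqP => [pyx|_]; first by rewrite pyx tau0 eqxx in tauy.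
  have ty : t y != 0.
    apply/eqP => ty; move: tauy; rewrite e3 ty expr0n eqn0Ngt.
    by have -> : (0 < #|stab act M x|)%N;
      [apply/card_gt0P; exists 1%g; apply/stabP; rewrite group1 actG1 | rewrite mulr0 eqxx].
  rewrite e1 // e3 expfzMl -[t y ^+ _]/(t y ^ #|stab act M x|%:Z) exprz_exp mulrN.
  rewrite /v -mulrA; congr (_ * _).
  by rewrite mulrCA -expfzDr // addrN expr0z mulr1.
apply/has_order_near; exists tau, v'; split=> //.
- by apply/(qm_reg qm); apply: (reg_at_eq gX rv).
- by rewrite /v' eqxx mulf_neq0 // expfz_neq0.
apply/(qm_near qm); apply: near_mono nw0 _ => y tauy Uy pyx; rewrite /v' ifN; last exact/eqP.
have ty : tau (p y) != 0 by apply: tauy => yx; rewrite yx in pyx.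
by rewrite -mulrA -expfzDr // addNr expr0z mulr1.
Qed.

Lemma principal_criterion (U : set Z) F (E : {freeg Z / int}) : open U -> reg U F ->
  (exists2 z, U z & F z != 0) ->
  (forall x t, uniformizer x t -> exists u, [/\ reg_at x u, u x != 0 &
    near_pt x (fun y => y <> x -> F (p y) = u y * t y ^ (#|stab act M x|%:Z * coeff (p x) E))]) ->
  principal_divisor E.
Proof.
move=> oU rF nz h; exists U, F; split=> // z; have [x <-] := qm_surj qm z.
have [t ut] := unifX x; apply: (descend_order _ ut); exact: h.
Qed.

End OneMap.

Lemma coeff_push (Z Y : fun_space K) (r : Z -> Y) (D : {freeg Z / int}) y :
  coeff y (push_divisor r D) = \sum_(z <- dom D | r z == y) coeff z D.
Proof.
rewrite /push_divisor raddf_sum [RHS]big_mkcond; apply: eq_bigr => z _ /=.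
by rewrite coeffU; case: eqP; rewrite ?mulr1 ?mulr0.
Qed.

Lemma push_divisor_uniq (Z Y : fun_space K) (r : Z -> Y) (D : {freeg Z / int}) (s : seq Z) y :
  uniq s -> {subset dom D <= s} ->
  coeff y (push_divisor r D) = \sum_(z <- s | r z == y) coeff z D.
Proof.
move=> us ds; rewrite coeff_push -big_filter -[RHS]big_filter.
apply: eq_big_support; rewrite ?filter_uniq ?uniq_dom // => z nz.
by rewrite !mem_filter; case: eqP => //= _; rewrite mem_dom nz ds // mem_dom.
Qed.

Lemma push_divisorD (Z Y : fun_space K) (r : Z -> Y) (D E : {freeg Z / int}) :
  push_divisor r (D + E) = push_divisor r D + push_divisor r E.
Proof.
apply/eqP/freeg_eqP => y; rewrite coeffD.
pose s := undup (dom D ++ dom E ++ dom (D + E)).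
have us : uniq s by apply: undup_uniq.
rewrite !(@push_divisor_uniq _ _ _ _ s) //; try by move=> z zD; rewrite mem_undup !mem_cat zD ?orbT.
by rewrite -big_split; apply: eq_bigr => z _; rewrite coeffD.
Qed.

Lemma push_divisor0 (Z Y : fun_space K) (r : Z -> Y) : push_divisor r 0 = 0.
Proof. by rewrite /push_divisor dom0 big_nil. Qed.

Lemma push_divisorN (Z Y : fun_space K) (r : Z -> Y) (D : {freeg Z / int}) :
  push_divisor r (- D) = - push_divisor r D.
Proof. by apply/eqP; rewrite -addr_eq0 -push_divisorD addNr push_divisor0. Qed.

Lemma push_divisorU (Z Y : fun_space K) (r : Z -> Y) k z :
  push_divisor r << k *g z >> = << k *g r z >>.
Proof.
have [->|k0] := eqVneq k 0; first by rewrite !freegU0 push_divisor0.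
by rewrite /push_divisor domU // big_seq1 coeffU eqxx mulr1.
Qed.

Lemma deg_push (Z Y : fun_space K) (r : Z -> Y) (D : {freeg Z / int}) :
  deg (push_divisor r D) = deg D.
Proof.
rewrite /push_divisor raddf_sum -[in RHS](freeg_sumE D) raddf_sum /=.
by apply: eq_bigr => z _; rewrite !degU.
Qed.

Lemma push_divisor_sum (Z Y : fun_space K) (r : Z -> Y) (I : Type) (s : seq I) (P : pred I) (D : I -> {freeg Z / int}) :
  push_divisor r (\sum_(i <- s | P i) D i) = \sum_(i <- s | P i) push_divisor r (D i).
Proof. exact: (big_morph _ (@push_divisorD Z Y r) (push_divisor0 r)). Qed.

Lemma push_divisor_comp (Z Y W : fun_space K) (r : Z -> Y) (s : Y -> W) (D : {freeg Z / int}) :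
  push_divisor s (push_divisor r D) = push_divisor (s \o r) D.
Proof.
rewrite [in LHS]/push_divisor -/(push_divisor s _) push_divisor_sum.
by apply: eq_bigr => z _; rewrite push_divisorU.
Qed.

Lemma eq_push_divisor (Z Y : fun_space K) (r r' : Z -> Y) (D : {freeg Z / int}) :
  r =1 r' -> push_divisor r D = push_divisor r' D.
Proof. by move=> e; apply: eq_bigr => z _; rewrite e. Qed.

End QuotientDivisors.

(** * Pull-back and push-forward of principal divisors *)

Section PushPull.
Variable K : closedFieldType.
Hypothesis char0 : forall m, m.+1%:R != 0 :> K.
Variables (X : fun_space K) (nX : nice X) (iX : irrset [set: X]).
Hypothesis twoX : exists x y : X, x <> y.
Hypothesis unifX : forall x : X, exists t, uniformizer x t.
Variables (gT : finGroupType) (act : gT -> X -> X) (G : {group gT}).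
Hypothesis actG : faithful_action act G.
Let gX : good X := nice_good nX.
Let actGM := act_mul actG.
Let actG1 := act_id actG.
Let actGK := act_cancel actG.
Let actGVK := act_cancelV actG.
Let actGm := act_morph nX actG.
Implicit Types (x : X) (M N : {group gT}).

Lemma quotient_map_conj (Z : fun_space K) (p : X -> Z) M g : quotient_map act G p M -> g \in G ->
  quotient_map act G (fun x => p (act g x)) (M :^ g)%G.
Proof.
move=> qm gG; have MG := qm_sub qm.
have inG h : h \in M -> h \in G by exact: fintype.subsetP MG h.
split.
- by rewrite -(conjGid gG) conjSg.
- exact: qm_good qm.
- by move=> z; have [x xz] := qm_surj qm z; exists (act g^-1 x); rewrite actGVK.
- move=> x y; split=> [/(qm_eq qm)[h hM e]|[h]].
    exists (h ^ g)%g; first by rewrite memJ_conjg.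
    have hG := inG _ hM.
    by rewrite conjgE actGM ?groupM ?groupV // actGM // -e actGK.
  rewrite mem_conjg => hM ->; apply/(qm_eq qm); exists (h ^ g^-1)%g => //.
  have hG : h \in G by have := inG _ hM; rewrite groupJr ?groupV.
  by rewrite conjgE invgK !actGM ?groupM ?groupV // actGK.
- move=> x P; split=> [/(qm_near qm)|n].
    by move=> /(actGm x gG).1.
  apply/(qm_near qm); have [+ _] := actGm (act g x) (groupVr gG); rewrite actGK // => /(_ _ n).
  by move=> /near_mono; apply=> y; rewrite actGVK.
move=> x f; split=> [/(qm_reg qm)|r].
  by move=> /(actGm x gG).2.
apply/(qm_reg qm); have [_ +] := actGm (act g x) (groupVr gG); rewrite actGK // => /(_ _ r).
by move=> /(reg_at_eq gX); apply; apply: nearT => // y; rewrite actGVK.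
Qed.

Lemma stab_group_set M x : M \subset G -> group_set (stab act M x).
Proof.
move=> MG; have inG h : h \in M -> h \in G by exact: fintype.subsetP MG h.
apply/group_setP; split; first by apply/stabP; rewrite group1 actG1.
move=> g h /stabP[gM gx] /stabP[hM hx]; apply/stabP.
by rewrite groupM // actGM ?inG // hx gx.
Qed.

Section Pull.
Variables (Z : fun_space K) (p : X -> Z) (M : {group gT}) (qm : quotient_map act G p M).
Let inG h : h \in M -> h \in G. Proof. exact: fintype.subsetP (qm_sub qm) h. Qed.

Lemma card_transporter x x' : p x = p x' -> #|[set g in M | act g x == x']| = #|stab act M x'|.
Proof.
move=> /(qm_eq qm)[g0 g0M ->].
rewrite -(card_rcoset _ g0); congr #|pred_of_set _|; apply/setP => g.
rewrite mem_rcoset; apply/idP/idP => [|/stabP[h1 h2]].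
  rewrite inE => /andP[gM /eqP gx]; apply/stabP.
  by rewrite groupM ?groupV // actGM ?groupV ?inG // actGK ?inG // gx.
have gM : g \in M by rewrite -[g](mulgKV g0) groupM.
rewrite inE gM; apply/eqP; rewrite -[g in LHS](mulgKV g0) actGM ?inG ?groupM ?groupV //.
Qed.

(** Pull-back after push-forward is the trace. The order of f p at x is #stab(x) times the
    coefficient of p_* D at p x, and each x' in the orbit of x is carried to x by #stab(x) elements
    of M. *)
Lemma principal_pull (D : {freeg X / int}) : principal_divisor (push_divisor p D) ->
  principal_divisor (\sum_(g in M) push_divisor (act g) D).
Proof.
move=> [U [f [oU rf [z0 Uz0 fz0] ord]]].
have [x0 px0] := qm_surj qm z0.
have qm1 := act_quotient_map nX actG (group1 G).
have gZ := qm_good qm.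
have pm := quotient_morph qm.
have oU' : open (p @^-1` U).
  by apply/(openP gX) => y Uy; apply: (pm y).1; apply: near_open.
apply: (principal_criterion char0 nX iX twoX unifX actG qm1 oU' (F := fun x => f (p x))).
- by apply/(regP gX); split=> // y Uy; apply: (pm y).2; apply: reg_reg_at rf Uy.
- by exists x0; rewrite /= px0.
move=> x t ut.
have := pull_order char0 nX iX twoX unifX actG qm oU (ex_intro _ z0 Uz0) (ord (p x)) ut.
move=> [u [ru ux nu]]; exists u; split=> //.
apply: near_mono nu _ => y h /h; rewrite actG1 => ->; congr (_ * _ ^ _).
have -> : stab act 1%G x = 1%g.
  apply/setP => g; apply/stabP/idP => [[]//|]; rewrite inE => /eqP ->.
  by split; [exact: eqxx | exact: actG1].
rewrite cards1 mul1r actG1 coeff_push raddf_sum /= mulr_sumr.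
under [RHS]eq_bigr do rewrite coeff_push big_mkcond.
rewrite exchange_big [LHS]big_mkcond; apply: eq_bigr => x' _ /=.
rewrite -big_mkcondr /=; case: eqP => [pxx'|pxx'].
  rewrite sumr_const -mulr_natl -(card_transporter pxx'); congr (_ * _).
  rewrite natz; congr (Posz _); apply: eq_card => g.
  by rewrite !inE.
rewrite big1 // => g /andP[gM /eqP gx]; case: pxx'.
by apply/(qm_eq qm); exists g.
Qed.

End Pull.

Section Push.
Variables (Z Y : fun_space K) (p : X -> Z) (q : X -> Y) (r : Z -> Y) (M N : {group gT}).
Hypotheses (qmp : quotient_map act G p M) (qmq : quotient_map act G q N) (MN : M \subset N).
Hypothesis rp : forall x, r (p x) = q x.
Let inG h : h \in N -> h \in G. Proof. exact: fintype.subsetP (qm_sub qmq) h. Qed.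
Let inN h : h \in M -> h \in N. Proof. exact: fintype.subsetP MN h. Qed.

(** Multiplicativity of ramification indices. The g in N with p(g x) = z form the set g0 M^g0 S,
    with S the stabilizer of x in N, and all have #stab of M^g equal to #(M^g0 :&: S). As #(M^g0 S)
    #(M^g0 :&: S) = #M #S, summing over these g and grouping them by cosets of M gives the
    formula. *)
Lemma sum_stab_fiber x z : r z = q x ->
  (\sum_(C in rcosets M N | p (act (repr C) x) == z) #|stab act (M :^ repr C)%G x|)%N = #|stab act N x|.
Proof.
move=> rz; have [x1 px1] := qm_surj qmp z.
have [g0 g0N x1E] : exists2 g, g \in N & x1 = act g x.
  by apply/(qm_eq qmq); rewrite -rz -px1 rp.
have zE : z = p (act g0 x) by rewrite -px1 x1E.
have gS := stab_group_set x (qm_sub qmq); pose S := Group gS.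
have stI g : g \in N -> stab act (M :^ g)%G x = ((M :^ g)%G :&: S)%g.
  move=> gN; apply/setP => h; rewrite finset.in_setI; apply/stabP/andP => [[h1 h2]|[h1 /stabP[h2 h3]]] //.
  split=> //; apply/stabP; split=> //; apply: (fintype.subsetP _ _ h1).
  by rewrite -(conjGid gN) conjSg.
have memC g : g \in N -> p (act g x) = z <-> (g \in g0 *: ((M :^ g0)%G * S))%g.
  move=> gN; rewrite zE mem_lcoset; split=> [/esym/(qm_eq qmp)[m mM e]|/mulsgP[m' s]].
    apply/mulsgP; exists (m ^ g0)%g ((m * g0)^-1 * g)%g.
    - by rewrite memJ_conjg.
    - have mN := inN mM; have mG := inG mN; have g0G := inG g0N; have gG := inG gN.
      apply/stabP; rewrite groupM ?groupV ?groupM //; split=> //.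
      by rewrite actGM ?groupV ?groupM // e -[act m _]actGM // actGK // groupM.
    by rewrite conjgE -mulgA mulKVg.
  rewrite mem_conjg => mM /stabP[sN sx] e.
  have gE : g = ((m' ^ g0^-1) * (g0 * s))%g.
    by rewrite conjgE invgK -[LHS](mulKVg g0) e -!mulgA mulKg.
  have m'N := inN mM.
  rewrite gE actGM; [|exact: inG|by apply: inG; rewrite groupM].
  rewrite actGM; [|exact: inG|exact: inG]; rewrite sx.
  by apply/esym/(qm_eq qmp); exists (m' ^ g0^-1)%g.
have cardC g : g \in N -> p (act g x) = z -> #|stab act (M :^ g)%G x| = #|((M :^ g0)%G :&: S)%g|.
  move=> gN /memC -/(_ gN); rewrite mem_lcoset => /mulsgP[m' s].
  rewrite mem_conjg => mM sS e; rewrite stI //.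
  have gE : g = ((m' ^ g0^-1) * (g0 * s))%g.
    by rewrite conjgE invgK -[LHS](mulKVg g0) e -!mulgA mulKg.
  rewrite /= gE conjsgM (conjGid mM) conjsgM -[X in (_ :&: X)%g](conjGid sS) -conjIg cardJg //.
have cosetE C g : C \in rcosets M N -> g \in C ->
    [/\ g \in N, p (act g x) = p (act (repr C) x) & (M :^ g = M :^ repr C)%g].
  move=> /rcosetsP[h hN ->] gC; have rC := mem_repr_rcoset M h.
  have CN k : k \in (M :* h)%g -> k \in N.
    by move=> /rcosetP[m mM ->]; rewrite groupM // inN.
  have [m mM gE] : exists2 m, m \in M & g = (m * repr (M :* h))%g.
    by apply/rcosetP; rewrite (rcoset_eqP rC).
  have rN := CN _ rC; split; first exact: CN.
    rewrite gE actGM; [|exact/inG/inN|exact: inG].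
    by apply/esym/(qm_eq qmp); exists m.
  by rewrite gE conjsgM (conjGid mM).
apply/eqP; rewrite -(@eqn_pmul2l #|M|) ?cardG_gt0 // -(cardJg M g0); apply/eqP.
rewrite [RHS](mul_cardG (M :^ g0)%G S) big_distrr /=.
rewrite -(card_lcoset ((M :^ g0)%G * S)%g g0) -sum_nat_const.
transitivity (\sum_(g in N | p (act g x) == z) #|stab act (M :^ g)%G x|)%N; last first.
  apply: eq_big => [g|g /andP[gN /eqP gz]]; last exact: cardC.
  apply/andP/idP => [[gN /eqP /(memC _ gN)]//|h].
  have gN : g \in N.
    move: h; rewrite mem_lcoset => /mulsgP[m' s]; rewrite mem_conjg => mM /stabP[sN _] e.
    rewrite -[g](mulKVg g0) e !groupM //.
    by have := inN mM; rewrite groupJr ?groupV.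
  by split=> //; apply/eqP/(memC _ gN).
rewrite (set_partition_big_cond _ (rcosets_partition MN)) /=.
rewrite big_mkcondr; apply: eq_bigr => C CM.
case: eqP => [pC|pC].
  have -> : #|(M :^ g0)%g| = #|C|.
    by have /rcosetsP[h _ ->] := CM; rewrite card_rcoset cardJg.
  rewrite -sum_nat_const; apply: eq_big => [g|g gC].
    by case gC : (g \in C) => //=; have [_ -> _] := cosetE C g CM gC; rewrite pC eqxx.
  have [_ _ e] := cosetE C g CM gC.
  by congr #|pred_of_set _|; apply/setP => k; apply/stabP/stabP; rewrite /= e.
by rewrite big1 // => g /andP[gC /eqP]; have [_ -> _] := cosetE C g CM gC.
Qed.

(** The norm of f is read on X as the product of the f(p(g x)) over the cosets M g in N. It is
    N-invariant, so it descends to Y, and [sum_stab_fiber] compares orders. *)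
Lemma principal_push (D : {freeg Z / int}) : principal_divisor D ->
  principal_divisor (push_divisor r D).
Proof.
move=> [U [f [oU rf [z0 Uz0 fz0] ord]]].
have [x0 px0] := qm_surj qmp z0.
have gY := qm_good qmq; have gZ := qm_good qmp.
have pm := quotient_morph qmp.
pose F0 x := \prod_(C in rcosets M N) f (p (act (repr C) x)).
have repN C : C \in rcosets M N -> repr C \in N.
  move=> /rcosetsP[h hN ->]; have /rcosetP[m mM ->] := mem_repr_rcoset M h.
  by rewrite groupM // inN.
have F0inv n x : n \in N -> F0 (act n x) = F0 x.
  move=> nN; rewrite /F0 [RHS](reindex_inj (can_inj (rcosetK n))) /=.
  have rcM C m : m \in N -> C \in rcosets M N -> (C :* m)%g \in rcosets M N.
    move=> mN /rcosetsP[h hN ->]; rewrite -rcosetM; apply/rcosetsP.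
    by exists (h * m)%g; rewrite ?groupM.
  apply: eq_big => [C|C CM].
    by apply/idP/idP => [/(rcM _ n nN)//|/(rcM _ n^-1%g (groupVr nN))]; rewrite rcosetK.
  have /rcosetsP[h hN CE] := CM; congr f; apply/(qm_eq qmp).
  have /rcosetP[m mM e] : (repr C * n)%g \in (M :* repr (C :* n))%g.
    have rn : repr (C :* n)%g \in (M :* (h * n))%g by rewrite CE -rcosetM mem_repr_rcoset.
    rewrite (rcoset_eqP rn) rcosetM mem_rcoset mulgK CE; exact: mem_repr_rcoset.
  exists m^-1%g; first by rewrite groupV.
  have rN : repr (C :* n)%g \in N by apply: repN; apply: rcM.
  have mG := inG (inN mM); have rG := inG (repN _ CM); have nG := inG nN.
  rewrite -(actGM x rG nG).
  by rewrite e actGM // ?actGK //; apply: inG.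
have /choice[sec hsec] := qm_surj qmq.
pose F y := F0 (sec y).
have FE x : F (q x) = F0 x.
  have /(qm_eq qmq)[g gN e] : q (sec (q x)) = q x by rewrite hsec.
  by rewrite /F {2}e F0inv.
pose UY : set Y := [set y | forall x, q x = y -> forall g, g \in N -> U (p (act g x))].
have UYE x : UY (q x) <-> forall g, g \in N -> U (p (act g x)).
  split=> [h g gN|h y /esym/(qm_eq qmq)[n nN ->] g gN]; first exact: h.
  by rewrite -actGM ?inG //; apply: h; rewrite groupM.
have oUY : open UY.
  apply/(openP gY) => y; have [x <-] := qm_surj qmq y => /UYE h; apply/(qm_near qmq).
  have n1 : near_pt x (fun x' => forall g : {g | g \in N}, U (p (act (val g) x'))).
    apply: near_all => // -[g gN] /=.
    have := (pm (act g x)).1 _ (near_open oU (h g gN)).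
    exact: (actGm x (inG gN)).1.
  apply: near_mono n1 _ => x' h'; apply/UYE => g gN; exact: (h' (exist _ g gN)).
have [|||] := @principal_criterion K char0 X nX iX twoX unifX gT act G actG Y q N qmq UY F (push_divisor r D) oUY.
- apply/(regP gY); split=> // y; have [x <-] := qm_surj qmq y => /UYE h; apply/(qm_reg qmq).
  have : reg_at x F0.
    apply: (reg_at_prod gX) => C CN; have gN := repN _ CN.
    have := (pm (act (repr C) x)).2 _ (reg_reg_at gZ rf (h _ gN)).
    exact: (actGm x (inG gN)).2.
  by move=> /(reg_at_eq gX); apply; apply: nearT => // x'; rewrite FE.
(* The translates of the nonempty open set where f is defined and nonzero have a common point, X
   being irreducible; the norm is nonzero there. *)
- have [|x hx] := @irr_meet K X {g | g \in N} (fun g x => U (p (act (val g) x)) /\ f (p (act (val g) x)) != 0) gX iX.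
    move=> [g gN] /=; exists (act g^-1 x0).
    have n0 : near_pt x0 (fun x => U (p x) /\ f (p x) != 0).
      rewrite -px0 in Uz0 fz0.
      apply: nearI => //; first by apply: (pm x0).1; apply: near_open.
      by apply: near_nz => //; apply: (pm x0).2; apply: reg_reg_at rf Uz0.
    have [+ _] := actGm (act g^-1 x0) (inG gN); rewrite actGVK ?inG // => /(_ _ n0).
    by [].
  exists (q x); first by apply/UYE => g gN; have [] := near_self (hx (exist _ g gN)).
  rewrite FE /F0; apply/prodf_neq0 => C CN.
  by have [] := near_self (hx (exist (fun g => g \in N) _ (repN _ CN))).
- move=> x t ut.
  have /choice[u hu] : forall C, exists u, C \in rcosets M N -> [/\ reg_at x u, u x != 0 &
     near_pt x (fun y => y <> x -> f (p (act (repr C) y)) =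
       u y * t y ^ (#|stab act (M :^ repr C)%G x|%:Z * coeff (p (act (repr C) x)) D))].
    move=> C; have [CN|_] := boolP (C \in rcosets M N); last by exists t.
    have gG := inG (repN _ CN).
    have [u hu] := pull_order char0 nX iX twoX unifX actG (quotient_map_conj qmp gG) oU
      (ex_intro _ z0 Uz0) (ord (p (act (repr C) x))) ut.
    by exists u.
  exists (fun y => \prod_(C in rcosets M N) u C y); split.
  + by apply: (reg_at_prod gX) => C CN; have [] := hu C CN.
  + by apply/prodf_neq0 => C CN; have [] := hu C CN.
  have n1 : near_pt x (fun y => forall C : {C | C \in rcosets M N}, y <> x ->
     f (p (act (repr (val C)) y)) = u (val C) y * t y ^ (#|stab act (M :^ repr (val C))%G x|%:Z * coeff (p (act (repr (val C)) x)) D)).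
    by apply: near_all => // -[C CN] /=; have [] := hu C CN.
  apply: near_app2 n1 (uniformizer_isolated nX ut) _ => // y hy iso yx.
  have ty : t y != 0 by apply/eqP => /iso.
  rewrite FE /F0.
  have -> : #|stab act N x|%:Z * coeff (q x) (push_divisor r D) =
     \sum_(C in rcosets M N) #|stab act (M :^ repr C)%G x|%:Z * coeff (p (act (repr C) x)) D.
    rewrite coeff_push mulr_sumr.
    have coE z : coeff z D = \sum_(z' <- dom D | z == z') coeff z' D.
      have [zD|zD] := boolP (z \in dom D).
        by rewrite big_mkcond (bigD1_seq z) ?uniq_dom //= eqxx big1 ?addr0 // => i /negPf; rewrite eq_sym => ->.
      rewrite coeff_outdom // big_seq_cond big1 // => z' /andP[z'D /eqP zz'].
      by rewrite zz' z'D in zD.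
    under [RHS]eq_bigr => C _ do rewrite coE mulr_sumr big_mkcond.
    rewrite exchange_big [LHS]big_mkcond; apply: eq_bigr => z _ /=.
    rewrite -big_mkcondr /= -mulr_suml; case: eqP => [rz|rz].
      rewrite -(sum_stab_fiber rz); congr (_ * _).
      by rewrite (big_morph Posz PoszD (erefl _)).
    rewrite big1 ?mul0r // => C /andP[CN /eqP e]; case: rz.
    by rewrite -e rp; apply/esym/(qm_eq qmq); exists (repr C) => //; apply: repN.
  have -> : \prod_(C in rcosets M N) f (p (act (repr C) y)) = \prod_(C in rcosets M N)
     (u C y * t y ^ (#|stab act (M :^ repr C)%G x|%:Z * coeff (p (act (repr C) x)) D)).
    by apply: eq_bigr => C CN; exact: (hy (exist _ C CN) yx).
  rewrite big_split; congr (_ * _).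
  by rewrite (big_morph (fun n => t y ^ n) (fun m n => expfzDr m n ty) (expr0z _)).
by move=> V hV; exists V.
Qed.

End Push.
End PushPull.

(** * Norm maps *)

Section JacobianClass.
Variables (K : closedFieldType) (Z : fun_space K) (J : jacobian Z).
Implicit Types D E : {freeg Z / int}.

Lemma jac_cl0 : jac_cl J 0 = 0.
Proof. by apply: (@addrI _ (jac_cl J 0)); rewrite -jac_clD ?addr0 ?deg0. Qed.

Lemma jac_clN D : deg D = 0 -> jac_cl J (- D) = - jac_cl J D.
Proof.
by move=> d; apply/eqP; rewrite -addr_eq0 -jac_clD ?degN ?d ?oppr0 // addNr jac_cl0.
Qed.

Lemma jac_clB D E : deg D = 0 -> deg E = 0 -> jac_cl J (D - E) = jac_cl J D - jac_cl J E.
Proof. by move=> d e; rewrite jac_clD ?jac_clN // degN e oppr0. Qed.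

Lemma jac_cl_eq D E : deg D = 0 -> deg E = 0 -> jac_cl J D = jac_cl J E ->
  principal_divisor (D - E).
Proof.
move=> d e DE; apply/(jac_cl_ker J); first by rewrite degB d e subrr.
by rewrite jac_clB // DE subrr.
Qed.

Lemma jac_cl_sum (I : Type) (s : seq I) (P : pred I) (D : I -> {freeg Z / int}) :
  (forall i, P i -> deg (D i) = 0) ->
  jac_cl J (\sum_(i <- s | P i) D i) = \sum_(i <- s | P i) jac_cl J (D i).
Proof.
move=> d; suff [//] : deg (\sum_(i <- s | P i) D i) = 0 /\
    jac_cl J (\sum_(i <- s | P i) D i) = \sum_(i <- s | P i) jac_cl J (D i).
apply: (big_rec2 (fun a b => deg a = 0 /\ jac_cl J a = b)); first by rewrite deg0 jac_cl0.
by move=> i a b Pi [da <-]; rewrite degD d // da addr0 jac_clD // d.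
Qed.

Lemma jac_cl_mulz D (k : int) : deg D = 0 -> jac_cl J (D *~ k) = jac_cl J D *~ k.
Proof.
move=> d.
have n_ok n : deg (D *+ n) = 0 /\ jac_cl J (D *+ n) = jac_cl J D *+ n.
  elim: n => [|n [d' IH]]; first by rewrite deg0 jac_cl0.
  by rewrite !mulrS degD d d' jac_clD ?IH.
case: k => n; first exact: (n_ok n).2.
by rewrite NegzE !mulrNz jac_clN -?pmulrn; [rewrite (n_ok _).2|exact: (n_ok _).1].
Qed.

Lemma jac_divisorP (a : J) : deg (jac_divisor a) = 0 /\ jac_cl J (jac_divisor a) = a.
Proof. by rewrite /jac_divisor; case: cid. Qed.

Definition jac_diff (z z' : Z) : J := jac_cl J (<<z>> - <<z'>>).

Lemma jac_diffxx z : jac_diff z z = 0.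
Proof. by rewrite /jac_diff subrr jac_cl0. Qed.

Lemma jac_diffC z z' : jac_diff z z' = - jac_diff z' z.
Proof. by rewrite /jac_diff -jac_clN ?opprB // degB !degU subrr. Qed.

Lemma jac_diffD x y z : jac_diff x z = jac_diff x y + jac_diff y z.
Proof. by rewrite /jac_diff -jac_clD ?subrKA // degB !degU subrr. Qed.

(** A divisor of degree 0 is the sum of its coefficients times z - z0. H need only absorb one
    difference at a time; exchanging z and z' accounts for negative coefficients. *)
Lemma jac_diff_generate (H : set J) (z0 : Z) : H 0 ->
  (forall h z z', H h -> H (h + jac_diff z z')) -> forall a, H a.
Proof.
move=> H0 HD a; have [D [dD <-]] := jac_cl_surj a.
have DE : D = \sum_(z <- dom D) (<<z>> - <<z0>>) *~ coeff z D.
  rewrite -[LHS]freeg_sumE.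
  transitivity (\sum_(z <- dom D) (<< coeff z D *g z >> - << coeff z D *g z0 >>)).
    rewrite big_split /= sumrN.
    have -> : \sum_(z <- dom D) << coeff z D *g z0 >> = << deg D *g z0 >>.
      rewrite -[in RHS](freeg_sumE D) raddf_sum /=.
      rewrite (big_morph (fun k : int => << k *g z0 >>) (op1 := +%R) (id1 := 0)).
      - by apply: eq_bigr => z _; rewrite degU.
      - by move=> k l; rewrite freegUD.
      - by rewrite freegU0.
    by rewrite dD freegU0 subr0.
  by apply: eq_bigr => z _; rewrite mulrzBl !freegU_mulz intz.
rewrite DE jac_cl_sum => [|z _]; last first.
  by rewrite raddfMz /= degB !degU subrr mul0rz.
have Hz h z (k : int) : H h -> H (h + jac_diff z z0 *~ k).
  move=> Hh; have Hn x y n : H (h + jac_diff x y *+ n).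
    by elim: n => [|n IH]; rewrite ?addr0 // mulrSr addrA; apply: HD.
  by case: k => n; rewrite ?NegzE ?mulrNz -?pmulrn -?mulNrn -?jac_diffC.
elim: (dom D) => [|z s IH]; rewrite ?big_nil // big_cons addrC jac_cl_mulz; first exact: Hz.
by rewrite degB !degU subrr.
Qed.

End JacobianClass.

Section Norms.
Variable K : closedFieldType.

Definition preserves_principal (Z Y : fun_space K) (r : Z -> Y) :=
  forall D, principal_divisor D -> principal_divisor (push_divisor r D).

Section Norm.
Variables (Z Y : fun_space K) (JZ : jacobian Z) (JY : jacobian Y) (r : Z -> Y).
Hypothesis ppr : preserves_principal r.

(** [Nm] uses a chosen divisor of the class; two choices differ by a principal divisor, which [ppr]
    keeps principal. *)
Lemma Nm_cl D : deg D = 0 -> Nm JY r (jac_cl JZ D) = jac_cl JY (push_divisor r D).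
Proof.
move=> d; have [d' e] := jac_divisorP (jac_cl JZ D).
apply/eqP; rewrite -subr_eq0 -jac_clB ?deg_push // -push_divisorN -push_divisorD; apply/eqP.
by apply/jac_cl_ker; [rewrite deg_push degB d d' subrr|apply/ppr/(jac_cl_eq _ _ e)].
Qed.

Lemma NmD (a b : JZ) : Nm JY r (a + b) = Nm JY r a + Nm JY r b.
Proof.
have [D [d <-]] := jac_cl_surj a; have [E [e <-]] := jac_cl_surj b.
by rewrite -jac_clD // !Nm_cl ?degD ?d ?e // push_divisorD jac_clD ?deg_push.
Qed.

Lemma Nm_surj : (forall y, exists z, r z = y) -> forall b, exists a : JZ, Nm JY r a = b.
Proof.
move=> sr b; have [E [e <-]] := jac_cl_surj b.
have /choice[s rs] := sr.
have rsE : push_divisor r (push_divisor s E) = E.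
  rewrite push_divisor_comp -[RHS]freeg_sumE; apply: eq_bigr => z _.
  by rewrite /= rs.
by exists (jac_cl JZ (push_divisor s E)); rewrite Nm_cl ?deg_push // rsE.
Qed.

Lemma Nm_jac_diff z z' : Nm JY r (jac_diff JZ z z') = jac_diff JY (r z) (r z').
Proof. by rewrite Nm_cl ?degB ?degU ?subrr // push_divisorD push_divisorN !push_divisorU. Qed.
End Norm.

Lemma Nm_comp (Z Y W : fun_space K) (JZ : jacobian Z) (JY : jacobian Y) (JW : jacobian W)
  (r : Z -> Y) (s : Y -> W) (t : Z -> W) (a : JZ) : preserves_principal s -> s \o r =1 t ->
  Nm JW s (Nm JY r a) = Nm JW t a.
Proof.
move=> pps e; have [d _] := jac_divisorP a.
by rewrite {2}/Nm Nm_cl ?deg_push // push_divisor_comp (eq_push_divisor _ e).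
Qed.

Lemma Nm_id (Z : fun_space K) (JZ : jacobian Z) (r : Z -> Z) (a : JZ) : r =1 id ->
  Nm JZ r a = a.
Proof.
move=> e; have [d <-] := jac_divisorP a; rewrite /Nm (eq_push_divisor _ e).
have [d' e'] := jac_divisorP (jac_cl JZ (jac_divisor a)).
rewrite -[RHS]e'; congr (jac_cl JZ _).
by rewrite -[RHS]freeg_sumE.
Qed.

Section NormMorphism.
Hypothesis uncK : ~ countable [set: K].
Hypothesis char0 : forall m, m.+1%:R != 0 :> K.
Variables (Z Y : fun_space K) (JZ : jacobian Z) (JY : jacobian Y) (r : Z -> Y).
Hypotheses (gZ : good Z) (cZ : complete_space Z) (iZ : irrset [set: Z]) (gY : good Y).
Hypotheses (mr : forall z, morph_at r z) (ppr : preserves_principal r).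
Local Notation GZ := (gspace JZ).
Local Notation GY := (gspace JY).
Let ZZ := prod_space Z Z.
Let gGZ : good GZ := ab_good uncK (jac_abelian JZ).
Let gGY : good GY := ab_good uncK (jac_abelian JY).
Lemma jac_diff_morph (W T : fun_space K) (J : jacobian W) (f g : T -> W) (t : T) :
  good W -> good T -> morph_at f t -> morph_at g t ->
  morph_at (fun t => jac_diff J (f t) (g t) : gspace J) t.
Proof.
move=> gW gT mf mg; pose w0 := f t.
have gJ : good (gspace J) := ab_good uncK (jac_abelian J).
have AJ w : morph_at (fun w => jac_diff J w w0 : gspace J) w.
  exact: (proj1 (morphismP _ gW gJ) (jac_AJ J w0)).
apply: (@morph_at_eq _ T (gspace J) (fun t => (jac_diff J (f t) w0 : J) - jac_diff J (g t) w0 : gspace J)) => //.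
  apply: (ab_subm uncK (jac_abelian J)) => //.
  - exact: morph_at_comp mf (AJ _).
  - exact: morph_at_comp mg (AJ _).
by apply: nearT => // t'; rewrite -jac_diffC -jac_diffD.
Qed.

(** Sets on which [Nm] becomes a morphism after pulling back to a complete irreducible [M], as
    [descent_morphism] demands. *)
Definition norm_parametrized (H : set GZ) := exists (M : fun_space K) (s : M -> GZ),
  [/\ good M, complete_space M /\ irrset [set: M], forall m, morph_at s m,
      forall m, morph_at (fun m => Nm JY r (s m) : GY) m & H = range s].

Definition add_diff (H : set GZ) : set GZ :=
  [set a | exists h z z', H h /\ a = h + jac_diff JZ z z' :> JZ].

Lemma norm_parametrized_add H : norm_parametrized H -> norm_parametrized (add_diff H).
Proof.
move=> [M [s [gM [cM iM] ms mns ->]]].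
have gZZ : good ZZ := prod_good gZ gZ.
have gMZ : good (prod_space M ZZ) := prod_good gM gZZ.
have m1 t : morph_at (fun t : prod_space M ZZ => t.1 : M) t by apply: fst_morph.
have m2 t : morph_at (fun t : prod_space M ZZ => t.2.1 : Z) t.
  by apply: (@morph_at_comp K (prod_space M ZZ) ZZ Z snd fst); [exact: snd_morph|exact: fst_morph].
have m3 t : morph_at (fun t : prod_space M ZZ => t.2.2 : Z) t.
  by apply: (@morph_at_comp K (prod_space M ZZ) ZZ Z snd snd); [exact: snd_morph|exact: snd_morph].
exists (prod_space M ZZ), (fun t => (s t.1 : JZ) + jac_diff JZ t.2.1 t.2.2 : GZ); split=> //.
- split; first by apply: complete_prod => //; apply: complete_prod.
  by apply: irrset_prod => //; apply: irrset_prod.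
- move=> t; apply: (ab_addm uncK (jac_abelian JZ)) => //.
    exact: morph_at_comp (m1 t) (ms _).
  exact: jac_diff_morph (m2 t) (m3 t).
- move=> t; apply: (@morph_at_eq _ (prod_space M ZZ) GY (fun t => (Nm JY r (s t.1) : JY) +
     jac_diff JY (r t.2.1) (r t.2.2) : GY)) => //.
    apply: (ab_addm uncK (jac_abelian JY)) => //; first exact: morph_at_comp (m1 t) (mns _).
    apply: jac_diff_morph => //; first exact: morph_at_comp (m2 t) (mr _).
    exact: morph_at_comp (m3 t) (mr _).
  by apply: nearT => // t'; rewrite NmD // Nm_jac_diff.
- apply/seteqP; split=> a.
    by move=> [h [z [z' [[m _ <-] ->]]]]; exists (m, (z, z')).
  by move=> [[m [z z']] _ <-]; exists (s m), z, z'; split=> //; exists m.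
Qed.

(** The sets of sums of i differences [z] - [z'] are closed, irreducible and increasing, so one
    equals the next. That one absorbs differences, hence is everything. *)
Lemma norm_parametrized_all : norm_parametrized [set: GZ].
Proof.
have [z0 _] := proj1 iZ.
pose H i := iter i add_diff [set (0 : JZ)].
have nH i : norm_parametrized (H i).
  elim: i => [|i IH]; last exact: norm_parametrized_add.
  exists Z, (fun=> 0 : GZ); split=> //; try by move=> m; apply: morph_at_cst.
  by apply/seteqP; split=> [a ->|a [z _ <-]] //; exists z0.
have incr i : H i `<=` H i.+1.
  by move=> a Ha; exists a, z0, z0; split=> //; rewrite jac_diffxx addr0.
have cH i : closed_set (H i) /\ irrset (H i).
  have [M [s [gM [cM iM] ms _ ->]]] := nH i; split.
    apply: (ab_image_closed uncK (jac_abelian JZ)) => // x; by case.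
  exact: (@irrset_image K M GZ s setT ms iM).
have [N nc] := nice_chain (ab_nice uncK (jac_abelian JZ)).
have [i Hi] : exists i, H i.+1 `<=` H i.
  apply: contrapT => ne; apply: nc; exists H; split=> // i _; split; first exact: incr.
  by move=> h; apply: ne; exists i.
suff -> : [set: GZ] = H i by [].
apply/seteqP; split=> // a _; apply: (@jac_diff_generate _ _ JZ (H i) z0).
  by elim: (i) => [|j IH] //; apply: incr.
by move=> h z z' Hh; apply: Hi; exists h, z, z'.
Qed.

Lemma Nm_morph (a : GZ) : morph_at (Nm JY r : GZ -> GY) a.
Proof.
have [M [s [gM [cM iM] ms mns e]]] := norm_parametrized_all.
apply: (descent_morphism uncK char0 (jac_abelian JZ) (jac_abelian JY) (NmD (JZ := JZ) JY ppr) gM cM ms _ mns a).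
by move=> b; have : range s b by [rewrite -e]; case=> m _ <-; exists m.
Qed.
End NormMorphism.
End Norms.

(** * Idempotents of rational group algebras *)

Lemma mem_envelop_ind (F : fieldType) (gT : finGroupType) (G : {group gT}) (P : 'M[F]_(gcard G) -> Prop) :
  (forall g, g \in G -> P (regular_repr F G g)) -> (forall k a, P a -> P (k *: a)) ->
  P 0 -> (forall a b, P a -> P b -> P (a + b)) ->
  forall a, (a \in group_ring F G)%MS -> P a.
Proof.
move=> PG PZ P0 PD a /envelop_mxP[c ->].
by elim/big_ind: _ => // g gG; apply/PZ/PG.
Qed.

(** In the full rank factorization of A, the product of the two factors in the opposite order is the
    identity of size the rank. *)
Lemma mxtrace_idem (F : fieldType) n (A : 'M[F]_n) : A *m A = A -> \tr A = (\rank A)%:R.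
Proof.
move=> AA; suff CR : row_base A *m col_base A = 1%:M.
  by rewrite -[A in LHS]mulmx_base mxtrace_mulC CR mxtrace1.
have Cf : row_free (col_base A)^T by rewrite /row_free mxrank_tr; have := col_base_full A.
have /row_fullP[C CC] := col_base_full A.
have /row_freeP[R RR] := row_base_free A.
have CA : C *m A = row_base A.
  transitivity (C *m (col_base A *m row_base A)); first by rewrite mulmx_base.
  by rewrite mulmxA CC mul1mx.
have AR : A *m R = col_base A.
  transitivity (col_base A *m row_base A *m R); first by rewrite mulmx_base.
  by rewrite -mulmxA RR mulmx1.
transitivity (C *m A *m (A *m R)); first by rewrite CA AR.
by rewrite mulmxA -(mulmxA C) AA CA RR.
Qed.

Lemma mxrank_orthogonal (F : fieldType) n (A B : 'M[F]_n) : A *m A = A -> B *m B = B ->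
  A *m B = 0 -> B *m A = 0 -> (\rank (A + B)%R = \rank A + \rank B)%N.
Proof.
move=> AA BB AB BA.
have cap : (A :&: B = 0)%MS.
  apply/eqP; rewrite -submx0; apply/rV_subP => v; rewrite sub_capmx => /andP[/submxP[u uA] /submxP[w wB]].
  by rewrite uA -AA mulmxA -uA wB -mulmxA BA mulmx0 sub0mx.
rewrite -(mxrank_disjoint_sum cap); apply/eqmx_rank/andP; split.
  by rewrite addmx_sub_adds.
rewrite addsmx_sub; apply/andP; split; apply/submxP.
- by exists A; rewrite mulmxDr AA AB addr0.
- by exists B; rewrite mulmxDr BB BA add0r.
Qed.

Section GroupRing.
Variables (gT : finGroupType) (G : {group gT}).
Local Notation QG := (group_ring rat G).
Local Notation aG := (regular_repr rat G).
Implicit Types a b p q f : 'M[rat]_(gcard G).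

Let QG_G : pgroup (negn [pchar rat]) G.
Proof. by apply/pgroupP => p _ _; rewrite inE /= pchar_num. Qed.

Lemma group_ring_mul a b : (a \in QG)%MS -> (b \in QG)%MS -> (a *m b \in QG)%MS.
Proof. exact: envelop_mxM. Qed.

Lemma group_ring_sub a b : (a \in QG)%MS -> (b \in QG)%MS -> (a - b \in QG)%MS.
Proof. by move=> aQ bQ; rewrite linearB /= addmx_sub // eqmx_opp. Qed.

Lemma group_ring_row_inj a : (a \in QG)%MS -> gring_row a = 0 -> a = 0.
Proof. by move=> aQ e; rewrite -(gring_rowK aQ) e linear0. Qed.

(* von Neumann regularity: a complement of the right ideal a Q[G] gives an
   idempotent generator ab of that ideal *)
Lemma group_ring_regular a : (a \in QG)%MS -> exists2 b, (b \in QG)%MS & a *m b *m a = a.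
Proof.
move=> aQ; pose U := cyclic_mx aG (gring_row a).
have [W modW sumW dirW] := mx_Maschke_pchar aG QG_G (cyclic_mx_module aG (gring_row a)) (submx1 U).
have : (gring_row (1%:M : 'M_(gcard G)) <= U + W)%MS by rewrite sumW submx1.
case/sub_addsmxP => -[u w] /= e1.
have /cyclic_mxP[b bQ ub] : (u *m U <= U)%MS by rewrite submxMl.
exists b => //.
have abaQ : (a - a *m b *m a \in QG)%MS.
  by apply: group_ring_sub => //; rewrite !group_ring_mul.
have inU : (gring_row (a - a *m b *m a) <= U)%MS.
  apply/cyclic_mxP; exists (1%:M - b *m a); last by rewrite mulmxBr mulmx1 linearB /= -mulmxA gring_row_mul.
  by rewrite group_ring_sub ?envelop_mx1 ?group_ring_mul.
have inW : (gring_row (a - a *m b *m a) <= W)%MS.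
  have -> : a - a *m b *m a = (1%:M - a *m b) *m a by rewrite mulmxBl mul1mx.
  rewrite gring_row_mul; apply: mxmodule_envelop modW aQ _.
  by rewrite linearB /= gring_row_mul -ub e1 addrAC subrr add0r submxMl.
have : (gring_row (a - a *m b *m a) <= U :&: W)%MS by rewrite sub_capmx inU.
rewrite (mxdirect_addsP dirW) submx0 => /eqP/(group_ring_row_inj abaQ)/eqP.
by rewrite subr_eq0 => /eqP.
Qed.

Lemma gring_opD n (rG : mx_representation rat G n) a b :
  gring_op rG (a + b) = gring_op rG a + gring_op rG b.
Proof. exact: linearD. Qed.

Definition equiv_idem p q :=
  exists a b, [/\ (a \in QG)%MS, (b \in QG)%MS, a *m b = p & b *m a = q].

(** f is a sum of n orthogonal idempotents equivalent to p, peeled off one at a time to match the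
    recursion of [gpow]. *)
Fixpoint splits p n f : Prop :=
  if n is n'.+1 then exists f1, [/\ equiv_idem p f1, f1 *m f1 = f1, f *m f1 = f1,
    f1 *m f = f1 & splits p n' (f - f1)]
  else f = 0.

Section Block.
Variables (sG : irrType rat G) (n : nat) (rG : mx_representation rat G n).
Hypothesis irrG : mx_irreducible rG.
Local Notation RI := (Wedderburn_subring (irr_comp sG rG)).
Local Notation eI := (Wedderburn_id (irr_comp sG rG)).
Local Notation op := (gring_op rG).

Lemma block_sub a : (a \in RI)%MS -> (a \in QG)%MS.
Proof. by move=> h; rewrite -(Wedderburn_sum_pchar sG QG_G) (sumsmx_sup (irr_comp sG rG)). Qed.

Lemma block_mulr a b : (a \in RI)%MS -> (b \in QG)%MS -> (a *m b \in RI)%MS.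
Proof.
move=> aI bQ; have /andP[_ /mulsmx_subP h] := Wedderburn_ideal (irr_comp sG rG).
exact: h.
Qed.

Lemma block_mull a b : (a \in QG)%MS -> (b \in RI)%MS -> (a *m b \in RI)%MS.
Proof.
move=> aI bQ; have /andP[/mulsmx_subP h _] := Wedderburn_ideal (irr_comp sG rG).
exact: h.
Qed.

Lemma op_block_id : op eI = 1%:M.
Proof.
have h : op 1%:M = op eI.
  rewrite -(Wedderburn_sum_id_pchar sG QG_G) linear_sum /= (bigD1 (irr_comp sG rG)) //= big1 ?addr0 //.
  by move=> j ne; apply: (irr_comp'_op0_pchar QG_G irrG ne); apply: Wedderburn_id_mem.
by rewrite -h gring_op1.
Qed.

Lemma block_id_mem : (eI \in RI)%MS. Proof. exact: Wedderburn_id_mem. Qed.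

Lemma block_idl a : (a \in RI)%MS -> eI *m a = a.
Proof. by have [_ _ h _] := Wedderburn_is_id_pchar QG_G (irr_comp sG rG); apply: h. Qed.

Lemma op_block_inj a : (a \in RI)%MS -> op a = 0 -> a = 0.
Proof.
move=> aI e; apply: (regular_op_inj_pchar (sG := sG) QG_G irrG) => //; rewrite ?inE ?e ?linear0 //.
by rewrite sub0mx.
Qed.

(** Some a in I acts nontrivially on rG, where the block identity acts as 1; so their product is a
    nonzero element of both ideals, and each is minimal. *)
Lemma simple_factor_block (I : 'A[rat]_(gcard G)) : simple_factor_of rG I -> (I :=: RI)%MS.
Proof.
move=> [[IQ idI] nzI minI [a aI opa]].
have /andP[/mulsmx_subP Il /mulsmx_subP Ir] := idI.
have aQ : (a \in QG)%MS := submx_trans aI IQ.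
pose J := (I :&: RI)%MS.
have eaJ : (eI *m a \in J)%MS.
  by rewrite sub_capmx Il ?(block_sub block_id_mem) // block_mulr // block_id_mem.
have nzJ : J != 0.
  apply: contraNneq opa => J0; move: eaJ; rewrite J0 submx0 mxvec_eq0 => /eqP e.
  by rewrite -[op a]mul1mx -op_block_id -gring_opM // e linear0.
have idJ : mx_ideal QG J.
  apply/andP; split; apply/mulsmx_subP => x y; rewrite !sub_capmx.
  - by move=> xQ /andP[yI yR]; rewrite Il // block_mull.
  - by move=> /andP[yI yR] xQ; rewrite Ir // block_mulr.
have JR := Wedderburn_min_ideal_pchar QG_G nzJ (capmxSr _ _) idJ.
have IJ : (I <= J)%MS by apply: minI; rewrite ?capmxSl //; split=> //; rewrite (submx_trans (capmxSl _ _)).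
apply/eqmxP/andP; split; first by apply: submx_trans IJ (capmxSr _ _).
by rewrite -JR capmxSl.
Qed.

Definition primitive p := primitive_idempotent RI p.

Lemma primitive_below f : (f \in RI)%MS -> f *m f = f -> f != 0 -> exists p,
  [/\ primitive p, f *m p = p & p *m f = p].
Proof.
have [m] := ubnP (\rank (op f)); elim: m f => // m IH f rf fI ff nf.
have [pf|] := pselect (primitive f); first by exists f.
move=> np.
have [q [r [qI rI qq rr [qr rq E nq nr]]]] : exists q r, [/\ (q \in RI)%MS, (r \in RI)%MS,
    q *m q = q, r *m r = r & [/\ q *m r = 0, r *m q = 0, f = q + r, q != 0 & r != 0]].
  apply: contrapT => h; apply: np; split=> // q r qI rI qq rr qr rq E.
  have [|nq] := eqVneq q 0; first by left.
  have [|nr] := eqVneq r 0; first by right.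
  by case: h; exists q, r.
have rk0 x : (x \in RI)%MS -> x != 0 -> (0 < \rank (op x))%N.
  by move=> xI; apply: contraNT; rewrite -eqn0Ngt mxrank_eq0 => /eqP/(op_block_inj xI)->.
have opM x y : (x \in RI)%MS -> (y \in RI)%MS -> op x *m op y = op (x *m y).
  by move=> _ /block_sub yQ; rewrite gring_opM.
have rE : \rank (op f) = (\rank (op q) + \rank (op r))%N.
  by rewrite E gring_opD mxrank_orthogonal // opM // ?qq ?rr ?qr ?rq ?linear0.
have [||||p [pp qp pq]] := IH q.
- by move: rf (rk0 r rI nr); rewrite rE; move: (\rank _) (\rank _) => x y; rewrite ltnS => h1 h2; apply: leq_trans h1; rewrite -addn1 leq_add2l.
- by [].
- by [].
- by [].
exists p; split=> //; rewrite E.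
- by rewrite mulmxDl qp -[p in r *m p]qp mulmxA rq mul0mx addr0.
- by rewrite mulmxDr pq -[p in p *m r]pq -mulmxA qr mulmx0 addr0.
Qed.

(** A nonzero vector in the image of p generates the simple module, so some x carries it to a vector
    that q does not kill. *)
Lemma primitive_connect p q : (p \in RI)%MS -> (q \in RI)%MS -> p != 0 -> q != 0 ->
  exists x, (x \in QG)%MS /\ p *m x *m q != 0.
Proof.
move=> pI qI np nq.
have /rowV0Pn[v /submxP[u vE] nv] : op p != 0.
  by apply: contraNneq np => /(op_block_inj pI)->.
have full : row_full (cyclic_mx rG v).
  by have [_ h] := (mx_irrP rG).1 irrG; apply: h; rewrite ?cyclic_mx_module ?cyclic_mx_eq0.
have /rowV0Pn[w /submxP[t wE] nw] : op q != 0.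
  by apply: contraNneq nq => /(op_block_inj qI)->.
have /cyclic_mxP[A /submxP[c AE] tE] : (t <= cyclic_mx rG v)%MS by rewrite submx_full.
pose x := gring_mx aG c.
have xQ : (x \in QG)%MS by apply: gring_mxP.
have opx : op x = A by rewrite gring_op_mx /gring_mx /= -AE mxvecK.
exists x; split=> //; apply: contraNneq nw => e.
rewrite wE tE vE -opx.
have -> : u *m op p *m op x *m op q = u *m op (p *m x *m q).
  by rewrite gring_opM ?(block_sub qI) // gring_opM // !mulmxA.
by rewrite e linear0 mulmx0.
Qed.

(** A nonzero x in p Q[G] q has a y in q Q[G] p with x y x = x, by regularity. Then x y and y x are
    nonzero idempotents below p and q, hence equal to them. *)
Lemma primitive_equiv p q : primitive p -> primitive q -> equiv_idem p q.
Proof.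
move=> [pI np pp pmin] [qI nq qq qmin].
have pQ := block_sub pI; have qQ := block_sub qI.
have [x0 [x0Q nx]] := primitive_connect pI qI np nq.
pose x := p *m x0 *m q.
have xI : (x \in RI)%MS by rewrite !block_mulr.
have px : p *m x = x by rewrite /x !mulmxA pp.
have xq : x *m q = x by rewrite /x -!mulmxA qq.
have [y0 y0Q xyx0] := group_ring_regular (block_sub xI).
pose y := q *m y0 *m p.
have yI : (y \in RI)%MS by rewrite !block_mulr.
have qy : q *m y = y by rewrite /y !mulmxA qq.
have yp : y *m p = y by rewrite /y -!mulmxA pp.
have xyx : x *m y *m x = x.
  by rewrite /y !(mulmxA x) xq -(mulmxA _ p) px xyx0.
have corner r z : (r \in RI)%MS -> r *m r = r -> (z \in RI)%MS -> z *m z = z -> r *m z = z -> z *m r = z ->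
    z != 0 -> (forall q r0, (q \in RI)%MS -> (r0 \in RI)%MS ->
        q *m q = q -> r0 *m r0 = r0 -> q *m r0 = 0 -> r0 *m q = 0 ->
        r = q + r0 -> q = 0 \/ r0 = 0) -> z = r.
  move=> rI rr zI zz rz zr nz h; have [|||||||e|/eqP] := h z (r - z); rewrite ?subrKC //.
  - by rewrite linearB /= addmx_sub // eqmx_opp.
  - by rewrite mulmxBl !mulmxBr rr rz zr zz subrr subr0.
  - by rewrite mulmxBr zr zz subrr.
  - by rewrite mulmxBl rz zz subrr.
  - by rewrite e eqxx in nz.
  - by rewrite subr_eq0 => /eqP.
exists x, y; split; rewrite ?block_sub //.
- apply: corner pmin; rewrite ?block_mulr ?(block_sub yI) //.
  + by rewrite mulmxA xyx.
  + by rewrite mulmxA px.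
  + by rewrite -mulmxA yp.
  + by apply: contraNneq nx => e; rewrite -/x -xyx e mul0mx.
- apply: corner qmin; rewrite ?block_mulr ?(block_sub xI) //.
  + by rewrite -mulmxA (mulmxA x) xyx.
  + by rewrite mulmxA qy.
  + by rewrite -mulmxA xq.
  + by apply: contraNneq nx => e; rewrite -/x -xyx -mulmxA e mulmx0.
Qed.

Lemma rank_equiv p q : (p \in QG)%MS -> (q \in QG)%MS -> p *m p = p -> q *m q = q ->
  equiv_idem p q -> \rank (op p) = \rank (op q).
Proof.
have le r s : r *m r = r -> equiv_idem r s -> (\rank (op r) <= \rank (op s))%N.
  move=> rr [a [b [aQ bQ ab ba]]]; rewrite -rr -ab mulmxA -(mulmxA a b a) ba -ba.
  by rewrite gring_opM // gring_opM ?group_ring_mul // (leq_trans (mxrankM_maxl _ _)) // mxrankM_maxr.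
move=> pQ qQ pp qq pq; apply/eqP; rewrite eqn_leq !le //.
by have [a [b [aQ bQ ab ba]]] := pq; exists b, a.
Qed.

Variables (p : 'M[rat]_(gcard G)) (s : nat).
Hypotheses (pp : primitive p) (rp : \rank (op p) = s) (s0 : (0 < s)%N).

(** All primitive idempotents of the block are equivalent to p, so they have rank s: each one
    removed from f lowers the rank by s. *)
Lemma block_splits m f : (f \in RI)%MS -> f *m f = f -> \rank (op f) = (m * s)%N ->
  splits p m f.
Proof.
elim: m f => [|m IH] f fI ff rf /=.
  by apply: (op_block_inj fI); apply/eqP; rewrite -mxrank_eq0 rf.
have nf : f != 0.
  by apply/eqP => f0; move: rf; rewrite f0 linear0 mxrank0; case: (s) s0.
have [f1 [pf1 ff1 f1f]] := primitive_below fI ff nf.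
have [f1I nf1 f11 _] := pf1; have [pI _ p2 _] := pp.
have e1 := primitive_equiv pp pf1.
have gI : (f - f1 \in RI)%MS by rewrite linearB /= addmx_sub // eqmx_opp.
have gg : (f - f1) *m (f - f1) = f - f1.
  by rewrite mulmxBl !mulmxBr ff ff1 f1f f11 subrr subr0.
exists f1; split=> //; apply: IH => //.
have rf1 := rank_equiv (block_sub pI) (block_sub f1I) p2 f11 e1.
have opM x y : (y \in RI)%MS -> op x *m op y = op (x *m y).
  by move=> /block_sub yQ; rewrite gring_opM.
have : \rank (op f) = (\rank (op f1) + \rank (op (f - f1)))%N.
  rewrite -mxrank_orthogonal ?opM ?gg ?f11 //.
  - by rewrite -gring_opD subrKC.
  - by rewrite mulmxBr f1f f11 subrr linear0.
  - by rewrite mulmxBl ff1 f11 subrr linear0.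
by rewrite rf -rf1 rp mulSn => /addnI.
Qed.
End Block.

Lemma primitive_of_rank (sG : irrType rat G) n (rG : mx_representation rat G n) q s :
  mx_irreducible rG -> (q \in Wedderburn_subring (irr_comp sG rG))%MS -> q *m q = q ->
  \rank (gring_op rG q) = s -> (0 < s)%N ->
  (forall f, (f \in Wedderburn_subring (irr_comp sG rG))%MS -> f *m f = f -> f != 0 ->
     (s <= \rank (gring_op rG f))%N) -> primitive sG rG q.
Proof.
move=> irrG qI qq rq s0 min; split=> //.
  by apply/eqP => q0; move: s0; rewrite -rq q0 linear0 mxrank0.
move=> f r fI rI ff rr fr rf E.
have [|nf] := eqVneq f 0; first by left.
have [|nr] := eqVneq r 0; first by right.
have opM x y : (x \in Wedderburn_subring (irr_comp sG rG))%MS ->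
    (y \in Wedderburn_subring (irr_comp sG rG))%MS -> gring_op rG x *m gring_op rG y = gring_op rG (x *m y).
  by move=> _ /block_sub yQ; rewrite gring_opM.
have := leq_add (min f fI ff nf) (min r rI rr nr).
rewrite -mxrank_orthogonal ?opM ?ff ?rr ?fr ?rf ?linear0 // -gring_opD -E rq.
by rewrite -[X in (_ <= X)%N]addn0 leq_add2l leqNgt s0.
Qed.

Lemma eq_primitive_idempotent (I J : 'A[rat]_(gcard G)) p : (I :=: J)%MS ->
  primitive_idempotent I p -> primitive_idempotent J p.
Proof.
move=> IJ [pI np pp h]; split; rewrite -?IJ // => q r.
by rewrite -!IJ; apply: h.
Qed.

End GroupRing.

(** * The group algebra of A5 *)

Section A5Subgroups.
Local Close Scope classical_set_scope.
Local Open Scope group_scope.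

Lemma letterE k (h : (k < 5)%N) : letter k.+1 = Ordinal h.
Proof. by apply: val_inj; rewrite /letter /= inordK. Qed.

Let l1 : letter 1 = @Ordinal 5 0 isT := @letterE 0 isT.
Let l2 : letter 2 = @Ordinal 5 1 isT := @letterE 1 isT.
Let l3 : letter 3 = @Ordinal 5 2 isT := @letterE 2 isT.
Let l4 : letter 4 = @Ordinal 5 3 isT := @letterE 3 isT.
Let l5 : letter 5 = @Ordinal 5 4 isT := @letterE 4 isT.

(** Permutations are compared through their lists of values, which turns relations in the group into
    computations on numbers. *)
Let table (l : seq nat) (i : 'I_5) : 'I_5 := inord (nth 0%N l i).

Let tableE (p : {perm 'I_5}) l : (forall i : 'I_5, val (p i) = nth 0%N l i) -> p =1 table l.
Proof. by move=> h i; apply: val_inj; rewrite /table /= inordK -h ?ltn_ord. Qed.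

Ltac table5 := case=> [[|[|[|[|[|?]]]]] ?] //;
  rewrite /c12345 /transp ?l1 ?l2 ?l3 ?l4 ?l5 !permM; by do ! rewrite permE /=.

Let cE : c12345 =1 table [:: 1; 2; 3; 4; 0]%N.
Proof. by apply: tableE; table5. Qed.
Let tE : transp 2 5 * transp 3 4 =1 table [:: 0; 4; 3; 2; 1]%N.
Proof. by apply: tableE; table5. Qed.
Let sE : transp 2 3 * transp 4 5 =1 table [:: 0; 2; 1; 4; 3]%N.
Proof. by apply: tableE; table5. Qed.
Let rE : transp 3 4 * transp 3 5 =1 table [:: 0; 1; 3; 4; 2]%N.
Proof. by apply: tableE; table5. Qed.

Let uE : transp 2 4 * transp 3 5 =1 table [:: 0; 3; 4; 1; 2]%N.
Proof. by apply: tableE; table5. Qed.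

Let table_ok l := (size l == 5) && all (fun k => k < 5)%N l.

Let tabM (p q : {perm 'I_5}) l l' : p =1 table l -> q =1 table l' -> table_ok l ->
  p * q =1 table [seq nth 0%N l' k | k <- l].
Proof.
move=> pl ql /andP[/eqP sl /allP a5] i; rewrite permM pl ql /table; congr inord.
by rewrite (nth_map 0%N) ?sl // inordK // a5 // mem_nth ?sl.
Qed.

Let tab1 : (1 : {perm 'I_5}) =1 table [:: 0; 1; 2; 3; 4]%N.
Proof. by apply: tableE => -[[|[|[|[|[|?]]]]] ?] //; rewrite perm1. Qed.

Let tab_eq (p q : {perm 'I_5}) l : p =1 table l -> q =1 table l -> p = q.
Proof. by move=> pl ql; apply/permP => i; rewrite pl ql. Qed.

Let tab_neq (p q : {perm 'I_5}) l l' : table_ok l -> table_ok l' -> l != l' -> p =1 table l -> q =1 table l' -> p != q.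
Proof.
move=> /andP[/eqP sl /allP a5] /andP[/eqP sl' /allP a5'] + pl ql; apply: contra => /eqP pq.
apply/eqP/(@eq_from_nth _ 0%N); rewrite ?sl' // => i; rewrite sl => i5.
have := congr1 val (etrans (esym (pl (Ordinal i5))) (etrans (congr1 (fun p : {perm 'I_5} => p (Ordinal i5)) pq) (ql _))).
rewrite /table /= !inordK //; first by apply/a5'/mem_nth; rewrite sl'.
by apply/a5/mem_nth; rewrite sl.
Qed.

Lemma c12345_order : #[c12345] = 5%N.
Proof.
apply: nt_prime_order => //.
  exact: (tab_eq (tabM cE (tabM cE (tabM cE (tabM cE cE isT) isT) isT) isT) tab1).
exact: tab_neq cE tab1.
Qed.

Canonical A4_group := [group of A4].
Canonical D5_group := [group of D5].
Canonical Z5_group := [group of Z5].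

Lemma card_Z5 : #|Z5| = 5%N. Proof. exact: c12345_order. Qed.

Lemma Z5_D5 : Z5 \subset D5.
Proof. by rewrite genS // finset.sub1set !inE eqxx. Qed.

Lemma joing_cycles (gT : finGroupType) (a b : gT) : <<[set a; b]%SET>> = <[a]> <*> <[b]>.
Proof. by rewrite joing_idl joing_idr. Qed.

Lemma card_D5 : #|D5| = 10%N.
Proof.
rewrite /D5; set t := transp 2 5 * transp 3 4.
have t2 : #[t] = 2%N by apply: nt_prime_order => //; [exact: (tab_eq (tabM tE tE isT) tab1)|exact: tab_neq tE tab1].
rewrite joing_cycles norm_joinEr; last first.
  rewrite cycle_subG; apply/normP; rewrite -cycleJ.
  have -> : c12345 ^ t = c12345^-1.
    apply: (mulgI t); rewrite -conjgC; apply: (mulIg c12345); rewrite mulgKV;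
      exact: tab_eq (tabM (tabM cE tE isT) cE isT) tE.
  by rewrite cycleV.
by rewrite coprime_cardMg -?orderE c12345_order t2.
Qed.

(** A4 is the Klein group of s and u = s^r extended by the group of order 3 of r, which permutes s,
    u and s u cyclically. *)
Lemma card_A4 : #|A4| = 12%N.
Proof.
rewrite /A4; set s := transp 2 3 * transp 4 5; set r := transp 3 4 * transp 3 5.
pose u := transp 2 4 * transp 3 5.
have r3 : #[r] = 3%N by apply: nt_prime_order => //; [exact: (tab_eq (tabM rE (tabM rE rE isT) isT) tab1)|exact: tab_neq rE tab1].
have s1 : s != 1 by exact: tab_neq sE tab1.
have s2 : #[s] = 2%N by apply: nt_prime_order => //; exact: (tab_eq (tabM sE sE isT) tab1).
have sr : s ^ r = u.
  by apply: (mulgI r); rewrite -conjgC; exact: tab_eq (tabM sE rE isT) (tabM rE uE isT).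
have ur : u ^ r = s * u.
  by apply: (mulgI r); rewrite -conjgC; exact: tab_eq (tabM uE rE isT) (tabM rE (tabM sE uE isT) isT).
have u2 : #[u] = 2%N by rewrite -sr orderJ.
have us : u != s by exact: tab_neq uE sE.
have su : u * s = s * u by exact: tab_eq (tabM uE sE isT) (tabM sE uE isT).
have VE : <[s]> <*> <[u]> = <[s]> * <[u]>.
  rewrite norm_joinEr // cycle_subG; apply/normP; rewrite -cycleJ; congr <[_]>.
  by rewrite conjgE -su mulKg.
have V4 : #|<[s]> <*> <[u]>| = 4%N.
  rewrite VE TI_cardMg -?orderE ?s2 ?u2 //; apply: prime_TIg; first by rewrite -orderE s2.
  by rewrite cycle_subG /= (cycle2g u2) !inE negb_or s1 eq_sym us.
have -> : <<[set s; r]%SET>> = (<[s]> <*> <[u]>) <*> <[r]>.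
  have [sV uV] : s \in <[s]> <*> <[u]> /\ u \in <[s]> <*> <[u]>.
    by split; rewrite mem_gen // inE cycle_id ?orbT.
  have [sA rA] : s \in <<[set s; r]%SET>> /\ r \in <<[set s; r]%SET>>.
    by split; rewrite mem_gen // !inE eqxx ?orbT.
  apply/eqP; rewrite finset.eqEsubset gen_subG !join_subG !cycle_subG sA rA -sr groupJ // !andbT.
  apply/fintype.subsetP => x; rewrite !inE => /orP[]/eqP->.
    by rewrite mem_gen // inE sr sV.
  by rewrite mem_gen // !inE cycle_id orbT.
rewrite norm_joinEr; last first.
  rewrite cycle_subG inE conjYg -!cycleJ sr ur join_subG !cycle_subG.
  have [sV uV] : s \in <[s]> <*> <[u]> /\ u \in <[s]> <*> <[u]>.
    by split; rewrite mem_gen // inE cycle_id ?orbT.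
  by rewrite uV groupM.
by rewrite coprime_cardMg -?orderE V4 r3.
Qed.

Lemma card_A5 : #|A5| = 60%N.
Proof.
have := card_Alt (T := 'I_5); rewrite card_ord => /(_ isT) e.
by apply/eqP; rewrite -(eqn_pmul2l (isT : 0 < 2)%N) e.
Qed.

Lemma A4_A5 : A4 \subset A5.
Proof.
rewrite gen_subG; apply/fintype.subsetP => x /set2P[]->;
by rewrite Alt_even /transp ?l2 l3 l4 l5 odd_permM !odd_tperm.
Qed.

Lemma D5_A5 : D5 \subset A5.
Proof.
rewrite gen_subG; apply/fintype.subsetP => x /set2P[]->;
by rewrite Alt_even /c12345 /transp ?l1 l2 l3 l4 l5 !odd_permM !odd_tperm.
Qed.
End A5Subgroups.

(** * Operators of the group algebra and traces *)

Section RepresentationOps.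
Variables (F : fieldType) (gT : finGroupType) (G : {group gT}).
Local Notation FG := (group_ring F G).
Local Notation aG := (regular_repr F G).

Lemma mxtrace_regular1 x : x \in G -> \tr (aG x) = (#|G| * (x == 1%g))%:R.
Proof.
move=> xG; rewrite /mxtrace /=.
transitivity (\sum_(i < gcard G) (x == 1%g)%:R : F).
  apply: eq_bigr => i _; rewrite !mxE eqxx /= -(inj_eq enum_val_inj) gring_indexK ?groupM ?enum_valP //.
  by rewrite -[X in X == _]mulg1 (inj_eq (mulgI _)) eq_sym.
by rewrite sumr_const cardT -cardE card_ord natrM mulr_natl.
Qed.

Lemma rsim_op n1 n2 (r1 : mx_representation F G n1) (r2 : mx_representation F G n2) :
  mx_rsim r1 r2 -> exists B B', B' *m B = 1%:M /\
    forall a, (a \in FG)%MS -> gring_op r1 a = B *m gring_op r2 a *m B'.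
Proof.
move=> /mx_rsim_def[B [B' BB h]]; exists B, B'; split=> // a; elim/mem_envelop_ind.
- by move=> g gG; rewrite !gring_opG // h.
- by move=> k b e; rewrite !linearZ /= e -?scalemxAr -?scalemxAl.
- by rewrite !linear0 ?mulmx0 mul0mx.
- by move=> b c eb ec; rewrite !linearD /= eb ec ?mulmxDr mulmxDl.
Qed.

Lemma rsim_op_trace n1 n2 (r1 : mx_representation F G n1) (r2 : mx_representation F G n2) a :
  mx_rsim r1 r2 -> (a \in FG)%MS -> \tr (gring_op r1 a) = \tr (gring_op r2 a).
Proof.
move=> /rsim_op[B [B' [BB h]]] aG; rewrite h // mxtrace_mulC mulmxA BB mul1mx //.
Qed.

Lemma rsim_op_eq0 n1 n2 (r1 : mx_representation F G n1) (r2 : mx_representation F G n2) a :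
  mx_rsim r1 r2 -> (a \in FG)%MS -> gring_op r2 a = 0 -> gring_op r1 a = 0.
Proof. by move=> /rsim_op[B [B' [BB h]]] aG e; rewrite h // e mulmx0 mul0mx. Qed.

Lemma dadd_op n1 n2 (r1 : mx_representation F G n1) (r2 : mx_representation F G n2) a :
  (a \in FG)%MS ->
  gring_op (direct_sum_repr r1 r2) a = block_mx (gring_op r1 a) 0 0 (gring_op r2 a).
Proof.
elim/mem_envelop_ind.
- by move=> g gG; rewrite !gring_opG.
- by move=> k b e; rewrite !linearZ /= e scale_block_mx !scaler0.
- by rewrite !linear0 /= block_mx0.
- by move=> b c eb ec; rewrite !linearD /= eb ec add_block_mx !addr0.
Qed.

Lemma triv_mx_repr : mx_repr G (fun _ : gT => 1%:M : 'M[F]_1).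
Proof. by split=> // x y _ _; rewrite mulmx1. Qed.

Definition triv_repr := MxRepresentation triv_mx_repr.

Lemma triv_irr : mx_irreducible triv_repr.
Proof. exact/mx_abs_irrW/linear_mx_abs_irr. Qed.

End RepresentationOps.

(* A group of order 60 = 1 + 16 + 25 + 9 + 9 with irreducible representations of
   these dimensions has no others. *)
Section FiveRepresentations.
Variables (F : fieldType) (gT : finGroupType) (G : {group gT}).
Hypotheses (splitG : group_splitting_field F G) (F'G : pgroup (negn [pchar F]) G).
Hypothesis G60 : #|G| = 60%N.
Local Notation FG := (group_ring F G).
Variables (r1 : mx_representation F G 1) (r4 : mx_representation F G 4)
  (r5 : mx_representation F G 5) (t1 t2 : mx_representation F G 3).
Hypotheses (irr1 : mx_irreducible r1) (irr4 : mx_irreducible r4) (irr5 : mx_irreducible r5)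
  (irrt1 : mx_irreducible t1) (irrt2 : mx_irreducible t2) (t12 : ~ mx_rsim t1 t2).

Section IrrType.
Variable sG : irrType F G.

Lemma irr_degree_comp n (r : mx_representation F G n) : mx_irreducible r ->
  irr_degree (irr_comp sG r) = n.
Proof. by move=> ir; apply/esym/mxrank_rsim/(rsim_irr_comp_pchar sG F'G ir). Qed.

Let five := [:: irr_comp sG r1; irr_comp sG r4; irr_comp sG r5; irr_comp sG t1; irr_comp sG t2].

Lemma five_uniq : uniq five.
Proof.
have ne n m (r : mx_representation F G n) (s : mx_representation F G m) :
    mx_irreducible r -> mx_irreducible s -> n <> m -> irr_comp sG r != irr_comp sG s.
  by move=> ir iq nm; apply/eqP => e; apply: nm; rewrite -(irr_degree_comp ir) e irr_degree_comp.
have nt : irr_comp sG t1 != irr_comp sG t2.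
  apply/eqP => e; apply: t12; apply: mx_rsim_trans (rsim_irr_comp_pchar sG F'G irrt1) _.
  by rewrite e; apply: mx_rsim_sym; apply: rsim_irr_comp_pchar.
rewrite /= !inE !negb_or nt !andbT; do ?[apply/andP; split]; exact: ne.
Qed.

Lemma five_all : perm_eq (index_enum sG) five.
Proof.
apply: uniq_perm; rewrite ?index_enum_uniq ?five_uniq // => i; rewrite mem_index_enum.
apply/esym; apply: contraT => ni.
have := sum_irr_degree_pchar sG F'G splitG; rewrite G60 => e.
have : (\sum_(i in five) irr_degree i ^ 2 = 60)%N.
  rewrite -big_uniq ?five_uniq //= !big_cons big_nil.
  by rewrite !irr_degree_comp.
move: e; rewrite (bigID (mem five)) /= => + e5.
rewrite e5 [X in (60 + X)%N](bigD1 i) //= => /eqP; rewrite -[X in _ == X]addn0 eqn_add2l addn_eq0.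
by rewrite expn_eq0 /= -leqn0 leqNgt irr_degree_gt0.
Qed.

Lemma five_faithful0 a : (a \in FG)%MS -> gring_op r1 a = 0 -> gring_op r4 a = 0 ->
  gring_op r5 a = 0 -> gring_op t1 a = 0 -> gring_op t2 a = 0 -> a = 0.
Proof.
move=> aG a1 a4 a5 at1 at2; rewrite -[a]mul1mx -(Wedderburn_sum_id_pchar sG F'G) mulmx_suml.
have z n (r : mx_representation F G n) : mx_irreducible r -> gring_op r a = 0 ->
    Wedderburn_id (irr_comp sG r) *m a = 0.
  move=> ir e; have idI : (Wedderburn_id (irr_comp sG r) *m a \in Wedderburn_subring (irr_comp sG r))%MS.
    have /andP[_ /mulsmx_subP h] := Wedderburn_ideal (irr_comp sG r).
    by apply: h => //; apply: Wedderburn_id_mem.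
  apply: (regular_op_inj_pchar (sG := sG) F'G ir) => //; first by rewrite inE /= linear0 sub0mx.
  by rewrite gring_opM // e mulmx0 linear0.
rewrite (perm_big _ five_all) big1_seq // => i /andP[_].
rewrite !inE => /or4P[/eqP->|/eqP->|/eqP->|/orP[/eqP->|/eqP->]];
  [exact: z _ _ irr1 a1|exact: z _ _ irr4 a4|exact: z _ _ irr5 a5|exact: z _ _ irrt1 at1|exact: z _ _ irrt2 at2].
Qed.

Lemma five_trace0 a : (a \in FG)%MS -> \tr a = \tr (gring_op r1 a) + \tr (gring_op r4 a) *+ 4 +
  \tr (gring_op r5 a) *+ 5 + \tr (gring_op t1 a) *+ 3 + \tr (gring_op t2 a) *+ 3.
Proof.
elim/mem_envelop_ind.
- move=> g gG; rewrite (mxtrace_regular_pchar sG) // (perm_big _ five_all) /= !big_cons big_nil.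
  have z n (r : mx_representation F G n) : mx_irreducible r ->
     \tr (socle_repr (irr_comp sG r) g) *+ irr_degree (irr_comp sG r) = \tr (gring_op r (regular_repr F G g)) *+ n.
    move=> ir; rewrite irr_degree_comp // gring_opG //; congr (_ *+ _).
    by apply/esym/mxtrace_rsim => //; apply: rsim_irr_comp_pchar.
  by rewrite !z // addr0 mulr1n !addrA.
- move=> k b e; rewrite !linearZ /= e !mulrDr; ring.
- by rewrite !linear0 !mul0rn !addr0.
- move=> b c eb ec; rewrite !linearD /= eb ec; ring.
Qed.
End IrrType.

Lemma five_faithful a : (a \in FG)%MS -> gring_op r1 a = 0 -> gring_op r4 a = 0 ->
  gring_op r5 a = 0 -> gring_op t1 a = 0 -> gring_op t2 a = 0 -> a = 0.
Proof.
(* [socle_exists] provides an [irrType] only towards boolean goals, hence the passage through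
   [asboolP]. *)
move=> aG a1 a4 a5 at1 at2; apply/asboolP/(@socle_exists _ _ G _ (regular_repr F G)) => sG.
exact/asboolP/(five_faithful0 sG).
Qed.

Lemma five_trace a : (a \in FG)%MS -> \tr a = \tr (gring_op r1 a) + \tr (gring_op r4 a) *+ 4 +
  \tr (gring_op r5 a) *+ 5 + \tr (gring_op t1 a) *+ 3 + \tr (gring_op t2 a) *+ 3.
Proof.
move=> aG; apply/asboolP/(@socle_exists _ _ G _ (regular_repr F G)) => sG.
exact/asboolP/(five_trace0 sG).
Qed.

End FiveRepresentations.

Section Averages.
Variables (gT : finGroupType) (G : {group gT}).
Local Notation QG := (group_ring rat G).
Local Notation aG := (regular_repr rat G).

Definition average (M : {set gT}) : 'M[rat]_(gcard G) :=
  #|M|%:R^-1 *: \sum_(g in M) aG g.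

Variables (M N : {group gT}) (MG : M \subset G) (NG : N \subset G) (MN : M \subset N).

Lemma average_mem (H : {group gT}) : H \subset G -> (average H \in QG)%MS.
Proof.
move=> HG; rewrite /average linearZ /= scalemx_sub // linear_sum summx_sub //= => g gH.
exact/envelop_mx_id/(fintype.subsetP HG).
Qed.

Lemma average_gl (H : {group gT}) g : H \subset G -> g \in H -> aG g *m average H = average H.
Proof.
move=> HG gH; have inG x : x \in H -> x \in G by exact: fintype.subsetP HG x.
rewrite -scalemxAr mulmx_sumr; congr (_ *: _).
rewrite [RHS](reindex_inj (mulgI g)) /=; apply: eq_big => x; first by rewrite groupMl.
by move=> xH; rewrite repr_mxM ?inG.
Qed.

Lemma average_gr (H : {group gT}) g : H \subset G -> g \in H -> average H *m aG g = average H.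
Proof.
move=> HG gH; have inG x : x \in H -> x \in G by exact: fintype.subsetP HG x.
rewrite -scalemxAl mulmx_suml; congr (_ *: _).
rewrite [RHS](reindex_inj (mulIg g)) /=; apply: eq_big => x; first by rewrite groupMr.
by move=> xH; rewrite repr_mxM ?inG.
Qed.

Let cN : #|M|%:R != 0 :> rat. Proof. by rewrite pnatr_eq0 -lt0n cardG_gt0. Qed.

Lemma averageMl : average M *m average N = average N.
Proof.
rewrite {1}/average -scalemxAl mulmx_suml (eq_bigr (fun=> average N)) => [|g gM]; last first.
  by rewrite average_gl // (fintype.subsetP MN).
by rewrite sumr_const -scaler_nat scalerA mulVf ?scale1r.
Qed.

Lemma averageMr : average N *m average M = average N.
Proof.
rewrite {2}/average -scalemxAr mulmx_sumr (eq_bigr (fun=> average N)) => [|g gM]; last first.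
  by rewrite average_gr // (fintype.subsetP MN).
by rewrite sumr_const -scaler_nat scalerA mulVf ?scale1r.
Qed.

Lemma average_trace : \tr (average M) = #|G|%:R / #|M|%:R.
Proof.
rewrite /average linearZ /= mulrC linear_sum /=; congr (_ / _).
rewrite (bigD1 1%g) //= mxtrace_regular1 // eqxx muln1 big1 ?addr0 // => g /andP[gM g1].
by rewrite mxtrace_regular1 ?(fintype.subsetP MG) // (negPf g1) muln0.
Qed.

End Averages.

Section A5Representations.
Variables (K : numClosedFieldType).
Local Notation QG := (group_ring rat A5).
Local Notation ratK := (ratr : {rmorphism rat -> K}).
Variables (V : mx_representation rat A5 4) (W : mx_representation rat A5 5)
  (T : mx_representation rat A5 6) (T1 T2 : mx_representation K A5 3).
Hypotheses (V_irr : mx_absolutely_irreducible V) (W_irr : mx_absolutely_irreducible W)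
  (T_irr : mx_irreducible T) (T1_irr : mx_irreducible T1) (T2_irr : mx_irreducible T2)
  (T1_T2 : ~ mx_rsim T1 T2)
  (T_sum : mx_rsim (map_repr ratK T) (direct_sum_repr T1 T2)).
Local Notation r1 := (triv_repr rat A5).
Implicit Types a : 'M[rat]_(gcard A5).

Let charG (F : numDomainType) : pgroup (negn [pchar F]) A5.
Proof. by apply/pgroupP => p _ _; rewrite inE /= pchar_num. Qed.
Let splitK : group_splitting_field K A5 := @group_closure_closed_field K _ A5.
Let irrV : mx_irreducible (map_repr ratK V).
Proof. by apply: mx_abs_irrW; rewrite map_mx_abs_irr. Qed.
Let irrW : mx_irreducible (map_repr ratK W).
Proof. by apply: mx_abs_irrW; rewrite map_mx_abs_irr. Qed.
Let irr1 : mx_irreducible (map_repr ratK r1).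
Proof. by apply: mx_abs_irrW; rewrite map_mx_abs_irr linear_mx_abs_irr. Qed.

Let mapQ a : (a \in QG)%MS -> (map_mx ratK a \in group_ring K A5)%MS.
Proof. by move=> aQ; rewrite -(map_group_ring ratK) -map_mxvec map_submx. Qed.

Lemma opT_eq0 a : (a \in QG)%MS -> gring_op T a = 0 <->
  gring_op T1 (map_mx ratK a) = 0 /\ gring_op T2 (map_mx ratK a) = 0.
Proof.
move=> aQ; have aK := mapQ aQ.
have e : gring_op T a = 0 <-> gring_op (map_repr ratK T) (map_mx ratK a) = 0.
  rewrite -map_gring_op; split=> [->|/eqP]; first by rewrite map_mx0.
  by rewrite map_mx_eq0 => /eqP.
rewrite e; split.
  move=> /(rsim_op_eq0 (mx_rsim_sym T_sum) aK); rewrite dadd_op // => h.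
  have [] := eq_block_mx (etrans h (esym (block_mx0 K 3 3 3 3))).
  by move=> -> _ _ ->.
move=> [e1 e2]; apply: (rsim_op_eq0 T_sum aK); rewrite dadd_op // e1 e2.
exact: block_mx0.
Qed.

Lemma A5_faithful a : (a \in QG)%MS -> gring_op r1 a = 0 -> gring_op V a = 0 ->
  gring_op W a = 0 -> gring_op T a = 0 -> a = 0.
Proof.
move=> aQ a1 aV aW /(opT_eq0 aQ)[aT1 aT2]; apply: (map_mx_inj (f := ratK)); rewrite map_mx0.
apply: (five_faithful splitK (charG K) card_A5 irr1 irrV irrW T1_irr T2_irr T1_T2) => //.
- exact: mapQ.
- by rewrite -map_gring_op a1 map_mx0.
- by rewrite -map_gring_op aV map_mx0.
- by rewrite -map_gring_op aW map_mx0.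
Qed.

Lemma A5_trace a : (a \in QG)%MS -> \tr a = \tr (gring_op r1 a) + \tr (gring_op V a) *+ 4 +
  \tr (gring_op W a) *+ 5 + \tr (gring_op T a) *+ 3.
Proof.
move=> aQ; have aK := mapQ aQ; apply: (fmorph_inj ratK).
rewrite 3!rmorphD 3!rmorphMn /= -!trace_map_mx !map_gring_op.
rewrite (five_trace splitK (charG K) card_A5 irr1 irrV irrW T1_irr T2_irr T1_T2) //.
rewrite (rsim_op_trace T_sum aK) dadd_op // mxtrace_block mulrnDl !addrA //.
Qed.

End A5Representations.

Section A5Blocks.
Variables (K : numClosedFieldType).
Local Notation QG := (group_ring rat A5).
Local Notation ratK := (ratr : {rmorphism rat -> K}).
Variables (V : mx_representation rat A5 4) (W : mx_representation rat A5 5)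
  (T : mx_representation rat A5 6) (T1 T2 : mx_representation K A5 3).
Hypotheses (V_irr : mx_absolutely_irreducible V) (W_irr : mx_absolutely_irreducible W)
  (T_irr : mx_irreducible T) (T1_irr : mx_irreducible T1) (T2_irr : mx_irreducible T2)
  (T1_T2 : ~ mx_rsim T1 T2)
  (T_sum : mx_rsim (map_repr ratK T) (direct_sum_repr T1 T2)).
Local Notation r1 := (triv_repr rat A5).
Local Notation avg M := (average A5 M).
Implicit Types a p q f : 'M[rat]_(gcard A5).

Let faithful := A5_faithful V_irr W_irr T1_irr T2_irr T1_T2 T_sum.
Let trace := A5_trace V_irr W_irr T1_irr T2_irr T1_T2 T_sum.
Let charQ : pgroup (negn [pchar rat]) A5.
Proof. by apply/pgroupP => p _ _; rewrite inE /= pchar_num. Qed.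
Let irrV := mx_abs_irrW V_irr.
Let irrW := mx_abs_irrW W_irr.
Let irr1 := triv_irr rat A5.

Lemma A5_ranks q c k : (q \in QG)%MS -> q *m q = q -> gring_op r1 q = c%:M ->
  \tr q = c + k%:R ->
  k = (\rank (gring_op V q) * 4 + \rank (gring_op W q) * 5 + \rank (gring_op T q) * 3)%N.
Proof.
move=> qQ qq q1; rewrite trace // q1 mxtrace_scalar mulr1n -!addrA => /addrI.
have idem n (r : mx_representation rat A5 n) : \tr (gring_op r q) = (\rank (gring_op r q))%:R.
  by apply: mxtrace_idem; rewrite -gring_opM // qq.
rewrite !idem -!mulrnA -!natrD => /eqP; rewrite eqr_nat => /eqP <-.
by rewrite mulnC; lia.
Qed.

Lemma triv_average (M : {group {perm 'I_5}}) : M \subset A5 -> gring_op r1 (avg M) = 1%:M.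
Proof.
move=> MG; rewrite /average linearZ linear_sum /= (eq_bigr (fun=> 1%:M)) => [|g gM]; last first.
  by rewrite gring_opG ?(fintype.subsetP MG).
rewrite sumr_const -scaler_nat scalerA mulVf ?scale1r //.
by rewrite pnatr_eq0 -lt0n cardG_gt0.
Qed.

(** f is a sum of elements b p a, so a representation over K that kills p kills f. *)
Lemma splits_map_op n (r : mx_representation K A5 n) p m f : (p \in QG)%MS -> splits p m f ->
  gring_op r (map_mx ratK p) = 0 -> gring_op r (map_mx ratK f) = 0.
Proof.
have mapQ a : (a \in QG)%MS -> (map_mx ratK a \in group_ring K A5)%MS.
  by move=> aQ; rewrite -(map_group_ring ratK) -map_mxvec map_submx.
move=> pQ + e; elim: m f => [|m IH] f /=; first by move=> ->; rewrite map_mx0 linear0.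
move=> [f1 [[a [b [aQ bQ ab ba]]] f11 _ _ /IH]]; rewrite map_mxB linearB /=.
have -> : f1 = b *m p *m a by rewrite -ab -f11 -ba !mulmxA.
have z : gring_op r (map_mx ratK (b *m p *m a)) = 0.
  rewrite map_mxM gring_opM ?mapQ // map_mxM gring_opM ?mapQ //.
  by rewrite e mulmx0 mul0mx.
by rewrite z subr0.
Qed.

Section IrrType.
Variable sG : irrType rat A5.
Local Notation block r := (Wedderburn_subring (irr_comp sG r)).
Local Notation bid r := (Wedderburn_id (irr_comp sG r)).

Let comp_degree n (r : mx_representation rat A5 n) : mx_irreducible r ->
  irr_degree (irr_comp sG r) = n.
Proof. exact: irr_degree_comp. Qed.

Lemma bid_other n m (r : mx_representation rat A5 n) (s : mx_representation rat A5 m) :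
  mx_irreducible r -> mx_irreducible s -> n <> m -> gring_op s (bid r) = 0.
Proof.
move=> ir iq nm; apply: (irr_comp'_op0_pchar charQ iq) (Wedderburn_id_mem _).
by apply/eqP => e; apply: nm; rewrite -(comp_degree ir) e comp_degree.
Qed.

Lemma bid_mul0 n m (r : mx_representation rat A5 n) (s : mx_representation rat A5 m) :
  mx_irreducible r -> mx_irreducible s -> n <> m -> bid r *m bid s = 0.
Proof.
move=> ir iq nm; apply: (@Wedderburn_mulmx0 _ _ _ sG (irr_comp sG r) (irr_comp sG s)); rewrite ?Wedderburn_id_mem //.
by apply/eqP => e; apply: nm; rewrite -(comp_degree ir) e comp_degree.
Qed.

Lemma mem_block n (r : mx_representation rat A5 n) q : mx_irreducible r -> (q \in QG)%MS ->
  gring_op r1 q = gring_op r1 (bid r) *m gring_op r1 q ->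
  gring_op V q = gring_op V (bid r) *m gring_op V q ->
  gring_op W q = gring_op W (bid r) *m gring_op W q ->
  gring_op T q = gring_op T (bid r) *m gring_op T q -> (q \in block r)%MS.
Proof.
move=> ir qQ h1 hV hW hT.
have eQ := block_sub (block_id_mem sG r).
suff -> : q = bid r *m q by rewrite block_mulr // block_id_mem.
apply/eqP; rewrite -subr_eq0; apply/eqP/faithful.
- by rewrite group_ring_sub // group_ring_mul.
- by rewrite linearB /= gring_opM // -h1 subrr.
- by rewrite linearB /= gring_opM // -hV subrr.
- by rewrite linearB /= gring_opM // -hW subrr.
- by rewrite linearB /= gring_opM // -hT subrr.
Qed.

Lemma block_rank_gt0 n (r : mx_representation rat A5 n) f : mx_irreducible r ->
  (f \in block r)%MS -> f != 0 -> (0 < \rank (gring_op r f))%N.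
Proof.
move=> ir fI; rewrite lt0n mxrank_eq0; apply: contraNneq.
by move=> /(op_block_inj ir fI) ->.
Qed.

(** An f of rank 1 would be primitive, and the block identity a sum of 6 idempotents equivalent to
    it. Over K the ranks of f on T1 and T2 add up to 1, so f vanishes on one of them; then so would
    the block identity, which acts there as 1. *)
Lemma block_rank_T f : (f \in block T)%MS -> f *m f = f -> f != 0 ->
  (2 <= \rank (gring_op T f))%N.
Proof.
move=> fI ff nf; have f0 := block_rank_gt0 T_irr fI nf.
have fQ := block_sub fI; have eQ := block_sub (block_id_mem sG T).
rewrite ltnNge; apply/negP => f1.
have rf : \rank (gring_op T f) = 1%N by apply/eqP; rewrite eqn_leq f1.
have pf : primitive sG T f.
  by apply: (primitive_of_rank T_irr fI ff rf) => // h hI hh; apply: block_rank_gt0.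
have sp : splits f 6 (bid T).
  apply: (block_splits T_irr pf rf) => //; first exact: block_id_mem.
    exact/block_idl/block_id_mem.
  by rewrite op_block_id // mxrank1.
have fK : (map_mx ratK f \in group_ring K A5)%MS.
  by rewrite -(map_group_ring ratK) -map_mxvec map_submx.
have idem (r : mx_representation K A5 3) : \tr (gring_op r (map_mx ratK f)) = (\rank (gring_op r (map_mx ratK f)))%:R.
  by apply: mxtrace_idem; rewrite -gring_opM // -map_mxM ff.
have := rsim_op_trace T_sum fK; rewrite dadd_op // mxtrace_block !idem -map_gring_op trace_map_mx.
rewrite mxtrace_idem -?gring_opM ?ff // rf rmorph1 -natrD => /eqP.
rewrite -[1]/(1%:R) eqr_nat => /eqP r12.
have [e1 e2] : gring_op T1 (map_mx ratK (1%:M - bid T)) = 0 /\ gring_op T2 (map_mx ratK (1%:M - bid T)) = 0.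
  apply/(opT_eq0 T_sum); first by rewrite group_ring_sub ?envelop_mx1.
  by rewrite linearB /= gring_op1 op_block_id ?subrr.
have kill (r : mx_representation K A5 3) : gring_op r (map_mx ratK (1%:M - bid T)) = 0 ->
    \rank (gring_op r (map_mx ratK f)) <> 0%N.
  move=> er /eqP; rewrite mxrank_eq0 => /eqP z.
  have eb := splits_map_op fQ sp z.
  move: er; rewrite map_mxB map_mx1 linearB /= gring_op1 eb subr0 => /eqP.
  by rewrite -mxrank_eq0 mxrank1.
by move: r12 (kill _ e1) (kill _ e2); clear; lia.
Qed.

Section Factor.
Variables (n s k : nat) (r : mx_representation rat A5 n) (irr : mx_irreducible r).
Variables (q : 'M[rat]_(gcard A5)).
Hypotheses (qI : (q \in block r)%MS) (qq : q *m q = q) (rq : \rank (gring_op r q) = s).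
Hypotheses (s0 : (0 < s)%N) (nE : n = (k * s)%N).
Hypothesis min : forall f, (f \in block r)%MS -> f *m f = f -> f != 0 ->
  (s <= \rank (gring_op r f))%N.

Lemma factor_splits (I : 'A[rat]_(gcard A5)) p : simple_factor_of r I ->
  primitive_idempotent I p -> [/\ (p \in QG)%MS, p *m p = p, equiv_idem p q & splits p k (bid r)].
Proof.
move=> sI pI; have IR := simple_factor_block sG irr sI.
have pp : primitive sG r p := eq_primitive_idempotent IR pI.
have pq := primitive_of_rank irr qI qq rq s0 min.
have [pB _ p2 _] := pp; have e := primitive_equiv irr pp pq; split=> //; first exact: block_sub pB.
apply: (block_splits irr pp _ s0); rewrite ?block_id_mem ?block_idl ?block_id_mem //.
  by rewrite -rq; apply: rank_equiv; rewrite ?(block_sub pB) ?(block_sub qI).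
by rewrite op_block_id // mxrank1.
Qed.
End Factor.

(** By [A5_ranks] with k = 0 the average over A5 vanishes on V, W and T. The identities are then
    checked in the four representations, which are jointly faithful. *)
Lemma A5_unit : [/\ avg A5 + (bid V + bid W + bid T) = 1%:M,
  forall n (r : mx_representation rat A5 n), mx_irreducible r -> n <> 1%N -> avg A5 *m bid r = 0 &
  forall n (r : mx_representation rat A5 n), mx_irreducible r -> n <> 1%N -> bid r *m avg A5 = 0].
Proof.
have GG := fintype.subxx A5.
have aQ : (avg A5 \in QG)%MS := average_mem GG.
have aa : avg A5 *m avg A5 = avg A5 := averageMl GG GG.
have a1 := triv_average GG.
have [aV aW aT] : [/\ gring_op V (avg A5) = 0, gring_op W (avg A5) = 0 & gring_op T (avg A5) = 0].
  have := A5_ranks (k := 0%N) aQ aa a1; rewrite average_trace // addr0 divff ?pnatr_eq0 ?card_A5 // => /(_ erefl)/esym/eqP.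
  by rewrite !addn_eq0 !muln_eq0 !mxrank_eq0 !orbF => /andP[/andP[/eqP-> /eqP->] /eqP->].
have bQ n (r : mx_representation rat A5 n) : (bid r \in QG)%MS := block_sub (block_id_mem sG r).
have zero n (r : mx_representation rat A5 n) : mx_irreducible r -> n <> 1%N ->
    avg A5 *m bid r = 0 /\ bid r *m avg A5 = 0.
  move=> ir n1; have e1 := bid_other ir irr1 n1.
  split; apply: faithful; rewrite ?group_ring_mul //= gring_opM // ?aV ?aW ?aT ?mul0mx ?mulmx0 //.
    by rewrite e1 mulmx0.
  by rewrite e1 mul0mx.
split=> [|n r ir n1|n r ir n1]; try by have [] := zero n r ir n1.
have opE n (r : mx_representation rat A5 n) A B C D : gring_op r (avg A5) = A ->
    gring_op r (bid V) = B -> gring_op r (bid W) = C -> gring_op r (bid T) = D ->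
    A + (B + C + D) = 1%:M -> gring_op r (avg A5 + (bid V + bid W + bid T) - 1%:M) = 0.
  by move=> <- <- <- <- e; rewrite linearB !linearD /= gring_op1 e subrr.
apply/eqP; rewrite -subr_eq0; apply/eqP/faithful.
- by rewrite group_ring_sub ?envelop_mx1 // linearD /= addmx_sub // !linearD /= !addmx_sub.
- have [eV eW eT] := And3 (bid_other irrV irr1 (ltac:(by []) : 4 <> 1 :> nat)) (bid_other irrW irr1 (ltac:(by []) : 5 <> 1 :> nat)) (bid_other T_irr irr1 (ltac:(by []) : 6 <> 1 :> nat)).
  by apply: opE a1 eV eW eT _; rewrite ?addr0 ?add0r ?addr0.
- have [eV eW eT] := And3 (op_block_id sG irrV) (bid_other irrW irrV (ltac:(by []) : 5 <> 4 :> nat)) (bid_other T_irr irrV (ltac:(by []) : 6 <> 4 :> nat)).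
  by apply: opE aV eV eW eT _; rewrite ?addr0 ?add0r ?addr0.
- have [eV eW eT] := And3 (bid_other irrV irrW (ltac:(by []) : 4 <> 5 :> nat)) (op_block_id sG irrW) (bid_other T_irr irrW (ltac:(by []) : 6 <> 5 :> nat)).
  by apply: opE aW eV eW eT _; rewrite ?addr0 ?add0r ?addr0.
- have [eV eW eT] := And3 (bid_other irrV T_irr (ltac:(by []) : 4 <> 6 :> nat)) (bid_other irrW T_irr (ltac:(by []) : 5 <> 6 :> nat)) (op_block_id sG T_irr).
  by apply: opE aT eV eW eT _; rewrite ?addr0 ?add0r ?addr0.
Qed.

Section Difference.
Variables (M N : {group {perm 'I_5}}) (NG : N \subset A5) (MN : M \subset N).
Let MG := fintype.subset_trans MN NG.
Local Notation q := (avg M - avg N).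

Lemma difference_mem : (q \in QG)%MS.
Proof. by rewrite group_ring_sub ?average_mem. Qed.

Lemma difference_idem : q *m q = q.
Proof.
have MM := averageMl MG (fintype.subxx M); have NN := averageMl NG (fintype.subxx N).
by rewrite mulmxBl !mulmxBr MM NN averageMl ?averageMr // subrr subr0.
Qed.

Lemma difference_triv : gring_op r1 q = 0.
Proof. by rewrite linearB /= !triv_average // subrr. Qed.

Lemma difference_ranks k : (60 %/ #|M| = 60 %/ #|N| + k)%N -> (#|M| %| 60)%N -> (#|N| %| 60)%N ->
  k = (\rank (gring_op V q) * 4 + \rank (gring_op W q) * 5 + \rank (gring_op T q) * 3)%N.
Proof.
move=> e dM dN; apply: (A5_ranks (c := 0)); rewrite ?difference_mem ?difference_idem //.
  by rewrite difference_triv raddf0.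
have tr (H : {group {perm 'I_5}}) : H \subset A5 -> (#|H| %| 60)%N -> \tr (avg H) = (60 %/ #|H|)%:R.
  move=> HG dH; rewrite average_trace // card_A5; apply: (mulIf (x := #|H|%:R)).
    by rewrite pnatr_eq0 -lt0n cardG_gt0.
  by rewrite divfK -?natrM ?divnK // pnatr_eq0 -lt0n cardG_gt0.
by rewrite linearB /= !tr // e natrD addrC addKr add0r.
Qed.
End Difference.

Lemma A5_decomposition0 (IV IW IT : 'A[rat]_(gcard A5)) pV pW pT :
  simple_factor_of V IV -> primitive_idempotent IV pV ->
  simple_factor_of W IW -> primitive_idempotent IW pW ->
  simple_factor_of T IT -> primitive_idempotent IT pT ->
  [/\ [/\ (pV \in QG)%MS, (pW \in QG)%MS & (pT \in QG)%MS],
     [/\ pV *m pV = pV, pW *m pW = pW & pT *m pT = pT],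
     [/\ equiv_idem pV (avg A4 - avg A5), equiv_idem pW (avg D5 - avg A5) &
       equiv_idem pT (avg Z5 - avg D5)] &
   exists fV fW fT,
   [/\ [/\ splits pV 4 fV, splits pW 5 fW & splits pT 3 fT],
       [/\ (fV \in QG)%MS, (fW \in QG)%MS & (fT \in QG)%MS],
       [/\ fV *m fV = fV, fW *m fW = fW & fT *m fT = fT],
       [/\ fV *m fW = 0, fV *m fT = 0, fW *m fT = 0, fW *m fV = 0 & (fT *m fV = 0 /\ fT *m fW = 0)] &
       [/\ avg A5 + (fV + (fW + fT)) = 1%:M,
         avg A5 *m fV = 0 /\ fV *m avg A5 = 0, avg A5 *m fW = 0 /\ fW *m avg A5 = 0
         & avg A5 *m fT = 0 /\ fT *m avg A5 = 0]]].
Proof.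
move=> sV PV sW PW sT PT.
have [unit al ar] := A5_unit.
have GG := fintype.subxx A5.
have A45 : A4 \subset A5 := A4_A5; have D55 : D5 \subset A5 := D5_A5.
have ZD : Z5 \subset D5 := Z5_D5.
pose qV := avg A4 - avg A5; pose qW := avg D5 - avg A5; pose qT := avg Z5 - avg D5.
have rank0 n (r : mx_representation rat A5 n) a : \rank (gring_op r a) = 0%N -> gring_op r a = 0.
  by move/eqP; rewrite mxrank_eq0 => /eqP.
(* The traces 4, 5 and 6 used for the three differences are 60/12 - 60/60, 60/10 - 60/60 and 60/5 -
   60/10. *)
have [V1 V2 V3] : [/\ \rank (gring_op V qV) = 1%N, gring_op W qV = 0 & gring_op T qV = 0].
  have := @difference_ranks A4_group A5 GG A45 4; rewrite /= card_A4 card_A5 => /(_ erefl erefl erefl) e.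
  by split; [|apply: rank0|apply: rank0]; move: e; rewrite -/qV; clear; lia.
have [W1 W2 W3] : [/\ \rank (gring_op W qW) = 1%N, gring_op V qW = 0 & gring_op T qW = 0].
  have := @difference_ranks D5_group A5 GG D55 5; rewrite /= card_D5 card_A5 => /(_ erefl erefl erefl) e.
  by split; [|apply: rank0|apply: rank0]; move: e; rewrite -/qW; clear; lia.
have [t1 t2 t3] : [/\ \rank (gring_op T qT) = 2%N, gring_op V qT = 0 & gring_op W qT = 0].
  have := @difference_ranks Z5_group D5_group D55 ZD 6; rewrite /= card_Z5 card_D5 => /(_ erefl erefl erefl) e.
  by split; [|apply: rank0|apply: rank0]; move: e; rewrite -/qT; clear; lia.
have qVB : (qV \in block V)%MS.
  apply: (mem_block irrV); rewrite ?(difference_mem GG A45) ?(difference_triv GG A45) ?V2 ?V3 ?mulmx0 //.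
  by rewrite op_block_id // mul1mx.
have qWB : (qW \in block W)%MS.
  apply: (mem_block irrW); rewrite ?(difference_mem GG D55) ?(difference_triv GG D55) ?W2 ?W3 ?mulmx0 //.
  by rewrite op_block_id // mul1mx.
have qTB : (qT \in block T)%MS.
  apply: (mem_block T_irr); rewrite ?(difference_mem D55 ZD) ?(difference_triv D55 ZD) ?t2 ?t3 ?mulmx0 //.
  by rewrite op_block_id // mul1mx.
have [pVQ pV2 eV splV] := @factor_splits 4 1 4 V irrV qV qVB (difference_idem GG A45) V1 isT erefl
  (fun f fI _ nf => block_rank_gt0 irrV fI nf) IV pV sV PV.
have [pWQ pW2 eW splW] := @factor_splits 5 1 5 W irrW qW qWB (difference_idem GG D55) W1 isT erefl
  (fun f fI _ nf => block_rank_gt0 irrW fI nf) IW pW sW PW.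
have [pTQ pT2 eT splT] := @factor_splits 6 2 3 T T_irr qT qTB (difference_idem D55 ZD) t1 isT erefl
  block_rank_T IT pT sT PT.
have bQ n (r : mx_representation rat A5 n) : (bid r \in QG)%MS := block_sub (block_id_mem sG r).
have bb n (r : mx_representation rat A5 n) : bid r *m bid r = bid r := block_idl (block_id_mem sG r).
split; [by []|by []|by []|exists (bid V), (bid W), (bid T)].
split; [by []|by []|by split; apply: bb| |].
  by split; [apply: bid_mul0 irrV irrW _|apply: bid_mul0 irrV T_irr _|apply: bid_mul0 irrW T_irr _|
    apply: bid_mul0 irrW irrV _|split; [apply: bid_mul0 T_irr irrV _|apply: bid_mul0 T_irr irrW _]].
by split; [exact: etrans (congr1 (+%R (avg A5)) (addrA _ _ _)) unit|split; [apply: al irrV _|apply: ar irrV _]|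
  split; [apply: al irrW _|apply: ar irrW _]|split; [apply: al T_irr _|apply: ar T_irr _]].
Qed.

End IrrType.

Lemma A5_decomposition (IV IW IT : 'A[rat]_(gcard A5)) pV pW pT :
  simple_factor_of V IV -> primitive_idempotent IV pV ->
  simple_factor_of W IW -> primitive_idempotent IW pW ->
  simple_factor_of T IT -> primitive_idempotent IT pT ->
  [/\ [/\ (pV \in QG)%MS, (pW \in QG)%MS & (pT \in QG)%MS],
     [/\ pV *m pV = pV, pW *m pW = pW & pT *m pT = pT],
     [/\ equiv_idem pV (avg A4 - avg A5), equiv_idem pW (avg D5 - avg A5) &
       equiv_idem pT (avg Z5 - avg D5)] &
   exists fV fW fT,
   [/\ [/\ splits pV 4 fV, splits pW 5 fW & splits pT 3 fT],
       [/\ (fV \in QG)%MS, (fW \in QG)%MS & (fT \in QG)%MS],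
       [/\ fV *m fV = fV, fW *m fW = fW & fT *m fT = fT],
       [/\ fV *m fW = 0, fV *m fT = 0, fW *m fT = 0, fW *m fV = 0 & (fT *m fV = 0 /\ fT *m fW = 0)] &
       [/\ avg A5 + (fV + (fW + fT)) = 1%:M,
         avg A5 *m fV = 0 /\ fV *m avg A5 = 0, avg A5 *m fW = 0 /\ fW *m avg A5 = 0
         & avg A5 *m fT = 0 /\ fT *m avg A5 = 0]]].
Proof.
move=> sV PV sW PW sT PT; apply/asboolP/(@socle_exists _ _ A5 _ (regular_repr rat A5)) => sG.
exact/asboolP/(A5_decomposition0 sG sV PV sW PW sT PT).
Qed.

End A5Blocks.

(** * Action of the group algebra on the Jacobian *)

Section GroupRingCoefficients.
Variables (gT : finGroupType) (G : {group gT}).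
Local Notation QG := (group_ring rat G).
Local Notation aG := (regular_repr rat G).

Definition integral_element (z : gT -> int) : 'M[rat]_(gcard G) :=
  \sum_(g in G) (z g)%:~R *: aG g.

Lemma integral_element_inj z z' : integral_element z = integral_element z' ->
  {in G, z =1 z'}.
Proof.
have coef w g : g \in G -> gring_proj g (integral_element w) = ((w g)%:~R : rat)%:M.
  move=> gG; rewrite linear_sum (bigD1 g) //= big1 ?addr0 => [|h /andP[hG hg]].
    by rewrite linearZ /= gring_projE // eqxx scalemx1.
  by rewrite linearZ /= gring_projE // eq_sym (negPf hg) scaler0.
move=> e g gG; have := coef z g gG; rewrite e coef // => /matrixP/(_ 0 0)/eqP; rewrite !mxE !mulr1n.
by rewrite eqr_int => /eqP.
Qed.

Lemma gring_coefE (a : 'M[rat]_(gcard G)) : (a \in QG)%MS ->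
  a = \sum_(g in G) gring_coef a g *: aG g.
Proof.
move=> aQ; rewrite -[LHS](gring_rowK aQ) /gring_mx /= mulmx_sum_row linear_sum /=.
rewrite [RHS](reindex (@enum_val _ (mem G))) /=; last first.
  by exists (gring_index G) => [i _|g gG]; [exact: gring_valK|exact: gring_indexK].
apply: eq_big => i; first by rewrite enum_valP.
by move=> _; rewrite linearZ /= rowK mxvecK /gring_coef gring_valK.
Qed.

Lemma integral_multiple (a : 'M[rat]_(gcard G)) : (a \in QG)%MS ->
  exists2 m : nat, (0 < m)%N & exists z, integral_element z = m%:R *: a.
Proof.
move=> aQ; pose d g := `|denq (gring_coef a g)|%N.
have d0 g : (0 < d g)%N by rewrite absz_gt0 denq_neq0.
pose m := (\prod_(g in G) d g)%N.
exists m; first by rewrite prodn_gt0.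
exists (fun g => numq (gring_coef a g) * (m %/ d g)%:Z).
rewrite [in RHS](gring_coefE aQ) scaler_sumr; apply: eq_bigr => g gG; rewrite scalerA; congr (_ *: _).
have dm : (d g %| m)%N by rewrite /m (bigD1 g) //= dvdn_mulr.
rewrite rmorphM /= -[X in _ = _ * X]divq_num_den -[in RHS](divnK dm) natrM.
have -> : (denq (gring_coef a g))%:~R = (d g)%:R :> rat.
  by rewrite /d -[RHS]/((d g)%:Z%:~R) abszE ger0_norm // ltW ?denq_gt0.
have : (d g)%:R != 0 :> rat by rewrite pnatr_eq0 -lt0n.
rewrite -pmulrn => h; field.
  by [].
Qed.

End GroupRingCoefficients.

Section JacobianAction.
Variable K : closedFieldType.
Hypothesis uncK : ~ countable [set: K].
Hypothesis char0 : forall m, m.+1%:R != 0 :> K.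
Variables (X : fun_space K) (nX : nice X) (iX : irrset [set: X]).
Hypothesis twoX : exists x y : X, x <> y.
Hypothesis unifX : forall x : X, exists t, uniformizer x t.
Variables (gT : finGroupType) (act : gT -> X -> X) (G : {group gT}).
Hypothesis actG : faithful_action act G.
Let gX : good X := nice_good nX.
Variable JX : jacobian X.
Local Notation QG := (group_ring rat G).
Local Notation aG := (regular_repr rat G).
Local Notation J := (gspace JX).
Let abJ := jac_abelian JX.
Let gJ : good J := ab_good uncK abJ.
Local Notation rhoG := (@rho K gT X act JX G).
Local Notation phi g := (Nm JX (act g)).

Lemma quotient_ppr (Z Y : fun_space K) (p : X -> Z) (q : X -> Y) (r : Z -> Y) (M N : {group gT}) :
  quotient_map act G p M -> quotient_map act G q N -> M \subset N ->
  (forall x, r (p x) = q x) -> preserves_principal r.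
Proof. by move=> qp qq MN rp D; apply: (principal_push char0 nX iX twoX unifX actG qp qq MN rp). Qed.

Lemma id_quotient_map : quotient_map act G (act 1%g) 1%G.
Proof. exact: act_quotient_map. Qed.

Lemma from_X_ppr (Y : fun_space K) (q : X -> Y) (N : {group gT}) :
  quotient_map act G q N -> preserves_principal q.
Proof.
by move=> qq; apply: (quotient_ppr id_quotient_map qq (sub1G N)) => x; rewrite (act_id actG).
Qed.

Lemma act_ppr g : g \in G -> preserves_principal (act g).
Proof. by move=> gG; apply: (from_X_ppr (N := 1%G)); apply: act_quotient_map. Qed.

Lemma phiD g (a b : JX) : g \in G -> phi g (a + b) = phi g a + phi g b.
Proof. by move=> gG; rewrite NmD //; apply: act_ppr. Qed.

Lemma phiM g h (a : JX) : g \in G -> h \in G -> phi g (phi h a) = phi (g * h)%g a.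
Proof.
by move=> gG hG; apply: Nm_comp; [exact: act_ppr|move=> x /=; rewrite (act_mul actG)].
Qed.

Lemma phi1 (a : JX) : phi 1%g a = a.
Proof. by apply: Nm_id => x; rewrite (act_id actG). Qed.

Lemma additive0 (A B : zmodType) (f : A -> B) : (forall x y, f (x + y) = f x + f y) -> f 0 = 0.
Proof. by move=> fD; apply: (@addrI _ (f 0)); rewrite -fD !addr0. Qed.

Lemma additiveN (A B : zmodType) (f : A -> B) x : (forall x y, f (x + y) = f x + f y) -> f (- x) = - f x.
Proof. by move=> fD; apply/eqP; rewrite -addr_eq0 -fD addNr (additive0 fD). Qed.

Lemma additive_muln (A B : zmodType) (f : A -> B) x n : (forall x y, f (x + y) = f x + f y) ->
  f (x *+ n) = f x *+ n.
Proof. by move=> fD; elim: n => [|n IH]; rewrite ?(additive0 fD) // !mulrS fD IH. Qed.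

Lemma additive_mulz (A B : zmodType) (f : A -> B) x (n : int) : (forall x y, f (x + y) = f x + f y) ->
  f (x *~ n) = f x *~ n.
Proof.
move=> fD; case: n => n; first exact: additive_muln.
by rewrite NegzE !mulrNz (additiveN _ fD) -!pmulrn additive_muln.
Qed.

Lemma additive_sum (A B : zmodType) (f : A -> B) (I : Type) (s : seq I) (P : pred I) (F : I -> A) :
  (forall x y, f (x + y) = f x + f y) ->
  f (\sum_(i <- s | P i) F i) = \sum_(i <- s | P i) f (F i).
Proof. by move=> fD; apply: (big_morph f fD (additive0 fD)). Qed.

Lemma rhoD z (a b : JX) : rhoG z (a + b) = rhoG z a + rhoG z b.
Proof. by rewrite /rho -big_split; apply: eq_bigr => g gG; rewrite phiD // mulrzDl. Qed.

Lemma phi_morph g (a : J) : g \in G -> morph_at (phi g : J -> J) a.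
Proof.
move=> gG; apply: (Nm_morph uncK char0 JX gX (nice_complete nX) iX gX) => [x|].
  exact: (act_morph nX actG).
exact: act_ppr.
Qed.

Lemma rho_morph z (a : J) : morph_at (rhoG z : J -> J) a.
Proof.
apply: (ab_summ uncK abJ gJ) => g gG; apply: (ab_mulzm uncK abJ gJ); exact: phi_morph.
Qed.

(** Q[G] acts on JX only up to denominators. [realizes_unique] turns an equality of integral
    elements of the algebra into an equality of maps. *)
Definition realizes (a : 'M[rat]_(gcard G)) (f : JX -> JX) :=
  exists2 z, a = integral_element G z & f =1 rhoG z.

Lemma realizes_unique a f f' : realizes a f -> realizes a f' -> f =1 f'.
Proof.
move=> [z -> fz] [z' /integral_element_inj zz fz'] x; rewrite fz fz'.
by apply: eq_bigr => g gG; rewrite zz.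
Qed.

Lemma realizes_eq a b f : a = b -> realizes a f -> realizes b f.
Proof. by move=> ->. Qed.

Lemma realizes_D a b f h : realizes a f -> realizes b h -> realizes (a + b) (fun x => f x + h x).
Proof.
move=> [z -> fz] [w -> hw]; exists (fun g => z g + w g) => [|x].
  by rewrite /integral_element -big_split; apply: eq_bigr => g _; rewrite rmorphD scalerDl.
by rewrite fz hw /rho -big_split; apply: eq_bigr => g _; rewrite mulrzDr.
Qed.

Lemma realizes_muln a f m : realizes a f -> realizes (m%:R *: a) (fun x => f x *+ m).
Proof.
move=> [z -> fz]; exists (fun g => z g *+ m) => [|x].
  by rewrite /integral_element scaler_sumr; apply: eq_bigr => g _; rewrite scalerA rmorphMn /= mulr_natl.
by rewrite fz /rho -sumrMnl; apply: eq_bigr => g _; rewrite -[z g *+ m]mulr_natr natz mulrzA -pmulrn.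
Qed.

Lemma realizes_gen g : g \in G -> realizes (aG g) (phi g).
Proof.
move=> gG; exists (fun h => (h == g)%:Z) => [|x].
  rewrite /integral_element (bigD1 g) //= eqxx scale1r big1 ?addr0 // => h /andP[_ /negPf->].
  by rewrite scale0r.
rewrite /rho (bigD1 g) //= eqxx mulr1z big1 ?addr0 // => h /andP[_ /negPf->].
by rewrite mulr0z.
Qed.

Lemma realizes_1 : realizes 1%:M id.
Proof.
have [z e h] := realizes_gen (group1 G); exists z; first by rewrite -e repr_mx1.
by move=> x; rewrite -h phi1.
Qed.

Lemma realizes_0 : realizes 0 (fun=> 0).
Proof.
exists (fun=> 0) => [|x]; first by rewrite /integral_element big1 // => g _; rewrite scale0r.
by rewrite /rho big1 // => g _; rewrite mulr0z.
Qed.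

Lemma realizes_M a b f h : realizes a f -> realizes b h -> realizes (a *m b) (f \o h).
Proof.
move=> [z -> fz] [w -> hw].
exists (fun k => \sum_(g in G) z g * w (g^-1 * k)%g) => [|x].
  rewrite /integral_element mulmx_suml.
  under [RHS]eq_bigr => k _ do rewrite rmorph_sum scaler_suml.
  rewrite exchange_big; apply: eq_bigr => g gG /=.
  rewrite mulmx_sumr [RHS](reindex_inj (mulgI g)) /=; apply: eq_big => k; first by rewrite groupMl.
  by move=> kG; rewrite mulKg rmorphM /= -scalemxAl -scalemxAr scalerA repr_mxM.
rewrite /= hw fz /rho.
under [RHS]eq_bigr => k _ do rewrite mulrz_sumr.
rewrite exchange_big; apply: eq_bigr => g gG /=.
have pD (u v : JX) : phi g (u + v) = phi g u + phi g v by apply: phiD.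
rewrite (additive_sum _ _ _ pD) mulrz_suml [RHS](reindex_inj (mulgI g)) /=.
apply: eq_big => k; first by rewrite groupMl.
by move=> kG; rewrite mulKg (additive_mulz _ _ pD) phiM // -mulrzA mulrC.
Qed.

Lemma realizes_additive a f : realizes a f -> forall x y, f (x + y) = f x + f y.
Proof. by move=> [z _ fz] x y; rewrite !fz rhoD. Qed.

Lemma realizes_morph a f : realizes a f -> forall x, morph_at (f : J -> J) x.
Proof.
move=> [z _ fz] x; apply: (morph_at_eq gJ (rho_morph z x)).
by apply: nearT => // y; rewrite fz.
Qed.

Lemma realizes_exists a : (a \in QG)%MS -> exists2 m, (0 < m)%N & exists f, realizes (m%:R *: a) f.
Proof.
by move=> /integral_multiple[m m0 [z e]]; exists m => //; exists (rhoG z), z.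
Qed.

Lemma realizes_average (M : {group gT}) : M \subset G ->
  realizes (#|M|%:R *: average G M) (fun x => \sum_(g in M) phi g x).
Proof.
move=> MG; rewrite /average scalerA divff ?scale1r; last by rewrite pnatr_eq0 -lt0n cardG_gt0.
suff h (s : seq gT) : {subset s <= G} -> realizes (\sum_(g <- s) aG g) (fun x => \sum_(g <- s) phi g x).
  rewrite -big_enum /=; have [g|z e1 e2] := h (enum M).
    by rewrite mem_enum; apply: (fintype.subsetP MG).
  by exists z => // x; rewrite -e2 -big_enum.
elim: s => [|g s IH] sG.
  have [z e1 e2] := realizes_0; exists z; first by rewrite big_nil.
  by move=> x; rewrite big_nil -e2.
have gG : g \in G by apply: sG; rewrite inE eqxx.
have sG' : {subset s <= G} by move=> k ks; apply: sG; rewrite inE ks orbT.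
have [z e1 e2] := realizes_D (realizes_gen gG) (IH sG'); exists z; first by rewrite big_cons.
by move=> x; rewrite big_cons -e2.
Qed.

End JacobianAction.

Section Isogenies.
Variable K : closedFieldType.
Hypothesis uncK : ~ countable [set: K].
Hypothesis char0 : forall m, m.+1%:R != 0 :> K.

Lemma isogenous_restrict (A B : subgroup_space K) (f : ambient A -> ambient B) (s : seq (ambient A)) :
  good (gspace (ambient A)) -> good (gspace (ambient B)) ->
  (forall x y, f (x + y) = f x + f y) ->
  (forall x, morph_at (f : gspace (ambient A) -> gspace (ambient B)) x) ->
  (forall x, supp x -> supp (f x)) ->
  (forall y, supp y -> exists x, supp x /\ f x = y) ->
  (forall x, supp x -> f x = 0 -> x \in s) -> isogenous A B.
Proof.
move=> gA gB fD fm fS fs fk.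
pose F (x : sspace A) : sspace B := SigSub (mem_set (fS (elt x) (set_mem (valP x)))).
have gsA : good (sspace A) := sub_good gA (@supp K A).
have gsB : good (sspace B) := sub_good gB (@supp K B).
exists F; split.
- apply/(morphismP F gsA gsB) => x; apply: (sub_morph gB gsA).
  by apply: (morph_at_comp (sub_val_morph gA x)); apply: fm.
- by move=> x y z e; rewrite /elt /= -fD -e.
- move=> y; have [x [sx fx]] := fs (elt y) (set_mem (valP y)).
  by exists (SigSub (mem_set sx)); apply: val_inj.
- have fin : finite_set [set` s] by exact: finite_seq.
  apply: sub_finite_set (finite_preimage (f := fun x : sspace A => elt x) _ fin).
    by move=> x /= e; apply: fk; [exact: set_mem (valP x)|exact: e].
  by move=> x y _ _; apply: val_inj.
Qed.
End Isogenies.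

Section Pieces.
Variable K : closedFieldType.
Hypothesis uncK : ~ countable [set: K].
Hypothesis char0 : forall m, m.+1%:R != 0 :> K.
Variables (X : fun_space K) (nX : nice X) (iX : irrset [set: X]).
Hypothesis twoX : exists x y : X, x <> y.
Hypothesis unifX : forall x : X, exists t, uniformizer x t.
Variables (gT : finGroupType) (act : gT -> X -> X) (G : {group gT}).
Hypothesis actG : faithful_action act G.
Let gX : good X := nice_good nX.
Variable JX : jacobian X.
Local Notation QG := (group_ring rat G).
Local Notation J := (gspace JX).
Let abJ := jac_abelian JX.
Let gJ : good J := ab_good uncK abJ.
Local Notation rhoG := (@rho K gT X act JX G).
Local Notation phi g := (Nm JX (act g)).
Local Notation realizes := (@realizes K X gT act G JX).

Let radd a f (r : realizes a f) : forall x y, f (x + y) = f x + f y :=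
  realizes_additive char0 nX iX twoX unifX actG r.
Let rM a b f h (ra : realizes a f) (rb : realizes b h) : realizes (a *m b) (f \o h) :=
  realizes_M char0 nX iX twoX unifX actG ra rb.

Lemma pair_muln (A B : zmodType) (a : A) (b : B) n : (a *+ n, b *+ n) = ((a, b) : (A * B)%type) *+ n.
Proof. by elim: n => // n IH; rewrite !mulrS -IH. Qed.

Definition subgroup_divisible (B : subgroup_space K) := forall n (b : ambient B),
  (0 < n)%N -> supp b -> exists b', supp b' /\ b' *+ n = b.

(* B is, up to isogeny, the direct summand of JX cut out by the idempotent e *)
Definition piece (B : subgroup_space K) (e : 'M[rat]_(gcard G)) := exists
  (alpha : JX -> ambient B) (sigma : ambient B -> JX) (m : nat) (f : JX -> JX),
  [/\ [/\ (0 < m)%N, realizes (m%:R *: e) f & forall x, sigma (alpha x) = f x],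
      [/\ forall x y, alpha (x + y) = alpha x + alpha y,
        forall x, morph_at (alpha : J -> gspace (ambient B)) x & forall x, supp (alpha x)],
      forall b, supp b -> alpha (sigma b) = b *+ m,
      good (gspace (ambient B)) & subgroup_divisible B].

(** By divisibility of B2 and JX, s2 b is m1 times some f2 u. So a1 (s2 b) = m1 a1 (f2 u) = a1 (s1
    (a1 (f2 u))) = a1 (f1 (f2 u)), and f1 f2 = 0. *)
Lemma piece_orthogonal (B1 B2 : subgroup_space K) e1 e2 (a1 : JX -> ambient B1) (s1 : ambient B1 -> JX) m1 f1
  (a2 : JX -> ambient B2) (s2 : ambient B2 -> JX) m2 f2 : (0 < m1)%N -> (0 < m2)%N ->
  realizes (m1%:R *: e1) f1 -> realizes (m2%:R *: e2) f2 ->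
  (forall x, s1 (a1 x) = f1 x) -> (forall x, s2 (a2 x) = f2 x) ->
  (forall x y, a1 (x + y) = a1 x + a1 y) -> (forall x, supp (a1 x)) ->
  (forall b, supp b -> a1 (s1 b) = b *+ m1) -> (forall b, supp b -> a2 (s2 b) = b *+ m2) ->
  subgroup_divisible B2 -> e1 *m e2 = 0 ->
  forall b, supp b -> a1 (s2 b) = 0.
Proof.
move=> m10 m20 r1 r2 sa1 sa2 aD aS as1 as2 div e12 b sb.
have [b' [sb' bb]] := div _ _ m20 sb.
have [u uE] := divisible uncK char0 abJ (s2 b') m10.
have -> : s2 b = f2 u *+ m1.
  by rewrite -(additive_muln _ _ (radd r2)) uE -sa2 as2 // bb.
rewrite (additive_muln _ _ aD) -as1 // sa1.
have z : f1 (f2 u) = 0.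
  have r12 := rM r1 r2.
  have e0 : m1%:R *: e1 *m (m2%:R *: e2) = 0 by rewrite -scalemxAl -scalemxAr e12 !scaler0.
  exact: (realizes_unique (realizes_eq e0 r12) (realizes_0 act G JX)).
by rewrite z (additive0 aD).
Qed.

Lemma piece_prod B1 B2 e1 e2 : piece B1 e1 -> piece B2 e2 -> e1 *m e2 = 0 -> e2 *m e1 = 0 ->
  piece (gprod B1 B2) (e1 + e2).
Proof.
move=> [a1 [s1 [m1 [f1 [[m10 r1 sa1] [aD1 am1 aS1] as1 gB1 div1]]]]].
move=> [a2 [s2 [m2 [f2 [[m20 r2 sa2] [aD2 am2 aS2] as2 gB2 div2]]]]] e12 e21.
have o12 := piece_orthogonal m10 m20 r1 r2 sa1 sa2 aD1 aS1 as1 as2 div2 e12.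
have o21 := piece_orthogonal m20 m10 r2 r1 sa2 sa1 aD2 aS2 as2 as1 div1 e21.
have gB : good (gspace (ambient (gprod B1 B2))) := prod_good gB1 gB2.
(* The crossed weights m2 and m1 give both components the same multiplier m1 m2. *)
exists (fun x => (a1 x, a2 x) : ambient (gprod B1 B2)), (fun b => s1 b.1 *+ m2 + s2 b.2 *+ m1),
  (m1 * m2)%N, (fun x => f1 x *+ m2 + f2 x *+ m1); split=> //.
- split; first by rewrite muln_gt0 m10.
    apply: realizes_eq (realizes_D (realizes_muln m2 r1) (realizes_muln m1 r2)).
    by rewrite !scalerA -!natrM scalerDr mulnC.
  by move=> x; rewrite /= sa1 sa2.
- split; last by move=> x; split; [exact: aS1|exact: aS2].
    by move=> x y; rewrite aD1 aD2.
  by move=> x; apply: (pair_morph gB1 gB2).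
- move=> [b1 b2] [/= sb1 sb2]; rewrite aD1 aD2 !(additive_muln _ _ aD1) !(additive_muln _ _ aD2).
  rewrite as1 // as2 // o12 // o21 // !mul0rn addr0 add0r -!mulrnA [(m2 * m1)%N]mulnC.
  exact: pair_muln.
- move=> n [b1 b2] n0 [/= sb1 sb2].
  have [c1 [sc1 e1']] := div1 _ _ n0 sb1; have [c2 [sc2 e2']] := div2 _ _ n0 sb2.
  exists ((c1, c2) : ambient (gprod B1 B2)); split=> //; rewrite -e1' -e2'.
  exact/esym/pair_muln.
Qed.

Lemma piece_isogenous B : piece B 1%:M -> isogenous (whole JX) B.
Proof.
move=> [a [s [m [f [[m0 r sa] [aD am aS] as_ gB div]]]]].
have fE x : f x = x *+ m.
  apply: (realizes_unique r (f' := fun x => x *+ m)).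
  by apply: realizes_muln; apply: (realizes_1 actG JX).
have [t tP] := torsion_finite uncK char0 abJ m0.
apply: (@isogenous_restrict K (whole JX) B a t) => //.
- move=> b sb; have [b' [sb' <-]] := div _ _ m0 sb.
  by exists (s b'); split=> //; apply: as_.
- move=> x _ ax; apply: tP; rewrite -fE -sa ax -(additive0 aD) sa fE.
  exact: mul0rn.
Qed.

Section Idempotent.
Variables (z : gT -> int) (m : nat) (p : 'M[rat]_(gcard G)).
Hypotheses (m0 : (0 < m)%N) (zp : realizes (m%:R *: p) (rhoG z)) (pp : p *m p = p).
Local Notation B := (im_rho act JX G z).

Lemma im_rho_divisible : subgroup_divisible B.
Proof.
move=> n b n0 [u _ <-]; have [v <-] := divisible uncK char0 abJ u n0.
exists (rhoG z v); split; first by exists v.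
by rewrite (additive_muln _ _ (radd zp)).
Qed.

(** With ab = p and ba = e, the maps rho(z) fa and fb are inverse to each other up to a positive
    integer: b p a = e, and p a b p = p on the image of rho(z). *)
Lemma piece_equiv e : equiv_idem p e -> e *m e = e -> piece B e.
Proof.
move=> [a [b [aQ bQ ab ba]]] ee.
have [k k0 [fa ra]] := realizes_exists act JX aQ.
have [l l0 [fb rb]] := realizes_exists act JX bQ.
have rza := rM zp ra.
exists (rhoG z \o fa), fb, (k * l * m)%N, (fb \o (rhoG z \o fa)); split=> //.
- split; first by rewrite !muln_gt0 k0 l0.
    apply: realizes_eq (rM rb rza).
    rewrite -!scalemxAl -!scalemxAr !scalerA -!natrM; congr (_%:R *: _); first by lia.
    by rewrite mulmxA -ab mulmxA ba -mulmxA ba ee.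
  by [].
- split; last by move=> x; exists (fa x).
    exact: (radd rza).
  exact: (realizes_morph uncK char0 nX iX twoX unifX actG rza).
- move=> _ [u _ <-].
  have E : (k * l * m)%:R *: (m%:R *: p) = (m%:R *: p *m (k%:R *: a)) *m (l%:R *: b *m (m%:R *: p)).
    rewrite -!scalemxAl -!scalemxAr -!scalemxAl -?scalemxAr !scalerA -!natrM.
    rewrite -mulmxA (mulmxA a) ab !pp; congr (_%:R *: _); lia.
  exact: (realizes_unique (rM rza (rM rb zp)) (realizes_eq E (realizes_muln _ zp)) u).
- exact: im_rho_divisible.
Qed.

Lemma splits_piece n f : (f \in QG)%MS -> f *m f = f -> splits p n.+1 f ->
  piece (iter n (gprod B) B) f.
Proof.
elim: n f => [|n IH] f fQ ff.
  move=> [f1 [e1 f11 _ _ /eqP]]; rewrite subr_eq0 => /eqP ->.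
  exact: piece_equiv e1 f11.
move=> [f1 [e1 f11 ff1 f1f sp]].
have f1Q : (f1 \in QG)%MS.
  by have [a [b [aQ bQ _ <-]]] := e1; apply: group_ring_mul.
have gg : (f - f1) *m (f - f1) = f - f1.
  by rewrite mulmxBl !mulmxBr ff ff1 f1f f11 subrr subr0.
rewrite -[f](subrKC f1); apply: piece_prod.
- exact: piece_equiv.
- by apply: IH => //; apply: group_ring_sub.
- by rewrite mulmxBr f1f f11 subrr.
- by rewrite mulmxBl ff1 f11 subrr.
Qed.

End Idempotent.

End Pieces.

(** * Prym varieties *)

Lemma closed_seq_union (K : closedFieldType) (X : fun_space K) (I : eqType) (s : seq I) (C : I -> set X) :
  good X -> (forall i, i \in s -> closed_set (C i)) ->
  closed_set [set x | exists2 i, i \in s & C i x].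
Proof.
move=> gX cC x nx; have : near_pt x (fun y => forall i, i \in s -> ~ C i y).
  by apply: near_all_seq => // i si; apply: cC => // Cx; apply: nx; exists i.
by move=> /near_mono; apply => y h [i si]; exact: h.
Qed.

Section Prym.
Variable K : closedFieldType.
Hypothesis uncK : ~ countable [set: K].
Hypothesis char0 : forall m, m.+1%:R != 0 :> K.

Lemma irrset_connected (X : fun_space K) (H : set X) : irrset H -> connected_in H.
Proof.
move=> [_ iH] U V oU oV HUV UV0.
have [HU|] := pselect (H `<=` U); first by left.
move=> /existsNP[x /not_implyP[Hx nUx]]; right => y Hy; apply: contrapT => nVy.
have Vx : V x by case: (HUV x Hx).
have Uy : U y by case: (HUV y Hy).
have [z [Hz Vz Uz]] := iH x y V U Hx Hy (near_open oV Vx) (near_open oU Uy).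
have : (H `&` U `&` V) z by [].
by rewrite UV0.
Qed.

(* K / H is finite, so the cosets of the closed divisible subgroup H are open
   and closed in K *)
Lemma component_divisible (A : group_space K) (H S : set A) c : abelian_variety A ->
  (0 < c)%N -> (H : set (gspace A)) 0 -> (forall x y, H x -> H y -> H (x + y)) ->
  (forall x, H x -> H (- x)) ->
  (forall x, H x -> exists y, H y /\ y *+ c = x) ->
  @closed_set K (gspace A) H -> @irrset K (gspace A) H -> H `<=` S ->
  (forall x, S x -> H (x *+ c)) ->
  @component_in K (gspace A) S 0 = H.
Proof.
move=> abA c0 H0 HD HN Hdiv cH iH HS SH.
have gA : good (gspace A) := ab_good uncK abA.
have [s sP] := torsion_finite uncK char0 abA c0.
apply/seteqP; split=> [y|y Hy]; last by exists H; split=> //; apply: irrset_connected.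
move=> [C [CS conC C0 Cy]].
have SHs x : S x -> exists2 t, t \in s & H (x - t).
  move=> /SH Hcx; have [h [Hh hc]] := Hdiv _ Hcx.
  exists (x - h); last by rewrite opprB addrC subrK.
  by apply: sP; rewrite mulrnBl hc subrr.
pose U' : set (gspace A) := [set x | exists2 t, t \in [seq t <- s | ~~ `[< H t >]] & H (x - t)].
have cU : @closed_set K (gspace A) U'.
  apply: (@closed_seq_union K (gspace A) _ _ (fun t x => H ((x : A) - t))) => // t _ x nH.
  exact: (ab_trans uncK abA (- t) x).1 _ (cH _ nH).
have oU : open (~` U' : set (gspace A)) by apply/(openP gA).
have oV : open (~` H : set (gspace A)) by apply/(openP gA).
have nU x : C x -> (~` U') x -> H x.
  move=> Cx nU; have [t ts Ht] := SHs _ (CS _ Cx).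
  have [Hit|nHt] := pselect (H t); first by rewrite -(subrK t x); apply: HD.
  by case: nU; exists t => //; rewrite mem_filter ts andbT; apply/asboolPn.
have [||CU|CV] := conC _ _ oU oV.
- move=> x Cx; have [Ux|] := pselect (U' x); last by left.
  right => Hx; case: Ux => t; rewrite mem_filter => /andP[/asboolPn nHt _] Ht; apply: nHt.
  by rewrite -[t](subKr x); apply: HD => //; apply: HN.
- by apply/seteqP; split=> // x [[Cx /(nU _ Cx) Hx] /(_ Hx)].
- exact: nU (CU _ Cy).
- by case: (CV _ C0).
Qed.

Variables (X : fun_space K) (nX : nice X) (iX : irrset [set: X]).
Hypothesis twoX : exists x y : X, x <> y.
Hypothesis unifX : forall x : X, exists t, uniformizer x t.
Variables (gT : finGroupType) (act : gT -> X -> X) (G : {group gT}).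
Hypothesis actG : faithful_action act G.
Let gX : good X := nice_good nX.
Variable JX : jacobian X.
Local Notation QG := (group_ring rat G).
Local Notation J := (gspace JX).
Let abJ := jac_abelian JX.
Let gJ : good J := ab_good uncK abJ.
Local Notation rhoG := (@rho K gT X act JX G).
Local Notation phi g := (Nm JX (act g)).
Local Notation realizes := (@realizes K X gT act G JX).
Let radd a f (r : realizes a f) : forall x y, f (x + y) = f x + f y :=
  realizes_additive char0 nX iX twoX unifX actG r.
Let rM a b f h (ra : realizes a f) (rb : realizes b h) : realizes (a *m b) (f \o h) :=
  realizes_M char0 nX iX twoX unifX actG ra rb.
Let rmor a f (r : realizes a f) : forall x, morph_at (f : J -> J) x :=
  realizes_morph uncK char0 nX iX twoX unifX actG r.

Section Quotient.
Variables (M : {group gT}) (MG : M \subset G) (JM : jacobian (quot act M)).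
Local Notation pM := (quot_pr act M : X -> quot act M).
Local Notation NM := (Nm JM pM).
Local Notation trM := (fun x : JX => \sum_(g in M) phi g x).
Let inG g : g \in M -> g \in G := fintype.subsetP MG g.

Lemma quot_ppr : preserves_principal (pM : X -> quot act M).
Proof. exact: (from_X_ppr char0 nX iX twoX unifX actG (quot_quotient_map nX actG MG)). Qed.

Lemma quot_NmD (x y : JX) : NM (x + y) = NM x + NM y. Proof. exact: NmD quot_ppr x y. Qed.

Lemma quot_Nm_surj y : exists x : JX, NM x = y.
Proof. by apply: Nm_surj quot_ppr _ y; apply: quot_pr_surj. Qed.

Lemma quot_Nm_morph (x : J) : morph_at (NM : J -> gspace JM) x.
Proof.
apply: (@Nm_morph K uncK char0 X (quot act M) JX JM pM gX (nice_complete nX) iX (quot_good nX act M)) => [z|].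
  exact: (quotient_morph (quot_quotient_map nX actG MG)).
exact: quot_ppr.
Qed.

Lemma quot_Nm_phi g (x : JX) : g \in M -> NM (phi g x) = NM x.
Proof.
move=> gM; apply: Nm_comp quot_ppr _ => y /=.
by rewrite (quotient_invariant (quot_quotient_map nX actG MG)).
Qed.

Lemma quot_Nm_trace (x : JX) : NM (trM x) = NM x *+ #|M|.
Proof.
rewrite (additive_sum _ _ _ quot_NmD) (eq_bigr (fun=> NM x)) ?sumr_const // => g gM.
exact: quot_Nm_phi.
Qed.

(** By [principal_pull], a class whose norm is zero has zero trace; this replaces the formula for
    pull-back after norm. *)
Lemma quot_Nm_ker (x : JX) : NM x = 0 -> trM x = 0.
Proof.
have [D [d <-]] := jac_cl_surj x; rewrite Nm_cl ?quot_ppr //; last exact: quot_ppr.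
move/(jac_cl_ker JM (D := push_divisor pM D)) => /(_ _) h.
rewrite (eq_bigr (fun g => jac_cl JX (push_divisor (act g) D))); last first.
  by move=> g gM; rewrite Nm_cl //; apply: act_ppr (inG gM).
rewrite -jac_cl_sum => [|g _]; last by rewrite deg_push.
apply/jac_cl_ker; first by rewrite raddf_sum big1 // => g _; apply: etrans (deg_push _ _) d.
apply: (principal_pull char0 nX iX twoX unifX actG (quot_quotient_map nX actG MG)).
by apply: h; rewrite deg_push.
Qed.

Lemma quot_Nm_eq (x y : JX) : NM x = NM y -> trM x = trM y.
Proof.
move=> e; have tD (a b : JX) : trM (a + b) = trM a + trM b.
  by rewrite -big_split; apply: eq_bigr => g gM; apply: (phiD char0 nX iX twoX unifX actG) (inG gM).
apply/eqP; rewrite -subr_eq0 -(additiveN _ tD) -tD; apply/eqP/quot_Nm_ker.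
by rewrite quot_NmD (additiveN _ quot_NmD) e subrr.
Qed.

Lemma quot_Nm_realizes0 a f (x : JX) : realizes a f -> average G M *m a = 0 -> NM (f x) = 0.
Proof.
move=> ra z.
have c0 : (0 < #|M|)%N := cardG_gt0 M.
have [u <-] := divisible uncK char0 abJ x c0.
rewrite (additive_muln _ _ (radd ra)) (additive_muln _ _ quot_NmD) -quot_Nm_trace.
have r0 : realizes 0 (trM \o f).
  by apply: realizes_eq (rM (realizes_average act JX MG) ra); rewrite -scalemxAl z scaler0.
have /= -> := realizes_unique r0 (realizes_0 act G JX) u.
exact: additive0 quot_NmD.
Qed.

(** The pull-back is replaced by the trace of an arbitrary lift, which is well defined by
    [quot_Nm_eq]; in [piece] only [alpha] has to be a morphism. *)
Lemma piece_quot : piece act JX (whole JM) (average G M).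
Proof.
have /choice[lift liftE] := quot_Nm_surj.
exists NM, (fun y => trM (lift y)), #|M|, trM; split=> //.
- split; first exact: cardG_gt0.
    exact: realizes_average.
  by move=> x; apply: quot_Nm_eq; rewrite liftE.
- split=> //; [exact: quot_NmD|exact: quot_Nm_morph].
- by move=> b _; rewrite quot_Nm_trace liftE.
- exact: (ab_good uncK (jac_abelian JM)).
- move=> n b n0 _; have [b' <-] := divisible uncK char0 (jac_abelian JM) b n0.
  by exists b'.
Qed.
End Quotient.

Section PrymIsogeny.
Variables (M N : {group gT}) (MN : M \subset N) (NG : N \subset G).
Variables (JM : jacobian (quot act M)) (JN : jacobian (quot act N)).
Let MG : M \subset G := fintype.subset_trans MN NG.
Variables (z : gT -> int) (m : nat) (p : 'M[rat]_(gcard G)).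
Hypotheses (m0 : (0 < m)%N) (zp : realizes (m%:R *: p) (rhoG z)) (pp : p *m p = p).
Local Notation q := (average G M - average G N).
Hypothesis pq : equiv_idem p q.
Local Notation B := (im_rho act JX G z).
Local Notation NM := (Nm JM (quot_pr act M)).
Local Notation NN := (Nm JN (quot_pr act N)).
Local Notation NMN := (Nm JN (quot_map act M N)).

Lemma quot_map_pr x : quot_map act M N (quot_pr act M x) = quot_pr act N x.
Proof.
rewrite /quot_map; case: cid => x' /= /(qm_eq (quot_quotient_map nX actG MG)) [g gM ->].
by apply/(qm_eq (quot_quotient_map nX actG NG)); exists g => //; apply: (fintype.subsetP MN).
Qed.

Lemma quot_map_ppr : preserves_principal (quot_map act M N).
Proof.
apply: (quotient_ppr char0 nX iX twoX unifX actG (quot_quotient_map nX actG MG) (quot_quotient_map nX actG NG) MN).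
exact: quot_map_pr.
Qed.

Lemma quot_map_Nm (x : JX) : NMN (NM x) = NN x.
Proof. by apply: Nm_comp quot_map_ppr _ => y; apply: quot_map_pr. Qed.

(** The isogeny is [NM] after [fb], which carries the image of p into that of q. The range of [h]
    lies in the kernel of [NMN] because e_N q = 0, and contains a multiple of each element of that
    kernel because e_M = q + e_N; [component_divisible] identifies it with the identity
    component. *)
Lemma prym_isogenous : isogenous B (prym JM JN (quot_map act M N)).
Proof.
have [a [b [aQ bQ ab ba]]] := pq.
have [k k0 [fa ra]] := realizes_exists act JX aQ.
have [l l0 [fb rb]] := realizes_exists act JX bQ.
have avM := realizes_average act JX MG; have avN := realizes_average act JX NG.
have MQ := average_mem MG; have NQ := average_mem NG.
have Mq : average G M *m q = q by rewrite mulmxBr !averageMl //; apply: averageMl.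
have Nq : average G N *m q = 0.
  by rewrite mulmxBr averageMr // averageMl // subrr.
have bp : b *m p = q *m b by rewrite -ab -ba mulmxA.
have NMD := quot_NmD MG JM.
have c0 : (0 < #|M| * #|N| * (l * m * k))%N by rewrite !muln_gt0 !cardG_gt0 l0 m0 k0.
pose f := NM \o fb.
have fD x y : f (x + y) = f x + f y by rewrite /f /= (radd rb) NMD.
have fm (x : J) : morph_at (f : J -> gspace JM) x.
  exact: morph_at_comp (rmor rb x) (quot_Nm_morph MG JM _).
pose h := f \o rhoG z.
have hD x y : h (x + y) = h x + h y by rewrite /h /= (radd zp) fD.
have hm (x : J) : morph_at (h : J -> gspace JM) x.
  exact: morph_at_comp (rmor zp x) (fm _).
pose S : set JM := [set y : JM | NMN y = 0].
have comp : @component_in K (gspace JM) S 0 = range h.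
  apply: (@component_divisible JM (range h) S _ (jac_abelian JM) c0).
  - by exists 0 => //; apply: additive0 hD.
  - by move=> _ _ [x _ <-] [y _ <-]; exists (x + y).
  - by move=> _ [x _ <-]; exists (- x) => //; apply: additiveN hD.
  - move=> _ [x _ <-]; have [u <-] := divisible uncK char0 abJ x c0.
    by exists (h u); split; [exists u|rewrite -(additive_muln _ _ hD)].
  - by apply: (ab_image_closed uncK (jac_abelian JM) gJ (nice_complete (ab_nice uncK abJ)) hm) => x; case.
  - exact: (@irrset_image K J (gspace JM) h setT hm (ab_irr uncK abJ)).
  - move=> _ [x _ <-]; rewrite /S /h /f /= quot_map_Nm.
    apply: (quot_Nm_realizes0 NG JN x (rM rb zp)).
    have -> : l%:R *: b *m (m%:R *: p) = (l * m)%:R *: (q *m b).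
      by rewrite -scalemxAl -scalemxAr scalerA -natrM bp.
    by rewrite -(scalemxAr _ (average G N)) mulmxA Nq mul0mx scaler0.
  - move=> y Sy; have [w wE] := quot_Nm_surj MG y.
    have trN : \sum_(g in N) phi g w = 0.
      by apply: (quot_Nm_ker NG (JM := JN)); rewrite -quot_map_Nm wE.
    (* Since e_M = b p a + e_N and the trace of w over N vanishes, the trace of w over M is, up to
       positive integers, fb (rho(z) (fa w)). *)
    exists (fa w *+ (#|M| * #|N|)) => //.
    rewrite (additive_muln _ _ hD) -wE.
    have -> : NM w *+ (#|M| * #|N| * (l * m * k)) = NM ((\sum_(g in M) phi g w) *+ (#|N| * (l * m * k))).
      by rewrite (additive_muln _ _ NMD) quot_Nm_trace // -mulrnA; congr (_ *+ _); lia.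
    rewrite /h /f /= -(additive_muln _ _ NMD); congr (NM _).
    have r1 := realizes_muln (#|M| * #|N|) (rM rb (rM zp ra)).
    have r2 := realizes_muln (#|N| * (l * m * k)) avM.
    have r3 := realizes_muln (#|M| * (l * m * k)) avN.
    have gen (A1 A2 : 'M[rat]_(gcard G)) : b *m (p *m a) = A1 - A2 ->
       (#|N| * (l * m * k))%:R *: (#|M|%:R *: A1) =
       (#|M| * #|N|)%:R *: (l%:R *: b *m (m%:R *: p *m (k%:R *: a))) +
       (#|M| * (l * m * k))%:R *: (#|N|%:R *: A2).
      move=> e; rewrite -!scalemxAl -!scalemxAr -?scalemxAl -?scalemxAr !scalerA e -!natrM.
      rewrite [X in _ = X%:R *: (A1 - A2) + _](_ : _ = (#|N| * (l * m * k) * #|M|)%N); last by lia.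
      rewrite [X in _ = _ + X%:R *: _](_ : _ = (#|N| * (l * m * k) * #|M|)%N); last by lia.
      by rewrite -scalerDr subrK.
    have E := gen (average G M) (average G N) _.
    rewrite mulmxA bp -mulmxA ba [X in X = _]mulmxBl Mq Nq subr0 in E.
    have := realizes_unique (realizes_eq (E erefl) r2) (realizes_D r1 r3) w => /= ->.
    by rewrite trN mul0rn addr0.
(* If v in the image of rho(z) has NM (fb v) = 0, the trace of fb v over M vanishes; applying [fa]
   and using a e_M b p = p gives #M k l v = 0. *)
have [s sP] := torsion_finite uncK char0 abJ (m := (#|M| * k * l)%N) ltac:(by rewrite !muln_gt0 cardG_gt0 k0 l0).
apply: (@isogenous_restrict K B (prym JM JN (quot_map act M N)) f s) => //.
- exact: (ab_good uncK (jac_abelian JM)).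
- move=> _ [u _ <-]; rewrite /prym /= -/S comp; exists u => //.
- move=> y; rewrite /prym /= -/S comp => -[u _ <-]; exists (rhoG z u); split=> //.
  by exists u.
- move=> _ [u _ <-] fx; apply: sP.
  have tr0 := quot_Nm_ker MG fx.
  have r1 := realizes_muln (#|M| * k * l) zp.
  have r2 := rM ra (rM avM (rM rb zp)).
  have gen (A : 'M[rat]_(gcard G)) : a *m (A *m (b *m p)) = p ->
     (#|M| * k * l)%:R *: (m%:R *: p) = k%:R *: a *m (#|M|%:R *: A *m (l%:R *: b *m (m%:R *: p))).
    move=> e; rewrite -!scalemxAl -!scalemxAr -?scalemxAl -?scalemxAr !scalerA -!natrM e.
    congr (_%:R *: _); lia.
  have E := gen (average G M) _.
  rewrite bp (mulmxA (average G M)) Mq -bp mulmxA ab pp in E.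
  have := realizes_unique (realizes_eq (E erefl) r1) r2 u => /= ->.
  by rewrite tr0 (additive0 (radd ra)).
Qed.
End PrymIsogeny.
End Prym.

(** * The complex numbers *)

Section ComplexNumbers.
Import Order.TTheory.
Local Open Scope ring_scope.
Variable R : realType.

(** Cantor's nested intervals: step n passes to a closed subinterval on which h avoids n. The
    supremum of the left ends lies in all of them, and step h x excludes it. *)
Lemma real_no_injection (h : R -> nat) : ~ injective h.
Proof.
move=> hI.
have /choice[F FP] : forall abn : R * R * nat, exists cd : R * R, abn.1.1 < abn.1.2 ->
    [/\ abn.1.1 <= cd.1, cd.1 < cd.2, cd.2 <= abn.1.2 &
      forall x, cd.1 <= x <= cd.2 -> h x <> abn.2].
  move=> [[a b] n] /=; have [ab|] := boolP (a < b); last by exists (a, b).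
  have [[x0 hx0]|nx] := pselect (exists x, h x = n); last first.
    by exists (a, b) => _; split=> // x _ hx; apply: nx; exists x.
  (* In the second case a quarter is taken and not a half: the subinterval is closed and x0 may be
     the midpoint. *)
  have [x0a|ax0] := ltP x0 ((a + b) / 2).
    exists ((a + b) / 2, b) => _ /=; split=> //; try lra.
    by move=> x /andP[x1 _] hx; have := hI x x0; rewrite hx hx0 => /(_ erefl) e; lra.
  exists (a, a + (b - a) / 4) => _ /=; split=> //; try lra.
  by move=> x /andP[_ x1] hx; have := hI x x0; rewrite hx hx0 => /(_ erefl) e; lra.
pose I := fix I n := if n is n'.+1 then F (I n', n') else (0, 1) : R * R.
have lt n : (I n).1 < (I n).2.
  elim: n => [|n IH] /=; first by rewrite ltr01.
  by have [] := FP (I n, n) IH.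
have sub n k : (I n).1 <= (I (n + k)%N).1 /\ (I (n + k)%N).2 <= (I n).2.
  elim: k => [|k [IH1 IH2]]; first by rewrite addn0.
  rewrite addnS /=; have [h1 _ h2 _] := FP (I (n + k)%N, (n + k)%N) (lt _).
  by split; [apply: le_trans IH1 h1|apply: le_trans h2 IH2].
have le n k : (I n).1 <= (I k).2.
  have [nk|kn] := leqP n k.
    by have [h1 _] := sub n (k - n)%N; rewrite subnKC // in h1; apply: le_trans h1 (ltW (lt k)).
  have [_ h1] := sub k (n - k)%N; rewrite subnKC ?(ltnW kn) // in h1.
  exact: le_trans (ltW (lt n)) h1.
pose E : set R := range (fun n => (I n).1).
have E0 : E !=set0 by exists (I 0%N).1, 0%N.
have x1 n : (I n).1 <= sup E.
  by apply: ub_le_sup; [exists (I 0%N).2 => _ [k _ <-]|exists n].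
have x2 n : sup E <= (I n).2 by apply: ge_sup => // _ [k _ <-].
have [_ _ _ /(_ (sup E))] := FP (I (h (sup E)), h (sup E)) (lt _).
by move=> hx; apply: hx => //; have := x1 (h (sup E)).+1; have := x2 (h (sup E)).+1 => /= -> ->.
Qed.

Lemma uncountable_complex : ~ countable [set: R[i]].
Proof.
move=> /pcard_injP[f fI]; apply: (@real_no_injection (fun x => f (real_complex R x))).
by move=> x y /fI; rewrite !inE => /(_ Logic.I Logic.I) /(congr1 (@complex.Re R)).
Qed.

Lemma char0_complex m : m.+1%:R != 0 :> R[i].
Proof. by rewrite pnatr_eq0. Qed.

End ComplexNumbers.

Section Curves.
Variable K : closedFieldType.
Hypothesis uncK : ~ countable [set: K].

(** Of dimension 1 only the strict inclusion in a chain of length 1 is used, to produce two distinct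
    points. *)
Lemma curve_basics (X : fun_space K) : smooth_projective_curve X ->
  [/\ nice X, irrset [set: X], exists x y : X, x <> y & forall x : X, exists t, uniformizer x t].
Proof.
move=> [pX [[Z [Zi Zs]] _] uX]; have [nX iX] := projective_nice uncK pX; split=> //.
have [_ [x Z0x] _] := Zi 0%N isT; have [Z01 nZ10] := Zs 0%N isT.
have [y [Zy nZy]] : exists y, Z 1%N y /\ ~ Z 0%N y.
  by apply: contrapT => h; apply: nZ10 => y Zy; apply: contrapT => nZy; apply: h; exists y.
by exists x, y => e; apply: nZy; rewrite -e.
Qed.

Lemma integral_realizes (X : fun_space K) (gT : finGroupType) (act : gT -> X -> X) (G : {group gT})
  (JX : jacobian X) (z : gT -> int) (m : nat) (p : 'M[rat]_(gcard G)) :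
  (p \in group_ring rat G)%MS -> {in G, forall g, (z g)%:~R = m%:R * gring_coef p g} ->
  @realizes K X gT act G JX (m%:R *: p) (@rho K gT X act JX G z).
Proof.
move=> pQ zp; exists z => //; rewrite [in LHS](gring_coefE pQ) scaler_sumr.
by apply: eq_bigr => g gG; rewrite scalerA zp.
Qed.

End Curves.

Theorem mainTheorem6 (R : realType)
  (X : fun_space R[i]) (act : {perm 'I_5} -> X -> X) (g : nat)
  (curveX : smooth_projective_curve X)
  (genusX : has_genus X g) (g_ge2 : (2 <= g)%N)
  (actX : faithful_action act A5)
  (V : mx_representation rat A5 4) (W : mx_representation rat A5 5)
  (T : mx_representation rat A5 6) (T1 T2 : mx_representation R[i] A5 3)
  (V_irr : mx_absolutely_irreducible V) (W_irr : mx_absolutely_irreducible W)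
  (T_irr : mx_irreducible T)
  (T1_irr : mx_irreducible T1) (T2_irr : mx_irreducible T2)
  (T1_T2 : ~ mx_rsim T1 T2)
  (T_sum : mx_rsim (map_repr (ratr : {rmorphism rat -> R[i]}) T)
                   (direct_sum_repr T1 T2))
  (zV zW zT : {perm 'I_5} -> int)
  (zV_V : integral_primitive_idempotent V zV)
  (zW_W : integral_primitive_idempotent W zW)
  (zT_T : integral_primitive_idempotent T zT)
  (JX : jacobian X) (JY : jacobian (quot act A5))
  (JA4 : jacobian (quot act A4)) (JD5 : jacobian (quot act D5))
  (JZ5 : jacobian (quot act Z5)) :
  let BV := im_rho act JX A5 zV in
  let BW := im_rho act JX A5 zW in
  let BT := im_rho act JX A5 zT in
  [/\ isogenous (whole JX)
        (gprod (whole JY) (gprod (gpow BV 4) (gprod (gpow BW 5) (gpow BT 3)))),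
      isogenous BV (prym JA4 JY (quot_map act A4 A5)),
      isogenous BW (prym JD5 JY (quot_map act D5 A5))
    & isogenous BT (prym JZ5 JD5 (quot_map act Z5 D5))].
Proof.
move=> BV BW BT.
have uncK := @uncountable_complex R; have char0 := @char0_complex R.
have [nX iX twoX unifX] := curve_basics uncK curveX.
have [mV [IV [pV [mV0 sV PV zVE]]]] := zV_V.
have [mW [IW [pW [mW0 sW PW zWE]]]] := zW_W.
have [mT [IT [pT [mT0 sT PT zTE]]]] := zT_T.
have [[pVQ pWQ pTQ] [pV2 pW2 pT2] [eV eW eT] [fV [fW [fT [[spV spW spT] [fVQ fWQ fTQ] [fV2 fW2 fT2]
  [VW VT WT WV [TV TW]] [unit [GV VG] [GW WG] [GT TG]]]]]]] :=
  A5_decomposition V_irr W_irr T_irr T1_irr T2_irr T1_T2 T_sum sV PV sW PW sT PT.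
have rV := integral_realizes act JX pVQ zVE.
have rW := integral_realizes act JX pWQ zWE.
have rT := integral_realizes act JX pTQ zTE.
have A45 : A4_group \subset A5 := A4_A5.
have D55 : D5_group \subset A5 := D5_A5.
have ZD : Z5_group \subset D5_group := Z5_D5.
split.
- have pieceV := splits_piece uncK char0 nX iX twoX unifX actX mV0 rV pV2 fVQ fV2 spV.
  have pieceW := splits_piece uncK char0 nX iX twoX unifX actX mW0 rW pW2 fWQ fW2 spW.
  have pieceT := splits_piece uncK char0 nX iX twoX unifX actX mT0 rT pT2 fTQ fT2 spT.
  have pieceY := piece_quot uncK char0 nX iX twoX unifX actX JX (fintype.subxx A5) JY.
  (* [unit] brackets its four idempotents as the product of the statement is bracketed, so
     [piece_prod] applies from the inside out. *)
  apply: (piece_isogenous uncK char0 actX); rewrite -unit.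
  have pieceWT := piece_prod uncK char0 nX iX twoX unifX actX pieceW pieceT WT TW.
  have [VWT WTV] : fV *m (fW + fT) = 0 /\ (fW + fT) *m fV = 0.
    by rewrite mulmxDr VW VT mulmxDl WV TV !addr0.
  have pieceVWT := piece_prod uncK char0 nX iX twoX unifX actX pieceV pieceWT VWT WTV.
  apply: (piece_prod uncK char0 nX iX twoX unifX actX pieceY pieceVWT).
  + by rewrite !mulmxDr GV GW GT !addr0.
  + by rewrite !mulmxDl VG WG TG !addr0.
- exact: (prym_isogenous uncK char0 nX iX twoX unifX actX A45 (fintype.subxx A5) JA4 JY mV0 rV pV2 eV).
- exact: (prym_isogenous uncK char0 nX iX twoX unifX actX D55 (fintype.subxx A5) JD5 JY mW0 rW pW2 eW).
- exact: (prym_isogenous uncK char0 nX iX twoX unifX actX ZD D55 JZ5 JD5 mT0 rT pT2 eT).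
Qed.
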